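(* Let $a_+,a_->0$ and $\eta\in\mathbb{R}$, and let $F^T(\eta;x,y)$, $x\in\mathbb{R}$, $y>0$, be the relativistic Toda eigenfunction defined in the context. Then $F^T(\eta;x,y)$ is a joint eigenfunction of the two relativistic Toda Hamiltonians $$H^T_\delta(\eta;x)=\big[1+e_\delta(-2x-ia_{-\delta}+2\eta)\big]^{1/2}\exp(ia_{-\delta}\partial_x)+\big[1+e_\delta(-2x+ia_{-\delta}+2\eta)\big]^{1/2}\exp(-ia_{-\delta}\partial_x),\qquad \delta=+,-,$$ with eigenvalues $2c_\delta(y)$, and of the two dual Toda Hamiltonians $$\hat H^T_\delta(\eta;y)=\frac{e_\delta(\eta)}{2}\,s_\delta(y)^{-1/2}\big(\exp(ia_{-\delta}\partial_y)+\exp(-ia_{-\delta}\partial_y)\big)s_\delta(y)^{-1/2},\qquad \delta=+,-,$$ with eigenvalues $e_\delta(x)$. That is, for $\delta=+,-$, $$H^T_\delta(\eta;x)F^T(\eta;x,y)=2c_\delta(y)F^T(\eta;x,y),\qquad \hat H^T_\delta(\eta;y)F^T(\eta;x,y)=e_\delta(x)F^T(\eta;x,y).$$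
   Context: Notation: $a=(a_++a_-)/2$, $\alpha=2\pi/(a_+a_-)$, and for $\delta=+,-$: $s_\delta(z)=\sinh(\pi z/a_\delta)$, $c_\delta(z)=\cosh(\pi z/a_\delta)$, $e_\delta(z)=\exp(\pi z/a_\delta)$. Operators: $\exp(c\,\partial_x)$ denotes the translation $f(x)\mapsto f(x+c)$, acting on analytic functions (so $F^T$ and the square roots are understood via analytic continuation), and similarly for $y$. The square roots in $H^T_\delta(\eta;x)$ are positive for $x\to\infty$; the square roots of $s_\delta(y)$ are positive for $y>0$. Hyperbolic gamma function: for $|\mathrm{Im}\,z|<a$ set $$g(z)=\int_0^\infty\frac{dt}{t}\left(\frac{\sin 2tz}{2\sinh(a_+t)\sinh(a_-t)}-\frac{z}{a_+a_-t}\right).$$ Then $G(z)=\exp(ig(z))$ for $|\mathrm{Im}\,z|<a$, extended meromorphically to $\mathbb{C}$ by $G(z+ia_\delta/2)/G(z-ia_\delta/2)=2c_{-\delta}(z)$, $\delta=+,-$. Put $\chi=\frac{\pi}{24}\left(\frac{a_+}{a_-}+\frac{a_-}{a_+}\right)$ and $G_R(z)=G(z)\exp(i\chi+i\alpha z^2/4)$, so that $G_R(u)\to1$ for $u\to\infty$. Relativistic Toda eigenfunction: for $\eta,x\in\mathbb{R}$ and $y>0$, $$F^T(\eta;x,y)=\left(\frac{G(y+ia)G(-y+ia)}{a_+a_-G_R(x-\eta)}\right)^{1/2}e^{i\alpha y^2/4}\int_{\mathbb{R}}dz\,G_R\big(z+(x-\eta)/2-ia/2\big)\,G_R\big(-z+(x-\eta)/2-ia/2\big)\,e^{i\alpha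 zy},$$ where the square root is positive for $x\to\infty$, and $G(y+ia)G(-y+ia)=4s_+(y)s_-(y)$. *)

(* Defs.v *)
From Stdlib Require Import Reals ZArith ClassicalEpsilon.
From Coquelicot Require Export Coquelicot.

Open Scope R_scope.

Definition cexp (z : C) : C :=
  (RtoC (exp (Re z)) * (cos (Im z), sin (Im z)))%C.

Definition csinh (z : C) : C := ((cexp z - cexp (- z)) / 2)%C.
Definition ccosh (z : C) : C := ((cexp z + cexp (- z)) / 2)%C.
Definition csin (z : C) : C :=
  ((cexp (Ci * z) - cexp (- (Ci * z))) / (2 * Ci))%C.

(* The index delta = +,- of the parameters a_+ (ap) and a_- (am). *)
Inductive sgn : Set := Plus | Minus.

Definition opp_sgn (d : sgn) : sgn :=
  match d with Plus => Minus | Minus => Plus end.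

Definition par (ap am : R) (d : sgn) : R :=
  match d with Plus => ap | Minus => am end.

Definition s_ (ap am : R) (d : sgn) (z : C) : C :=
  csinh (PI * z / par ap am d)%C.
Definition c_ (ap am : R) (d : sgn) (z : C) : C :=
  ccosh (PI * z / par ap am d)%C.
Definition e_ (ap am : R) (d : sgn) (z : C) : C :=
  cexp (PI * z / par ap am d)%C.

Definition amean (ap am : R) : R := (ap + am) / 2.
Definition alpha (ap am : R) : R := 2 * PI / (ap * am).
Definition chi (ap am : R) : R := PI / 24 * (ap / am + am / ap).

(* Improper Riemann integral of a complex-valued function. *)
Definition CInt (f : R -> C) (Fa Fb : (R -> Prop) -> Prop) : C :=
  RInt_gen (V := C_R_CompleteNormedModule) f Fa Fb.

Definition hg_integrand (ap am : R) (z : C) (t : R) : C :=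
  ((csin (2 * t * z) / (2 * RtoC (sinh (ap * t)) * RtoC (sinh (am * t)))
    - z / (ap * am * t)) / t)%C.

(* The function g, for |Im z| < amean. *)
Definition hg (ap am : R) (z : C) : C :=
  CInt (hg_integrand ap am z) (at_right 0) (Rbar_locally p_infty).

(* G z is exp(i g) at the translate of z by a multiple of i ap, computed with
     G (z + i ap / 2) = 2 c_- (z) G (z - i ap / 2).
   The relation with ap and am exchanged holds for the same function.  At a
   pole of G the value is the one given by Cinv. *)
Fixpoint hG_up (ap am : R) (n : nat) (z : C) : C :=
  match n with
  | O => cexp (Ci * hg ap am z)
  | S m => (2 * c_ ap am Minus (z - Ci * ap / 2)
              * hG_up ap am m (z - Ci * ap))%C
  end.

Fixpoint hG_down (ap am : R) (n : nat) (z : C) : C :=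
  match n with
  | O => cexp (Ci * hg ap am z)
  | S m => (hG_down ap am m (z + Ci * ap)
              / (2 * c_ ap am Minus (z + Ci * ap / 2)))%C
  end.

(* Least n such that |Im z| - n ap < amean. *)
Definition hG_steps (ap am : R) (z : C) : nat :=
  Z.to_nat (up ((Rabs (Im z) - amean ap am) / ap)).

Definition hG (ap am : R) (z : C) : C :=
  if Rle_dec 0 (Im z)
  then hG_up ap am (hG_steps ap am z) z
  else hG_down ap am (hG_steps ap am z) z.

Definition hGR (ap am : R) (z : C) : C :=
  (hG ap am z * cexp (Ci * chi ap am + Ci * alpha ap am * z ^ 2 / 4))%C.

(* The value at p of the branch of f^(1/2) that is positive for x -> +oo: the
   branch is continued from +oo along the horizontal half-line p + [0, +oo).
   Meaningful when f has no zero or pole on that half-line and tends to a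
   positive limit along it; the branch is then unique. *)
Definition sqrt_from_infty (f : C -> C) (p : C) : C :=
  epsilon (inhabits (RtoC 0)) (fun w =>
    exists r : R -> C,
      (forall t : R, 0 <= t ->
         continuous (U := C_UniformSpace) r t /\
         (r t * r t = f (p + t))%C) /\
      (exists L : R, 0 < L /\
         filterlim r (Rbar_locally p_infty)
           (locally (T := C_UniformSpace) (RtoC L))) /\
      r 0 = w).

(* On the half-plane Re y > 0, the branch of f^(1/2) that is positive for
   real y > 0. *)
Definition sqrt_right_half (f : C -> C) : C -> C :=
  epsilon (inhabits (fun _ : C => RtoC 0)) (fun r : C -> C =>
    forall y : C, 0 < Re y ->
      continuous (T := C_UniformSpace) (U := C_UniformSpace) r y /\
      (r y * r y = f y)%C /\
      (Im y = 0 -> 0 < Re (r y) /\ Im (r y) = 0)).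

Definition FT_prefactor_sq (ap am eta y : R) (x : C) : C :=
  (hG ap am (y + Ci * amean ap am) * hG ap am (- y + Ci * amean ap am)
   / (ap * am * hGR ap am (x - eta)))%C.

Definition FT_integrand (ap am eta x y z : R) : C :=
  (hGR ap am (z + (x - eta) / 2 - Ci * amean ap am / 2)
   * hGR ap am (- z + (x - eta) / 2 - Ci * amean ap am / 2)
   * cexp (Ci * alpha ap am * z * y))%C.

(* The relativistic Toda eigenfunction, for real x and y > 0. *)
Definition FT (ap am eta x y : R) : C :=
  (sqrt_from_infty (FT_prefactor_sq ap am eta y) x
   * cexp (Ci * alpha ap am * y ^ 2 / 4)
   * CInt (FT_integrand ap am eta x y)
       (Rbar_locally m_infty) (Rbar_locally p_infty))%C.

(* The operator exp(c d/dx). *)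
Definition translate (c : C) (f : C -> C) : C -> C := fun z => f (z + c)%C.

Definition HT (ap am eta : R) (d : sgn) (f : C -> C) (x : C) : C :=
  let b := par ap am (opp_sgn d) in
  (sqrt_from_infty
     (fun u => 1 + e_ ap am d (- (2 * u) - Ci * b + 2 * eta)) x
     * translate (Ci * b) f x
   + sqrt_from_infty
       (fun u => 1 + e_ ap am d (- (2 * u) + Ci * b + 2 * eta)) x
     * translate (- (Ci * b)) f x)%C.

Definition HThat (ap am eta : R) (d : sgn) (f : C -> C) (y : C) : C :=
  let b := par ap am (opp_sgn d) in
  let h := fun u : C => (/ sqrt_right_half (s_ ap am d) u * f u)%C in
  (e_ ap am d eta / 2 * / sqrt_right_half (s_ ap am d) y
   * (translate (Ci * b) h y + translate (- (Ci * b)) h y))%C.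

(* Phi is holomorphic on D and equal to f on the real set I.  The sets D used
   below are open and connected, so Phi is unique on D. *)
Definition analytic_continuation
    (D : C -> Prop) (I : R -> Prop) (f : R -> C) (Phi : C -> C) : Prop :=
  (forall z : C, D z -> ex_derive (K := C_AbsRing) (V := C_NormedModule) Phi z)
  /\ (forall t : R, I t -> Phi (RtoC t) = f t).

(* The complex plane cut along the horizontal half-lines going left from the
   zeros and poles eta +- i (amean + k ap + l am) of x |-> G_R (x - eta), which
   are the branch points of x |-> FT eta x y.  It contains the real line, and
   in it the branches are determined by x -> +oo as in sqrt_from_infty. *)
Definition xdom (ap am eta : R) (x : C) : Prop :=
  forall k l : nat,
    eta < Re x \/ Rabs (Im x) <> amean ap am + INR k * ap + INR l * am.

(* Main.v *)
Require Import Defs.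
From Stdlib Require Import Reals Lra Lia ZArith ClassicalEpsilon Classical FunctionalExtensionality PropExtensionality.
From Coquelicot Require Import Coquelicot.
Open Scope R_scope.

(** Write p, q for a_+, a_-, and for the index d of an operator write b for the
    length of its shift and b' for the other one of p, q.

    The function g is an integral over the real line with a removable
    singularity at 0.  Split into exponentials and moved to a line Im t = kap
    with kap > 0, it becomes T z / (4 i) plus a quadratic polynomial in z, where
    T z is the integral of exp (2 i t z) / (t sinh (p t) sinh (q t)) over that
    line; the polynomial comes from the triple pole at 0, and it is cancelled by
    the Gaussian factor in G_R.  So G_R = exp (T / 4) in the strip |Im z| < a
    (hg_integral, Gstrip_eq), which shows that G_R is holomorphic there, has no
    zeros and tends to 1 on the right.  A shift of z removes one of the two sinh
    factors, and a residue computes the derivative of the remaining integral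
    (W_one_period, exp_logq); this gives
      G_R (z + i b) = (1 + exp (- 2 pi (z + i b / 2) / b')) G_R z
    for both choices of b (hGR_step, hGR_step_q).  Since g is odd, G_R z G_R (- z)
    is an explicit Gaussian (hGR_reflection).

    The integral I (u, y) of G_R (z + u) G_R (- z + u) exp (i alpha z y) over
    the real line converges for - a < Im u < - |Im y| only.  By the reflection
    equation the integrand contains a Gaussian factor; with the contour bent
    upwards on the right and downwards on the left, this factor makes the
    integral converge for all complex y and all u with Im u > - a,
    holomorphically in both (It_holo).  The step of G_R, and a shift of the
    contour over i b / 2 within the domain of holomorphy, give
      I (u + i b / 2, y) = exp (- pi y / b') (I (u, y) + Q u I (u, y + i b)),
    where Q u = exp (- 2 pi (u + i b / 2) / b') (It_shift).  Since I is even in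
    y, this also holds with y replaced by - y on the right.  Elimination between
    the two relations gives the second order difference equation in u
    (It_x_equation) and the one in y (It_y_equation).

    In x, the equation is solved for its lowest term to continue I downwards;
    its coefficient vanishes there only at the end points of cuts, and the
    equation for the other shift survives because the two difference operators
    commute (holo_Itil, Itil_equation).  Finally the square roots are branches
    of G_R (x - eta)^(-1/2) and of sinh (pi y / b)^(1/2).  The former is
    multiplied under x -> x + i b by the inverse of the square root in the
    Hamiltonian (rho_step), the latter by i under y -> y + i b (rhalf_up), and
    this turns the difference equations of I into those of the theorem. *)

(** * Differentiation over the complex numbers *)

Definition cder (f : C -> C) (z l : C) : Prop :=
  is_derive (K := C_AbsRing) (V := C_NormedModule) f z l.
Definition holo (f : C -> C) (z : C) : Prop :=
  ex_derive (K := C_AbsRing) (V := C_NormedModule) f z.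
Definition rcont (f : R -> C) (t : R) : Prop :=
  continuous (T := R_UniformSpace) (U := C_UniformSpace) f t.
Definition ccont (f : C -> C) (z : C) : Prop :=
  continuous (T := C_UniformSpace) (U := C_UniformSpace) f z.
Definition CRI (f : R -> C) (a b : R) : C :=
  RInt (V := C_R_CompleteNormedModule) f a b.

Lemma Cmod_minus_sym x y : Cmod (x - y)%C = Cmod (y - x)%C.
Proof. rewrite <- Cmod_opp. f_equal. ring. Qed.

Lemma Cmod_triangle_rev x y : Cmod x - Cmod y <= Cmod (x + y)%C.
Proof.
  pose proof (Cmod_triangle (x + y)%C (- y)%C) as H.
  rewrite Cmod_opp in H. replace (x + y + - y)%C with x in H by ring. lra.
Qed.

Lemma Cmod_triangle_minus x y : Cmod (x - y)%C <= Cmod x + Cmod y.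
Proof. unfold Cminus. rewrite <- (Cmod_opp y). apply Cmod_triangle. Qed.

Lemma im_le_Cmod (c : C) : Rabs (Im c) <= Cmod c.
Proof. eapply Rle_trans; [apply Rmax_r|apply Rmax_Cmod]. Qed.

Lemma Cmod_le_re_im (c : C) : Cmod c <= Rabs (Re c) + Rabs (Im c).
Proof.
  replace c with (RtoC (Re c) + Ci * RtoC (Im c))%C at 1.
  - eapply Rle_trans; [apply Cmod_triangle|].
    rewrite Cmod_mult, Cmod_Ci, !Cmod_R. lra.
  - destruct c; unfold Cplus, Cmult, RtoC, Ci; simpl. f_equal; ring.
Qed.

Lemma Cmod_mult_le x y a b :
  Cmod x <= a -> Cmod y <= b -> Cmod (x * y)%C <= a * b.
Proof.
  intros Hx Hy. rewrite Cmod_mult.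
  apply Rmult_le_compat; auto using Cmod_ge_0.
Qed.

(** The uniform structure of C uses the maximum of the two coordinates; the
    proofs below use the modulus. *)
Lemma locally_Cmod (z : C) (P : C -> Prop) :
  locally (T := C_UniformSpace) z P <->
  exists d : R, 0 < d /\ forall w, Cmod (w - z)%C < d -> P w.
Proof.
  rewrite locally_C. split.
  - intros [d Hd]. exists d. split; [apply cond_pos|].
    intros w Hw. apply Hd. exact Hw.
  - intros [d [Hd H]]. exists (mkposreal d Hd).
    intros w Hw. apply H. exact Hw.
Qed.

(** Derivatives refer to C as an absolute ring, continuity to C as a product
    space. The two uniform structures have the same neighbourhoods. *)
Lemma locally_Cabs (z : C) (P : C -> Prop) :
  locally (T := AbsRing_UniformSpace C_AbsRing) z P <->
  exists d : R, 0 < d /\ forall w, Cmod (w - z)%C < d -> P w.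
Proof. rewrite <- locally_C. apply locally_Cmod. Qed.

Lemma continuous_Cabs {T : UniformSpace} (f : T -> C) x :
  continuous (U := AbsRing_UniformSpace C_AbsRing) f x <->
  continuous (U := C_UniformSpace) f x.
Proof.
  split; intros H P HP; apply H; apply locally_C; exact HP.
Qed.

Lemma continuous_Cmod {T : UniformSpace} (f : T -> C) x :
  continuous (U := C_UniformSpace) f x <->
  forall eps, 0 < eps -> locally x (fun y => Cmod (f y - f x)%C < eps).
Proof.
  split.
  - intros H eps He. apply (H (fun w => Cmod (w - f x)%C < eps)).
    apply locally_Cmod. exists eps. auto.
  - intros H P HP. apply locally_Cmod in HP. destruct HP as [d [Hd HP]].
    unfold filtermap. refine (filter_imp _ _ _ (H d Hd)). intros y; apply HP.
Qed.

Lemma cont_plus {T : UniformSpace} (f g : T -> C) x :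
  continuous (U := C_UniformSpace) f x -> continuous (U := C_UniformSpace) g x ->
  continuous (U := C_UniformSpace) (fun y => (f y + g y)%C) x.
Proof. exact (continuous_plus (V := C_NormedModule) f g x). Qed.

Lemma cont_opp {T : UniformSpace} (f : T -> C) x :
  continuous (U := C_UniformSpace) f x ->
  continuous (U := C_UniformSpace) (fun y => (- f y)%C) x.
Proof. exact (continuous_opp (V := C_NormedModule) f x). Qed.

Lemma cont_minus {T : UniformSpace} (f g : T -> C) x :
  continuous (U := C_UniformSpace) f x -> continuous (U := C_UniformSpace) g x ->
  continuous (U := C_UniformSpace) (fun y => (f y - g y)%C) x.
Proof. intros Hf Hg. apply cont_plus; [exact Hf|]. apply cont_opp; exact Hg. Qed.

Lemma cont_mult {T : UniformSpace} (f g : T -> C) x :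
  continuous (U := C_UniformSpace) f x -> continuous (U := C_UniformSpace) g x ->
  continuous (U := C_UniformSpace) (fun y => (f y * g y)%C) x.
Proof.
  intros Hf Hg. apply continuous_Cabs in Hf.
  exact (continuous_scal (V := C_NormedModule) f g x Hf Hg).
Qed.

Lemma cont_const {T : UniformSpace} (c : C) (x : T) :
  continuous (U := C_UniformSpace) (fun _ => c) x.
Proof. apply continuous_const. Qed.

Lemma cont_comp {T : UniformSpace} (f : T -> C) (g : C -> C) x :
  continuous (U := C_UniformSpace) f x -> ccont g (f x) ->
  continuous (U := C_UniformSpace) (fun y => g (f y)) x.
Proof. intros; apply (continuous_comp f g); assumption. Qed.

Lemma cont_RtoC {T : UniformSpace} (f : T -> R) x :
  continuous (U := R_UniformSpace) f x ->
  continuous (U := C_UniformSpace) (fun y => RtoC (f y)) x.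
Proof.
  intros H. apply continuous_Cmod. intros eps He.
  assert (H1 : locally (f x) (fun v : R => Rabs (v - f x) < eps)).
  { exists (mkposreal eps He). intros v Hv. exact Hv. }
  specialize (H _ H1). unfold filtermap in H.
  refine (filter_imp _ _ _ H). intros y Hy.
  rewrite <- RtoC_minus, Cmod_R. exact Hy.
Qed.

Lemma cont_id_R (t : R) : rcont (fun s => RtoC s) t.
Proof. apply cont_RtoC. apply continuous_id. Qed.

Lemma cder_eps f z l :
  cder f z l <->
  forall eps, 0 < eps -> exists d, 0 < d /\ forall h, Cmod h < d ->
    Cmod (f (z + h) - f z - l * h)%C <= eps * Cmod h.
Proof.
  split.
  - intros [_ H] eps He.
    specialize (H z (fun P HP => HP) (mkposreal eps He)).
    apply locally_Cabs in H. destruct H as [d [Hd H]].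
    exists d. split; [exact Hd|]. intros h Hh.
    specialize (H (z + h)%C).
    replace (z + h - z)%C with h in H by ring. specialize (H Hh).
    change (Cmod (f (z + h) + - f z + - ((z + h + - z) * l))%C
            <= eps * Cmod (z + h + - z)%C) in H.
    replace (f (z + h) - f z - l * h)%C
      with (f (z + h) + - f z + - ((z + h + - z) * l))%C by ring.
    replace (Cmod h) with (Cmod (z + h + - z)%C) by (f_equal; ring).
    exact H.
  - intros H. split; [apply is_linear_scal_l|].
    intros x Hx. pose proof (is_filter_lim_locally_unique (V := AbsRing_NormedModule C_AbsRing) z x Hx) as Hx0. clear Hx.
    rewrite <- Hx0. intros eps. destruct (H eps (cond_pos eps)) as [d [Hd Hh]].
    apply locally_Cabs. exists d. split; [exact Hd|]. intros w Hw.
    specialize (Hh (w - z)%C Hw).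
    change (Cmod (f w + - f z + - ((w + - z) * l))%C
            <= eps * Cmod (w + - z)%C).
    replace (z + (w - z))%C with w in Hh by ring.
    replace (f w + - f z + - ((w + - z) * l))%C
      with (f w - f z - l * (w - z))%C by ring.
    exact Hh.
Qed.

Lemma cder_ccont f z l : cder f z l -> ccont f z.
Proof.
  intros H. apply continuous_Cmod. intros eps He.
  destruct (proj1 (cder_eps f z l) H 1 Rlt_0_1) as [d [Hd Hh]].
  pose proof (Cmod_ge_0 l) as Hl.
  apply locally_Cmod. exists (Rmin d (eps / (Cmod l + 2))).
  split. { apply Rmin_pos; [exact Hd|]. apply Rdiv_lt_0_compat; lra. }
  intros w Hw.
  assert (H1 : Cmod (w - z)%C < d) by (eapply Rlt_le_trans; [exact Hw|apply Rmin_l]).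
  assert (H2 : Cmod (w - z)%C < eps / (Cmod l + 2))
    by (eapply Rlt_le_trans; [exact Hw|apply Rmin_r]).
  specialize (Hh _ H1). replace (z + (w - z))%C with w in Hh by ring.
  replace (f w - f z)%C with ((f w - f z - l * (w - z)) + l * (w - z))%C by ring.
  eapply Rle_lt_trans; [apply Cmod_triangle|]. rewrite Cmod_mult.
  apply (Rmult_lt_compat_r (Cmod l + 2)) in H2; [|lra].
  unfold Rdiv in H2. rewrite Rmult_assoc, Rinv_l, Rmult_1_r in H2 by lra.
  pose proof (Cmod_ge_0 (w - z)%C). nra.
Qed.

Lemma holo_ccont f z : holo f z -> ccont f z.
Proof. intros [l H]. exact (cder_ccont f z l H). Qed.

Lemma cder_eq f z l l' : cder f z l -> l = l' -> cder f z l'.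
Proof. intros H <-. exact H. Qed.

Lemma cder_const c z : cder (fun _ => c) z 0%C.
Proof. exact (is_derive_const (K := C_AbsRing) (V := C_NormedModule) c z). Qed.

Lemma cder_plus f g z l m :
  cder f z l -> cder g z m -> cder (fun w => f w + g w)%C z (l + m)%C.
Proof. exact (is_derive_plus (K := C_AbsRing) (V := C_NormedModule) f g z l m). Qed.

Lemma cder_opp f z l : cder f z l -> cder (fun w => - f w)%C z (- l)%C.
Proof. exact (is_derive_opp (K := C_AbsRing) (V := C_NormedModule) f z l). Qed.

Lemma cder_minus f g z l m :
  cder f z l -> cder g z m -> cder (fun w => f w - g w)%C z (l - m)%C.
Proof. exact (is_derive_minus (K := C_AbsRing) (V := C_NormedModule) f g z l m). Qed.

Lemma cder_id z : cder (fun w => w) z 1%C.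
Proof.
  apply cder_eps. intros eps He. exists 1. split; [lra|]. intros h _.
  replace (z + h - z - 1 * h)%C with (RtoC 0) by ring. rewrite Cmod_0.
  pose proof (Cmod_ge_0 h). nra.
Qed.

Lemma cder_mult f g z l m :
  cder f z l -> cder g z m ->
  cder (fun w => f w * g w)%C z (l * g z + f z * m)%C.
Proof.
  intros Hf Hg.
  pose proof (cder_ccont _ _ _ Hg) as Cg.
  apply cder_eps. intros eps He.
  pose proof (Cmod_ge_0 l) as Pl. pose proof (Cmod_ge_0 (f z)) as Pf. pose proof (Cmod_ge_0 (g z)) as Pg.
  set (K := 2 + Cmod l + Cmod (f z) + Cmod (g z)).
  assert (HK : 0 < K) by (unfold K; lra).
  assert (Hek : 0 < eps / K) by (apply Rdiv_lt_0_compat; lra).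
  assert (HeK : eps / K * K = eps) by (field; lra).
  destruct (proj1 (cder_eps f z l) Hf _ Hek) as [d1 [Hd1 H1]].
  destruct (proj1 (cder_eps g z m) Hg _ Hek) as [d2 [Hd2 H2]].
  assert (Hm1 : 0 < Rmin (eps / K) 1) by (apply Rmin_pos; lra).
  apply continuous_Cmod with (eps := Rmin (eps / K) 1) in Cg; [|exact Hm1].
  apply locally_Cmod in Cg. destruct Cg as [d3 [Hd3 H3]].
  exists (Rmin d1 (Rmin d2 d3)).
  split. { repeat apply Rmin_pos; assumption. }
  intros h Hh.
  assert (Hh1 : Cmod h < d1) by (eapply Rlt_le_trans; [exact Hh|apply Rmin_l]).
  assert (Hh2 : Cmod h < d2)
    by (eapply Rlt_le_trans; [exact Hh|eapply Rle_trans; [apply Rmin_r|apply Rmin_l]]).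
  assert (Hh3 : Cmod h < d3)
    by (eapply Rlt_le_trans; [exact Hh|eapply Rle_trans; [apply Rmin_r|apply Rmin_r]]).
  specialize (H1 h Hh1). specialize (H2 h Hh2). specialize (H3 (z + h)%C).
  replace (z + h - z)%C with h in H3 by ring. specialize (H3 Hh3).
  assert (Hg1 : Cmod (g (z + h)%C - g z)%C < eps / K)
    by (eapply Rlt_le_trans; [exact H3|apply Rmin_l]).
  assert (Hg2 : Cmod (g (z + h)%C - g z)%C < 1)
    by (eapply Rlt_le_trans; [exact H3|apply Rmin_r]).
  replace (f (z + h) * g (z + h) - f z * g z - (l * g z + f z * m) * h)%C
    with ((f (z + h) - f z - l * h) * (g z + (g (z + h) - g z))
          + (l * h * (g (z + h) - g z) + f z * (g (z + h) - g z - m * h)))%C by ring.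
  eapply Rle_trans; [apply Cmod_triangle|].
  assert (A1 : Cmod ((f (z + h) - f z - l * h) * (g z + (g (z + h) - g z)))%C
               <= (eps / K * Cmod h) * (Cmod (g z) + 1)).
  { apply Cmod_mult_le; [exact H1|].
    eapply Rle_trans; [apply Cmod_triangle|]. lra. }
  assert (A2 : Cmod (l * h * (g (z + h) - g z))%C <= (Cmod l * Cmod h) * (eps / K)).
  { apply Cmod_mult_le; [rewrite Cmod_mult; lra|lra]. }
  assert (A3 : Cmod (f z * (g (z + h) - g z - m * h))%C
               <= Cmod (f z) * (eps / K * Cmod h)).
  { apply Cmod_mult_le; [lra|exact H2]. }
  pose proof (Cmod_triangle (l * h * (g (z + h) - g z))%C
                (f z * (g (z + h) - g z - m * h))%C) as A4.
  assert (E : eps * Cmod h = eps / K * Cmod h * (2 + Cmod l + Cmod (f z) + Cmod (g z))).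
  { rewrite <- HeK at 1. unfold K. ring. }
  rewrite E.
  assert (0 <= eps / K * Cmod h)
    by (apply Rmult_le_pos; [lra|apply Cmod_ge_0]).
  nra.
Qed.

Lemma cder_scal_l (c : C) f z l : cder f z l -> cder (fun w => c * f w)%C z (c * l)%C.
Proof.
  intros H. eapply cder_eq; [apply cder_mult; [apply cder_const|exact H]|]. cbv beta; ring.
Qed.

Lemma cder_comp f g z l m :
  cder f (g z) l -> cder g z m -> cder (fun w => f (g w)) z (l * m)%C.
Proof.
  intros Hf Hg. pose proof (cder_ccont _ _ _ Hg) as Cg.
  apply cder_eps. intros eps He.
  pose proof (Cmod_ge_0 l) as Pl. pose proof (Cmod_ge_0 m) as Pm.
  set (K := 2 + Cmod l + Cmod m).
  assert (HK : 0 < K) by (unfold K; lra).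
  set (e := Rmin 1 (eps / K)).
  assert (Hek : 0 < e) by (apply Rmin_pos; [lra|apply Rdiv_lt_0_compat; lra]).
  assert (He1 : e <= 1) by apply Rmin_l.
  assert (HeK : e * K <= eps).
  { assert (e <= eps / K) by apply Rmin_r.
    apply (Rmult_le_compat_r K) in H; [|lra].
    replace (eps / K * K) with eps in H by (field; lra). exact H. }
  destruct (proj1 (cder_eps f (g z) l) Hf _ Hek) as [d1 [Hd1 H1]].
  destruct (proj1 (cder_eps g z m) Hg _ Hek) as [d2 [Hd2 H2]].
  apply continuous_Cmod with (eps := d1) in Cg; [|exact Hd1].
  apply locally_Cmod in Cg. destruct Cg as [d3 [Hd3 H3]].
  exists (Rmin d2 d3). split; [apply Rmin_pos; assumption|].
  intros h Hh.
  assert (Hh2 : Cmod h < d2) by (eapply Rlt_le_trans; [exact Hh|apply Rmin_l]).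
  assert (Hh3 : Cmod h < d3) by (eapply Rlt_le_trans; [exact Hh|apply Rmin_r]).
  specialize (H3 (z + h)%C). replace (z + h - z)%C with h in H3 by ring.
  specialize (H1 _ (H3 Hh3)). specialize (H2 _ Hh2).
  replace (g z + (g (z + h) - g z))%C with (g (z + h)%C) in H1 by ring.
  replace (f (g (z + h)) - f (g z) - l * m * h)%C
    with ((f (g (z + h)) - f (g z) - l * (g (z + h) - g z))
          + l * (g (z + h) - g z - m * h))%C by ring.
  eapply Rle_trans; [apply Cmod_triangle|].
  assert (A : Cmod (g (z + h) - g z)%C <= (e + Cmod m) * Cmod h).
  { replace (g (z + h) - g z)%C with ((g (z + h) - g z - m * h) + m * h)%C by ring.
    eapply Rle_trans; [apply Cmod_triangle|]. rewrite Cmod_mult. lra. }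
  rewrite Cmod_mult. pose proof (Cmod_ge_0 h).
  assert (B1 : e * Cmod (g (z + h) - g z)%C <= e * ((e + Cmod m) * Cmod h))
    by (apply Rmult_le_compat_l; lra).
  assert (B2 : Cmod l * Cmod (g (z + h) - g z - m * h)%C <= Cmod l * (e * Cmod h))
    by (apply Rmult_le_compat_l; lra).
  assert (B3 : (e * K) * Cmod h <= eps * Cmod h) by (apply Rmult_le_compat_r; lra).
  unfold K in B3. assert (0 <= e * Cmod h) by (apply Rmult_le_pos; lra).
  nra.
Qed.

Lemma cder_inv (z : C) : z <> 0%C -> cder (fun w => / w)%C z (- / (z * z))%C.
Proof.
  intros Hz. pose proof (proj1 (Cmod_gt_0 z) Hz) as Hp.
  apply cder_eps. intros eps He.
  exists (Rmin (Cmod z / 2) (eps * (Cmod z ^ 3) / 2)).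
  split. { apply Rmin_pos; [lra|]. pose proof (pow_lt _ 3 Hp). nra. }
  intros h Hh.
  assert (H1 : Cmod h < Cmod z / 2) by (eapply Rlt_le_trans; [exact Hh|apply Rmin_l]).
  assert (H2 : Cmod h < eps * (Cmod z ^ 3) / 2)
    by (eapply Rlt_le_trans; [exact Hh|apply Rmin_r]).
  assert (H3 : Cmod z / 2 <= Cmod (z + h)%C)
    by (pose proof (Cmod_triangle_rev z h); lra).
  assert (Hzh : (z + h)%C <> 0%C) by (apply Cmod_gt_0; lra).
  replace (/ (z + h) - / z - - / (z * z) * h)%C
    with (h * (h * / (z * z * (z + h))))%C by (field; auto).
  rewrite Cmod_mult, (Rmult_comm eps).
  apply Rmult_le_compat_l; [apply Cmod_ge_0|].
  rewrite Cmod_mult, Cmod_inv; [|repeat apply Cmult_neq_0; assumption].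
  rewrite !Cmod_mult.
  assert (H4 : 0 < Cmod z * Cmod z * Cmod (z + h)%C)
    by (apply Rmult_lt_0_compat; [nra|lra]).
  apply (Rmult_le_reg_r (Cmod z * Cmod z * Cmod (z + h)%C)); [exact H4|].
  rewrite Rmult_assoc, Rinv_l by lra.
  assert (Cmod z * Cmod z * (Cmod z / 2) <= Cmod z * Cmod z * Cmod (z + h)%C)
    by (apply Rmult_le_compat_l; nra).
  simpl in H2. nra.
Qed.

Lemma cder_Cinv f z l :
  cder f z l -> f z <> 0%C -> cder (fun w => / f w)%C z (- / (f z * f z) * l)%C.
Proof. intros Hf Hz. exact (cder_comp (fun w => / w)%C f z _ _ (cder_inv _ Hz) Hf). Qed.

Lemma cder_ext_loc (f g : C -> C) (z l : C) d :
  0 < d -> (forall w, Cmod (w - z)%C < d -> f w = g w) -> cder f z l -> cder g z l.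
Proof.
  intros Hd H Hf. refine (is_derive_ext_loc _ _ _ _ _ Hf). apply locally_Cabs. exists d; auto.
Qed.

Lemma holo_ext_loc (f g : C -> C) (z : C) d :
  0 < d -> (forall w, Cmod (w - z)%C < d -> f w = g w) -> holo f z -> holo g z.
Proof. intros Hd H [l Hf]. exists l. exact (cder_ext_loc f g z l d Hd H Hf). Qed.

Lemma holo_const (c z : C) : holo (fun _ => c) z.
Proof. exists (RtoC 0). apply cder_const. Qed.
Lemma holo_id (z : C) : holo (fun w => w) z.
Proof. exists (RtoC 1). apply cder_id. Qed.
Lemma holo_plus f g z : holo f z -> holo g z -> holo (fun w => f w + g w)%C z.
Proof. intros [l Hf] [m Hg]. exists (l + m)%C. exact (cder_plus _ _ _ _ _ Hf Hg). Qed.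
Lemma holo_opp f z : holo f z -> holo (fun w => - f w)%C z.
Proof. intros [l Hf]. exists (- l)%C. exact (cder_opp _ _ _ Hf). Qed.
Lemma holo_minus f g z : holo f z -> holo g z -> holo (fun w => f w - g w)%C z.
Proof. intros [l Hf] [m Hg]. exists (l - m)%C. exact (cder_minus _ _ _ _ _ Hf Hg). Qed.
Lemma holo_mult f g z : holo f z -> holo g z -> holo (fun w => f w * g w)%C z.
Proof. intros [l Hf] [m Hg]. eexists. exact (cder_mult _ _ _ _ _ Hf Hg). Qed.
Lemma holo_comp f g z : holo f (g z) -> holo g z -> holo (fun w => f (g w)) z.
Proof. intros [l Hf] [m Hg]. eexists. exact (cder_comp _ _ _ _ _ Hf Hg). Qed.
Lemma holo_inv f z : holo f z -> f z <> 0%C -> holo (fun w => / f w)%C z.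
Proof. intros [l Hf] Hz. eexists. exact (cder_Cinv _ _ _ Hf Hz). Qed.
Lemma holo_div f g z :
  holo f z -> holo g z -> g z <> 0%C -> holo (fun w => f w / g w)%C z.
Proof. intros Hf Hg Hz. apply holo_mult; [exact Hf|apply holo_inv; assumption]. Qed.

Lemma C_eq (z w : C) : Re z = Re w -> Im z = Im w -> z = w.
Proof. destruct z, w; simpl; intros; subst; reflexivity. Qed.

Lemma Re_plus (z w : C) : Re (z + w)%C = Re z + Re w. Proof. reflexivity. Qed.
Lemma Im_plus (z w : C) : Im (z + w)%C = Im z + Im w. Proof. reflexivity. Qed.
Lemma Re_opp (z : C) : Re (- z)%C = - Re z. Proof. reflexivity. Qed.
Lemma Im_opp (z : C) : Im (- z)%C = - Im z. Proof. reflexivity. Qed.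
Lemma Re_minus (z w : C) : Re (z - w)%C = Re z - Re w. Proof. reflexivity. Qed.
Lemma Im_minus (z w : C) : Im (z - w)%C = Im z - Im w. Proof. reflexivity. Qed.
Lemma Re_mult (z w : C) : Re (z * w)%C = Re z * Re w - Im z * Im w.
Proof. reflexivity. Qed.
Lemma Im_mult (z w : C) : Im (z * w)%C = Re z * Im w + Im z * Re w.
Proof. reflexivity. Qed.
Lemma Re_RtoC (x : R) : Re (RtoC x) = x. Proof. reflexivity. Qed.
Lemma Im_RtoC (x : R) : Im (RtoC x) = 0. Proof. reflexivity. Qed.
Lemma Re_Ci : Re Ci = 0. Proof. reflexivity. Qed.
Lemma Im_Ci : Im Ci = 1. Proof. reflexivity. Qed.
Lemma Re_div_R (z : C) (x : R) : x <> 0 -> Re (z / RtoC x)%C = Re z / x.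
Proof.
  intros Hx. unfold Cdiv. rewrite <- RtoC_inv by exact Hx. rewrite Re_mult, Re_RtoC, Im_RtoC.
  unfold Rdiv; ring.
Qed.
Lemma Im_div_R (z : C) (x : R) : x <> 0 -> Im (z / RtoC x)%C = Im z / x.
Proof.
  intros Hx. unfold Cdiv. rewrite <- RtoC_inv by exact Hx. rewrite Im_mult, Re_RtoC, Im_RtoC.
  unfold Rdiv; ring.
Qed.

Ltac reim :=
  repeat first
    [ rewrite Re_plus | rewrite Im_plus | rewrite Re_minus | rewrite Im_minus
    | rewrite Re_opp | rewrite Im_opp | rewrite Re_mult | rewrite Im_mult
    | rewrite Re_RtoC | rewrite Im_RtoC | rewrite Re_Ci | rewrite Im_Ci ].

Lemma Ci2 : (Ci * Ci)%C = (- (1))%C.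
Proof. apply C_eq; simpl; ring. Qed.

Lemma RtoC_neq_0 (x : R) : x <> 0 -> RtoC x <> 0%C.
Proof. intros H E. apply H. exact (f_equal Re E). Qed.

Lemma Ci_neq_0 : Ci <> 0%C.
Proof. intros E. apply (f_equal Im) in E. simpl in E. lra. Qed.

(** * The complex exponential *)

Lemma cexp_plus (z w : C) : cexp (z + w)%C = (cexp z * cexp w)%C.
Proof.
  unfold cexp. rewrite Re_plus, Im_plus, exp_plus, cos_plus, sin_plus.
  apply C_eq; simpl; ring.
Qed.

Lemma cexp_R (x : R) : cexp (RtoC x) = RtoC (exp x).
Proof.
  unfold cexp. rewrite Re_RtoC, Im_RtoC, cos_0, sin_0. apply C_eq; simpl; ring.
Qed.

Lemma cexp_0 : cexp 0%C = 1%C.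
Proof. rewrite cexp_R, exp_0. reflexivity. Qed.

Lemma cexp_opp_l (z : C) : (cexp (- z) * cexp z)%C = 1%C.
Proof. rewrite <- cexp_plus, <- cexp_0. f_equal. ring. Qed.

Lemma cexp_neq_0 (z : C) : cexp z <> 0%C.
Proof.
  intros E. pose proof (cexp_opp_l z) as H. rewrite E, Cmult_0_r in H.
  apply (f_equal Re) in H. simpl in H. lra.
Qed.

Lemma cexp_opp (z : C) : cexp (- z)%C = (/ cexp z)%C.
Proof.
  pose proof (cexp_neq_0 z) as Hz.
  rewrite <- (Cmult_1_l (/ cexp z)), <- (cexp_opp_l z). field. exact Hz.
Qed.

Lemma cexp_minus (z w : C) : cexp (z - w)%C = (cexp z / cexp w)%C.
Proof. unfold Cminus. rewrite cexp_plus, cexp_opp. reflexivity. Qed.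

Lemma Cmod_cexp (z : C) : Cmod (cexp z) = exp (Re z).
Proof.
  unfold cexp. rewrite Cmod_mult, Cmod_R, Rabs_pos_eq by (left; apply exp_pos).
  replace (Cmod (cos (Im z), sin (Im z))) with 1; [ring|].
  unfold Cmod, fst, snd. pose proof (sin2_cos2 (Im z)) as H. unfold Rsqr in H.
  replace (cos (Im z) ^ 2 + sin (Im z) ^ 2) with 1 by (simpl; lra).
  symmetry; apply sqrt_1.
Qed.

Lemma cexp_iPI : cexp (Ci * PI)%C = (- (1))%C.
Proof.
  unfold cexp. reim.
  replace (0 * PI - 1 * 0) with 0 by ring. replace (0 * 0 + 1 * PI) with PI by ring.
  rewrite exp_0, cos_PI, sin_PI. apply C_eq; simpl; ring.
Qed.

Lemma cexp_iPI2 : cexp (Ci * (PI / 2))%C = Ci.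
Proof.
  unfold cexp.
  replace (Ci * (PI / 2))%C with (Ci * RtoC (PI / 2))%C
    by (rewrite RtoC_div; [reflexivity|lra]).
  reim.
  replace (0 * (PI / 2) - 1 * 0) with 0 by ring.
  replace (0 * 0 + 1 * (PI / 2)) with (PI / 2) by ring.
  rewrite exp_0, cos_PI2, sin_PI2. apply C_eq; simpl; ring.
Qed.

Lemma deriv_at_0 (f : R -> R) (l : R) :
  is_derive f 0 l -> forall eps, 0 < eps -> exists d, 0 < d /\ forall x, Rabs x < d -> Rabs (f x - f 0 - l * x) <= eps * Rabs x.
Proof.
  intros [_ H] eps He.
  specialize (H 0 (fun P HP => HP) (mkposreal eps He)).
  destruct H as [d Hd]. exists d. split; [apply cond_pos|]. intros x Hx.
  specialize (Hd x).
  replace (f x - f 0 - l * x) with (f x + - f 0 + - ((x + - 0) * l)) by ring.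
  replace (Rabs x) with (Rabs (x + - 0)) by (f_equal; ring).
  apply Hd. change (Rabs (x + - 0) < d). replace (x + - 0) with x by ring. exact Hx.
Qed.

Lemma cder_cexp (z : C) : cder cexp z (cexp z).
Proof.
  apply cder_eps. intros eps He.
  assert (Hz : 0 < Cmod (cexp z)) by (apply Cmod_gt_0, cexp_neq_0).
  set (K := Cmod (cexp z)) in *.
  set (e := Rmin 1 (eps / (10 * K))).
  assert (Hep : 0 < e) by (apply Rmin_pos; [lra|apply Rdiv_lt_0_compat; lra]).
  assert (He1 : e <= 1) by apply Rmin_l.
  assert (HeK : e * 10 * K <= eps).
  { assert (H : e <= eps / (10 * K)) by apply Rmin_r.
    apply (Rmult_le_compat_r (10 * K)) in H; [|lra].
    replace (eps / (10 * K) * (10 * K)) with eps in H by (field; lra). lra. }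
  assert (D1 : is_derive exp 0 1)
    by (pose proof (is_derive_exp 0) as H; rewrite exp_0 in H; exact H).
  assert (D2 : is_derive cos 0 0).
  { pose proof (is_derive_cos 0) as H. rewrite sin_0, Ropp_0 in H. exact H. }
  assert (D3 : is_derive sin 0 1).
  { pose proof (is_derive_sin 0) as H. rewrite cos_0 in H. exact H. }
  destruct (deriv_at_0 _ _ D1 e Hep) as [d1 [Hd1 H1]].
  destruct (deriv_at_0 _ _ D2 e Hep) as [d2 [Hd2 H2]].
  destruct (deriv_at_0 _ _ D3 e Hep) as [d3 [Hd3 H3]].
  exists (Rmin (e / 2) (Rmin d1 (Rmin d2 d3))).
  split. { repeat apply Rmin_pos; lra. }
  intros h Hh.
  assert (M0 := Rmin_l (e / 2) (Rmin d1 (Rmin d2 d3))).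
  assert (M1 := Rmin_r (e / 2) (Rmin d1 (Rmin d2 d3))).
  assert (M2 := Rmin_l d1 (Rmin d2 d3)). assert (M3 := Rmin_r d1 (Rmin d2 d3)).
  assert (M4 := Rmin_l d2 d3). assert (M5 := Rmin_r d2 d3).
  pose proof (re_le_Cmod h) as Rx. pose proof (im_le_Cmod h) as Ry.
  specialize (H1 (Re h) ltac:(lra)). specialize (H2 (Im h) ltac:(lra)).
  specialize (H3 (Im h) ltac:(lra)).
  rewrite exp_0 in H1. rewrite cos_0 in H2. rewrite sin_0 in H3.
  rewrite cexp_plus.
  replace (cexp z * cexp h - cexp z - cexp z * h)%C
    with (cexp z * (cexp h - 1 - h))%C by ring.
  rewrite Cmod_mult. fold K.
  set (x := Re h) in *. set (y := Im h) in *. set (r := Cmod h) in *.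
  assert (E1 : Rabs (exp x - 1) <= 2 * Rabs x).
  { replace (exp x - 1) with ((exp x - 1 - 1 * x) + x) by ring.
    eapply Rle_trans; [apply Rabs_triang|]. pose proof (Rabs_pos x). nra. }
  assert (E2 : Rabs (exp x) <= 2).
  { replace (exp x) with ((exp x - 1) + 1) by ring.
    eapply Rle_trans; [apply Rabs_triang|]. rewrite Rabs_R1. lra. }
  assert (B : Cmod (cexp h - 1 - h)%C <= 10 * e * r).
  { eapply Rle_trans; [apply Cmod_le_re_im|].
    unfold cexp. fold x. fold y.
    replace (Re ((RtoC (exp x) * (cos y, sin y)) - 1 - h)%C)
      with ((exp x - 1 - 1 * x) + exp x * (cos y - 1 - 0 * y))
      by (reim; change (Re (cos y, sin y)) with (cos y);
          change (Im (cos y, sin y)) with (sin y); fold x; fold y; ring).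
    replace (Im ((RtoC (exp x) * (cos y, sin y)) - 1 - h)%C)
      with (exp x * (sin y - 0 - 1 * y) + (exp x - 1) * y)
      by (reim; change (Re (cos y, sin y)) with (cos y);
          change (Im (cos y, sin y)) with (sin y); fold x; fold y; ring).
    pose proof (Rabs_triang (exp x - 1 - 1 * x) (exp x * (cos y - 1 - 0 * y))) as T1.
    pose proof (Rabs_triang (exp x * (sin y - 0 - 1 * y)) ((exp x - 1) * y)) as T2.
    rewrite Rabs_mult in T1.
    rewrite (Rabs_mult (exp x)), (Rabs_mult (exp x - 1)) in T2.
    pose proof (Rabs_pos x). pose proof (Rabs_pos y).
    assert (Q1 : Rabs (exp x) * Rabs (cos y - 1 - 0 * y) <= 2 * (e * Rabs y))
      by (apply Rmult_le_compat; auto using Rabs_pos).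
    assert (Q2 : Rabs (exp x) * Rabs (sin y - 0 - 1 * y) <= 2 * (e * Rabs y))
      by (apply Rmult_le_compat; auto using Rabs_pos).
    assert (Q3 : Rabs (exp x - 1) * Rabs y <= e * Rabs y)
      by (apply Rmult_le_compat_r; lra).
    assert (e * Rabs x <= e * r) by (apply Rmult_le_compat_l; lra).
    assert (e * Rabs y <= e * r) by (apply Rmult_le_compat_l; lra).
    assert (0 <= e * Rabs x) by (apply Rmult_le_pos; lra).
    lra. }
  assert (0 <= r) by apply Cmod_ge_0.
  eapply Rle_trans; [apply Rmult_le_compat_l; [lra|exact B]|].
  replace (K * (10 * e * r)) with (e * 10 * K * r) by ring.
  apply Rmult_le_compat_r; assumption.
Qed.

Lemma holo_cexp (f : C -> C) z : holo f z -> holo (fun w => cexp (f w)) z.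
Proof.
  intros H. apply (holo_comp cexp f); [|exact H].
  exists (cexp (f z)). apply cder_cexp.
Qed.

Lemma cder_cexp_comp (f : C -> C) z l :
  cder f z l -> cder (fun w => cexp (f w)) z (cexp (f z) * l)%C.
Proof. intros H. exact (cder_comp cexp f z _ _ (cder_cexp _) H). Qed.

(** Closes the holomorphy goals that follow from the shape of the function; the
    nonvanishing of denominators is left to the user. *)
Ltac holo_auto :=
  match goal with
  | H : holo ?f ?z |- holo ?f ?z => exact H
  | |- holo (fun w => w) _ => apply holo_id
  | |- holo (fun _ => ?c) _ => apply holo_const
  | |- holo (Cmult ?c) _ => apply (holo_mult (fun _ => c) (fun w => w)); holo_auto
  | |- holo (Cplus ?c) _ => apply (holo_plus (fun _ => c) (fun w => w)); holo_auto
  | |- holo (fun w => (@?f w + @?g w)%C) _ => apply (holo_plus f g); holo_auto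
  | |- holo (fun w => (@?f w - @?g w)%C) _ => apply (holo_minus f g); holo_auto
  | |- holo (fun w => (@?f w * @?g w)%C) _ => apply (holo_mult f g); holo_auto
  | |- holo (fun w => (@?f w / @?g w)%C) _ => apply (holo_div f g); [holo_auto|holo_auto|]
  | |- holo (fun w => (/ @?f w)%C) _ => apply (holo_inv f); [holo_auto|]
  | |- holo (fun w => (- @?f w)%C) _ => apply (holo_opp f); holo_auto
  | |- holo (fun w => cexp (@?f w)) _ => apply (holo_cexp f); holo_auto
  | _ => idtac
  end.

(** * Riemann integrals of complex-valued functions *)

Lemma norm_CR (z : C) : norm (K := R_AbsRing) (V := C_R_NormedModule) z = Cmod z.
Proof.
  unfold norm; simpl. unfold prod_norm, Cmod. f_equal.
  change (Rabs (fst z) ^ 2 + Rabs (snd z) ^ 2 = fst z ^ 2 + snd z ^ 2).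
  rewrite !RPow_abs, !Rabs_pos_eq by apply pow2_ge_0. reflexivity.
Qed.

Lemma scal_CR (k : R) (z : C) :
  scal (K := R_AbsRing) (V := C_R_NormedModule) k z = (RtoC k * z)%C.
Proof.
  destruct z as [z1 z2]. apply C_eq;
    [change (k * z1 = k * z1 - 0 * z2)|change (k * z2 = k * z2 + 0 * z1)]; ring.
Qed.

Definition is_CRI (f : R -> C) (a b : R) (l : C) : Prop :=
  is_RInt (V := C_R_NormedModule) f a b l.

Lemma is_CRI_unique f a b l : is_CRI f a b l -> CRI f a b = l.
Proof. exact (is_RInt_unique (V := C_R_CompleteNormedModule) f a b l). Qed.

Lemma CRI_correct f a b :
  a <= b -> (forall t, a <= t <= b -> rcont f t) -> is_CRI f a b (CRI f a b).
Proof.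
  intros Hab H. apply (RInt_correct (V := C_R_CompleteNormedModule)).
  apply (ex_RInt_continuous (V := C_R_CompleteNormedModule)).
  intros t Ht. rewrite Rmin_left, Rmax_right in Ht by exact Hab.
  exact (H t Ht).
Qed.

Lemma is_CRI_ext f g a b l :
  a <= b -> (forall t, a <= t <= b -> f t = g t) -> is_CRI f a b l -> is_CRI g a b l.
Proof.
  intros Hab H. apply (is_RInt_ext (V := C_R_NormedModule)).
  intros t Ht. rewrite Rmin_left, Rmax_right in Ht by exact Hab. apply H; lra.
Qed.

Lemma CRI_ext f g a b :
  a <= b -> (forall t, a <= t <= b -> f t = g t) -> CRI f a b = CRI g a b.
Proof.
  intros Hab H. apply (RInt_ext (V := C_R_CompleteNormedModule)).
  intros t Ht. rewrite Rmin_left, Rmax_right in Ht by exact Hab. apply H; lra.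
Qed.

Lemma is_CRI_plus f g a b l m :
  is_CRI f a b l -> is_CRI g a b m -> is_CRI (fun t => f t + g t)%C a b (l + m)%C.
Proof. exact (is_RInt_plus (V := C_R_NormedModule) f g a b l m). Qed.

Lemma is_CRI_minus f g a b l m :
  is_CRI f a b l -> is_CRI g a b m -> is_CRI (fun t => f t - g t)%C a b (l - m)%C.
Proof. exact (is_RInt_minus (V := C_R_NormedModule) f g a b l m). Qed.

Lemma is_CRI_Ci f a b l : is_CRI f a b l -> is_CRI (fun t => Ci * f t)%C a b (Ci * l)%C.
Proof.
  intros H. destruct l as [l1 l2].
  assert (H1 : is_RInt (V := R_NormedModule) (fun t => fst (f t)) a b l1)
    by exact (is_RInt_fct_extend_fst (U := R_NormedModule) (V := R_NormedModule) f a b _ H).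
  assert (H2 : is_RInt (V := R_NormedModule) (fun t => snd (f t)) a b l2)
    by exact (is_RInt_fct_extend_snd (U := R_NormedModule) (V := R_NormedModule) f a b _ H).
  replace (Ci * (l1, l2))%C with (- l2, l1) by (apply C_eq; simpl; ring).
  apply (is_RInt_fct_extend_pair (U := R_NormedModule) (V := R_NormedModule)); simpl.
  - apply (is_RInt_ext (V := R_NormedModule) (fun t => opp (snd (f t)))).
    + intros t _. unfold opp; simpl; ring.
    + apply (is_RInt_opp (V := R_NormedModule)). exact H2.
  - apply (is_RInt_ext (V := R_NormedModule) (fun t => fst (f t))).
    + intros t _. simpl; ring.
    + exact H1.
Qed.

(** Integration is real-linear, and multiplication by i exchanges the
    coordinates; complex linearity follows. *)
Lemma is_CRI_scal (c : C) f a b l :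
  is_CRI f a b l -> is_CRI (fun t => c * f t)%C a b (c * l)%C.
Proof.
  intros H.
  assert (S : forall (k : R) g m, is_CRI g a b m ->
     is_CRI (fun t => RtoC k * g t)%C a b (RtoC k * m)%C).
  { intros k g m Hg.
    rewrite <- scal_CR.
    apply (is_RInt_ext (V := C_R_NormedModule) (fun t => scal (V := C_R_NormedModule) k (g t))).
    - intros t _. apply scal_CR.
    - apply (is_RInt_scal (V := C_R_NormedModule)). exact Hg. }
  assert (E : forall z, (c * z)%C = (RtoC (Re c) * z + RtoC (Im c) * (Ci * z))%C).
  { intros [z1 z2]; destruct c as [c1 c2]; apply C_eq; simpl; ring. }
  rewrite E.
  apply (is_RInt_ext (V := C_R_NormedModule)
    (fun t => RtoC (Re c) * f t + RtoC (Im c) * (Ci * f t))%C).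
  - intros t _. symmetry. apply E.
  - apply is_CRI_plus; apply S; [exact H|apply is_CRI_Ci; exact H].
Qed.

Lemma CRI_plus f g a b :
  a <= b -> (forall t, a <= t <= b -> rcont f t) -> (forall t, a <= t <= b -> rcont g t) ->
  CRI (fun t => f t + g t)%C a b = (CRI f a b + CRI g a b)%C.
Proof. intros. apply is_CRI_unique, is_CRI_plus; apply CRI_correct; assumption. Qed.

Lemma CRI_minus f g a b :
  a <= b -> (forall t, a <= t <= b -> rcont f t) -> (forall t, a <= t <= b -> rcont g t) ->
  CRI (fun t => f t - g t)%C a b = (CRI f a b - CRI g a b)%C.
Proof. intros. apply is_CRI_unique, is_CRI_minus; apply CRI_correct; assumption. Qed.

Lemma CRI_scal c f a b :
  a <= b -> (forall t, a <= t <= b -> rcont f t) ->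
  CRI (fun t => c * f t)%C a b = (c * CRI f a b)%C.
Proof. intros. apply is_CRI_unique, is_CRI_scal; apply CRI_correct; assumption. Qed.

Lemma is_CRI_Chasles f a b c l m :
  is_CRI f a b l -> is_CRI f b c m -> is_CRI f a c (l + m)%C.
Proof. exact (is_RInt_Chasles (V := C_R_NormedModule) f a b c l m). Qed.

Lemma CRI_Chasles f a b c :
  a <= b -> b <= c -> (forall t, a <= t <= c -> rcont f t) ->
  (CRI f a b + CRI f b c)%C = CRI f a c.
Proof.
  intros Hab Hbc H. symmetry. apply is_CRI_unique. apply (is_CRI_Chasles f a b c).
  - apply CRI_correct; [exact Hab|]. intros; apply H; lra.
  - apply CRI_correct; [exact Hbc|]. intros; apply H; lra.
Qed.

Lemma CRI_point f a : CRI f a a = 0%C.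
Proof. exact (RInt_point (V := C_R_CompleteNormedModule) a f). Qed.

Lemma is_CRI_bound f a b l M :
  a <= b -> (forall t, a <= t <= b -> Cmod (f t) <= M) -> is_CRI f a b l ->
  Cmod l <= M * (b - a).
Proof.
  intros Hab HM H. rewrite <- norm_CR.
  apply (norm_RInt_le (V := C_R_NormedModule) f (fun _ => M) a b l (M * (b - a)) Hab).
  - intros x Hx. rewrite norm_CR. apply HM; exact Hx.
  - exact H.
  - replace (M * (b - a)) with (scal (V := R_NormedModule) (b - a) M)
      by (unfold scal; simpl; unfold mult; simpl; ring).
    apply (is_RInt_const (V := R_NormedModule)).
Qed.

Lemma CRI_bound f a b M :
  a <= b -> (forall t, a <= t <= b -> rcont f t) ->
  (forall t, a <= t <= b -> Cmod (f t) <= M) -> Cmod (CRI f a b) <= M * (b - a).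
Proof.
  intros Hab Hc HM. apply (is_CRI_bound f a b _ M Hab HM). apply CRI_correct; assumption.
Qed.

Lemma is_CRI_norm f g a b l m :
  a <= b -> (forall t, a <= t <= b -> Cmod (f t) <= g t) -> is_CRI f a b l ->
  is_RInt g a b m -> Cmod l <= m.
Proof.
  intros Hab HM H Hg. rewrite <- norm_CR.
  apply (norm_RInt_le (V := C_R_NormedModule) f g a b l m Hab); [|exact H|exact Hg].
  intros x Hx. rewrite norm_CR. apply HM; exact Hx.
Qed.

Lemma is_CRI_shift f a b c l :
  is_CRI f (a + c) (b + c) l -> is_CRI (fun t => f (t + c)) a b l.
Proof.
  intros H.
  pose proof (is_RInt_comp_lin (V := C_R_NormedModule) f 1 c a b l) as K.
  rewrite !Rmult_1_l in K. specialize (K H).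
  refine (is_RInt_ext (V := C_R_NormedModule) _ _ _ _ _ _ K).
  intros t _. rewrite Rmult_1_l. exact (scal_one (V := C_R_NormedModule) _).
Qed.

Lemma CRI_shift f a b c :
  a <= b -> (forall t, a + c <= t <= b + c -> rcont f t) ->
  CRI (fun t => f (t + c)) a b = CRI f (a + c) (b + c).
Proof.
  intros Hab H. apply is_CRI_unique, is_CRI_shift, CRI_correct; [lra|exact H].
Qed.

Lemma is_CRI_neg f a b l :
  is_CRI f (- b) (- a) l -> is_CRI (fun t => f (- t)) a b l.
Proof.
  intros H. apply (is_RInt_swap (V := C_R_NormedModule)) in H.
  pose proof (is_RInt_comp_lin (V := C_R_NormedModule) f (-1) 0 a b) as K.
  replace (-1 * a + 0) with (- a) in K by ring.
  replace (-1 * b + 0) with (- b) in K by ring.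
  specialize (K _ H). apply (is_RInt_opp (V := C_R_NormedModule)) in K.
  rewrite opp_opp in K.
  refine (is_RInt_ext (V := C_R_NormedModule) _ _ _ _ _ _ K).
  intros t _. replace (-1 * t + 0) with (- t) by ring.
  destruct (f (- t)) as [u v]; apply C_eq;
    [change (- (-1 * u) = u)|change (- (-1 * v) = v)]; ring.
Qed.

Lemma CRI_neg f a b :
  a <= b -> (forall t, - b <= t <= - a -> rcont f t) ->
  CRI (fun t => f (- t)) a b = CRI f (- b) (- a).
Proof.
  intros Hab H. apply is_CRI_unique, is_CRI_neg, CRI_correct; [lra|exact H].
Qed.

(** * Complex functions along real lines *)

(** The chain rule between a complex derivative and a real parameter. *)
Lemma is_derive_line F f (p q : C) (t : R) :
  cder F (p + q * t)%C f ->
  is_derive (K := R_AbsRing) (V := C_R_NormedModule) (fun s : R => F (p + q * RtoC s)%C) t (q * f)%C.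
Proof.
  intros H. split. { apply (is_linear_scal_l (K := R_AbsRing) (V := C_R_NormedModule)). }
  intros x Hx. pose proof (is_filter_lim_locally_unique (V := R_NormedModule) t x Hx) as Hx0.
  clear Hx. rewrite <- Hx0. clear x Hx0. intros eps.
  pose proof (Cmod_ge_0 q) as Hq.
  assert (He : 0 < eps / (Cmod q + 1)) by (apply Rdiv_lt_0_compat; [apply cond_pos|lra]).
  destruct (proj1 (cder_eps _ _ _) H _ He) as [d [Hd K]].
  assert (Hd' : 0 < d / (Cmod q + 1)) by (apply Rdiv_lt_0_compat; lra).
  exists (mkposreal _ Hd'). intros s Hs.
  change (Rabs (s - t) < d / (Cmod q + 1)) in Hs.
  rewrite norm_CR. change (norm (minus s t)) with (Rabs (s - t)).
  specialize (K (q * RtoC (s - t))%C).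
  rewrite Cmod_mult, Cmod_R in K.
  apply (Rmult_lt_compat_r (Cmod q + 1)) in Hs; [|lra].
  replace (d / (Cmod q + 1) * (Cmod q + 1)) with d in Hs by (field; lra).
  pose proof (Rabs_pos (s - t)) as Hp.
  assert (K0 : Cmod q * Rabs (s - t) < d) by nra. specialize (K K0).
  rewrite RtoC_minus in K.
  replace (p + q * t + q * (s - t))%C with (p + q * s)%C in K by ring.
  match goal with |- Cmod ?X <= _ => replace X with
    (F (p + q * s) - F (p + q * t) - f * (q * (s - t)))%C end.
  - eapply Rle_trans; [exact K|].
    rewrite <- Rmult_assoc. apply Rmult_le_compat_r; [exact Hp|].
    apply (Rmult_le_reg_r (Cmod q + 1)); [lra|].
    replace (eps / (Cmod q + 1) * Cmod q * (Cmod q + 1)) with (eps * Cmod q) by (field; lra).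
    pose proof (cond_pos eps). nra.
  - rewrite <- RtoC_minus.
    match goal with |- _ = minus _ ?Y => replace Y with (RtoC (s - t) * (q * f))%C end.
    + match goal with |- ?X = minus (minus ?A ?B) ?D => change (X = (A - B - D)%C) end.
      ring.
    + symmetry. apply scal_CR.
Qed.

Lemma FTC_line F f (p q : C) a b :
  a <= b ->
  (forall t, a <= t <= b -> cder F (p + q * RtoC t)%C (f (p + q * RtoC t)%C)) ->
  (forall t, a <= t <= b -> ccont f (p + q * RtoC t)%C) ->
  is_CRI (fun t => q * f (p + q * RtoC t))%C a b (F (p + q * RtoC b) - F (p + q * RtoC a))%C.
Proof.
  intros Hab H Hc.
  apply (is_RInt_derive (V := C_R_CompleteNormedModule)
    (fun t => F (p + q * RtoC t)%C) (fun t => (q * f (p + q * RtoC t))%C)).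
  - intros t Ht. rewrite Rmin_left, Rmax_right in Ht by exact Hab.
    apply is_derive_line. apply H; exact Ht.
  - intros t Ht. rewrite Rmin_left, Rmax_right in Ht by exact Hab.
    apply cont_mult; [apply cont_const|]. apply (cont_comp (fun s : R => p + q * RtoC s)%C f).
    + apply cont_plus; [apply cont_const|]. apply cont_mult; [apply cont_const|apply cont_id_R].
    + apply Hc; exact Ht.
Qed.

Lemma pair_eq (x y : R) : ((x, y) : C) = (RtoC x + Ci * RtoC y)%C.
Proof. apply C_eq; simpl; ring. Qed.

Lemma rcont_h f (c t : R) : ccont f (t, c) -> rcont (fun s => f (s, c)) t.
Proof.
  intros H. apply (cont_comp (fun s : R => (s, c) : C) f t); [|exact H].
  apply continuous_ext with (fun s : R => (RtoC s + Ci * RtoC c)%C).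
  - intros s. symmetry. apply pair_eq.
  - apply cont_plus; [apply cont_id_R|apply cont_const].
Qed.

Lemma rcont_v f (c t : R) : ccont f (c, t) -> rcont (fun s => f (c, s)) t.
Proof.
  intros H. apply (cont_comp (fun s : R => (c, s) : C) f t); [|exact H].
  apply continuous_ext with (fun s : R => (RtoC c + Ci * RtoC s)%C).
  - intros s. symmetry. apply pair_eq.
  - apply cont_plus; [apply cont_const|]. apply cont_mult; [apply cont_const|apply cont_id_R].
Qed.

(** * Integrals over the boundary of a rectangle *)

Definition hint (f : C -> C) (a b c : R) : C := CRI (fun t => f (t, c)) a b.
Definition vint (f : C -> C) (a c d : R) : C := CRI (fun s => f (a, s)) c d.
(** The integral of f over the boundary of [a, b] x [c, d], counterclockwise. *)
Definition rect (f : C -> C) (a b c d : R) : C :=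
  (hint f a b c + Ci * vint f b c d - hint f a b d - Ci * vint f a c d)%C.

Definition on_rect (a b c d : R) (P : C -> Prop) : Prop :=
  forall x y, a <= x <= b -> c <= y <= d -> P (x, y).

Definition on_bd (a b c d : R) (P : C -> Prop) : Prop :=
  (forall x, a <= x <= b -> P (x, c) /\ P (x, d)) /\
  (forall y, c <= y <= d -> P (a, y) /\ P (b, y)).

Lemma on_rect_bd a b c d P : a <= b -> c <= d -> on_rect a b c d P -> on_bd a b c d P.
Proof. intros H1 H2 H; split; intros; split; apply H; lra. Qed.

Lemma hint_Chasles f a m b c :
  a <= m -> m <= b -> (forall x, a <= x <= b -> ccont f (x, c)) ->
  hint f a b c = (hint f a m c + hint f m b c)%C.
Proof.
  intros H1 H2 H. unfold hint. symmetry. apply CRI_Chasles; [exact H1|exact H2|].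
  intros t Ht. apply rcont_h, H; exact Ht.
Qed.

Lemma vint_Chasles f a c m d :
  c <= m -> m <= d -> (forall y, c <= y <= d -> ccont f (a, y)) ->
  vint f a c d = (vint f a c m + vint f a m d)%C.
Proof.
  intros H1 H2 H. unfold vint. symmetry. apply CRI_Chasles; [exact H1|exact H2|].
  intros t Ht. apply rcont_v, H; exact Ht.
Qed.

Lemma hint_bound f a b c M :
  a <= b -> (forall x, a <= x <= b -> ccont f (x, c)) ->
  (forall x, a <= x <= b -> Cmod (f (x, c)) <= M) -> Cmod (hint f a b c) <= M * (b - a).
Proof.
  intros Hab Hc HM. apply CRI_bound; [exact Hab| |exact HM].
  intros t Ht. apply rcont_h, Hc; exact Ht.
Qed.

Lemma vint_bound f a c d M :
  c <= d -> (forall y, c <= y <= d -> ccont f (a, y)) ->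
  (forall y, c <= y <= d -> Cmod (f (a, y)) <= M) -> Cmod (vint f a c d) <= M * (d - c).
Proof.
  intros Hab Hc HM. apply CRI_bound; [exact Hab| |exact HM].
  intros t Ht. apply rcont_v, Hc; exact Ht.
Qed.

Lemma rect_split_h f a m b c d :
  a <= m -> m <= b -> (forall x, a <= x <= b -> ccont f (x, c)) ->
  (forall x, a <= x <= b -> ccont f (x, d)) ->
  rect f a b c d = (rect f a m c d + rect f m b c d)%C.
Proof.
  intros H1 H2 Hc Hd. unfold rect.
  rewrite (hint_Chasles f a m b c), (hint_Chasles f a m b d); try assumption.
  ring.
Qed.

Lemma rect_split_v f a b c n d :
  c <= n -> n <= d -> (forall y, c <= y <= d -> ccont f (a, y)) ->
  (forall y, c <= y <= d -> ccont f (b, y)) ->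
  rect f a b c d = (rect f a b c n + rect f a b n d)%C.
Proof.
  intros H1 H2 Ha Hb. unfold rect.
  rewrite (vint_Chasles f a c n d), (vint_Chasles f b c n d); try assumption.
  ring.
Qed.

Lemma rect_bound f a b c d M :
  a <= b -> c <= d -> on_bd a b c d (ccont f) ->
  on_bd a b c d (fun z => Cmod (f z) <= M) ->
  Cmod (rect f a b c d) <= 2 * M * ((b - a) + (d - c)).
Proof.
  intros H1 H2 [Hc1 Hc2] [HM1 HM2].
  pose proof (hint_bound f a b c M H1 ltac:(intros; apply Hc1; lra)
    ltac:(intros; apply HM1; lra)) as A1.
  pose proof (hint_bound f a b d M H1 ltac:(intros; apply Hc1; lra)
    ltac:(intros; apply HM1; lra)) as A2.
  pose proof (vint_bound f a c d M H2 ltac:(intros; apply Hc2; lra)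
    ltac:(intros; apply HM2; lra)) as A3.
  pose proof (vint_bound f b c d M H2 ltac:(intros; apply Hc2; lra)
    ltac:(intros; apply HM2; lra)) as A4.
  unfold rect.
  pose proof (Cmod_triangle_minus (hint f a b c + Ci * vint f b c d - hint f a b d)%C
    (Ci * vint f a c d)%C) as T1.
  pose proof (Cmod_triangle_minus (hint f a b c + Ci * vint f b c d)%C (hint f a b d)) as T2.
  pose proof (Cmod_triangle (hint f a b c) (Ci * vint f b c d)%C) as T3.
  rewrite Cmod_mult, Cmod_Ci in T1. rewrite Cmod_mult, Cmod_Ci in T3. lra.
Qed.

Lemma rect_minus f g a b c d :
  a <= b -> c <= d -> on_bd a b c d (ccont f) -> on_bd a b c d (ccont g) ->
  rect (fun z => f z - g z)%C a b c d = (rect f a b c d - rect g a b c d)%C.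
Proof.
  intros H1 H2 [Hf1 Hf2] [Hg1 Hg2]. unfold rect, hint, vint.
  rewrite (CRI_minus (fun t => f (t, c)) (fun t => g (t, c)));
  [|exact H1|intros; apply rcont_h, Hf1; lra|intros; apply rcont_h, Hg1; lra].
  rewrite (CRI_minus (fun t => f (t, d)) (fun t => g (t, d)));
  [|exact H1|intros; apply rcont_h, Hf1; lra|intros; apply rcont_h, Hg1; lra].
  rewrite (CRI_minus (fun t => f (a, t)) (fun t => g (a, t)));
  [|exact H2|intros; apply rcont_v, Hf2; lra|intros; apply rcont_v, Hg2; lra].
  rewrite (CRI_minus (fun t => f (b, t)) (fun t => g (b, t)));
  [|exact H2|intros; apply rcont_v, Hf2; lra|intros; apply rcont_v, Hg2; lra].
  ring.
Qed.

Lemma rect_scal k f a b c d :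
  a <= b -> c <= d -> on_bd a b c d (ccont f) ->
  rect (fun z => k * f z)%C a b c d = (k * rect f a b c d)%C.
Proof.
  intros H1 H2 [Hf1 Hf2]. unfold rect, hint, vint.
  rewrite (CRI_scal k (fun t => f (t, c)));
  [|exact H1|intros; apply rcont_h, Hf1; lra].
  rewrite (CRI_scal k (fun t => f (t, d)));
  [|exact H1|intros; apply rcont_h, Hf1; lra].
  rewrite (CRI_scal k (fun t => f (a, t)));
  [|exact H2|intros; apply rcont_v, Hf2; lra].
  rewrite (CRI_scal k (fun t => f (b, t)));
  [|exact H2|intros; apply rcont_v, Hf2; lra].
  ring.
Qed.

Lemma rect_ext f g a b c d :
  a <= b -> c <= d -> on_bd a b c d (fun z => f z = g z) ->
  rect f a b c d = rect g a b c d.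
Proof.
  intros H1 H2 [E1 E2]. unfold rect, hint, vint.
  rewrite (CRI_ext (fun t => f (t, c)) (fun t => g (t, c))) by (auto; intros; apply E1; lra).
  rewrite (CRI_ext (fun t => f (t, d)) (fun t => g (t, d))) by (auto; intros; apply E1; lra).
  rewrite (CRI_ext (fun t => f (a, t)) (fun t => g (a, t))) by (auto; intros; apply E2; lra).
  rewrite (CRI_ext (fun t => f (b, t)) (fun t => g (b, t))) by (auto; intros; apply E2; lra).
  reflexivity.
Qed.

Lemma hint_primitive F f a b c :
  a <= b -> (forall x, a <= x <= b -> cder F (x, c) (f (x, c))) ->
  (forall x, a <= x <= b -> ccont f (x, c)) ->
  hint f a b c = (F (b, c) - F (a, c))%C.
Proof.
  intros Hab HF Hf. apply is_CRI_unique.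
  assert (E : forall x : R, ((x, c) : C) = (Ci * RtoC c + 1 * RtoC x)%C)
    by (intros; apply C_eq; simpl; ring).
  rewrite !E.
  apply (is_CRI_ext (fun t => 1 * f (Ci * RtoC c + 1 * RtoC t))%C); [exact Hab| |].
  - intros t _. rewrite <- E. ring.
  - apply FTC_line; [exact Hab| |]; intros t Ht; rewrite <- E; auto.
Qed.

Lemma vint_primitive F f a c d :
  c <= d -> (forall y, c <= y <= d -> cder F (a, y) (f (a, y))) ->
  (forall y, c <= y <= d -> ccont f (a, y)) ->
  (Ci * vint f a c d)%C = (F (a, d) - F (a, c))%C.
Proof.
  intros Hab HF Hf.
  assert (E : forall x : R, ((a, x) : C) = (RtoC a + Ci * RtoC x)%C)
    by (intros; apply C_eq; simpl; ring).
  unfold vint. rewrite <- CRI_scal; [|exact Hab|intros; apply rcont_v, Hf; assumption].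
  apply is_CRI_unique. rewrite !E.
  apply (is_CRI_ext (fun t => Ci * f (RtoC a + Ci * RtoC t))%C); [exact Hab| |].
  - intros t _. rewrite <- E. ring.
  - apply FTC_line; [exact Hab| |]; intros t Ht; rewrite <- E; auto.
Qed.

Lemma rect_primitive F f a b c d :
  a <= b -> c <= d -> on_rect a b c d (fun z => cder F z (f z)) ->
  on_rect a b c d (ccont f) -> rect f a b c d = 0%C.
Proof.
  intros H1 H2 HF Hf. unfold rect.
  rewrite (hint_primitive F f a b c), (hint_primitive F f a b d),
    (vint_primitive F f a c d), (vint_primitive F f b c d); try assumption;
    try (intros; apply HF; lra); try (intros; apply Hf; lra).
  ring.
Qed.

(** * The theorem of Goursat *)

(** If P fails on the whole rectangle, it fails on a quarter of it; the
    rectangles obtained by repetition shrink to a point near which P holds. *)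
Lemma bisection (P : R -> R -> R -> R -> Prop) a0 b0 c0 d0 :
  a0 < b0 -> c0 < d0 ->
  (forall a b c d, a0 <= a -> a < b -> b <= b0 -> c0 <= c -> c < d -> d <= d0 ->
     P a ((a + b) / 2) c ((c + d) / 2) -> P ((a + b) / 2) b c ((c + d) / 2) ->
     P a ((a + b) / 2) ((c + d) / 2) d -> P ((a + b) / 2) b ((c + d) / 2) d ->
     P a b c d) ->
  (forall x y, a0 <= x <= b0 -> c0 <= y <= d0 -> exists delta, 0 < delta /\
     forall a b c d, a0 <= a -> a <= x <= b -> b <= b0 -> c0 <= c -> c <= y <= d -> d <= d0 ->
       a < b -> c < d -> b - a < delta -> d - c < delta -> P a b c d) ->
  P a0 b0 c0 d0.
Proof.
  intros Hab0 Hcd0 Hq Hloc. apply NNPP. intros Hn.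
  set (bad := fun q : (R * R) * (R * R) =>
    a0 <= fst (fst q) /\ fst (fst q) < snd (fst q) /\ snd (fst q) <= b0 /\
    c0 <= fst (snd q) /\ fst (snd q) < snd (snd q) /\ snd (snd q) <= d0 /\
    ~ P (fst (fst q)) (snd (fst q)) (fst (snd q)) (snd (snd q))).
  set (sub := fun q r : (R * R) * (R * R) =>
    fst (fst q) <= fst (fst r) /\ snd (fst r) <= snd (fst q) /\
    fst (snd q) <= fst (snd r) /\ snd (snd r) <= snd (snd q) /\
    snd (fst r) - fst (fst r) = (snd (fst q) - fst (fst q)) / 2 /\
    snd (snd r) - fst (snd r) = (snd (snd q) - fst (snd q)) / 2).
  assert (Hstep : forall q, bad q -> exists r, bad r /\ sub q r).
  { intros [[a b] [c d]] (Q1 & Q2 & Q3 & Q4 & Q5 & Q6 & Q7); simpl in *.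
    assert (Hc : ~ P a ((a + b) / 2) c ((c + d) / 2) \/ ~ P ((a + b) / 2) b c ((c + d) / 2)
      \/ ~ P a ((a + b) / 2) ((c + d) / 2) d \/ ~ P ((a + b) / 2) b ((c + d) / 2) d).
    { apply NNPP. intros Hc. apply Q7. apply Hq; try assumption; apply NNPP; tauto. }
    destruct Hc as [Hc|[Hc|[Hc|Hc]]].
    - exists ((a, (a + b) / 2), (c, (c + d) / 2)). unfold bad, sub; simpl.
      repeat split; try lra; exact Hc.
    - exists (((a + b) / 2, b), (c, (c + d) / 2)). unfold bad, sub; simpl.
      repeat split; try lra; exact Hc.
    - exists ((a, (a + b) / 2), ((c + d) / 2, d)). unfold bad, sub; simpl.
      repeat split; try lra; exact Hc.
    - exists (((a + b) / 2, b), ((c + d) / 2, d)). unfold bad, sub; simpl.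
      repeat split; try lra; exact Hc. }
  set (next := fun q : {q | bad q} =>
    let (r, Hr) := constructive_indefinite_description _ (Hstep (proj1_sig q) (proj2_sig q)) in
    exist bad r (proj1 Hr)).
  assert (Hnext : forall q, sub (proj1_sig q) (proj1_sig (next q))).
  { intros q. unfold next. destruct (constructive_indefinite_description _ _) as [r Hr].
    exact (proj2 Hr). }
  assert (Hb0 : bad ((a0, b0), (c0, d0))).
  { unfold bad; simpl. repeat split; try lra; exact Hn. }
  set (s := fix s (n : nat) : {q | bad q} :=
    match n with O => exist bad _ Hb0 | S m => next (s m) end).
  set (A := fun n => fst (fst (proj1_sig (s n)))).
  set (B := fun n => snd (fst (proj1_sig (s n)))).
  set (U := fun n => fst (snd (proj1_sig (s n)))).
  set (V := fun n => snd (snd (proj1_sig (s n)))).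
  assert (Hs : forall n, A n <= A (S n) /\ B (S n) <= B n /\ U n <= U (S n) /\ V (S n) <= V n /\
     B (S n) - A (S n) = (B n - A n) / 2 /\ V (S n) - U (S n) = (V n - U n) / 2).
  { intros n. exact (Hnext (s n)). }
  assert (Hbad : forall n, a0 <= A n /\ A n < B n /\ B n <= b0 /\ c0 <= U n /\ U n < V n /\
     V n <= d0 /\ ~ P (A n) (B n) (U n) (V n)).
  { intros n. exact (proj2_sig (s n)). }
  assert (Hmon : forall n k, A n <= A (n + k)%nat /\ B (n + k)%nat <= B n /\
     U n <= U (n + k)%nat /\ V (n + k)%nat <= V n).
  { intros n k. induction k as [|k IH].
    - rewrite Nat.add_0_r. lra.
    - rewrite Nat.add_succ_r. pose proof (Hs (n + k)%nat). lra. }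
  assert (Hcross : forall n m, A n < B m /\ U n < V m).
  { intros n m. pose proof (Hmon n m) as M1. pose proof (Hmon m n) as M2.
    rewrite (Nat.add_comm m n) in M2. pose proof (Hbad (n + m)%nat). lra. }
  destruct (completeness (fun x => exists n, x = A n)) as [x [Hx1 Hx2]].
  { exists b0. intros x [n ->]. pose proof (Hbad n). lra. }
  { exists (A 0%nat), 0%nat. reflexivity. }
  destruct (completeness (fun x => exists n, x = U n)) as [y [Hy1 Hy2]].
  { exists d0. intros y [n ->]. pose proof (Hbad n). lra. }
  { exists (U 0%nat), 0%nat. reflexivity. }
  assert (Hx : forall n, A n <= x <= B n).
  { intros n. split.
    - apply Hx1. exists n; reflexivity.
    - apply Hx2. intros z [m ->]. pose proof (Hcross m n). lra. }
  assert (Hy : forall n, U n <= y <= V n).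
  { intros n. split.
    - apply Hy1. exists n; reflexivity.
    - apply Hy2. intros z [m ->]. pose proof (Hcross m n). lra. }
  assert (Hsize : forall n, B n - A n = (b0 - a0) * (/ 2) ^ n /\
                            V n - U n = (d0 - c0) * (/ 2) ^ n).
  { induction n as [|n IH].
    - unfold A, B, U, V; simpl. lra.
    - pose proof (Hs n) as (_ & _ & _ & _ & E1 & E2). rewrite E1, E2.
      destruct IH as [-> ->]. simpl. split; field. }
  destruct (Hloc x y) as [delta [Hdelta HP]].
  { pose proof (Hx 0%nat). pose proof (Hbad 0%nat). lra. }
  { pose proof (Hy 0%nat). pose proof (Hbad 0%nat). lra. }
  set (L := (b0 - a0) + (d0 - c0)).
  assert (HL : 0 < L) by (unfold L; lra).
  destruct (pow_lt_1_zero (/ 2) ltac:(rewrite Rabs_pos_eq; lra) (delta / L)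
    ltac:(apply Rdiv_lt_0_compat; lra)) as [N HN].
  specialize (HN N (le_n N)).
  assert (Hp : 0 < (/ 2) ^ N) by (apply pow_lt; lra).
  rewrite Rabs_pos_eq in HN by lra.
  apply (Rmult_lt_compat_r L) in HN; [|exact HL].
  replace (delta / L * L) with delta in HN by (field; lra).
  destruct (Hsize N) as [S1 S2]. pose proof (Hbad N) as (B1 & B2 & B3 & B4 & B5 & B6 & B7).
  apply B7. apply HP; try assumption; try apply Hx; try apply Hy; unfold L in HN; nra.
Qed.

(** The affine part of f at a point has a primitive, so its boundary integral
    vanishes; the rest is at most eps times the square of the perimeter on small
    rectangles around the point. This bound passes from the four quarters of a
    rectangle to the rectangle. *)
Theorem goursat f a b c d :
  a < b -> c < d -> on_rect a b c d (holo f) -> rect f a b c d = 0%C.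
Proof.
  intros Hab Hcd Hf.
  assert (Hc : on_rect a b c d (ccont f)) by (intros x y Hx Hy; apply holo_ccont, Hf; assumption).
  apply Cmod_eq_0. apply Rle_antisym; [|apply Cmod_ge_0].
  assert (Key : forall eps, 0 < eps ->
    Cmod (rect f a b c d) <= eps * ((b - a) + (d - c)) ^ 2).
  { intros eps He.
    apply (bisection (fun a b c d => Cmod (rect f a b c d) <= eps * ((b - a) + (d - c)) ^ 2)
      a b c d Hab Hcd).
    - intros a1 b1 c1 d1 A1 A2 A3 A4 A5 A6 H1 H2 H3 H4.
      set (m := (a1 + b1) / 2) in *. set (n := (c1 + d1) / 2) in *.
      assert (Hc1 : on_rect a1 b1 c1 d1 (ccont f)) by (intros x y Hx Hy; apply Hc; lra).
      rewrite (rect_split_h f a1 m b1 c1 d1), (rect_split_v f a1 m c1 n d1),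
        (rect_split_v f m b1 c1 n d1); unfold m, n in *; try lra;
        try (intros; apply Hc1; lra).
      eapply Rle_trans; [apply Cmod_triangle|].
      eapply Rle_trans; [apply Rplus_le_compat; apply Cmod_triangle|].
      nra.
    - intros x y Hx Hy. destruct (Hf x y Hx Hy) as [l Hl].
      change (cder f (x, y) l) in Hl.
      assert (He' : 0 < eps / 2) by lra.
      destruct (proj1 (cder_eps _ _ _) Hl _ He') as [dl [Hdl K]].
      exists (dl / 2). split; [lra|].
      intros a1 b1 c1 d1 A1 A2 A3 A4 A5 A6 A7 A8 A9 A10.
      set (z0 := (x, y) : C).
      set (g := fun z : C => (f z0 + l * (z - z0))%C).
      assert (Hg : forall z, ccont g z).
      { intros z. apply holo_ccont. unfold g. holo_auto. }
      assert (Hg0 : rect g a1 b1 c1 d1 = 0%C).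
      { apply (rect_primitive (fun z => f z0 * z + l * (z * z * / 2 - z0 * z))%C);
        [lra|lra| |intros u v _ _; apply Hg].
        intros u v _ _. eapply cder_eq.
        - apply cder_plus.
          + apply cder_scal_l, cder_id.
          + apply cder_scal_l, cder_minus; [|apply cder_scal_l, cder_id].
            apply cder_mult; [apply cder_mult; apply cder_id|apply cder_const].
        - unfold g. field. }
      assert (E : rect f a1 b1 c1 d1 = rect (fun z => f z - g z)%C a1 b1 c1 d1).
      { rewrite rect_minus; [rewrite Hg0; ring|lra|lra| |]; apply on_rect_bd; try lra.
        - intros u v Hu Hv; apply Hc; lra.
        - intros u v _ _; apply Hg. }
      rewrite E. set (s := (b1 - a1) + (d1 - c1)).
      replace (eps * s ^ 2) with (2 * (eps / 2 * s) * s) by field.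
      apply rect_bound; [lra|lra| |]; apply on_rect_bd; try lra.
      + intros u v Hu Hv. apply cont_minus; [apply Hc; lra|apply Hg].
      + intros u v Hu Hv.
        set (h := ((u, v) - z0)%C).
        assert (Hh : Cmod h <= s).
        { eapply Rle_trans; [apply Cmod_le_re_im|]. unfold h, z0, s. simpl.
          apply Rplus_le_compat; apply Rabs_le; lra. }
        assert (Hhd : Cmod h < dl) by (unfold s in Hh; lra).
        specialize (K h Hhd).
        replace ((x, y) + h)%C with ((u, v) : C) in K by (apply C_eq; unfold h, z0; simpl; ring).
        unfold g. fold h.
        replace (f (u, v) - (f z0 + l * h))%C with (f (u, v) - f z0 - l * h)%C by ring.
        eapply Rle_trans; [exact K|]. apply Rmult_le_compat_l; [lra|exact Hh]. }
  apply Rnot_lt_le. intros Hpos.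
  set (s := ((b - a) + (d - c)) ^ 2) in *.
  assert (Hs : 0 < s) by (unfold s; apply pow_lt; lra).
  specialize (Key (Cmod (rect f a b c d) / (2 * s)) ltac:(apply Rdiv_lt_0_compat; lra)).
  replace (Cmod (rect f a b c d) / (2 * s) * s) with (Cmod (rect f a b c d) / 2) in Key
    by (field; lra).
  lra.
Qed.

(** * Residues and the Cauchy formula *)

Lemma on_bd_and2 a b c d (P Q S : C -> Prop) :
  on_bd a b c d P -> on_bd a b c d Q -> (forall z, P z -> Q z -> S z) -> on_bd a b c d S.
Proof.
  intros [P1 P2] [Q1 Q2] H. split; intros t Ht; split; apply H;
    solve [apply (P1 t Ht)|apply (Q1 t Ht)|apply (P2 t Ht)|apply (Q2 t Ht)].
Qed.

(** The four rectangles that surround the inner one are free of singularities.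
    *)
Lemma rect_annulus f a b c d a1 b1 c1 d1 :
  a < a1 -> a1 < b1 -> b1 < b -> c < c1 -> c1 < d1 -> d1 < d ->
  (forall x y, a <= x <= b -> c <= y <= d ->
     ~ (a1 < x < b1 /\ c1 < y < d1) -> holo f (x, y)) ->
  rect f a b c d = rect f a1 b1 c1 d1.
Proof.
  intros H1 H2 H3 H4 H5 H6 H.
  rewrite (rect_split_h f a a1 b c d), (rect_split_h f a1 b1 b c d),
    (rect_split_v f a1 b1 c c1 d), (rect_split_v f a1 b1 c1 d1 d); try lra;
    try (intros; apply holo_ccont, H; lra).
  rewrite (goursat f a a1 c d), (goursat f b1 b c d), (goursat f a1 b1 c c1),
    (goursat f a1 b1 d1 d); try lra; try (intros x y Hx Hy; apply H; lra).
  ring.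
Qed.

(** By symmetry every side contributes the same amount, i pi / 2, an arctangent.
    *)
Lemma rect_pole p r : 0 < r ->
  rect (fun w => / (w - p))%C (Re p - r) (Re p + r) (Im p - r) (Im p + r) = (2 * PI * Ci)%C.
Proof.
  intros Hr. destruct p as [x y]; simpl.
  (* E t = 1 / (t - i r) on the bottom side; the other sides are its rotations *)
  set (E := fun t : R => (t / (t ^ 2 + r ^ 2), r / (t ^ 2 + r ^ 2)) : C).
  assert (Hp : forall t : R, 0 < t ^ 2 + r ^ 2) by (intros t; nra).
  assert (Hp2 : forall t : R, 0 < t * (t * 1) + r * (r * 1))
    by (intros t; specialize (Hp t); simpl in Hp; exact Hp).
  assert (HE : is_CRI E (- r) r (Ci * (PI / 2))%C).
  { replace (Ci * (PI / 2))%C with ((0, PI / 2) : C)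
      by (rewrite <- RtoC_div by lra; apply C_eq; simpl; ring).
    apply (is_RInt_fct_extend_pair (U := R_NormedModule) (V := R_NormedModule)); simpl.
    - replace 0 with (minus (/ 2 * ln (r ^ 2 + r ^ 2)) (/ 2 * ln ((- r) ^ 2 + r ^ 2))).
      + apply (is_RInt_derive (fun t => / 2 * ln (t ^ 2 + r ^ 2))).
        * intros t _. auto_derive; [apply Hp2|]. field. specialize (Hp2 t); lra.
        * intros t _. apply (ex_derive_continuous (V := R_NormedModule)).
          auto_derive. specialize (Hp2 t); lra.
      + unfold minus, plus, opp; simpl. replace (- r * (- r * 1)) with (r * (r * 1)) by ring. ring.
    - replace (PI / 2) with (minus (atan (r / r)) (atan (- r / r))).
      + apply (is_RInt_derive (fun t => atan (t / r))).
        * intros t _. auto_derive; [lra|]. field. specialize (Hp2 t); split; lra.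
        * intros t _. apply (ex_derive_continuous (V := R_NormedModule)).
          auto_derive. specialize (Hp2 t); lra.
      + replace (r / r) with 1 by (field; lra). replace (- r / r) with (- (1)) by (field; lra).
        rewrite atan_opp, atan_1. unfold minus, plus, opp; simpl. field. }
  assert (HE' : is_CRI (fun t => E (- t)) (- r) r (Ci * (PI / 2))%C).
  { apply is_CRI_neg. rewrite Ropp_involutive. exact HE. }
  assert (S : forall (g : R -> C) m, is_CRI g (- r) r (Ci * (PI / 2))%C ->
     CRI (fun t => g (t + - m)) (m - r) (m + r) = (Ci * (PI / 2))%C).
  { intros g m Hg. apply is_CRI_unique, is_CRI_shift.
    replace (m - r + - m) with (- r) by ring. replace (m + r + - m) with r by ring. exact Hg. }
  assert (I0 : forall u v : R, 0 < u ^ 2 + v ^ 2 -> (u, v) <> RtoC 0).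
  { intros u v H K. apply (f_equal (fun z => Re z ^ 2 + Im z ^ 2)) in K.
    simpl in K, H. lra. }
  unfold rect, hint, vint.
  rewrite (CRI_ext (fun t => / ((t, (y - r)%R) - (x, y)))%C (fun t => E (t + - x)%R)); [|lra|].
  2: { intros t _. replace ((t, (y - r)%R) - (x, y))%C with ((t + - x, - r) : C)
         by (apply C_eq; simpl; ring).
       unfold E, Cinv; simpl. specialize (Hp2 (t + - x)).
       apply C_eq; simpl; field; lra. }
  rewrite (CRI_ext (fun t => / ((t, (y + r)%R) - (x, y)))%C (fun t => (- (1)) * E (- (t + - x))%R)%C); [|lra|].
  2: { intros t _. replace ((t, (y + r)%R) - (x, y))%C with ((t + - x, r) : C)
         by (apply C_eq; simpl; ring).
       unfold E, Cinv; simpl. specialize (Hp2 (t + - x)).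
       apply C_eq; simpl; field; nra. }
  rewrite (CRI_ext (fun s => / (((x + r)%R, s) - (x, y)))%C (fun t => (- Ci) * E (t + - y)%R)%C); [|lra|].
  2: { intros t _. replace (((x + r)%R, t) - (x, y))%C with ((r, t + - y) : C)
         by (apply C_eq; simpl; ring).
       unfold E, Cinv; simpl. specialize (Hp2 (t + - y)).
       apply C_eq; simpl; field; nra. }
  rewrite (CRI_ext (fun s => / (((x - r)%R, s) - (x, y)))%C (fun t => Ci * E (- (t + - y))%R)%C); [|lra|].
  2: { intros t _. replace (((x - r)%R, t) - (x, y))%C with ((- r, t + - y) : C)
         by (apply C_eq; simpl; ring).
       unfold E, Cinv; simpl. specialize (Hp2 (t + - y)).
       apply C_eq; simpl; field; nra. }
  rewrite (S E x HE).
  rewrite (is_CRI_unique (fun t => - (1) * E (- (t + - x))%R)%C (x - r) (x + r)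
    (- (1) * (Ci * (PI / 2)))%C).
  2: { apply is_CRI_scal. apply (is_CRI_shift (fun t => E (- t))).
       replace (x - r + - x) with (- r) by ring. replace (x + r + - x) with r by ring. exact HE'. }
  rewrite (is_CRI_unique (fun t => - Ci * E (t + - y)%R)%C (y - r) (y + r)
    (- Ci * (Ci * (PI / 2)))%C).
  2: { apply is_CRI_scal. apply (is_CRI_shift E).
       replace (y - r + - y) with (- r) by ring. replace (y + r + - y) with r by ring. exact HE. }
  rewrite (is_CRI_unique (fun t => Ci * E (- (t + - y))%R)%C (y - r) (y + r)
    (Ci * (Ci * (PI / 2)))%C).
  2: { apply is_CRI_scal. apply (is_CRI_shift (fun t => E (- t))).
       replace (y - r + - y) with (- r) by ring. replace (y + r + - y) with r by ring. exact HE'. }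
  replace (Ci * (PI / 2) + Ci * (- Ci * (Ci * (PI / 2))) - - (1) * (Ci * (PI / 2))
     - Ci * (Ci * (Ci * (PI / 2))))%C
    with ((1 - Ci * Ci) * (2 * (Ci * (PI / 2))))%C by ring.
  rewrite Ci2. apply C_eq; simpl; field.
Qed.

Lemma pair_minus (x y : R) (p : C) : ((x, y) - p)%C = (x - Re p, y - Im p).
Proof. destruct p; apply C_eq; simpl; ring. Qed.

Lemma Cmod_minus_ge_re (z p : C) : Rabs (Re z - Re p) <= Cmod (z - p)%C.
Proof. exact (re_le_Cmod (z - p)%C). Qed.
Lemma Cmod_minus_ge_im (z p : C) : Rabs (Im z - Im p) <= Cmod (z - p)%C.
Proof. exact (im_le_Cmod (z - p)%C). Qed.

(** The boundary of the square of half-side r lies between the circles of radii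
    r and 2 r. *)
Lemma on_square (p : C) r (P : C -> Prop) : 0 < r ->
  (forall w, r <= Cmod (w - p)%C <= 2 * r -> P w) ->
  on_bd (Re p - r) (Re p + r) (Im p - r) (Im p + r) P.
Proof.
  intros Hr H.
  assert (Hu : forall x y, Rabs (x - Re p) <= r -> Rabs (y - Im p) <= r ->
     Cmod ((x, y) - p)%C <= 2 * r).
  { intros x y Hx Hy. eapply Rle_trans; [apply Cmod_le_re_im|].
    rewrite pair_minus. simpl. lra. }
  split; intros t Ht; split; apply H; split;
    try (apply Hu; apply Rabs_le; lra).
  - eapply Rle_trans; [|apply Cmod_minus_ge_im]. simpl.
    replace (Im p - r - Im p) with (- r) by ring. rewrite Rabs_Ropp, Rabs_pos_eq; lra.
  - eapply Rle_trans; [|apply Cmod_minus_ge_im]. simpl.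
    replace (Im p + r - Im p) with r by ring. rewrite Rabs_pos_eq; lra.
  - eapply Rle_trans; [|apply Cmod_minus_ge_re]. simpl.
    replace (Re p - r - Re p) with (- r) by ring. rewrite Rabs_Ropp, Rabs_pos_eq; lra.
  - eapply Rle_trans; [|apply Cmod_minus_ge_re]. simpl.
    replace (Re p + r - Re p) with r by ring. rewrite Rabs_pos_eq; lra.
Qed.

Lemma holo_pole (p w : C) : w <> p -> holo (fun v => / (v - p))%C w.
Proof.
  intros H. holo_auto. intros E. apply H.
  replace w with (w - p + p)%C by ring. rewrite E. ring.
Qed.

(** On a small square around p the function differs from A / (w - p) by at most
    eps / |w - p|, while the square has perimeter 8 r. *)
Theorem residue f a b c d (p A : C) :
  a < Re p < b -> c < Im p < d ->
  on_rect a b c d (fun z => z <> p -> holo f z) ->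
  (forall eps, 0 < eps -> exists delta, 0 < delta /\ forall w, w <> p ->
     Cmod (w - p)%C < delta -> Cmod ((w - p) * f w - A)%C <= eps) ->
  rect f a b c d = (A * (2 * PI * Ci))%C.
Proof.
  intros Hx Hy Hf Hlim.
  replace (rect f a b c d) with ((rect f a b c d - A * (2 * PI * Ci)) + A * (2 * PI * Ci))%C by ring.
  replace (rect f a b c d - A * (2 * PI * Ci))%C with (RtoC 0); [ring|].
  symmetry. apply Cmod_eq_0. apply Rle_antisym; [|apply Cmod_ge_0].
  apply Rnot_lt_le. intros Hpos.
  set (e := Cmod (rect f a b c d - A * (2 * PI * Ci))%C) in *.
  (* rect_bound costs a factor 8, so that the ninth part of e gives a contradiction *)
  destruct (Hlim (e / 9) ltac:(lra)) as [dl [Hdl K]].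
  set (m := Rmin (Rmin (Re p - a) (b - Re p)) (Rmin (Im p - c) (d - Im p))).
  assert (Hm : 0 < m) by (repeat apply Rmin_pos; lra).
  pose proof (Rmin_l (Rmin (Re p - a) (b - Re p)) (Rmin (Im p - c) (d - Im p))) as M1.
  pose proof (Rmin_r (Rmin (Re p - a) (b - Re p)) (Rmin (Im p - c) (d - Im p))) as M2.
  pose proof (Rmin_l (Re p - a) (b - Re p)). pose proof (Rmin_r (Re p - a) (b - Re p)).
  pose proof (Rmin_l (Im p - c) (d - Im p)). pose proof (Rmin_r (Im p - c) (d - Im p)).
  fold m in M1, M2.
  set (r := Rmin (m / 2) (dl / 3)).
  assert (Hr : 0 < r) by (apply Rmin_pos; lra).
  assert (Hrm : r <= m / 2) by apply Rmin_l. assert (Hrd : r <= dl / 3) by apply Rmin_r.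
  assert (Hne : forall w, r <= Cmod (w - p)%C -> w <> p).
  { intros w Hw ->. replace (p - p)%C with (RtoC 0) in Hw by ring. rewrite Cmod_0 in Hw. lra. }
  assert (Hfc : on_bd (Re p - r) (Re p + r) (Im p - r) (Im p + r) (ccont f)).
  { apply (on_bd_and2 _ _ _ _ (fun z => z <> p -> ccont f z) (fun z => z <> p)).
    - apply on_rect_bd; [lra|lra|].
      intros x y H3 H4 Hn. apply holo_ccont, Hf; [lra|lra|exact Hn].
    - apply on_square; [exact Hr|]. intros w Hw. apply Hne; lra.
    - intros z Z1 Z2. exact (Z1 Z2). }
  assert (Hpc : on_bd (Re p - r) (Re p + r) (Im p - r) (Im p + r)
     (ccont (fun w => A * / (w - p))%C)).
  { apply on_square; [exact Hr|]. intros w Hw. apply holo_ccont.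
    apply (holo_mult (fun _ => A)); [apply holo_const|apply holo_pole, Hne; lra]. }
  assert (E : rect f a b c d
     = rect f (Re p - r) (Re p + r) (Im p - r) (Im p + r)).
  { apply rect_annulus; try lra. intros x y H3 H4 Hn. apply Hf; [lra|lra|].
    intros Z. apply Hn. rewrite <- Z. simpl. lra. }
  assert (E2 : e = Cmod (rect (fun w => f w - A * / (w - p))%C
     (Re p - r) (Re p + r) (Im p - r) (Im p + r))).
  { unfold e. rewrite E, <- (rect_pole p r Hr). f_equal.
    rewrite rect_minus; [|lra|lra|exact Hfc|exact Hpc].
    rewrite rect_scal; [reflexivity|lra|lra|].
    apply on_square; [exact Hr|]. intros w Hw. apply holo_ccont, holo_pole, Hne; lra. }
  assert (B : e <= 2 * (e / 9 / r) * ((Re p + r - (Re p - r)) + (Im p + r - (Im p - r)))).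
  { rewrite E2 at 1. apply rect_bound; [lra|lra| |].
    - apply (on_bd_and2 _ _ _ _ _ _ _ Hfc Hpc). intros z Z1 Z2. exact (cont_minus _ _ z Z1 Z2).
    - apply on_square; [exact Hr|]. intros w Hw.
      assert (Hn : w <> p) by (apply Hne; lra).
      assert (Hn2 : (w - p)%C <> 0%C).
      { intros Z. apply Hn. replace w with (w - p + p)%C by ring. rewrite Z. ring. }
      replace (f w - A * / (w - p))%C with (((w - p) * f w - A) * / (w - p))%C by (field; exact Hn2).
      unfold Rdiv at 1. apply Cmod_mult_le.
      + apply K; [exact Hn|]. lra.
      + rewrite Cmod_inv by exact Hn2. apply Rinv_le_contravar; lra. }
  replace (2 * (e / 9 / r) * ((Re p + r - (Re p - r)) + (Im p + r - (Im p - r))))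
    with (8 / 9 * e) in B by (field; lra).
  lra.
Qed.

Theorem cauchy_formula f a b c d (p : C) :
  a < Re p < b -> c < Im p < d -> on_rect a b c d (holo f) ->
  rect (fun w => f w * / (w - p))%C a b c d = (f p * (2 * PI * Ci))%C.
Proof.
  intros Hx Hy Hf. apply (residue _ a b c d p); [exact Hx|exact Hy| |].
  - intros x y H1 H2 Hn. apply holo_mult; [apply Hf; assumption|apply holo_pole; exact Hn].
  - intros eps He.
    assert (Hc : ccont f p).
    { apply holo_ccont. destruct p as [x y]. apply Hf; simpl in *; lra. }
    apply continuous_Cmod with (eps := eps) in Hc; [|exact He].
    apply locally_Cmod in Hc. destruct Hc as [dl [Hdl K]].
    exists dl. split; [exact Hdl|]. intros w Hn Hw.
    assert (Hn2 : (w - p)%C <> 0%C).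
    { intros Z. apply Hn. replace w with (w - p + p)%C by ring. rewrite Z. ring. }
    replace ((w - p) * (f w * / (w - p)) - f p)%C with (f w - f p)%C by (field; exact Hn2).
    left. apply K. exact Hw.
Qed.

Lemma PI_gt_3 : 3 < PI.
Proof. pose proof PI2_3_2. lra. Qed.

(** The Cauchy formulas for f p and f (p + h), and the integral l of f w / (w -
    p)^2, are combined with 1 / (w - p - h) - 1 / (w - p) - h / (w - p)^2 = h^2
    / ((w - p)^2 (w - p - h)). The estimate is uniform in f; this makes it
    useful under an integral sign. *)
Theorem cauchy_taylor f (p : C) r M :
  0 < r -> on_rect (Re p - r) (Re p + r) (Im p - r) (Im p + r) (holo f) ->
  on_rect (Re p - r) (Re p + r) (Im p - r) (Im p + r) (fun z => Cmod (f z) <= M) ->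
  exists l, Cmod l <= 2 * M / r /\ cder f p l /\
    forall h, Cmod h <= r / 2 -> Cmod (f (p + h) - f p - l * h)%C <= 3 * M * Cmod h ^ 2 / r ^ 2.
Proof.
  intros Hr Hf HM.
  assert (HM0 : 0 <= M).
  { eapply Rle_trans; [apply Cmod_ge_0|]. apply (HM (Re p) (Im p)); lra. }
  pose proof PI_gt_3 as HPI.
  set (a := Re p - r) in *. set (b := Re p + r) in *.
  set (c := Im p - r) in *. set (d := Im p + r) in *.
  set (k := (2 * PI * Ci)%C).
  assert (Hk : Cmod k = 2 * PI).
  { unfold k. rewrite !Cmod_mult, Cmod_Ci, !Cmod_R, !Rabs_pos_eq; lra. }
  assert (Hk0 : k <> 0%C) by (apply Cmod_gt_0; lra).
  assert (Hne : forall w, r <= Cmod (w - p)%C -> (w - p)%C <> 0%C).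
  { intros w Hw Z. rewrite Z, Cmod_0 in Hw. lra. }
  assert (Hbd : on_bd a b c d (fun z => holo f z /\ Cmod (f z) <= M /\ r <= Cmod (z - p)%C)).
  { pose proof (on_rect_bd a b c d _ ltac:(unfold a, b; lra) ltac:(unfold c, d; lra) Hf) as F.
    pose proof (on_rect_bd a b c d _ ltac:(unfold a, b; lra) ltac:(unfold c, d; lra) HM) as G.
    pose proof (on_square p r (fun z => r <= Cmod (z - p)%C) Hr (fun w Hw => proj1 Hw)) as K.
    fold a b c d in K.
    apply (on_bd_and2 a b c d _ _ _ F (on_bd_and2 a b c d _ _ _ G K (fun z A B => conj A B))).
    intros z A B. exact (conj A B). }
  assert (Himp : forall P : C -> Prop,
     (forall z, holo f z -> Cmod (f z) <= M -> r <= Cmod (z - p)%C -> P z) -> on_bd a b c d P).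
  { intros P HP. apply (on_bd_and2 a b c d _ _ _ Hbd Hbd). intros z Z _. apply HP; apply Z. }
  set (l := (rect (fun w => f w * (/ (w - p) * / (w - p)))%C a b c d / k)%C).
  assert (Hh2 : holo f p) by (destruct p as [x y]; apply Hf; unfold a, b, c, d; simpl; lra).
  assert (Htay : forall h, Cmod h <= r / 2 ->
     Cmod (f (p + h) - f p - l * h)%C <= 3 * M * Cmod h ^ 2 / r ^ 2).
  { intros h Hh.
    assert (Hne2 : forall w, r <= Cmod (w - p)%C -> r / 2 <= Cmod (w - (p + h))%C).
    { intros w Hw. replace (w - (p + h))%C with ((w - p) + - h)%C by ring.
      pose proof (Cmod_triangle_rev (w - p)%C (- h)%C) as T. rewrite Cmod_opp in T. lra. }
    assert (Hne3 : forall w, r <= Cmod (w - p)%C -> (w - (p + h))%C <> 0%C).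
    { intros w Hw Z. specialize (Hne2 w Hw). rewrite Z, Cmod_0 in Hne2. lra. }
    pose proof (re_le_Cmod h) as R1. pose proof (im_le_Cmod h) as R2.
    apply Rabs_le_between in R1. apply Rabs_le_between in R2.
    assert (C1 : rect (fun w => f w * / (w - p))%C a b c d = (f p * k)%C).
    { apply cauchy_formula; [unfold a, b; lra|unfold c, d; lra|exact Hf]. }
    assert (C2 : rect (fun w => f w * / (w - (p + h)))%C a b c d = (f (p + h)%C * k)%C).
    { apply cauchy_formula; [unfold a, b; rewrite Re_plus; lra|
        unfold c, d; rewrite Im_plus; lra|exact Hf]. }
    assert (E : (f (p + h) - f p - l * h)%C
      = (rect (fun w => f w * (h * h * (/ (w - p) * / (w - p) * / (w - (p + h)))))%C a b c d / k)%C).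
    { replace (f (p + h)%C) with (f (p + h)%C * k / k)%C by (field; exact Hk0).
      replace (f p) with (f p * k / k)%C by (field; exact Hk0).
      rewrite <- C1, <- C2. unfold l.
      rewrite (rect_ext (fun w => f w * (h * h * (/ (w - p) * / (w - p) * / (w - (p + h)))))%C
        (fun w => (f w * / (w - (p + h)) - f w * / (w - p)) - h * (f w * (/ (w - p) * / (w - p))))%C);
      [|unfold a, b; lra|unfold c, d; lra|].
      2: { apply Himp. intros z _ _ Hz. field. split; auto. }
      assert (A1 : on_bd a b c d (ccont (fun w => f w * / (w - p))%C)).
      { apply Himp. intros z Z1 Z2 Z3. apply holo_ccont. apply holo_mult; [exact Z1|].
        holo_auto. auto. }
      assert (A2 : on_bd a b c d (ccont (fun w => f w * / (w - (p + h)))%C)).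
      { apply Himp. intros z Z1 Z2 Z3. apply holo_ccont. apply holo_mult; [exact Z1|].
        holo_auto. auto. }
      assert (A3 : on_bd a b c d (ccont (fun w => f w * (/ (w - p) * / (w - p)))%C)).
      { apply Himp. intros z Z1 Z2 Z3. apply holo_ccont. apply holo_mult; [exact Z1|].
        holo_auto; auto. }
      rewrite (rect_minus (fun w => f w * / (w - (p + h)) - f w * / (w - p))%C
         (fun w => h * (f w * (/ (w - p) * / (w - p))))%C), rect_minus, rect_scal;
        try (unfold a, b; lra); try (unfold c, d; lra); try assumption.
      - field. exact Hk0.
      - apply Himp. intros z Z1 Z2 Z3. apply holo_ccont.
        apply holo_minus; (apply holo_mult; [exact Z1|]); holo_auto; auto.
      - apply Himp. intros z Z1 Z2 Z3. apply holo_ccont. apply holo_mult; [holo_auto|].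
        apply holo_mult; [exact Z1|]. holo_auto; auto. }
    rewrite E. unfold Cdiv. rewrite Cmod_mult, Cmod_inv by exact Hk0. rewrite Hk.
    assert (B : Cmod (rect (fun w => f w * (h * h * (/ (w - p) * / (w - p) * / (w - (p + h)))))%C a b c d)
       <= 2 * (M * (Cmod h * Cmod h * (/ r * / r * / (r / 2)))) * ((b - a) + (d - c))).
    { apply rect_bound; [unfold a, b; lra|unfold c, d; lra| |].
      - apply Himp. intros z Z1 Z2 Z3. apply holo_ccont. apply holo_mult; [exact Z1|].
        holo_auto; auto.
      - apply Himp. intros z Z1 Z2 Z3.
        apply Cmod_mult_le; [exact Z2|]. apply Cmod_mult_le; [rewrite Cmod_mult; lra|].
        assert (Q : Cmod (/ (z - p))%C <= / r).
        { rewrite Cmod_inv by auto. apply Rinv_le_contravar; lra. }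
        apply Cmod_mult_le; [apply Cmod_mult_le; exact Q|].
        rewrite Cmod_inv by auto. apply Rinv_le_contravar; [lra|auto]. }
    replace (b - a + (d - c)) with (4 * r) in B by (unfold a, b, c, d; ring).
    set (R0 := Cmod (rect _ _ _ _ _)) in *.
    apply (Rmult_le_reg_r (2 * PI)); [lra|].
    replace (R0 * / (2 * PI) * (2 * PI)) with R0 by (field; lra).
    eapply Rle_trans; [exact B|].
    assert (Hx : 0 <= M * Cmod h ^ 2 / r ^ 2).
    { unfold Rdiv. apply Rmult_le_pos; [apply Rmult_le_pos; [exact HM0|apply pow2_ge_0]|].
      left. apply Rinv_0_lt_compat. nra. }
    (* the constant 3 comes from 16 <= 6 PI *)
    replace (2 * (M * (Cmod h * Cmod h * (/ r * / r * / (r / 2)))) * (4 * r))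
      with (16 * (M * Cmod h ^ 2 / r ^ 2)) by (field; lra).
    replace (3 * M * Cmod h ^ 2 / r ^ 2 * (2 * PI)) with (6 * PI * (M * Cmod h ^ 2 / r ^ 2))
      by (field; lra).
    apply Rmult_le_compat_r; lra. }
  exists l. split; [|split; [|exact Htay]].
  - unfold l, Cdiv. rewrite Cmod_mult, Cmod_inv by exact Hk0. rewrite Hk.
    assert (B : Cmod (rect (fun w => f w * (/ (w - p) * / (w - p)))%C a b c d)
       <= 2 * (M * (/ r * / r)) * ((b - a) + (d - c))).
    { apply rect_bound; [unfold a, b; lra|unfold c, d; lra| |].
      - apply Himp. intros z Z1 Z2 Z3. apply holo_ccont. apply holo_mult; [exact Z1|].
        holo_auto; auto.
      - apply Himp. intros z Z1 Z2 Z3.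
        assert (Q : Cmod (/ (z - p))%C <= / r).
        { rewrite Cmod_inv by auto. apply Rinv_le_contravar; lra. }
        apply Cmod_mult_le; [exact Z2|]. apply Cmod_mult_le; exact Q. }
    replace (b - a + (d - c)) with (4 * r) in B by (unfold a, b, c, d; ring).
    set (R0 := Cmod (rect _ _ _ _ _)) in *.
    apply (Rmult_le_reg_r (2 * PI)); [lra|].
    replace (R0 * / (2 * PI) * (2 * PI)) with R0 by (field; lra).
    eapply Rle_trans; [exact B|].
    assert (Hx : 0 <= M / r).
    { unfold Rdiv. apply Rmult_le_pos; [exact HM0|]. left. apply Rinv_0_lt_compat. exact Hr. }
    replace (2 * (M * (/ r * / r)) * (4 * r)) with (8 * (M / r)) by (field; lra).
    replace (2 * M / r * (2 * PI)) with (4 * PI * (M / r)) by (field; lra).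
    apply Rmult_le_compat_r; lra.
  - apply cder_eps. intros eps He.
    set (K := 3 * M / r ^ 2 + 1).
    assert (HK : 0 < K).
    { unfold K. assert (0 <= 3 * M / r ^ 2); [|lra].
      unfold Rdiv. apply Rmult_le_pos; [lra|]. left. apply Rinv_0_lt_compat. nra. }
    exists (Rmin (r / 2) (eps / K)). split; [apply Rmin_pos; [lra|apply Rdiv_lt_0_compat; lra]|].
    intros h Hh.
    assert (h1 : Cmod h < r / 2) by (eapply Rlt_le_trans; [exact Hh|apply Rmin_l]).
    assert (h2 : Cmod h < eps / K) by (eapply Rlt_le_trans; [exact Hh|apply Rmin_r]).
    eapply Rle_trans; [apply Htay; lra|].
    apply (Rmult_lt_compat_r K) in h2; [|exact HK].
    replace (eps / K * K) with eps in h2 by (field; lra).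
    pose proof (Cmod_ge_0 h).
    replace (3 * M * Cmod h ^ 2 / r ^ 2) with ((Cmod h * (K - 1)) * Cmod h)
      by (unfold K; field; lra).
    apply Rmult_le_compat_r; [assumption|]. nra.
Qed.

(** * Integrals over half-lines *)

(** Completeness in the form of Cauchy sequences for the modulus. *)
Lemma C_complete (u : nat -> C) :
  (forall eps, 0 < eps -> exists N, forall n m, (N <= n)%nat -> (N <= m)%nat ->
     Cmod (u n - u m)%C < eps) ->
  exists l : C, forall eps, 0 < eps -> exists N, forall n, (N <= n)%nat ->
     Cmod (u n - l)%C < eps.
Proof.
  intros H.
  assert (Hre : Cauchy_crit (fun n => Re (u n))).
  { intros eps He. destruct (H eps He) as [N HN]. exists N. intros n m Hn Hm.
    eapply Rle_lt_trans; [apply (re_le_Cmod (u n - u m)%C)|]. apply HN; assumption. }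
  assert (Him : Cauchy_crit (fun n => Im (u n))).
  { intros eps He. destruct (H eps He) as [N HN]. exists N. intros n m Hn Hm.
    eapply Rle_lt_trans; [apply (im_le_Cmod (u n - u m)%C)|]. apply HN; assumption. }
  destruct (Rcomplete.R_complete _ Hre) as [a Ha]. destruct (Rcomplete.R_complete _ Him) as [b Hb].
  exists (a, b). intros eps He.
  destruct (Ha (eps / 2) ltac:(lra)) as [N1 H1]. destruct (Hb (eps / 2) ltac:(lra)) as [N2 H2].
  exists (max N1 N2). intros n Hn.
  eapply Rle_lt_trans; [apply Cmod_le_re_im|].
  specialize (H1 n ltac:(lia)). specialize (H2 n ltac:(lia)).
  unfold Rdist in H1, H2. rewrite Re_minus, Im_minus. change (Re (a, b)) with a; change (Im (a, b)) with b. lra.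
Qed.

Lemma exp_small m eps : 0 < m -> 0 < eps -> exists X, 0 < X /\ forall x, X <= x -> exp (- m * x) < eps.
Proof.
  intros Hm He. exists (Rmax 1 ((1 - ln eps) / m)).
  split; [eapply Rlt_le_trans; [apply Rlt_0_1|apply Rmax_l]|].
  intros x Hx. assert (Hx2 : (1 - ln eps) / m <= x) by (eapply Rle_trans; [apply Rmax_r|exact Hx]).
  apply (Rmult_le_compat_r m) in Hx2; [|lra].
  replace ((1 - ln eps) / m * m) with (1 - ln eps) in Hx2 by (field; lra).
  rewrite <- (exp_ln eps) at 1 by exact He. apply exp_increasing. lra.
Qed.

Lemma exp_le_mono x y : x <= y -> exp x <= exp y.
Proof. intros [H| ->]; [left; apply exp_increasing; exact H|lra]. Qed.

Lemma is_RInt_exp M m a b : 0 < m ->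
  is_RInt (fun t => M * exp (- m * t)) a b (M / m * (exp (- m * a) - exp (- m * b))).
Proof.
  intros Hm.
  replace (M / m * (exp (- m * a) - exp (- m * b)))
    with (minus (- (M / m) * exp (- m * b)) (- (M / m) * exp (- m * a)))
    by (unfold minus, plus, opp; simpl; ring).
  apply (is_RInt_derive (fun t => - (M / m) * exp (- m * t))).
  - intros t _. auto_derive; [exact I|]. field. lra.
  - intros t _. apply (ex_derive_continuous (V := R_NormedModule)). auto_derive. exact I.
Qed.

(** All integrals over half-lines below converge exponentially; edom is the
    class of integrands for which the calculus of IL is developed. *)
Definition edom (f : R -> C) (M m : R) : Prop :=
  0 < m /\ forall t, 0 <= t -> rcont f t /\ Cmod (f t) <= M * exp (- m * t).

Definition is_IL (f : R -> C) (l : C) : Prop :=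
  forall eps, 0 < eps -> exists N, forall x, N <= x -> Cmod (CRI f 0 x - l)%C < eps.

(** The integral over [0, +oo), as a total function of the integrand. *)
Definition IL (f : R -> C) : C := epsilon (inhabits (RtoC 0)) (is_IL f).

Lemma edom_tail f M m a b :
  edom f M m -> 0 <= a -> a <= b -> Cmod (CRI f a b) <= M / m * exp (- m * a).
Proof.
  intros [Hm H] Ha Hab.
  assert (HM : 0 <= M).
  { pose proof (proj2 (H 0 (Rle_refl 0))) as K. rewrite Rmult_0_r, exp_0, Rmult_1_r in K.
    eapply Rle_trans; [apply Cmod_ge_0|exact K]. }
  eapply Rle_trans.
  - apply (is_CRI_norm f (fun t => M * exp (- m * t)) a b _ _ Hab); [| |apply is_RInt_exp; exact Hm].
    + intros t Ht. apply H; lra.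
    + apply CRI_correct; [exact Hab|]. intros t Ht. apply H; lra.
  - assert (0 <= M / m) by (apply Rmult_le_pos; [exact HM|left; apply Rinv_0_lt_compat; exact Hm]).
    apply Rmult_le_compat_l; [assumption|]. pose proof (exp_pos (- m * b)). lra.
Qed.

Lemma is_IL_unique f l l' : is_IL f l -> is_IL f l' -> l = l'.
Proof.
  intros H H'. replace l with ((l - l') + l')%C by ring.
  replace (l - l')%C with (RtoC 0); [ring|]. symmetry. apply Cmod_eq_0.
  apply Rle_antisym; [|apply Cmod_ge_0]. apply Rnot_lt_le. intros Hp.
  destruct (H (Cmod (l - l')%C / 2) ltac:(lra)) as [N1 H1].
  destruct (H' (Cmod (l - l')%C / 2) ltac:(lra)) as [N2 H2].
  specialize (H1 (Rmax N1 N2) (Rmax_l _ _)). specialize (H2 (Rmax N1 N2) (Rmax_r _ _)).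
  replace (l - l')%C with ((CRI f 0 (Rmax N1 N2) - l') - (CRI f 0 (Rmax N1 N2) - l))%C in * by ring.
  pose proof (Cmod_triangle_minus (CRI f 0 (Rmax N1 N2) - l')%C (CRI f 0 (Rmax N1 N2) - l)%C).
  lra.
Qed.

Lemma IL_unique f l : is_IL f l -> IL f = l.
Proof.
  intros H. apply (is_IL_unique f); [|exact H].
  unfold IL. apply epsilon_spec. exists l; exact H.
Qed.

Lemma edom_M_pos f M m : edom f M m -> 0 <= M.
Proof.
  intros [Hm H]. pose proof (proj2 (H 0 (Rle_refl 0))) as K.
  rewrite Rmult_0_r, exp_0, Rmult_1_r in K. eapply Rle_trans; [apply Cmod_ge_0|exact K].
Qed.

Lemma edom_diff f M m a b :
  edom f M m -> 0 <= a -> a <= b -> Cmod (CRI f 0 b - CRI f 0 a)%C <= M / m * exp (- m * a).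
Proof.
  intros H Ha Hab. rewrite <- (CRI_Chasles f 0 a b); [|exact Ha|exact Hab|].
  - replace (CRI f 0 a + CRI f a b - CRI f 0 a)%C with (CRI f a b) by ring.
    apply edom_tail; assumption.
  - intros t Ht. apply (proj2 H); lra.
Qed.

Lemma IL_correct f M m : edom f M m -> is_IL f (IL f).
Proof.
  intros H. pose proof (edom_M_pos _ _ _ H) as HM. pose proof (proj1 H) as Hm.
  unfold IL. apply epsilon_spec.
  assert (HMm : 0 <= M / m) by (apply Rmult_le_pos; [exact HM|left; apply Rinv_0_lt_compat; exact Hm]).
  assert (Hs : forall eps, 0 < eps -> exists X, 0 <= X /\ forall a b, X <= a -> X <= b ->
    Cmod (CRI f 0 b - CRI f 0 a)%C < eps).
  { intros eps He. destruct (exp_small m (eps / (M / m + 1)) Hm) as [X [HX K]].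
    { apply Rdiv_lt_0_compat; lra. }
    exists X. split; [lra|].
    assert (W : forall a b, X <= a -> a <= b -> Cmod (CRI f 0 b - CRI f 0 a)%C < eps).
    { intros a b Ha Hab. eapply Rle_lt_trans; [apply (edom_diff f M m); [exact H|lra|exact Hab]|].
      specialize (K a Ha). apply (Rmult_lt_compat_r (M / m + 1)) in K; [|lra].
      replace (eps / (M / m + 1) * (M / m + 1)) with eps in K by (field; lra).
      pose proof (exp_pos (- m * a)). nra. }
    intros a b Ha Hb. destruct (Rle_dec a b) as [L|L].
    - apply W; assumption.
    - rewrite Cmod_minus_sym. apply W; lra. }
  destruct (C_complete (fun n => CRI f 0 (INR n))) as [l Hl].
  { intros eps He. destruct (Hs eps He) as [X [HX K]].
    destruct (nfloor_ex X HX) as [N HN]. exists (S N). intros n k Hn Hk.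
    apply K; rewrite ?S_INR in *; apply le_INR in Hn, Hk; rewrite S_INR in Hn, Hk; lra. }
  exists l. intros eps He.
  destruct (Hs (eps / 2) ltac:(lra)) as [X [HX K]]. destruct (Hl (eps / 2) ltac:(lra)) as [N HN].
  exists X. intros x Hx.
  destruct (nfloor_ex X HX) as [N2 HN2].
  set (n := max N (S N2)).
  assert (Hn : X <= INR n).
  { assert (Q : (S N2 <= n)%nat) by (unfold n; lia). apply le_INR in Q. rewrite S_INR in Q. lra. }
  specialize (HN n ltac:(unfold n; lia)). specialize (K (INR n) x Hn Hx).
  replace (CRI f 0 x - l)%C with ((CRI f 0 x - CRI f 0 (INR n)) + (CRI f 0 (INR n) - l))%C by ring.
  eapply Rle_lt_trans; [apply Cmod_triangle|]. lra.
Qed.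

Lemma is_IL_limit_bound f l x B :
  is_IL f l -> (forall y, x <= y -> Cmod (CRI f 0 y - CRI f 0 x)%C <= B) ->
  Cmod (l - CRI f 0 x)%C <= B.
Proof.
  intros Hl HB. apply Rnot_lt_le. intros Hp.
  destruct (Hl (Cmod (l - CRI f 0 x)%C - B) ltac:(lra)) as [N HN].
  specialize (HN (Rmax N x) (Rmax_l _ _)). specialize (HB (Rmax N x) (Rmax_r _ _)).
  rewrite Cmod_minus_sym in HN.
  pose proof (Cmod_triangle (l - CRI f 0 (Rmax N x))%C (CRI f 0 (Rmax N x) - CRI f 0 x)%C) as T.
  replace (l - CRI f 0 (Rmax N x) + (CRI f 0 (Rmax N x) - CRI f 0 x))%C
    with (l - CRI f 0 x)%C in T by ring.
  lra.
Qed.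

Lemma IL_tail f M m x :
  edom f M m -> 0 <= x -> Cmod (IL f - CRI f 0 x)%C <= M / m * exp (- m * x).
Proof.
  intros H Hx. apply is_IL_limit_bound; [apply (IL_correct f M m H)|].
  intros y Hy. apply edom_diff; assumption.
Qed.

Lemma IL_bound f M m : edom f M m -> Cmod (IL f) <= M / m.
Proof.
  intros H. pose proof (IL_tail f M m 0 H (Rle_refl 0)) as K.
  rewrite CRI_point, Rmult_0_r, exp_0, Rmult_1_r in K.
  replace (IL f - 0)%C with (IL f) in K by ring. exact K.
Qed.

Lemma CRI_0_continuity f M m x : edom f M m -> 0 <= x ->
  forall t, 0 <= t <= x -> rcont f t.
Proof. intros H Hx t Ht. apply (proj2 H); lra. Qed.

Lemma IL_ext f g : (forall t, 0 <= t -> f t = g t) -> IL f = IL g.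
Proof.
  intros H. unfold IL. f_equal.
  apply functional_extensionality. intros l.
  assert (E : forall a b, (forall t, 0 <= t -> a t = b t) -> is_IL a l -> is_IL b l).
  { intros a b Hab K eps He. destruct (K eps He) as [N HN]. exists (Rmax 0 N).
    intros x Hx. rewrite (CRI_ext b a).
    - apply HN. eapply Rle_trans; [apply Rmax_r|exact Hx].
    - eapply Rle_trans; [apply Rmax_l|exact Hx].
    - intros t Ht. symmetry. apply Hab; lra. }
  apply propositional_extensionality. split; apply E; auto.
  intros; symmetry; auto.
Qed.

Lemma is_IL_comb f g M m M' m' c :
  edom f M m -> edom g M' m' -> is_IL (fun t => f t + c * g t)%C (IL f + c * IL g)%C.
Proof.
  intros Hf Hg eps He.
  pose proof (Cmod_ge_0 c) as Hc.
  destruct (IL_correct f M m Hf (eps / 2) ltac:(lra)) as [N1 H1].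
  destruct (IL_correct g M' m' Hg (eps / (2 * (Cmod c + 1)))) as [N2 H2].
  { apply Rdiv_lt_0_compat; lra. }
  exists (Rmax 0 (Rmax N1 N2)). intros x Hx.
  assert (X0 : 0 <= x) by (eapply Rle_trans; [apply Rmax_l|exact Hx]).
  assert (X1 : N1 <= x).
  { eapply Rle_trans; [|exact Hx]. eapply Rle_trans; [apply (Rmax_l N1 N2)|apply Rmax_r]. }
  assert (X2 : N2 <= x).
  { eapply Rle_trans; [|exact Hx]. eapply Rle_trans; [apply (Rmax_r N1 N2)|apply Rmax_r]. }
  specialize (H1 x X1). specialize (H2 x X2).
  pose proof (CRI_0_continuity f M m x Hf X0) as Cf.
  pose proof (CRI_0_continuity g M' m' x Hg X0) as Cg.
  rewrite CRI_plus; [|exact X0|exact Cf|].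
  2: { intros t Ht. apply cont_mult; [apply cont_const|apply Cg; exact Ht]. }
  rewrite CRI_scal; [|exact X0|exact Cg].
  replace (CRI f 0 x + c * CRI g 0 x - (IL f + c * IL g))%C
    with ((CRI f 0 x - IL f) + c * (CRI g 0 x - IL g))%C by ring.
  eapply Rle_lt_trans; [apply Cmod_triangle|]. rewrite Cmod_mult.
  apply (Rmult_lt_compat_r (Cmod c + 1)) in H2; [|lra].
  replace (eps / (2 * (Cmod c + 1)) * (Cmod c + 1)) with (eps / 2) in H2 by (field; lra).
  pose proof (Cmod_ge_0 (CRI g 0 x - IL g)%C). nra.
Qed.

Lemma IL_comb f g M m M' m' c :
  edom f M m -> edom g M' m' -> IL (fun t => f t + c * g t)%C = (IL f + c * IL g)%C.
Proof. intros. apply IL_unique. eapply is_IL_comb; eassumption. Qed.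

Lemma edom_zero : edom (fun _ => RtoC 0) 0 1.
Proof.
  split; [lra|]. intros t _. split; [apply cont_const|]. rewrite Cmod_0. lra.
Qed.

Lemma IL_zero : IL (fun _ => RtoC 0) = RtoC 0.
Proof.
  apply IL_unique. intros eps He. exists 0. intros x Hx.
  rewrite (is_CRI_unique (fun _ => RtoC 0) 0 x (RtoC 0 * 0)%C).
  - replace (0 * 0 - 0)%C with (RtoC 0) by ring. rewrite Cmod_0. exact He.
  - apply (is_CRI_ext (fun t => RtoC 0 * RtoC 0)%C); [exact Hx|intros; ring|].
    rewrite <- (Cmult_0_l (CRI (fun _ => RtoC 0) 0 x)) at 2.
    replace (0 * (0 * CRI (fun _ => RtoC 0) 0 x))%C with (0 * CRI (fun _ => RtoC 0) 0 x)%C by ring.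
    apply is_CRI_scal. apply CRI_correct; [exact Hx|]. intros; apply cont_const.
Qed.

Lemma IL_scal f M m c : edom f M m -> IL (fun t => c * f t)%C = (c * IL f)%C.
Proof.
  intros H. rewrite (IL_ext _ (fun t => 0 + c * f t)%C) by (intros; ring).
  rewrite (IL_comb (fun _ => RtoC 0) f 0 1 M m c edom_zero H), IL_zero. ring.
Qed.

Lemma edom_shift f M m c : 0 <= c -> edom f M m -> edom (fun t => f (t + c)) M m.
Proof.
  intros Hc H. pose proof (edom_M_pos _ _ _ H) as HM. destruct H as [Hm H].
  split; [exact Hm|]. intros t Ht. destruct (H (t + c) ltac:(lra)) as [H1 H2]. split.
  - apply (continuous_comp (fun s : R => s + c) f); [|exact H1].
    apply (continuous_plus (V := R_NormedModule)); [apply continuous_id|apply continuous_const].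
  - eapply Rle_trans; [exact H2|]. apply Rmult_le_compat_l; [exact HM|].
    apply exp_le_mono. nra.
Qed.

Lemma IL_Chasles f M m c :
  0 <= c -> edom f M m -> IL f = (CRI f 0 c + IL (fun t => f (t + c)%R))%C.
Proof.
  intros Hc H. apply IL_unique. intros eps He.
  destruct (IL_correct _ M m (edom_shift f M m c Hc H) eps He) as [N HN].
  exists (Rmax 0 N + c). intros x Hx.
  assert (X0 : 0 <= x - c) by (pose proof (Rmax_l 0 N); lra).
  assert (X1 : N <= x - c) by (pose proof (Rmax_r 0 N); lra).
  specialize (HN (x - c) X1).
  rewrite CRI_shift in HN; [|exact X0|intros t Ht; apply (proj2 H); lra].
  rewrite Rplus_0_l in HN. replace (x - c + c) with x in HN by ring.
  rewrite <- (CRI_Chasles f 0 c x); [|exact Hc|lra|intros t Ht; apply (proj2 H); lra].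
  replace (CRI f 0 c + CRI f c x - (CRI f 0 c + IL (fun t => f (t + c)%R)))%C
    with (CRI f c x - IL (fun t => f (t + c)%R))%C by ring.
  exact HN.
Qed.

(** * Holomorphic dependence on a parameter *)

(** Integration over a bounded interval and over a half-line share these
    properties, which are all that differentiation under the integral uses. *)
Definition bounded_functional (D : R -> Prop) (w : R -> R) (K : R) (L : (R -> C) -> C) : Prop :=
  let good f := (forall t, D t -> rcont f t) /\
                exists M, forall t, D t -> Cmod (f t) <= M * w t in
  (forall f g c, good f -> good g -> L (fun t => f t + c * g t)%C = (L f + c * L g)%C) /\
  (forall f M, (forall t, D t -> rcont f t) ->
     (forall t, D t -> Cmod (f t) <= M * w t) -> Cmod (L f) <= K * M).

Lemma bounded_functional_CRI a b : a <= b ->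
  bounded_functional (fun t => a <= t <= b) (fun _ => 1) (b - a) (fun f => CRI f a b).
Proof.
  intros Hab. split.
  - intros f g c [Hf _] [Hg _]. rewrite CRI_plus, CRI_scal; auto.
    intros t Ht. apply cont_mult; [apply cont_const|apply Hg; exact Ht].
  - intros f M Hf HM. rewrite Rmult_comm. apply CRI_bound; [exact Hab|exact Hf|].
    intros t Ht. specialize (HM t Ht). lra.
Qed.

Lemma bounded_functional_IL m : 0 < m ->
  bounded_functional (fun t => 0 <= t) (fun t => exp (- m * t)) (/ m) IL.
Proof.
  intros Hm.
  assert (E : forall f, (forall t, 0 <= t -> rcont f t) ->
     forall M, (forall t, 0 <= t -> Cmod (f t) <= M * exp (- m * t)) -> edom f M m).
  { intros f H M HM. split; [exact Hm|]. intros t Ht. split; auto. }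
  split.
  - intros f g c [Hf [M HM]] [Hg [M' HM']]. eapply IL_comb; apply E; eauto.
  - intros f M Hf HM. rewrite Rmult_comm. apply IL_bound. apply E; assumption.
Qed.

Definition in_square (p : C) (r : R) (z : C) : Prop :=
  Re p - r <= Re z <= Re p + r /\ Im p - r <= Im z <= Im p + r.

Lemma in_square_Cmod p r h : Cmod h <= r -> in_square p r (p + h)%C.
Proof.
  intros H. pose proof (re_le_Cmod h) as H1. pose proof (im_le_Cmod h) as H2.
  apply Rabs_le_between in H1. apply Rabs_le_between in H2.
  unfold in_square. rewrite Re_plus, Im_plus. lra.
Qed.

Lemma on_rect_square p r (P : C -> Prop) :
  (forall z, in_square p r z -> P z) ->
  on_rect (Re p - r) (Re p + r) (Im p - r) (Im p + r) P.
Proof. intros H x y Hx Hy. apply H. split; assumption. Qed.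

Section Dependence.
Variables (D : R -> Prop) (wt : R -> R) (K : R) (L : (R -> C) -> C).
Hypothesis HL : bounded_functional D wt K L.
Hypothesis Hwt : forall t, D t -> 0 <= wt t.
Variables (F : C -> R -> C) (p : C) (r M : R).
Hypothesis Hr : 0 < r.
Hypothesis Hcont : forall z t, in_square p r z -> D t -> rcont (F z) t.
Hypothesis Hholo : forall z t, in_square p r z -> D t -> holo (fun v => F v t) z.
Hypothesis Hbound : forall z t, in_square p r z -> D t -> Cmod (F z t) <= M * wt t.

Lemma param_taylor t : D t -> exists l, cder (fun v => F v t) p l /\
  Cmod l <= 2 * M / r * wt t /\
  forall h, Cmod h <= r / 2 ->
    Cmod (F (p + h)%C t - F p t - l * h)%C <= 3 * M * Cmod h ^ 2 / r ^ 2 * wt t.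
Proof.
  intros Ht.
  destruct (cauchy_taylor (fun v => F v t) p r (M * wt t) Hr) as [l [H1 [H2 H3]]].
  - apply on_rect_square. intros z Hz. apply Hholo; assumption.
  - apply on_rect_square. intros z Hz. apply Hbound; assumption.
  - exists l. split; [exact H2|]. split.
    + eapply Rle_trans; [exact H1|]. right. field. lra.
    + intros h Hh. eapply Rle_trans; [apply H3; exact Hh|]. right. field. lra.
Qed.

(** The Taylor estimate for F v t at p, with a constant that is integrable in t,
    may be integrated term by term. *)
Lemma param_holo_der (F1 : R -> C) :
  (forall t, D t -> cder (fun v => F v t) p (F1 t)) -> (forall t, D t -> rcont F1 t) ->
  cder (fun v => L (F v)) p (L F1).
Proof.
  intros HF1 HF1c. destruct HL as [HL1 HL2].
  assert (Hp : in_square p r p).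
  { replace p with (p + 0)%C at 2 by ring. apply in_square_Cmod. rewrite Cmod_0. lra. }
  assert (HF1b : forall t, D t -> Cmod (F1 t) <= 2 * M / r * wt t).
  { intros t Ht. destruct (param_taylor t Ht) as [l [H1 [H2 H3]]].
    replace (F1 t) with l; [exact H2|].
    rewrite <- (is_C_derive_unique _ _ _ H1). apply is_C_derive_unique, HF1; exact Ht. }
  apply cder_eps. intros eps He.
  set (B := K * (3 * M / r ^ 2)).
  exists (Rmin (r / 2) (eps / (Rabs B + 1))).
  pose proof (Rabs_pos B) as HB.
  split. { apply Rmin_pos; [lra|apply Rdiv_lt_0_compat; lra]. }
  intros h Hh.
  assert (h1 : Cmod h < r / 2) by (eapply Rlt_le_trans; [exact Hh|apply Rmin_l]).
  assert (h2 : Cmod h < eps / (Rabs B + 1)) by (eapply Rlt_le_trans; [exact Hh|apply Rmin_r]).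
  assert (Hph : in_square p r (p + h)%C) by (apply in_square_Cmod; lra).
  assert (G1 : forall z, in_square p r z -> (forall t, D t -> rcont (F z) t) /\
      exists M0, forall t, D t -> Cmod (F z t) <= M0 * wt t).
  { intros z Hz. split; [intros; apply Hcont; assumption|]. exists M. intros; apply Hbound; assumption. }
  assert (E : (L (F (p + h)%C) - L (F p) - L F1 * h)%C
     = L (fun t => (F (p + h)%C t + (- (1)) * F p t) + (- h) * F1 t)%C).
  { rewrite (HL1 (fun t => F (p + h)%C t + (- (1)) * F p t)%C F1).
    - rewrite (HL1 (F (p + h)%C) (F p)); [ring|apply G1; exact Hph|apply G1; exact Hp].
    - split.
      + intros t Ht. apply cont_plus; [apply Hcont; assumption|].
        apply cont_mult; [apply cont_const|apply Hcont; assumption].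
      + exists (2 * M). intros t Ht. eapply Rle_trans; [apply Cmod_triangle|].
        rewrite Cmod_mult, Cmod_opp, Cmod_1.
        pose proof (Hbound _ _ Hph Ht). pose proof (Hbound _ _ Hp Ht). lra.
    - split; [exact HF1c|]. exists (2 * M / r). exact HF1b. }
  rewrite E. eapply Rle_trans; [apply (HL2 _ (3 * M * Cmod h ^ 2 / r ^ 2))|].
  - intros t Ht. apply cont_plus; [apply cont_plus|].
    + apply Hcont; assumption.
    + apply cont_mult; [apply cont_const|apply Hcont; assumption].
    + apply cont_mult; [apply cont_const|apply HF1c; assumption].
  - intros t Ht. destruct (param_taylor t Ht) as [l [H1 [H2 H3]]].
    assert (El : l = F1 t).
    { rewrite <- (is_C_derive_unique _ _ _ H1). apply is_C_derive_unique, HF1; exact Ht. }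
    replace (F (p + h)%C t + - (1) * F p t + - h * F1 t)%C
      with (F (p + h)%C t - F p t - l * h)%C by (rewrite El; ring).
    apply H3. lra.
  - replace (K * (3 * M * Cmod h ^ 2 / r ^ 2)) with (B * Cmod h * Cmod h) by (unfold B; field; lra).
    apply Rmult_le_compat_r; [apply Cmod_ge_0|].
    apply (Rmult_lt_compat_r (Rabs B + 1)) in h2; [|lra].
    replace (eps / (Rabs B + 1) * (Rabs B + 1)) with eps in h2 by (field; lra).
    pose proof (Rle_abs B). pose proof (Cmod_ge_0 h). nra.
Qed.

(** Convergence of the difference quotients of v |-> L (F v), without an
    expression for the limit: by param_taylor those for h and k differ by a
    multiple of |h| + |k|. *)
Theorem param_holo : holo (fun v => L (F v)) p.
Proof.
  destruct HL as [HL1 HL2].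
  assert (Hp : in_square p r p).
  { replace p with (p + 0)%C at 2 by ring. apply in_square_Cmod. rewrite Cmod_0. lra. }
  assert (G1 : forall z, in_square p r z -> (forall t, D t -> rcont (F z) t) /\
      exists M0, forall t, D t -> Cmod (F z t) <= M0 * wt t).
  { intros z Hz. split; [intros; apply Hcont; assumption|]. exists M. intros; apply Hbound; assumption. }
  set (Q := fun h => ((L (F (p + h)%C) - L (F p)) / h)%C).
  set (B := Rabs (K * (3 * M / r ^ 2))).
  assert (HB : 0 <= B) by apply Rabs_pos.
  assert (G2 : forall h, Cmod h <= r / 2 -> (forall t, D t -> rcont (fun t => F (p + h)%C t + - (1) * F p t)%C t) /\
      exists M0, forall t, D t -> Cmod (F (p + h)%C t + - (1) * F p t)%C <= M0 * wt t).
  { intros h Hh. assert (Hph : in_square p r (p + h)%C) by (apply in_square_Cmod; lra). split.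
    - intros t Ht. apply cont_plus; [apply Hcont; assumption|].
      apply cont_mult; [apply cont_const|apply Hcont; assumption].
    - exists (2 * M). intros t Ht. eapply Rle_trans; [apply Cmod_triangle|].
      rewrite Cmod_mult, Cmod_opp, Cmod_1.
      pose proof (Hbound _ _ Hph Ht). pose proof (Hbound _ _ Hp Ht). lra. }
  assert (HQ : forall h k : C, h <> 0%C -> k <> 0%C -> Cmod h <= r / 2 -> Cmod k <= r / 2 ->
     Cmod (Q h - Q k)%C <= B * (Cmod h + Cmod k)).
  { intros h k Hh0 Hk0 Hh Hk.
    set (f := fun t => (0 + / h * (F (p + h)%C t + - (1) * F p t))%C).
    assert (Hz : (forall t, D t -> rcont (fun _ => RtoC 0) t) /\
      exists M0, forall t, D t -> Cmod (RtoC 0) <= M0 * wt t).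
    { split; [intros; apply cont_const|]. exists 0. intros. rewrite Cmod_0. lra. }
    assert (L0 : L (fun _ => RtoC 0) = RtoC 0).
    { apply Cmod_eq_0. apply Rle_antisym; [|apply Cmod_ge_0].
      replace 0 with (K * 0) at 1 by ring.
      apply HL2; [intros; apply cont_const|]. intros; rewrite Cmod_0; lra. }
    assert (Gf : (forall t, D t -> rcont f t) /\
      exists M0, forall t, D t -> Cmod (f t) <= M0 * wt t).
    { destruct (G2 h Hh) as [G2a [M0 G2b]]. split.
      - intros t Ht. apply cont_plus; [apply cont_const|].
        apply cont_mult; [apply cont_const|]. apply G2a; exact Ht.
      - exists (Cmod (/ h)%C * M0). intros t Ht. unfold f. rewrite Cplus_0_l, Cmod_mult.
        rewrite Rmult_assoc. apply Rmult_le_compat_l; [apply Cmod_ge_0|]. apply G2b; exact Ht. }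
    assert (E : (Q h - Q k)%C = L (fun t => f t + (- / k) * (F (p + k)%C t + - (1) * F p t))%C).
    { rewrite (HL1 f); [|exact Gf|apply G2; exact Hk].
      unfold f. rewrite (HL1 (fun _ => RtoC 0)), L0; [|exact Hz|apply G2; exact Hh].
      assert (Hph : in_square p r (p + h)%C) by (apply in_square_Cmod; lra).
      assert (Hpk : in_square p r (p + k)%C) by (apply in_square_Cmod; lra).
      rewrite (HL1 _ _ (- (1))%C (G1 _ Hph) (G1 _ Hp)), (HL1 _ _ (- (1))%C (G1 _ Hpk) (G1 _ Hp)).
      unfold Q. field. split; assumption. }
    rewrite E.
    replace (B * (Cmod h + Cmod k)) with (Rabs K * (Rabs (3 * M / r ^ 2) * (Cmod h + Cmod k)))
      by (unfold B; rewrite Rabs_mult; ring).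
    eapply Rle_trans.
    { apply (HL2 _ (3 * M / r ^ 2 * (Cmod h + Cmod k))).
      - intros t Ht. apply cont_plus; [apply Gf; exact Ht|].
        apply cont_mult; [apply cont_const|]. apply (G2 k Hk); exact Ht.
      - intros t Ht. destruct (param_taylor t Ht) as [l [H1 [H2 H3]]].
        replace (f t + - / k * (F (p + k)%C t + - (1) * F p t))%C
          with ((F (p + h)%C t - F p t - l * h) * / h - (F (p + k)%C t - F p t - l * k) * / k)%C
          by (unfold f; field; split; assumption).
        eapply Rle_trans; [apply Cmod_triangle_minus|].
        rewrite !Cmod_mult, !Cmod_inv by assumption.
        pose proof (proj1 (Cmod_gt_0 h) Hh0) as P1. pose proof (proj1 (Cmod_gt_0 k) Hk0) as P2.
        pose proof (H3 h Hh) as A1. pose proof (H3 k Hk) as A2.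
        apply (Rmult_le_compat_r (/ Cmod h)) in A1; [|left; apply Rinv_0_lt_compat; exact P1].
        apply (Rmult_le_compat_r (/ Cmod k)) in A2; [|left; apply Rinv_0_lt_compat; exact P2].
        replace (3 * M * Cmod h ^ 2 / r ^ 2 * wt t * / Cmod h) with (3 * M / r ^ 2 * Cmod h * wt t) in A1
          by (field; lra).
        replace (3 * M * Cmod k ^ 2 / r ^ 2 * wt t * / Cmod k) with (3 * M / r ^ 2 * Cmod k * wt t) in A2
          by (field; lra).
        lra. }
    eapply Rle_trans; [apply Rle_abs|]. rewrite !Rabs_mult.
    rewrite (Rabs_pos_eq (Cmod h + Cmod k)); [lra|].
    pose proof (Cmod_ge_0 h); pose proof (Cmod_ge_0 k); lra. }
  set (hn := fun n : nat => RtoC (r / 2 / (INR n + 1))).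
  assert (Hpos : forall n, 0 < INR n + 1) by (intros n; pose proof (pos_INR n); lra).
  assert (Hhn : forall n, Cmod (hn n) = r / 2 / (INR n + 1)).
  { intros n. unfold hn. rewrite Cmod_R, Rabs_pos_eq; [reflexivity|].
    left. apply Rdiv_lt_0_compat; [lra|apply Hpos]. }
  assert (Hhn0 : forall n, hn n <> 0%C).
  { intros n. apply Cmod_gt_0. rewrite Hhn. apply Rdiv_lt_0_compat; [lra|apply Hpos]. }
  assert (Hhnr : forall n, Cmod (hn n) <= r / 2).
  { intros n. rewrite Hhn. apply (Rmult_le_reg_r (INR n + 1)); [apply Hpos|].
    replace (r / 2 / (INR n + 1) * (INR n + 1)) with (r / 2) by (field; pose proof (Hpos n); lra).
    pose proof (pos_INR n). nra. }
  assert (Hsmall : forall eps, 0 < eps -> exists N, forall n, (N <= n)%nat -> Cmod (hn n) < eps).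
  { intros eps He. destruct (nfloor_ex (r / eps)) as [N HN].
    { left. apply Rdiv_lt_0_compat; lra. }
    exists N. intros n Hn. rewrite Hhn. apply le_INR in Hn.
    apply (Rmult_lt_reg_r (INR n + 1)); [apply Hpos|].
    replace (r / 2 / (INR n + 1) * (INR n + 1)) with (r / 2) by (field; pose proof (Hpos n); lra).
    assert (Q1 : r / eps < INR n + 1) by lra.
    apply (Rmult_lt_compat_r eps) in Q1; [|lra].
    replace (r / eps * eps) with r in Q1 by (field; lra). lra. }
  destruct (C_complete (fun n => Q (hn n))) as [l Hl].
  { intros eps He.
    destruct (Hsmall (eps / (2 * (B + 1)))) as [N HN]. { apply Rdiv_lt_0_compat; lra. }
    exists N. intros n m Hn Hm.
    eapply Rle_lt_trans; [apply HQ; auto|].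
    pose proof (HN n Hn) as A1. pose proof (HN m Hm) as A2.
    pose proof (Cmod_ge_0 (hn n)). pose proof (Cmod_ge_0 (hn m)).
    assert (A3 : Cmod (hn n) + Cmod (hn m) < eps / (B + 1)).
    { replace (eps / (B + 1)) with (eps / (2 * (B + 1)) + eps / (2 * (B + 1))) by (field; lra). lra. }
    apply (Rmult_lt_compat_r (B + 1)) in A3; [|lra].
    replace (eps / (B + 1) * (B + 1)) with eps in A3 by (field; lra). nra. }
  assert (HQl : forall h : C, h <> 0%C -> Cmod h <= r / 2 -> Cmod (Q h - l)%C <= B * Cmod h).
  { intros h Hh0 Hh. apply Rnot_lt_le. intros Hc.
    set (e := Cmod (Q h - l)%C - B * Cmod h) in *.
    assert (He : 0 < e) by (unfold e; lra).
    destruct (Hl (e / 2) ltac:(lra)) as [N1 HN1].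
    destruct (Hsmall (e / (2 * (B + 1)))) as [N2 HN2]. { apply Rdiv_lt_0_compat; lra. }
    set (n := max N1 N2).
    specialize (HN1 n ltac:(unfold n; lia)). specialize (HN2 n ltac:(unfold n; lia)).
    pose proof (HQ h (hn n) Hh0 (Hhn0 n) Hh (Hhnr n)) as A.
    pose proof (Cmod_triangle (Q h - Q (hn n))%C (Q (hn n) - l)%C) as T.
    replace (Q h - Q (hn n) + (Q (hn n) - l))%C with (Q h - l)%C in T by ring.
    apply (Rmult_lt_compat_r (B + 1)) in HN2; [|lra].
    replace (e / (2 * (B + 1)) * (B + 1)) with (e / 2) in HN2 by (field; lra).
    pose proof (Cmod_ge_0 (hn n)). unfold e in *. nra. }
  exists l. apply cder_eps. intros eps He.
  exists (Rmin (r / 2) (eps / (B + 1))).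
  split. { apply Rmin_pos; [lra|apply Rdiv_lt_0_compat; lra]. }
  intros h Hh.
  assert (h1 : Cmod h < r / 2) by (eapply Rlt_le_trans; [exact Hh|apply Rmin_l]).
  assert (h2 : Cmod h < eps / (B + 1)) by (eapply Rlt_le_trans; [exact Hh|apply Rmin_r]).
  destruct (excluded_middle_informative (h = 0%C)) as [->|Hh0].
  - replace (p + 0)%C with p by ring.
    replace (L (F p) - L (F p) - l * 0)%C with (RtoC 0) by ring. rewrite Cmod_0. lra.
  - replace (L (F (p + h)%C) - L (F p) - l * h)%C with ((Q h - l) * h)%C
      by (unfold Q; field; exact Hh0).
    rewrite Cmod_mult. apply Rmult_le_compat_r; [apply Cmod_ge_0|].
    eapply Rle_trans; [apply HQl; [exact Hh0|lra]|].
    apply (Rmult_lt_compat_r (B + 1)) in h2; [|lra].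
    replace (eps / (B + 1) * (B + 1)) with eps in h2 by (field; lra).
    pose proof (Cmod_ge_0 h). nra.
Qed.
End Dependence.

(** * Moving half-lines and lines of integration *)

Lemma C_small_eq (z w : C) : (forall eps, 0 < eps -> Cmod (z - w)%C <= eps) -> z = w.
Proof.
  intros H. replace z with ((z - w) + w)%C by ring.
  replace (z - w)%C with (RtoC 0); [ring|]. symmetry. apply Cmod_eq_0.
  apply Rle_antisym; [|apply Cmod_ge_0]. apply Rnot_lt_le. intros Hp.
  specialize (H (Cmod (z - w)%C / 2) ltac:(lra)). lra.
Qed.

Lemma rcont_ray h T c t : ccont h (T + t, c) -> rcont (fun s => h (T + s, c)) t.
Proof.
  intros H. apply (continuous_comp (fun s : R => T + s) (fun x => h (x, c))).
  - apply (continuous_plus (V := R_NormedModule)); [apply continuous_const|apply continuous_id].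
  - apply rcont_h. exact H.
Qed.

Lemma hint_ray h T n c : 0 <= n -> (forall x, T <= x <= T + n -> ccont h (x, c)) ->
  hint h T (T + n) c = CRI (fun t => h (T + t, c)) 0 n.
Proof.
  intros Hn Hc. unfold hint. symmetry.
  transitivity (CRI (fun t => (fun x => h (x, c)) (t + T)) 0 n).
  - apply CRI_ext; [exact Hn|]. intros t _. do 2 f_equal; ring.
  - etransitivity; [apply (CRI_shift (fun x => h (x, c))); [exact Hn|]|f_equal; ring].
    intros t Ht. apply rcont_h, Hc; lra.
Qed.

(** The boundary integral over [T, T + n] x [c, d] vanishes, and its right side
    tends to 0. *)
Lemma IL_vshift h T c d M m :
  c <= d -> 0 < m ->
  (forall x y, T <= x -> c <= y <= d -> holo h (x, y)) ->
  (forall x y, T <= x -> c <= y <= d -> Cmod (h (x, y)) <= M * exp (- m * (x - T))) ->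
  IL (fun t => h (T + t, c)) = (Ci * vint h T c d + IL (fun t => h ((T + t)%R, d)))%C.
Proof.
  intros Hcd Hm Hh HM.
  destruct Hcd as [Hcd| ->].
  2: { unfold vint. rewrite CRI_point. ring. }
  assert (HE : forall y, c <= y <= d -> edom (fun t => h (T + t, y)) M m).
  { intros y Hy. split; [exact Hm|]. intros t Ht. split.
    - apply rcont_ray, holo_ccont, Hh; lra.
    - eapply Rle_trans; [apply HM; lra|]. right. do 3 f_equal; ring. }
  pose proof (edom_M_pos _ _ _ (HE c ltac:(lra))) as HM0.
  apply C_small_eq. intros eps He.
  set (B := M / m + (d - c) * M + M / m).
  assert (HB : 0 <= B).
  { assert (0 <= M / m) by (apply Rmult_le_pos; [exact HM0|left; apply Rinv_0_lt_compat; exact Hm]).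
    unfold B. nra. }
  destruct (exp_small m (eps / (B + 1)) Hm) as [n [Hn Hsm]]. { apply Rdiv_lt_0_compat; lra. }
  specialize (Hsm n (Rle_refl n)).
  assert (HR : rect h T (T + n) c d = 0%C).
  { apply goursat; [lra|exact Hcd|]. intros x y Hx Hy. apply Hh; lra. }
  unfold rect in HR.
  rewrite !hint_ray in HR by (first [lra|intros; apply holo_ccont, Hh; lra]).
  pose proof (IL_tail _ M m n (HE c ltac:(lra)) ltac:(lra)) as A1.
  pose proof (IL_tail _ M m n (HE d ltac:(lra)) ltac:(lra)) as A2.
  pose proof (vint_bound h (T + n) c d (M * exp (- m * n)) ltac:(lra)
    ltac:(intros; apply holo_ccont, Hh; lra)) as A3.
  assert (A3' : Cmod (vint h (T + n) c d) <= M * exp (- m * n) * (d - c)).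
  { apply A3. intros y Hy. eapply Rle_trans; [apply HM; lra|]. right. do 3 f_equal; ring. }
  set (I1 := IL (fun t => h (T + t, c))) in *. set (I2 := IL (fun t => h (T + t, d))) in *.
  set (J1 := CRI (fun t => h (T + t, c)) 0 n) in *. set (J2 := CRI (fun t => h (T + t, d)) 0 n) in *.
  set (V1 := vint h (T + n) c d) in *. set (V0 := vint h T c d) in *.
  replace (I1 - (Ci * V0 + I2))%C with ((I1 - J1) + (- (Ci * V1) + - (I2 - J2)))%C.
  2: { replace ((I1 - J1) + (- (Ci * V1) + - (I2 - J2)))%C
         with ((I1 - I2 - Ci * V0) - (J1 + Ci * V1 - J2 - Ci * V0))%C by ring.
       rewrite HR. ring. }
  eapply Rle_trans; [apply Cmod_triangle|].
  pose proof (Cmod_triangle (- (Ci * V1))%C (- (I2 - J2))%C) as T2.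
  rewrite !Cmod_opp, Cmod_mult, Cmod_Ci in T2.
  apply (Rmult_lt_compat_r (B + 1)) in Hsm; [|lra].
  replace (eps / (B + 1) * (B + 1)) with eps in Hsm by (field; lra).
  pose proof (exp_pos (- m * n)). unfold B in Hsm. nra.
Qed.

(** The integral over the horizontal line Im z = c. *)
Definition LI (h : C -> C) (c : R) : C :=
  (IL (fun t => h (t, c)) + IL (fun t => h ((- t)%R, c)))%C.

Definition ldom (h : C -> C) (c M m : R) : Prop :=
  0 < m /\ forall x, ccont h (x, c) /\ Cmod (h (x, c)) <= M * exp (- m * Rabs x).

Lemma ldom_r h c M m : ldom h c M m -> edom (fun t => h (t, c)) M m.
Proof.
  intros [Hm H]. split; [exact Hm|]. intros t Ht. destruct (H t) as [H1 H2].
  rewrite Rabs_pos_eq in H2 by exact Ht. split; [apply rcont_h; exact H1|exact H2].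
Qed.

Lemma ldom_l h c M m : ldom h c M m -> edom (fun t => h (- t, c)) M m.
Proof.
  intros [Hm H]. split; [exact Hm|]. intros t Ht. destruct (H (- t)) as [H1 H2].
  rewrite Rabs_Ropp, Rabs_pos_eq in H2 by exact Ht. split; [|exact H2].
  apply (continuous_comp (fun s : R => - s) (fun x => h (x, c))).
  - apply (continuous_opp (V := R_NormedModule)). apply continuous_id.
  - apply rcont_h. exact H1.
Qed.

Lemma LI_lim h c M m n : ldom h c M m -> 0 <= n ->
  Cmod (LI h c - hint h (- n) n c)%C <= 2 * (M / m) * exp (- m * n).
Proof.
  intros H Hn.
  rewrite (hint_Chasles h (- n) 0 n c); [|lra|lra|intros; apply (proj2 H)].
  replace (hint h (- n) 0 c) with (CRI (fun t => h (- t, c)) 0 n).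
  2: { unfold hint. rewrite (CRI_neg (fun x => h (x, c))); [f_equal; ring|exact Hn|].
       intros t _. apply rcont_h, (proj2 H). }
  pose proof (IL_tail _ M m n (ldom_r _ _ _ _ H) Hn) as A1.
  pose proof (IL_tail _ M m n (ldom_l _ _ _ _ H) Hn) as A2.
  unfold LI, hint.
  replace (IL (fun t => h (t, c)) + IL (fun t => h ((- t)%R, c)) -
     (CRI (fun t => h ((- t)%R, c)) 0 n + CRI (fun t => h (t, c)) 0 n))%C
    with ((IL (fun t => h (t, c)) - CRI (fun t => h (t, c)) 0 n) +
      (IL (fun t => h ((- t)%R, c)) - CRI (fun t => h ((- t)%R, c)) 0 n))%C by ring.
  eapply Rle_trans; [apply Cmod_triangle|]. lra.
Qed.

Lemma LI_bound h c M m : ldom h c M m -> Cmod (LI h c) <= 2 * M / m.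
Proof.
  intros H. eapply Rle_trans; [apply Cmod_triangle|].
  pose proof (IL_bound _ _ _ (ldom_r _ _ _ _ H)). pose proof (IL_bound _ _ _ (ldom_l _ _ _ _ H)).
  unfold Rdiv in *. lra.
Qed.

Lemma LI_comb f g c M m M' m' k :
  ldom f c M m -> ldom g c M' m' ->
  LI (fun z => f z + k * g z)%C c = (LI f c + k * LI g c)%C.
Proof.
  intros Hf Hg. unfold LI.
  rewrite (IL_comb (fun t => f (t, c)) (fun t => g (t, c)) M m M' m');
    [|apply ldom_r; exact Hf|apply ldom_r; exact Hg].
  rewrite (IL_comb (fun t => f (- t, c)) (fun t => g (- t, c)) M m M' m');
    [|apply ldom_l; exact Hf|apply ldom_l; exact Hg].
  ring.
Qed.

Lemma LI_scal f c M m k : ldom f c M m -> LI (fun z => k * f z)%C c = (k * LI f c)%C.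
Proof.
  intros Hf. unfold LI.
  rewrite (IL_scal (fun t => f (t, c)) M m) by (apply ldom_r; exact Hf).
  rewrite (IL_scal (fun t => f (- t, c)) M m) by (apply ldom_l; exact Hf).
  ring.
Qed.

Lemma LI_ext f g c : (forall x, f (x, c) = g (x, c)) -> LI f c = LI g c.
Proof. intros H. unfold LI. f_equal; apply IL_ext; intros; apply H. Qed.

(** The residue theorem on [- n, n] x [c, d], in the limit n -> oo. *)
Theorem LI_residue h c d p A M m X :
  c < Im p < d -> 0 < m ->
  (forall x y, c <= y <= d -> (x, y) <> p -> holo h (x, y)) ->
  (forall x y, c <= y <= d -> X <= Rabs x -> Cmod (h (x, y)) <= M * exp (- m * Rabs x)) ->
  (exists M', ldom h c M' m) -> (exists M', ldom h d M' m) ->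
  (forall eps, 0 < eps -> exists delta, 0 < delta /\ forall w, w <> p ->
     Cmod (w - p)%C < delta -> Cmod ((w - p) * h w - A)%C <= eps) ->
  (LI h c - LI h d)%C = (A * (2 * PI * Ci))%C.
Proof.
  intros Hp Hm Hh HM [M1 H1] [M2 H2] Hlim. apply C_small_eq. intros eps He.
  set (B := Rabs (2 * (M1 / m)) + Rabs (2 * (M2 / m)) + 2 * Rabs M * (d - c)).
  assert (HB : 0 <= B).
  { unfold B. pose proof (Rabs_pos (2 * (M1 / m))). pose proof (Rabs_pos (2 * (M2 / m))).
    pose proof (Rabs_pos M). nra. }
  destruct (exp_small m (eps / (B + 1)) Hm) as [n0 [Hn0 Hsm]]. { apply Rdiv_lt_0_compat; lra. }
  set (n := Rmax n0 (Rmax X (Rabs (Re p) + 1))).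
  assert (N1 : n0 <= n) by apply Rmax_l.
  assert (N2 : X <= n) by (eapply Rle_trans; [apply (Rmax_l X)|apply Rmax_r]).
  assert (N3 : Rabs (Re p) + 1 <= n)
    by (eapply Rle_trans; [apply (Rmax_r X)|apply Rmax_r]).
  specialize (Hsm n N1).
  assert (Hre : - n < Re p < n).
  { pose proof (Rabs_def2 (Re p) n). pose proof (Rle_abs (Re p)).
    pose proof (Rle_abs (- Re p)) as Q. rewrite Rabs_Ropp in Q. lra. }
  assert (Hrn : Rabs n = n) by (apply Rabs_pos_eq; lra).
  assert (Hne : forall x y, Rabs x = n -> (x, y) <> p).
  { intros x y Hx E. assert (Ex : Re p = x) by (rewrite <- E; reflexivity).
    rewrite Ex in N3. lra. }
  assert (HR : rect h (- n) n c d = (A * (2 * PI * Ci))%C).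
  { apply (residue h (- n) n c d p A Hre Hp); [|exact Hlim].
    intros x y _ Hy Hn. apply Hh; assumption. }
  rewrite <- HR. unfold rect.
  pose proof (LI_lim h c M1 m n H1 ltac:(lra)) as A1.
  pose proof (LI_lim h d M2 m n H2 ltac:(lra)) as A2.
  assert (A3 : Cmod (vint h n c d) <= M * exp (- m * n) * (d - c)).
  { apply vint_bound; [lra| |].
    - intros y Hy. apply holo_ccont, Hh; [lra|]. apply Hne; exact Hrn.
    - intros y Hy. eapply Rle_trans; [apply HM; [exact Hy|lra]|]. rewrite Hrn. lra. }
  assert (A4 : Cmod (vint h (- n) c d) <= M * exp (- m * n) * (d - c)).
  { apply vint_bound; [lra| |].
    - intros y Hy. apply holo_ccont, Hh; [lra|]. apply Hne. rewrite Rabs_Ropp; exact Hrn.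
    - intros y Hy. eapply Rle_trans; [apply HM; [exact Hy|rewrite Rabs_Ropp; lra]|].
      rewrite Rabs_Ropp, Hrn. lra. }
  replace (LI h c - LI h d - (hint h (- n) n c + Ci * vint h n c d - hint h (- n) n d
      - Ci * vint h (- n) c d))%C
    with ((LI h c - hint h (- n) n c) + (- (LI h d - hint h (- n) n d) +
      (- (Ci * vint h n c d) + Ci * vint h (- n) c d)))%C by ring.
  eapply Rle_trans; [apply Cmod_triangle|].
  pose proof (Cmod_triangle (- (LI h d - hint h (- n) n d))%C
    (- (Ci * vint h n c d) + Ci * vint h (- n) c d)%C) as T1.
  pose proof (Cmod_triangle (- (Ci * vint h n c d))%C (Ci * vint h (- n) c d)%C) as T2.
  rewrite Cmod_opp in T1. rewrite Cmod_opp, !Cmod_mult, Cmod_Ci in T2.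
  apply (Rmult_lt_compat_r (B + 1)) in Hsm; [|lra].
  replace (eps / (B + 1) * (B + 1)) with eps in Hsm by (field; lra).
  pose proof (exp_pos (- m * n)) as He0. unfold B in Hsm.
  pose proof (Rle_abs (2 * (M1 / m))). pose proof (Rle_abs (2 * (M2 / m))). pose proof (Rle_abs M).
  assert (B1 : 2 * (M1 / m) * exp (- m * n) <= Rabs (2 * (M1 / m)) * exp (- m * n))
    by (apply Rmult_le_compat_r; lra).
  assert (B2 : 2 * (M2 / m) * exp (- m * n) <= Rabs (2 * (M2 / m)) * exp (- m * n))
    by (apply Rmult_le_compat_r; lra).
  assert (B3 : M * exp (- m * n) * (d - c) <= Rabs M * exp (- m * n) * (d - c)).
  { apply Rmult_le_compat_r; [lra|]. apply Rmult_le_compat_r; lra. }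
  nra.
Qed.

(** The residue of g / S at a simple zero of S. *)
Lemma simple_pole (g S : C -> C) (p s : C) :
  ccont g p -> S p = 0%C -> cder S p s -> s <> 0%C ->
  forall eps, 0 < eps -> exists delta, 0 < delta /\ forall w, w <> p ->
     Cmod (w - p)%C < delta -> Cmod ((w - p) * (g w / S w) - g p / s)%C <= eps.
Proof.
  intros Hg HS Hs Hs0.
  assert (Hp : 0 < Cmod s) by (apply Cmod_gt_0; exact Hs0).
  intros eps He.
  (* it is enough that (w - p) / S w tends to 1 / s *)
  assert (K : forall e, 0 < e -> exists delta, 0 < delta /\ forall w, w <> p ->
     Cmod (w - p)%C < delta -> S w <> 0%C /\ Cmod ((w - p) / S w - / s)%C <= e).
  { intros e Hep.
    set (e1 := Rmin (Cmod s / 2) (e * (Cmod s * Cmod s) / 2)).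
    assert (He1 : 0 < e1) by (apply Rmin_pos; [lra|]; apply Rdiv_lt_0_compat; [|lra];
      apply Rmult_lt_0_compat; [exact Hep|apply Rmult_lt_0_compat; exact Hp]).
    assert (E1 : e1 <= Cmod s / 2) by apply Rmin_l.
    assert (E2 : e1 <= e * (Cmod s * Cmod s) / 2) by apply Rmin_r.
    destruct (proj1 (cder_eps _ _ _) Hs e1 He1) as [dl [Hdl Hd]].
    exists dl. split; [exact Hdl|]. intros w Hw Hwd. specialize (Hd _ Hwd).
    replace (p + (w - p))%C with w in Hd by ring. rewrite HS in Hd.
    set (h := (w - p)%C) in *.
    assert (Hh0 : h <> 0%C).
    { unfold h. intros Z. apply Hw. replace w with (w - p + p)%C by ring. rewrite Z. ring. }
    pose proof (proj1 (Cmod_gt_0 h) Hh0) as Hh.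
    replace (S w - 0 - s * h)%C with (S w - s * h)%C in Hd by ring.
    assert (Sl : Cmod s / 2 * Cmod h <= Cmod (S w)).
    { pose proof (Cmod_triangle_rev (s * h)%C (S w - s * h)%C) as T.
      replace (s * h + (S w - s * h))%C with (S w) in T by ring.
      rewrite Cmod_mult in T. nra. }
    assert (HS0 : S w <> 0%C) by (apply Cmod_gt_0; nra).
    split; [exact HS0|].
    replace (h / S w - / s)%C with (- (S w - s * h) * / (S w * s))%C by (field; auto).
    rewrite Cmod_mult, Cmod_opp, Cmod_inv, Cmod_mult by (apply Cmult_neq_0; assumption).
    apply (Rmult_le_reg_r (Cmod (S w) * Cmod s)).
    - apply Rmult_lt_0_compat; [nra|exact Hp].
    - rewrite Rmult_assoc, Rinv_l by (apply Rgt_not_eq, Rmult_lt_0_compat; [nra|exact Hp]).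
      rewrite Rmult_1_r. eapply Rle_trans; [exact Hd|].
      assert (e * (Cmod s / 2 * Cmod h * Cmod s) <= e * (Cmod (S w) * Cmod s)).
      { apply Rmult_le_compat_l; [lra|]. apply Rmult_le_compat_r; lra. }
      assert (e1 * Cmod h <= e * (Cmod s * Cmod s) / 2 * Cmod h) by (apply Rmult_le_compat_r; lra).
      nra. }
  set (G := Cmod (g p) + 1 + / Cmod s).
  assert (HG : 0 < G).
  { unfold G. pose proof (Cmod_ge_0 (g p)). pose proof (Rinv_0_lt_compat _ Hp). lra. }
  set (e := Rmin 1 (eps / (2 * G))).
  assert (Hep : 0 < e) by (apply Rmin_pos; [lra|apply Rdiv_lt_0_compat; lra]).
  assert (Ee : e <= 1) by apply Rmin_l.
  assert (EG : e * (2 * G) <= eps).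
  { assert (Q : e <= eps / (2 * G)) by apply Rmin_r.
    apply (Rmult_le_compat_r (2 * G)) in Q; [|lra].
    replace (eps / (2 * G) * (2 * G)) with eps in Q by (field; lra). exact Q. }
  destruct (K e Hep) as [d1 [Hd1 K1]].
  apply continuous_Cmod with (eps := e) in Hg; [|exact Hep].
  apply locally_Cmod in Hg. destruct Hg as [d2 [Hd2 K2]].
  exists (Rmin d1 d2). split; [apply Rmin_pos; assumption|].
  intros w Hw Hwd.
  destruct (K1 w Hw ltac:(eapply Rlt_le_trans; [exact Hwd|apply Rmin_l])) as [S0 B1].
  pose proof (K2 w ltac:(eapply Rlt_le_trans; [exact Hwd|apply Rmin_r])) as B2.
  replace ((w - p) * (g w / S w) - g p / s)%C
    with ((g w - g p) * (((w - p) / S w - / s) + / s) + g p * ((w - p) / S w - / s))%C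
    by (field; auto).
  eapply Rle_trans; [apply Cmod_triangle|].
  assert (C1 : Cmod ((g w - g p) * (((w - p) / S w - / s) + / s))%C <= e * (1 + / Cmod s)).
  { apply Cmod_mult_le; [lra|]. eapply Rle_trans; [apply Cmod_triangle|].
    rewrite Cmod_inv by exact Hs0. lra. }
  assert (C2 : Cmod (g p * ((w - p) / S w - / s))%C <= Cmod (g p) * e)
    by (apply Cmod_mult_le; lra).
  unfold G in EG. pose proof (Cmod_ge_0 (g p)). pose proof (Rinv_0_lt_compat _ Hp). nra.
Qed.

(** * The complex hyperbolic sine *)

Lemma Re_cexp (w : C) : Re (cexp w) = exp (Re w) * cos (Im w).
Proof. unfold cexp. rewrite Re_mult, Re_RtoC, Im_RtoC. simpl. ring. Qed.
Lemma Im_cexp (w : C) : Im (cexp w) = exp (Re w) * sin (Im w).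
Proof. unfold cexp. rewrite Im_mult, Re_RtoC, Im_RtoC. simpl. ring. Qed.

Lemma Re_csinh (w : C) : Re (csinh w) = sinh (Re w) * cos (Im w).
Proof.
  unfold csinh. rewrite Re_div_R by lra. rewrite Re_minus, !Re_cexp, Re_opp, Im_opp, cos_neg.
  unfold sinh. field.
Qed.
Lemma Im_csinh (w : C) : Im (csinh w) = cosh (Re w) * sin (Im w).
Proof.
  unfold csinh. rewrite Im_div_R by lra. rewrite Im_minus, !Im_cexp, Re_opp, Im_opp, sin_neg.
  unfold cosh. field.
Qed.

Lemma cosh_ge_exp u : exp (Rabs u) / 2 <= cosh u.
Proof.
  unfold cosh. unfold Rabs. destruct (Rcase_abs u) as [H|H].
  - pose proof (exp_pos u). lra.
  - pose proof (exp_pos (- u)). lra.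
Qed.

Lemma csinh_lower (w : C) : Rabs (sin (Im w)) * (exp (Rabs (Re w)) / 2) <= Cmod (csinh w).
Proof.
  eapply Rle_trans; [|apply im_le_Cmod]. rewrite Im_csinh, Rabs_mult, Rmult_comm.
  apply Rmult_le_compat_r; [apply Rabs_pos|].
  pose proof (cosh_ge_exp (Re w)) as H. pose proof (exp_pos (Rabs (Re w))).
  rewrite (Rabs_pos_eq (cosh (Re w))); lra.
Qed.

Lemma cosh2_sinh2 u : cosh u ^ 2 = sinh u ^ 2 + 1.
Proof. unfold cosh, sinh. rewrite exp_Ropp. field. apply Rgt_not_eq, exp_pos. Qed.

(** 2.4 ^ 2 exceeds 16 / 3, which is what csinh_lower_re needs. *)
Lemma exp_1_gt : 2.4 <= exp 1.
Proof.
  assert (E5 : exp 1 = exp (/ 4) * exp (/ 4) * (exp (/ 4) * exp (/ 4)))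
    by (rewrite <- !exp_plus; f_equal; lra).
  pose proof (exp_ineq1 (/ 4) ltac:(lra)).
  assert (Q2 : 1.56 <= exp (/ 4) * exp (/ 4)) by nra.
  rewrite E5; nra.
Qed.

(** Away from the imaginary axis the real part alone bounds the sine below. *)
Lemma csinh_lower_re (w : C) : 1 <= Rabs (Re w) -> exp (Rabs (Re w)) / 4 <= Cmod (csinh w).
Proof.
  intros H. pose proof (cosh_ge_exp (Re w)) as Hch. pose proof (exp_pos (Rabs (Re w))) as He.
  assert (E6 : exp 1 <= exp (Rabs (Re w))) by (apply exp_le_mono; exact H).
  pose proof exp_1_gt as E7.
  assert (e4 : (exp (Rabs (Re w)) / 2) ^ 2 <= cosh (Re w) ^ 2) by (apply pow_incr; lra).
  assert (Hsh : (exp (Rabs (Re w)) / 4) ^ 2 <= sinh (Re w) ^ 2).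
  { replace (sinh (Re w) ^ 2) with (cosh (Re w) ^ 2 - 1) by (rewrite cosh2_sinh2; ring). nra. }
  assert (Hsq : (exp (Rabs (Re w)) / 4) ^ 2 <= Cmod (csinh w) ^ 2).
  { rewrite Cmod2_alt, Re_csinh, Im_csinh.
    pose proof (sin2_cos2 (Im w)) as SC. unfold Rsqr in SC.
    replace ((sinh (Re w) * cos (Im w)) ^ 2 + (cosh (Re w) * sin (Im w)) ^ 2)
      with (sinh (Re w) ^ 2 * (cos (Im w) * cos (Im w))
            + cosh (Re w) ^ 2 * (sin (Im w) * sin (Im w))) by ring.
    rewrite cosh2_sinh2. nra. }
  pose proof (Cmod_ge_0 (csinh w)).
  apply Rsqr_incr_0_var; [|assumption]. unfold Rsqr. simpl in Hsq. lra.
Qed.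

Lemma csinh_lower_lin a x y : 0 < a -> 1 <= a * Rabs x ->
  exp (a * Rabs x) / 4 <= Cmod (csinh (RtoC a * (x, y)))%C.
Proof.
  intros Ha H.
  assert (E : Rabs (Re (RtoC a * (x, y))%C) = a * Rabs x).
  { replace (Re (RtoC a * (x, y))%C) with (a * x) by (simpl; ring).
    rewrite Rabs_mult, (Rabs_pos_eq a) by lra. reflexivity. }
  rewrite <- E. apply csinh_lower_re. rewrite E. exact H.
Qed.

Lemma csinh_zero (w : C) : csinh w = 0%C -> Re w = 0 /\ sin (Im w) = 0.
Proof.
  intros H. pose proof (f_equal Im H) as H1. pose proof (f_equal Re H) as H2.
  rewrite Im_csinh, Im_RtoC in H1. rewrite Re_csinh, Re_RtoC in H2.
  assert (Hs : sin (Im w) = 0).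
  { apply Rmult_integral in H1. destruct H1 as [H1|H1]; [|exact H1].
    pose proof (cosh_ge_exp (Re w)). pose proof (exp_pos (Rabs (Re w))). lra. }
  split; [|exact Hs].
  apply Rmult_integral in H2. destruct H2 as [H2|H2].
  - unfold sinh in H2. assert (E : exp (Re w) = exp (- Re w)) by lra.
    apply exp_inv in E. lra.
  - pose proof (sin2_cos2 (Im w)) as Q. rewrite Hs, H2 in Q. unfold Rsqr in Q. lra.
Qed.

Lemma csinh_R (t : R) : csinh (RtoC t) = RtoC (sinh t).
Proof.
  unfold csinh, sinh. rewrite <- RtoC_opp, !cexp_R, <- RtoC_minus, <- RtoC_div by lra.
  reflexivity.
Qed.

Lemma csinh_opp (w : C) : csinh (- w)%C = (- csinh w)%C.
Proof. unfold csinh. replace (- - w)%C with w by ring. field. Qed.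

Lemma cder_csinh (w : C) : cder csinh w (ccosh w).
Proof.
  eapply cder_eq.
  - unfold csinh, Cdiv. apply cder_mult; [|apply cder_const].
    apply cder_minus; [apply cder_cexp|]. apply (cder_cexp_comp (fun w => - w)%C).
    apply cder_opp, cder_id.
  - unfold ccosh. cbv beta. field.
Qed.

Lemma holo_csinh f z : holo f z -> holo (fun w => csinh (f w)) z.
Proof.
  intros H. apply (holo_comp csinh f); [|exact H]. exists (ccosh (f z)). apply cder_csinh.
Qed.

Lemma holo_csinh_lin (a : R) z : holo (fun w => csinh (RtoC a * w))%C z.
Proof. apply (holo_csinh (fun w => RtoC a * w)%C). holo_auto. Qed.

Lemma sin_pos_lt_PI v : 0 < v < PI -> 0 < sin v.
Proof. intros [H1 H2]. apply sin_gt_0; assumption. Qed.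

Lemma csinh_lin_neq_0 a x y : 0 < a -> (x <> 0 \/ 0 < a * y < PI) -> csinh (RtoC a * (x, y))%C <> 0%C.
Proof.
  intros Ha H E. apply csinh_zero in E. destruct E as [E1 E2].
  replace (Re (RtoC a * (x, y))%C) with (a * x) in E1 by (simpl; ring).
  replace (Im (RtoC a * (x, y))%C) with (a * y) in E2 by (simpl; ring).
  destruct H as [H|H].
  - apply H. apply Rmult_integral in E1. lra.
  - pose proof (sin_pos_lt_PI _ H). lra.
Qed.

Lemma inv_csinh_bound a x y : 0 < a -> 0 < sin (a * y) ->
  Cmod (/ csinh (RtoC a * (x, y)))%C <= 2 / sin (a * y) * exp (- a * Rabs x).
Proof.
  intros Ha Hs.
  pose proof (csinh_lower (RtoC a * (x, y))%C) as B.
  replace (Re (RtoC a * (x, y))%C) with (a * x) in B by (simpl; ring).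
  replace (Im (RtoC a * (x, y))%C) with (a * y) in B by (simpl; ring).
  rewrite Rabs_mult, (Rabs_pos_eq a), (Rabs_pos_eq (sin (a * y))) in B by lra.
  pose proof (exp_pos (a * Rabs x)) as He.
  assert (Hp : 0 < sin (a * y) * (exp (a * Rabs x) / 2)) by (apply Rmult_lt_0_compat; lra).
  rewrite Cmod_inv by (apply Cmod_gt_0; lra).
  eapply Rle_trans; [apply Rinv_le_contravar; [exact Hp|exact B]|].
  replace (- a * Rabs x) with (- (a * Rabs x)) by ring. rewrite exp_Ropp.
  right. field. lra.
Qed.

(** * Integral transforms along the line of height k *)

(** The kernels q decay on the line like exp (- mu |Re t|), so W q k is
    holomorphic for |Im z| < mu / 2; the factor exp (- 2 k Re z) that the height
    k of the line produces is the decay of W q k z for Re z -> +oo. *)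
Definition W (q : C -> C) (k : R) (z : C) : C :=
  LI (fun t => q t * cexp (2 * Ci * t * z))%C k.

Definition kernel (q : C -> C) (k Q mu : R) : Prop :=
  forall x, ccont q (x, k) /\ Cmod (q (x, k)) <= Q * exp (- mu * Rabs x).

Lemma kernel_Q_pos q k Q mu : kernel q k Q mu -> 0 <= Q.
Proof.
  intros H. pose proof (proj2 (H 0)) as K. rewrite Rabs_R0, Rmult_0_r, exp_0, Rmult_1_r in K.
  eapply Rle_trans; [apply Cmod_ge_0|exact K].
Qed.

Lemma Cmod_cexp_kernel x k (z : C) :
  Cmod (cexp (2 * Ci * (x, k) * z)%C) = exp (-2 * k * Re z) * exp (-2 * x * Im z).
Proof.
  rewrite Cmod_cexp, <- exp_plus. f_equal. destruct z as [u v]. simpl. ring.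
Qed.

Lemma ccont_kernel_exp (z w : C) : ccont (fun t => cexp (2 * Ci * t * z))%C w.
Proof. apply holo_ccont. holo_auto. Qed.

Lemma kernel_bound q k Q mu z B x :
  kernel q k Q mu -> 0 <= k -> Rabs (Im z) <= B ->
  Cmod (q (x, k) * cexp (2 * Ci * (x, k) * z))%C
    <= Q * exp (-2 * k * Re z) * exp (- (mu - 2 * B) * Rabs x).
Proof.
  intros Hq Hk HB. pose proof (kernel_Q_pos _ _ _ _ Hq) as HQ.
  rewrite Cmod_mult, Cmod_cexp_kernel.
  destruct (Hq x) as [_ Hx].
  assert (E : exp (-2 * x * Im z) <= exp (2 * B * Rabs x)).
  { apply exp_le_mono. pose proof (Rle_abs (- (x * Im z))) as A.
    rewrite Rabs_Ropp, Rabs_mult in A. pose proof (Rabs_pos x).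
    assert (Rabs x * Rabs (Im z) <= Rabs x * B) by (apply Rmult_le_compat_l; lra). lra. }
  replace (- (mu - 2 * B) * Rabs x) with (- mu * Rabs x + 2 * B * Rabs x) by ring.
  rewrite exp_plus.
  replace (Q * exp (-2 * k * Re z) * (exp (- mu * Rabs x) * exp (2 * B * Rabs x)))
    with ((Q * exp (- mu * Rabs x)) * (exp (-2 * k * Re z) * exp (2 * B * Rabs x))) by ring.
  apply Rmult_le_compat; [apply Cmod_ge_0| |exact Hx|].
  - apply Rmult_le_pos; left; apply exp_pos.
  - apply Rmult_le_compat_l; [left; apply exp_pos|exact E].
Qed.

Lemma W_ldom q k Q mu z :
  kernel q k Q mu -> 0 <= k -> Rabs (Im z) < mu / 2 ->
  ldom (fun t => q t * cexp (2 * Ci * t * z))%C k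
    (Q * exp (-2 * k * Re z)) (mu - 2 * Rabs (Im z)).
Proof.
  intros Hq Hk Hz. split; [lra|]. intros x. split.
  - apply cont_mult; [apply Hq|apply ccont_kernel_exp].
  - apply kernel_bound; [exact Hq|exact Hk|lra].
Qed.

Lemma W_bound q k Q mu z :
  kernel q k Q mu -> 0 <= k -> Rabs (Im z) < mu / 2 ->
  Cmod (W q k z) <= 2 * (Q * exp (-2 * k * Re z)) / (mu - 2 * Rabs (Im z)).
Proof.
  intros Hq Hk Hz. apply LI_bound. apply W_ldom; assumption.
Qed.

Lemma W_der q k Q mu Q' z :
  kernel q k Q mu -> kernel (fun t => q t * (2 * Ci * t))%C k Q' mu -> 0 <= k ->
  Rabs (Im z) < mu / 2 ->
  cder (W q k) z (W (fun t => q t * (2 * Ci * t))%C k z).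
Proof.
  intros Hq Hq' Hk Hz.
  set (r := (mu / 2 - Rabs (Im z)) / 2). assert (Hr : 0 < r) by (unfold r; lra).
  set (B := Rabs (Im z) + r).
  set (m := mu - 2 * B). assert (Hm : 0 < m) by (unfold m, B, r; lra).
  set (M := Q * exp (-2 * k * (Re z - r))).
  pose proof (kernel_Q_pos _ _ _ _ Hq) as HQ.
  assert (Hsq : forall v x, in_square z r v ->
     Cmod (q (x, k) * cexp (2 * Ci * (x, k) * v))%C <= M * exp (- m * Rabs x)).
  { intros v x [Hv1 Hv2].
    assert (HvB : Rabs (Im v) <= B).
    { unfold B. pose proof (Rle_abs (Im z)). pose proof (Rle_abs (- Im z)) as A.
      rewrite Rabs_Ropp in A. apply Rabs_le. lra. }
    eapply Rle_trans; [apply (kernel_bound q k Q mu v B x Hq Hk HvB)|].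
    fold m. apply Rmult_le_compat_r; [left; apply exp_pos|]. unfold M.
    apply Rmult_le_compat_l; [exact HQ|]. apply exp_le_mono. nra. }
  assert (Hd : forall w, cder (fun v => q w * cexp (2 * Ci * w * v))%C z
     (q w * (2 * Ci * w) * cexp (2 * Ci * w * z))%C).
  { intros w. eapply cder_eq.
    - apply cder_scal_l. apply (cder_cexp_comp (fun v => 2 * Ci * w * v)%C).
      apply cder_scal_l, cder_id.
    - ring. }
  assert (Hopp : forall (f : C -> C) t, (forall x, ccont f (x, k)) -> rcont (fun s => f (- s, k)) t).
  { intros f t Hf. apply (continuous_comp (fun s : R => - s) (fun x => f (x, k))).
    - apply (continuous_opp (V := R_NormedModule)). apply continuous_id.
    - apply rcont_h, Hf. }
  unfold W, LI. apply cder_plus.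
  - apply (param_holo_der (fun t => 0 <= t) (fun t => exp (- m * t)) (/ m) IL
      (bounded_functional_IL m Hm) (fun v t => q (t, k) * cexp (2 * Ci * (t, k) * v))%C z r M Hr).
    + intros v t Hv Ht. apply (rcont_h (fun w => q w * cexp (2 * Ci * w * v))%C).
      apply cont_mult; [apply Hq|apply ccont_kernel_exp].
    + intros v t Hv Ht. holo_auto.
    + intros v t Hv Ht. eapply Rle_trans; [apply Hsq; exact Hv|]. rewrite Rabs_pos_eq by exact Ht. lra.
    + intros t Ht. apply Hd.
    + intros t Ht. apply (rcont_h (fun w => q w * (2 * Ci * w) * cexp (2 * Ci * w * z))%C).
      apply cont_mult; [apply Hq'|apply ccont_kernel_exp].
  - apply (param_holo_der (fun t => 0 <= t) (fun t => exp (- m * t)) (/ m) IL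
      (bounded_functional_IL m Hm) (fun v t => q ((- t)%R, k) * cexp (2 * Ci * ((- t)%R, k) * v))%C z r M Hr).
    + intros v t Hv Ht. apply (Hopp (fun w => q w * cexp (2 * Ci * w * v))%C).
      intros x. apply cont_mult; [apply Hq|apply ccont_kernel_exp].
    + intros v t Hv Ht. holo_auto.
    + intros v t Hv Ht. eapply Rle_trans; [apply Hsq; exact Hv|].
      rewrite Rabs_Ropp, Rabs_pos_eq by exact Ht. lra.
    + intros t Ht. apply Hd.
    + intros t Ht. apply (Hopp (fun w => q w * (2 * Ci * w) * cexp (2 * Ci * w * z))%C).
      intros x. apply cont_mult; [apply Hq'|apply ccont_kernel_exp].
Qed.

Lemma kernel_inv_csinh a k : 0 < a -> 0 < a * k < PI ->
  kernel (fun t => / csinh (RtoC a * t))%C k (2 / sin (a * k)) a.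
Proof.
  intros Ha Hk x. split.
  - apply holo_ccont. apply holo_inv; [apply holo_csinh_lin|].
    apply csinh_lin_neq_0; [exact Ha|right; exact Hk].
  - apply inv_csinh_bound; [exact Ha|apply sin_pos_lt_PI; exact Hk].
Qed.

Lemma kernel_const_mult q k Q mu c :
  kernel q k Q mu -> kernel (fun t => c * q t)%C k (Cmod c * Q) mu.
Proof.
  intros Hq x. destruct (Hq x) as [H1 H2]. split.
  - apply cont_mult; [apply cont_const|exact H1].
  - rewrite Cmod_mult, Rmult_assoc. apply Rmult_le_compat_l; [apply Cmod_ge_0|exact H2].
Qed.

Lemma pair_neq_0 (x k : R) : k <> 0 -> (x, k) <> RtoC 0.
Proof. intros H E. apply (f_equal Im) in E. simpl in E. lra. Qed.

Lemma kernel_div_id q k Q mu :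
  0 < k -> kernel q k Q mu -> kernel (fun t => / t * q t)%C k (/ k * Q) mu.
Proof.
  intros Hk Hq x. destruct (Hq x) as [H1 H2]. split.
  - apply cont_mult; [|exact H1]. apply holo_ccont. apply (holo_inv (fun t => t)); [apply holo_id|].
    apply pair_neq_0; lra.
  - rewrite Rmult_assoc. apply Cmod_mult_le; [|exact H2].
    rewrite Cmod_inv by (apply pair_neq_0; lra). apply Rinv_le_contravar; [exact Hk|].
    eapply Rle_trans; [|apply im_le_Cmod]. simpl. apply Rle_abs.
Qed.

Lemma kernel_ext q q' k Q mu :
  (forall x, q (x, k) = q' (x, k)) -> (forall x, ccont q' (x, k)) ->
  kernel q k Q mu -> kernel q' k Q mu.
Proof. intros E Hc H x. split; [apply Hc|]. rewrite <- E. apply H. Qed.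

Lemma kernel_mult q q' k Q Q' mu mu' :
  kernel q k Q mu -> kernel q' k Q' mu' ->
  kernel (fun t => q t * q' t)%C k (Q * Q') (mu + mu').
Proof.
  intros H H' x. destruct (H x) as [H1 H2], (H' x) as [H3 H4]. split.
  - apply cont_mult; assumption.
  - replace (- (mu + mu') * Rabs x) with (- mu * Rabs x + - mu' * Rabs x) by ring.
    rewrite exp_plus.
    replace (Q * Q' * (exp (- mu * Rabs x) * exp (- mu' * Rabs x)))
      with ((Q * exp (- mu * Rabs x)) * (Q' * exp (- mu' * Rabs x))) by ring.
    apply Cmod_mult_le; assumption.
Qed.

(** * Evaluation of the one-period transform *)

(** The kernel whose transform is a logarithm, see exp_logq. *)
Definition logq (a : R) (t : C) : C := (/ t * / csinh (RtoC a * t))%C.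

Lemma kernel_logq a k : 0 < a -> 0 < k -> a * k < PI ->
  kernel (logq a) k (/ k * (2 / sin (a * k))) a.
Proof.
  intros Ha Hk Hak. apply kernel_div_id; [exact Hk|].
  apply kernel_inv_csinh; [exact Ha|]. split; [apply Rmult_lt_0_compat; assumption|exact Hak].
Qed.

Lemma cexp_period (w : C) : cexp (w + Ci * PI)%C = (- cexp w)%C.
Proof. rewrite cexp_plus, cexp_iPI. ring. Qed.

Lemma csinh_period (w : C) : csinh (w + Ci * PI)%C = (- csinh w)%C.
Proof.
  unfold csinh. rewrite cexp_period.
  replace (- (w + Ci * PI))%C with (- w - Ci * PI)%C by ring.
  rewrite cexp_minus, cexp_iPI. field.
Qed.

(** Between the lines of heights k and k + pi / a the integrand has one pole, at
    i pi / a, and it is multiplied by - exp (- 2 pi z / a) from the lower to the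
    upper line. *)
Lemma W_one_period a k z : 0 < a -> 0 < k -> a * k < PI -> Rabs (Im z) < a / 2 ->
  ((1 + cexp (- (2 * PI * z / a))) * W (fun t => 2 * Ci * / csinh (RtoC a * t)) k z
   = 4 * PI / a * cexp (- (2 * PI * z / a)))%C.
Proof.
  intros Ha Hk Hak Hz.
  pose proof PI_RGT_0 as HPI.
  assert (Hak0 : 0 < a * k) by (apply Rmult_lt_0_compat; assumption).
  assert (HaC : RtoC a <> 0%C) by (apply RtoC_neq_0; lra).
  set (h := fun t : C => (2 * Ci * / csinh (RtoC a * t) * cexp (2 * Ci * t * z))%C).
  set (E := cexp (- (2 * PI * z / a))%C).
  set (d := k + PI / a).
  set (p := (0, PI / a) : C).
  assert (HPa : 0 < PI / a) by (apply Rdiv_lt_0_compat; lra).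
  assert (Hkd : k < PI / a).
  { apply (Rmult_lt_reg_l a); [exact Ha|]. replace (a * (PI / a)) with PI by (field; lra). exact Hak. }
  assert (Hper : forall x, h (x, d) = (- E * h (x, k))%C).
  { intros x. unfold h.
    replace ((x, d) : C) with ((x, k) + Ci * PI / a)%C.
    2: { unfold Cdiv. rewrite <- RtoC_inv by lra. apply C_eq; simpl; unfold d; field; lra. }
    replace (RtoC a * ((x, k) + Ci * PI / a))%C with (RtoC a * (x, k) + Ci * PI)%C by (field; exact HaC).
    rewrite csinh_period.
    replace (2 * Ci * ((x, k) + Ci * PI / a) * z)%C
      with (2 * Ci * (x, k) * z + (Ci * Ci) * (2 * PI * z / a))%C by (field; exact HaC).
    rewrite Ci2, cexp_plus.
    replace (- (1) * (2 * PI * z / a))%C with (- (2 * PI * z / a))%C by ring.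
    fold E. field. apply csinh_lin_neq_0; [exact Ha|]. right; lra. }
  set (Q := Cmod (2 * Ci)%C * (2 / sin (a * k))).
  assert (Hker : kernel (fun t => 2 * Ci * / csinh (RtoC a * t))%C k Q a)
    by (apply kernel_const_mult, kernel_inv_csinh; [exact Ha|lra]).
  assert (Hld : ldom h k (Q * exp (-2 * k * Re z)) (a - 2 * Rabs (Im z)))
    by (apply (W_ldom _ _ _ _ _ Hker); lra).
  set (m := a - 2 * Rabs (Im z)) in *. assert (Hm : 0 < m) by (unfold m; lra).
  assert (Hne : forall x y, k <= y <= d -> (x, y) <> p -> csinh (RtoC a * (x, y))%C <> 0%C).
  { intros x y Hy Hn. destruct (Req_dec x 0) as [->|Hx]; [|apply csinh_lin_neq_0; [exact Ha|left; exact Hx]].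
    intros Z. apply csinh_zero in Z. destruct Z as [_ Z].
    replace (Im (RtoC a * (0, y))%C) with (a * y) in Z by (simpl; ring).
    assert (Hay : a * y < 2 * PI).
    { assert (y < 2 * (PI / a)) by (unfold d in Hy; lra).
      apply Rlt_le_trans with (a * (2 * (PI / a))); [apply Rmult_lt_compat_l; lra|].
      right; field; lra. }
    assert (Hay0 : 0 < a * y) by (apply Rmult_lt_0_compat; lra).
    destruct (Rtotal_order (a * y) PI) as [L|[L|L]].
    - pose proof (sin_gt_0 _ Hay0 L). lra.
    - apply Hn. unfold p. f_equal. apply (Rmult_eq_reg_l a); [|lra]. rewrite L. field; lra.
    - pose proof (sin_lt_0 _ L ltac:(lra)). lra. }
  assert (Hres : (LI h k - LI h d)%C = (2 * Ci * E / (- a) * (2 * PI * Ci))%C).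
  { apply (LI_residue h k d p _ (2 * 2 * 2 * (exp (2 * d * Rabs (Re z)))) m (/ a)).
    - unfold p; simpl. unfold d. lra.
    - exact Hm.
    - intros x y Hy Hn. unfold h.
      apply holo_mult; [apply holo_mult; [apply holo_const|]|holo_auto].
      apply holo_inv; [apply holo_csinh_lin|apply Hne; assumption].
    - intros x y Hy Hx. unfold h. rewrite Cmod_mult.
      rewrite Cmod_cexp_kernel.
      assert (Hs : exp (a * Rabs x) / 4 <= Cmod (csinh (RtoC a * (x, y)))%C).
      { apply csinh_lower_lin; [exact Ha|].
        apply (Rmult_le_compat_l a) in Hx; [|lra]. rewrite Rinv_r in Hx by lra. exact Hx. }
      assert (Hc0 : csinh (RtoC a * (x, y))%C <> 0%C).
      { apply Cmod_gt_0. pose proof (exp_pos (a * Rabs x)). lra. }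
      assert (Hinv : Cmod (2 * Ci * / csinh (RtoC a * (x, y)))%C <= 2 * (4 * exp (- a * Rabs x))).
      { apply Cmod_mult_le; [rewrite Cmod_mult, Cmod_Ci, Cmod_R, Rabs_pos_eq; lra|].
        rewrite Cmod_inv by exact Hc0. pose proof (exp_pos (a * Rabs x)).
        eapply Rle_trans; [apply Rinv_le_contravar; [|exact Hs]; lra|].
        replace (- a * Rabs x) with (- (a * Rabs x)) by ring. rewrite exp_Ropp.
        right. field. lra. }
      assert (He1 : exp (-2 * y * Re z) <= exp (2 * d * Rabs (Re z))).
      { apply exp_le_mono. pose proof (Rle_abs (- Re z)) as A. rewrite Rabs_Ropp in A.
        pose proof (Rabs_pos (Re z)). assert (0 <= y) by lra.
        assert (y * - Re z <= y * Rabs (Re z)) by (apply Rmult_le_compat_l; lra).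
        assert (y * Rabs (Re z) <= d * Rabs (Re z)) by (apply Rmult_le_compat_r; lra). lra. }
      assert (He2 : exp (-2 * x * Im z) <= exp (2 * Rabs (Im z) * Rabs x)).
      { apply exp_le_mono. pose proof (Rle_abs (- (x * Im z))) as A.
        rewrite Rabs_Ropp, Rabs_mult in A. lra. }
      unfold m. replace (- (a - 2 * Rabs (Im z)) * Rabs x)
        with (- a * Rabs x + 2 * Rabs (Im z) * Rabs x) by ring.
      rewrite exp_plus.
      replace (2 * 2 * 2 * exp (2 * d * Rabs (Re z)) * (exp (- a * Rabs x) * exp (2 * Rabs (Im z) * Rabs x)))
        with (2 * (4 * exp (- a * Rabs x)) * (exp (2 * d * Rabs (Re z)) * exp (2 * Rabs (Im z) * Rabs x))) by ring.
      apply Rmult_le_compat; [apply Cmod_ge_0| |exact Hinv|].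
      + apply Rmult_le_pos; left; apply exp_pos.
      + apply Rmult_le_compat; try (left; apply exp_pos); assumption.
    - eexists. exact Hld.
    - exists (Cmod (- E)%C * (Q * exp (-2 * k * Re z))).
      split; [exact Hm|]. intros x. split.
      + apply holo_ccont. unfold h.
        apply holo_mult; [apply holo_mult; [apply holo_const|]|holo_auto].
        apply holo_inv; [apply holo_csinh_lin|apply Hne; [unfold d; lra|]].
        unfold p. intros Z. apply (f_equal Im) in Z. simpl in Z. unfold d in Z. lra.
      + rewrite Hper, Cmod_mult, Rmult_assoc. apply Rmult_le_compat_l; [apply Cmod_ge_0|].
        apply (proj2 Hld).
    - intros eps He.
      assert (Hap : (RtoC a * p)%C = (Ci * PI)%C).
      { unfold p. apply C_eq; simpl; field; lra. }
      destruct (simple_pole (fun t => 2 * Ci * cexp (2 * Ci * t * z))%C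
        (fun t => csinh (RtoC a * t))%C p (- a)%C) with (eps := eps) as [dl [Hdl K]].
      + apply holo_ccont. holo_auto.
      + rewrite Hap. replace (Ci * PI)%C with (0 + Ci * PI)%C by ring.
        rewrite csinh_period, csinh_R, sinh_0. ring.
      + eapply cder_eq.
        * apply (cder_comp csinh (fun t => RtoC a * t)%C); [apply cder_csinh|].
          apply cder_scal_l, cder_id.
        * rewrite Hap. unfold ccosh. rewrite cexp_opp, cexp_iPI. field.
      + rewrite <- RtoC_opp. apply RtoC_neq_0. lra.
      + exact He.
      + exists dl. split; [exact Hdl|]. intros w Hw Hwd. specialize (K w Hw Hwd).
        replace (2 * Ci * p * z)%C with (- (2 * PI * z / a))%C in K.
        * fold E in K. unfold h.
          replace ((w - p) * (2 * Ci * / csinh (a * w) * cexp (2 * Ci * w * z)))%C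
            with ((w - p) * (2 * Ci * cexp (2 * Ci * w * z) / csinh (a * w)))%C
            by (unfold Cdiv; ring).
          exact K.
        * replace p with (Ci * PI / a)%C.
          -- replace (2 * Ci * (Ci * PI / a) * z)%C with ((Ci * Ci) * (2 * PI * z / a))%C by (field; exact HaC).
             rewrite Ci2. ring.
          -- rewrite <- Hap. field. exact HaC. }
  change (W (fun t => 2 * Ci * / csinh (RtoC a * t))%C k z) with (LI h k).
  assert (HLd : LI h d = (- E * LI h k)%C).
  { rewrite <- (LI_scal h k _ m (- E)%C Hld). unfold LI. f_equal; apply IL_ext; intros; apply Hper. }
  rewrite HLd in Hres.
  replace ((1 + E) * LI h k)%C with (LI h k - - E * LI h k)%C by ring.
  rewrite Hres.
  replace (2 * Ci * E / - a * (2 * PI * Ci))%C with (- (Ci * Ci) * (4 * PI / a * E))%C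
    by (field; exact HaC).
  rewrite Ci2. ring.
Qed.

Lemma zero_derivative_line F v a b :
  a <= b -> (forall x, a <= x <= b -> cder F (x, v) 0%C) -> F (b, v) = F (a, v).
Proof.
  intros Hab H.
  assert (E : hint (fun _ => RtoC 0) a b v = (F (b, v) - F (a, v))%C).
  { apply hint_primitive; [exact Hab|exact H|]. intros; apply cont_const. }
  assert (Z : hint (fun _ => RtoC 0) a b v = 0%C).
  { apply Cmod_eq_0. apply Rle_antisym; [|apply Cmod_ge_0].
    eapply Rle_trans; [apply (hint_bound _ a b v 0 Hab)|lra].
    - intros; apply cont_const.
    - intros; right; apply Cmod_0. }
  rewrite Z in E. replace (F (b, v)) with ((F (b, v) - F (a, v)) + F (a, v))%C by ring.
  rewrite <- E. ring.
Qed.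

Lemma kernel_logq_der a k : 0 < a -> 0 < k -> a * k < PI ->
  kernel (fun t => logq a t * (2 * Ci * t))%C k (Cmod (2 * Ci)%C * (2 / sin (a * k))) a.
Proof.
  intros Ha Hk Hak. assert (Hak0 : 0 < a * k) by (apply Rmult_lt_0_compat; assumption).
  apply (kernel_ext (fun t => 2 * Ci * / csinh (RtoC a * t))%C).
  - intros x. unfold logq. field. split.
    + apply csinh_lin_neq_0; [exact Ha|right; lra].
    + apply pair_neq_0; lra.
  - intros x. apply cont_mult; [|apply holo_ccont; holo_auto].
    apply (kernel_logq a k Ha Hk Hak x).
  - apply kernel_const_mult, kernel_inv_csinh; [exact Ha|lra].
Qed.

Lemma exp_decay_shift b c eps : 0 < b -> 0 < eps ->
  exists X, forall x, X <= x -> c * exp (- b * x) < eps.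
Proof.
  intros Hb He. destruct (exp_small b (eps / (Rabs c + 1)) Hb) as [X [HX K]].
  { pose proof (Rabs_pos c). apply Rdiv_lt_0_compat; lra. }
  exists X. intros x Hx. specialize (K x Hx).
  pose proof (Rabs_pos c) as Hc. pose proof (Rle_abs c).
  apply (Rmult_lt_compat_r (Rabs c + 1)) in K; [|lra].
  replace (eps / (Rabs c + 1) * (Rabs c + 1)) with eps in K by (field; lra).
  pose proof (exp_pos (- b * x)). nra.
Qed.

(** The product of exp (W / 2) and 1 + exp (- 2 pi z / a) has derivative 0 along
    horizontal lines by W_one_period, and tends to 1 on the right. *)
Theorem exp_logq a k z : 0 < a -> 0 < k -> a * k < PI -> Rabs (Im z) < a / 2 ->
  cexp (- (/ 2) * W (logq a) k z)%C = (1 + cexp (- (2 * PI * z / a)))%C.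
Proof.
  intros Ha Hk Hak Hz. pose proof PI_RGT_0 as HPI.
  assert (HaC : RtoC a <> 0%C) by (apply RtoC_neq_0; lra).
  set (E := fun w : C => cexp (- (2 * PI * w / a))%C).
  set (F := fun w : C => (cexp (/ 2 * W (logq a) k w) * (1 + E w))%C).
  assert (HF : forall w, Im w = Im z -> cder F w 0%C).
  { intros w Hw. unfold F.
    eapply cder_eq.
    - apply cder_mult.
      + apply (cder_cexp_comp (fun w => / 2 * W (logq a) k w)%C). apply cder_scal_l.
        eapply (W_der _ _ _ a _ w (kernel_logq a k Ha Hk Hak) (kernel_logq_der a k Ha Hk Hak));
          [lra|rewrite Hw; exact Hz].
      + apply cder_plus; [apply cder_const|]. apply (cder_cexp_comp (fun w => - (2 * PI * w / a))%C).
        apply cder_opp. unfold Cdiv. apply cder_mult; [|apply cder_const].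
        apply cder_scal_l, cder_id.
    - cbv beta. fold (E w).
      assert (Q : W (fun t => logq a t * (2 * Ci * t))%C k w
         = W (fun t => 2 * Ci * / csinh (RtoC a * t))%C k w).
      { apply LI_ext. intros x. f_equal. unfold logq. field. split.
        - apply csinh_lin_neq_0; [exact Ha|right]. split; [apply Rmult_lt_0_compat|]; assumption.
        - apply pair_neq_0; lra. }
      rewrite Q. pose proof (W_one_period a k w Ha Hk Hak ltac:(rewrite Hw; exact Hz)) as P.
      fold (E w) in P.
      replace (cexp (/ 2 * W (logq a) k w) *
          (/ 2 * W (fun t : C => 2 * Ci * / csinh (a * t)) k w) * (1 + E w) +
          cexp (/ 2 * W (logq a) k w) *
          (0 + E w * - (2 * PI * 1 * / a + 2 * PI * w * 0)))%C
        with (cexp (/ 2 * W (logq a) k w) * (/ 2 * ((1 + E w) * W (fun t : C => 2 * Ci * / csinh (a * t)) k w)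
              - E w * (2 * PI * / a)))%C by ring.
      rewrite P. field. exact HaC. }
  assert (HF1 : F z = 1%C).
  { apply C_small_eq. intros eps He.
    set (Q := / k * (2 / sin (a * k))).
    assert (Hc : ccont cexp 0%C) by (apply (cder_ccont _ _ _ (cder_cexp 0%C))).
    set (e := Rmin 1 (eps / 4)).
    assert (Hep : 0 < e) by (apply Rmin_pos; lra).
    assert (E1 : e <= 1) by apply Rmin_l. assert (E2 : e <= eps / 4) by apply Rmin_r.
    apply continuous_Cmod with (eps := e) in Hc; [|exact Hep].
    apply locally_Cmod in Hc. destruct Hc as [dl [Hdl Hd]].
    destruct (exp_decay_shift (2 * k) (2 * Q / (a - 2 * Rabs (Im z))) dl) as [X1 K1]; [lra|exact Hdl|].
    destruct (exp_decay_shift (2 * PI / a) 1 e) as [X2 K2]; [apply Rdiv_lt_0_compat; lra|exact Hep|].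
    set (x := Rmax (Re z) (Rmax X1 X2)).
    assert (Hx0 : Re z <= x) by apply Rmax_l.
    assert (Hx1 : X1 <= x) by (eapply Rle_trans; [apply (Rmax_l X1 X2)|apply Rmax_r]).
    assert (Hx2 : X2 <= x) by (eapply Rle_trans; [apply (Rmax_r X1 X2)|apply Rmax_r]).
    specialize (K1 x Hx1). specialize (K2 x Hx2).
    replace (F z) with (F (x, Im z)).
    2: { rewrite (zero_derivative_line F (Im z) (Re z) x Hx0).
         - destruct z; reflexivity.
         - intros t _. apply HF. reflexivity. }
    set (w := (x, Im z) : C).
    assert (HW : Cmod (/ 2 * W (logq a) k w)%C < dl).
    { rewrite Cmod_mult, Cmod_inv, Cmod_R, Rabs_pos_eq by (try apply RtoC_neq_0; lra).
      pose proof (W_bound _ k Q a w (kernel_logq a k Ha Hk Hak) ltac:(lra) ltac:(unfold w; simpl; exact Hz)) as B.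
      unfold w in B. simpl in B.
      replace (2 * (Q * exp (-2 * k * x)) / (a - 2 * Rabs (Im z)))
        with (2 * Q / (a - 2 * Rabs (Im z)) * exp (- (2 * k) * x)) in B
        by (replace (- (2 * k) * x) with (-2 * k * x) by ring; unfold Rdiv; ring).
      pose proof (Cmod_ge_0 (W (logq a) k w)). fold w in B. lra. }
    specialize (Hd (/ 2 * W (logq a) k w)%C).
    replace (/ 2 * W (logq a) k w - 0)%C with (/ 2 * W (logq a) k w)%C in Hd by ring.
    specialize (Hd HW). rewrite cexp_0 in Hd.
    assert (HE : Cmod (E w) < e).
    { unfold E. rewrite Cmod_cexp. rewrite Rmult_1_l in K2.
      replace (Re (- (2 * PI * w / a))%C) with (- (2 * PI / a) * x); [exact K2|].
      unfold Cdiv. rewrite <- RtoC_inv by lra. unfold w; simpl. field. lra. }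
    unfold F.
    replace (cexp (/ 2 * W (logq a) k w) * (1 + E w) - 1)%C
      with ((cexp (/ 2 * W (logq a) k w) - 1) * (1 + E w) + E w)%C by ring.
    eapply Rle_trans; [apply Cmod_triangle|].
    assert (HA : Cmod ((cexp (/ 2 * W (logq a) k w) - 1) * (1 + E w))%C <= e * 2).
    { apply Cmod_mult_le; [lra|]. eapply Rle_trans; [apply Cmod_triangle|]. rewrite Cmod_1. lra. }
    lra. }
  unfold F in HF1. fold (E z).
  replace (- / 2 * W (logq a) k z)%C with (- (/ 2 * W (logq a) k z))%C by ring.
  rewrite cexp_opp. set (c := cexp (/ 2 * W (logq a) k z)%C) in *.
  transitivity (c * (1 + E z) * / c)%C; [rewrite HF1; ring|].
  field. apply cexp_neq_0.
Qed.

(** * The hyperbolic gamma function in the strip *)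

(** A height between 0 and the first poles i pi / p, i pi / q that is symmetric
    in p and q. *)
Definition kap (p q : R) : R := PI / (2 * (p + q)).

Lemma kap_pos p q : 0 < p -> 0 < q -> 0 < kap p q.
Proof. intros. unfold kap. pose proof PI_RGT_0. apply Rdiv_lt_0_compat; lra. Qed.

Lemma kap_lt_l p q : 0 < p -> 0 < q -> p * kap p q < PI.
Proof.
  intros. unfold kap. pose proof PI_RGT_0.
  apply (Rmult_lt_reg_r (2 * (p + q))); [lra|].
  replace (p * (PI / (2 * (p + q))) * (2 * (p + q))) with (p * PI) by (field; lra). nra.
Qed.

Lemma kap_sym p q : kap p q = kap q p.
Proof. unfold kap. do 2 f_equal. ring. Qed.

Lemma kap_lt_r p q : 0 < p -> 0 < q -> q * kap p q < PI.
Proof. intros. rewrite kap_sym. apply kap_lt_l; assumption. Qed.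

Definition gamq (p q : R) (t : C) : C :=
  (/ t * (/ csinh (RtoC p * t) * / csinh (RtoC q * t)))%C.

Definition gamQ (p q : R) : R :=
  / kap p q * (2 / sin (p * kap p q) * (2 / sin (q * kap p q))).

Lemma kernel_prod p q : 0 < p -> 0 < q ->
  kernel (fun t => / csinh (RtoC p * t) * / csinh (RtoC q * t))%C (kap p q)
    (2 / sin (p * kap p q) * (2 / sin (q * kap p q))) (p + q).
Proof.
  intros Hp Hq. pose proof (kap_pos p q Hp Hq) as Hk.
  apply kernel_mult; apply kernel_inv_csinh; try assumption; split;
    try (apply Rmult_lt_0_compat; assumption); [apply kap_lt_l|apply kap_lt_r]; assumption.
Qed.

Lemma kernel_gamq p q : 0 < p -> 0 < q -> kernel (gamq p q) (kap p q) (gamQ p q) (p + q).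
Proof.
  intros Hp Hq. apply kernel_div_id; [apply kap_pos; assumption|apply kernel_prod; assumption].
Qed.

Lemma kernel_gamq_der p q : 0 < p -> 0 < q -> exists Q,
  kernel (fun t => gamq p q t * (2 * Ci * t))%C (kap p q) Q (p + q).
Proof.
  intros Hp Hq. pose proof (kap_pos p q Hp Hq) as Hk.
  eexists. apply (kernel_ext (fun t => 2 * Ci * (/ csinh (RtoC p * t) * / csinh (RtoC q * t)))%C).
  - intros x. unfold gamq. field. repeat split.
    + apply csinh_lin_neq_0; [exact Hq|right]. split; [apply Rmult_lt_0_compat; assumption|].
      apply kap_lt_r; assumption.
    + apply csinh_lin_neq_0; [exact Hp|right]. split; [apply Rmult_lt_0_compat; assumption|].
      apply kap_lt_l; assumption.
    + apply pair_neq_0; lra.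
  - intros x. apply cont_mult; [apply (kernel_gamq p q Hp Hq)|apply holo_ccont; holo_auto].
  - apply kernel_const_mult, kernel_prod; assumption.
Qed.

(** Four times the logarithm of G_R in the strip (Gstrip_eq). *)
Definition gamT (p q : R) (z : C) : C := W (gamq p q) (kap p q) z.

(** G_R in the strip, in a form that exhibits its limit 1 on the right. *)
Definition Gstrip (p q : R) (z : C) : C := cexp (gamT p q z / 4)%C.

Lemma gamT_bound p q z : 0 < p -> 0 < q -> Rabs (Im z) < (p + q) / 2 ->
  Cmod (gamT p q z) <= 2 * (gamQ p q * exp (-2 * kap p q * Re z)) / (p + q - 2 * Rabs (Im z)).
Proof.
  intros Hp Hq Hz. apply W_bound; [apply kernel_gamq; assumption| |exact Hz].
  left; apply kap_pos; assumption.
Qed.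

Lemma holo_gamT p q z : 0 < p -> 0 < q -> Rabs (Im z) < (p + q) / 2 -> holo (gamT p q) z.
Proof.
  intros Hp Hq Hz. destruct (kernel_gamq_der p q Hp Hq) as [Q HQ].
  eexists. eapply W_der; [apply kernel_gamq; assumption|exact HQ| |exact Hz].
  left; apply kap_pos; assumption.
Qed.

Lemma holo_Gstrip p q z : 0 < p -> 0 < q -> Rabs (Im z) < (p + q) / 2 -> holo (Gstrip p q) z.
Proof.
  intros Hp Hq Hz. unfold Gstrip. apply (holo_cexp (fun w => gamT p q w / 4)%C).
  apply (holo_div (gamT p q) (fun _ => RtoC 4)).
  - apply holo_gamT; assumption.
  - apply holo_const.
  - apply RtoC_neq_0; lra.
Qed.

Lemma gamT_sym p q z : gamT p q z = gamT q p z.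
Proof.
  unfold gamT, W. rewrite (kap_sym p q). apply LI_ext. intros x. unfold gamq. ring.
Qed.

Lemma Gstrip_sym p q z : Gstrip p q z = Gstrip q p z.
Proof. unfold Gstrip. rewrite gamT_sym. reflexivity. Qed.

(** The shift multiplies the kernel by exp (- p t) - exp (p t) = - 2 sinh (p t),
    which cancels one of its denominators. *)
Lemma gamT_step p q z : 0 < p -> 0 < q ->
  Rabs (Im z) < q / 2 ->
  (gamT p q (z + Ci * p / 2) - gamT p q (z - Ci * p / 2))%C
    = (- (2) * W (logq q) (kap p q) z)%C.
Proof.
  intros Hp Hq Hz.
  pose proof (kap_pos p q Hp Hq) as Hk.
  assert (I1 : Im (z + Ci * p / 2)%C = Im z + p / 2).
  { rewrite Im_plus, Im_div_R by lra. simpl. lra. }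
  assert (I2 : Im (z - Ci * p / 2)%C = Im z - p / 2).
  { rewrite Im_minus, Im_div_R by lra. simpl. lra. }
  assert (A1 : Rabs (Im (z + Ci * p / 2)%C) < (p + q) / 2).
  { rewrite I1. apply Rabs_def1; apply Rabs_def2 in Hz; lra. }
  assert (A2 : Rabs (Im (z - Ci * p / 2)%C) < (p + q) / 2).
  { rewrite I2. apply Rabs_def1; apply Rabs_def2 in Hz; lra. }
  pose proof (W_ldom _ _ _ _ _ (kernel_gamq p q Hp Hq) ltac:(lra) A1) as D1.
  pose proof (W_ldom _ _ _ _ _ (kernel_gamq p q Hp Hq) ltac:(lra) A2) as D2.
  pose proof (W_ldom _ _ _ _ z (kernel_logq q (kap p q) Hq Hk (kap_lt_r p q Hp Hq)) ltac:(lra) Hz) as D3.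
  unfold gamT. unfold W at 3. rewrite <- (LI_scal _ _ _ _ (- (2))%C D3).
  replace (W (gamq p q) (kap p q) (z + Ci * p / 2) - W (gamq p q) (kap p q) (z - Ci * p / 2))%C
    with (W (gamq p q) (kap p q) (z + Ci * p / 2) + - (1) * W (gamq p q) (kap p q) (z - Ci * p / 2))%C by ring.
  unfold W. rewrite <- (LI_comb _ _ _ _ _ _ _ (- (1))%C D1 D2).
  apply LI_ext. intros x. set (t := (x, kap p q) : C).
  assert (Hsp : csinh (RtoC p * t)%C <> 0%C).
  { apply csinh_lin_neq_0; [exact Hp|right]. split; [apply Rmult_lt_0_compat; assumption|].
    apply kap_lt_l; assumption. }
  assert (Hsq : csinh (RtoC q * t)%C <> 0%C).
  { apply csinh_lin_neq_0; [exact Hq|right]. split; [apply Rmult_lt_0_compat; assumption|].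
    apply kap_lt_r; assumption. }
  assert (Ht : t <> 0%C) by (apply pair_neq_0; lra).
  assert (X1 : (2 * Ci * t * (z + Ci * p / 2))%C = (2 * Ci * t * z + - (RtoC p * t))%C).
  { replace (2 * Ci * t * (z + Ci * p / 2))%C with (2 * Ci * t * z + (Ci * Ci) * (RtoC p * t))%C by field.
    rewrite Ci2. ring. }
  assert (X2 : (2 * Ci * t * (z - Ci * p / 2))%C = (2 * Ci * t * z + RtoC p * t)%C).
  { replace (2 * Ci * t * (z - Ci * p / 2))%C with (2 * Ci * t * z - (Ci * Ci) * (RtoC p * t))%C by field.
    rewrite Ci2. ring. }
  rewrite X1, X2, !cexp_plus.
  unfold gamq, logq.
  set (ez := cexp (2 * Ci * t * z)%C).
  replace (/ t * (/ csinh (p * t) * / csinh (q * t)) * (ez * cexp (- (p * t))) +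
     - (1) * (/ t * (/ csinh (p * t) * / csinh (q * t)) * (ez * cexp (p * t))))%C
    with (/ t * / csinh (q * t) * ez * (/ csinh (p * t) * (cexp (- (p * t)) - cexp (p * t))))%C by ring.
  replace (cexp (- (p * t)) - cexp (p * t))%C with (- (2) * csinh (p * t))%C by (unfold csinh; field).
  field. auto.
Qed.

(** By gamT_step at the midpoint of w and w + i p, and exp_logq. *)
Theorem Gstrip_step p q w : 0 < p -> 0 < q ->
  - ((p + q) / 2) < Im w -> Im w + p < (p + q) / 2 ->
  Gstrip p q (w + Ci * p)%C = (Gstrip p q w * (1 + cexp (- (2 * PI * (w + Ci * p / 2) / q))))%C.
Proof.
  intros Hp Hq H1 H2.
  set (z := (w + Ci * p / 2)%C).
  assert (Iz : Im z = Im w + p / 2).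
  { unfold z. rewrite Im_plus, Im_div_R by lra. simpl. lra. }
  assert (Hz : Rabs (Im z) < q / 2) by (rewrite Iz; apply Rabs_def1; lra).
  pose proof (gamT_step p q z Hp Hq Hz) as S.
  replace (z + Ci * p / 2)%C with (w + Ci * p)%C in S by (unfold z; field).
  replace (z - Ci * p / 2)%C with w in S by (unfold z; field).
  rewrite <- (exp_logq q (kap p q) z Hq (kap_pos p q Hp Hq) (kap_lt_r p q Hp Hq) Hz).
  unfold Gstrip. rewrite <- cexp_plus. f_equal.
  replace (gamT p q (w + Ci * p)) with (gamT p q w + (gamT p q (w + Ci * p) - gamT p q w))%C by ring.
  rewrite S. field.
Qed.

(** * Orders of vanishing at 0 *)

(** f t = O(t^n) for t -> 0. *)
Definition order (n : nat) (f : C -> C) : Prop :=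
  exists K d, 0 <= K /\ 0 < d <= 1 /\ forall t, Cmod t <= d -> Cmod (f t) <= K * Cmod t ^ n.

Lemma order_plus n f g : order n f -> order n g -> order n (fun t => f t + g t)%C.
Proof.
  intros [K [d [HK [Hd H]]]] [K' [d' [HK' [Hd' H']]]].
  exists (K + K'), (Rmin d d'). split; [lra|]. split.
  { split; [apply Rmin_pos; lra|]. eapply Rle_trans; [apply Rmin_l|lra]. }
  intros t Ht. eapply Rle_trans; [apply Cmod_triangle|].
  pose proof (H t (Rle_trans _ _ _ Ht (Rmin_l _ _))).
  pose proof (H' t (Rle_trans _ _ _ Ht (Rmin_r _ _))). lra.
Qed.

Lemma order_mult n m f g : order n f -> order m g -> order (n + m) (fun t => f t * g t)%C.
Proof.
  intros [K [d [HK [Hd H]]]] [K' [d' [HK' [Hd' H']]]].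
  exists (K * K'), (Rmin d d'). split; [apply Rmult_le_pos; assumption|]. split.
  { split; [apply Rmin_pos; lra|]. eapply Rle_trans; [apply Rmin_l|lra]. }
  intros t Ht. rewrite pow_add.
  replace (K * K' * (Cmod t ^ n * Cmod t ^ m)) with ((K * Cmod t ^ n) * (K' * Cmod t ^ m)) by ring.
  apply Cmod_mult_le; [apply H|apply H'].
  - exact (Rle_trans _ _ _ Ht (Rmin_l _ _)).
  - exact (Rle_trans _ _ _ Ht (Rmin_r _ _)).
Qed.

Lemma order_const c : order 0 (fun _ => c).
Proof.
  exists (Cmod c), 1. split; [apply Cmod_ge_0|]. split; [lra|]. intros t _. simpl. lra.
Qed.

Lemma order_id : order 1 (fun t => t).
Proof. exists 1, 1. split; [lra|]. split; [lra|]. intros t _. simpl. lra. Qed.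

Lemma order_weaken n m f : (m <= n)%nat -> order n f -> order m f.
Proof.
  intros Hnm [K [d [HK [Hd H]]]]. exists K, d. split; [exact HK|]. split; [exact Hd|].
  intros t Ht. eapply Rle_trans; [apply H; exact Ht|]. apply Rmult_le_compat_l; [exact HK|].
  pose proof (Cmod_ge_0 t). replace n with ((n - m) + m)%nat by lia. rewrite pow_add.
  rewrite <- (Rmult_1_l (Cmod t ^ m)) at 2. apply Rmult_le_compat_r; [apply pow_le; assumption|].
  rewrite <- (pow1 (n - m)). apply pow_incr. lra.
Qed.

Lemma order_scal c n f : order n f -> order n (fun t => c * f t)%C.
Proof. intros H. exact (order_mult 0 n _ _ (order_const c) H). Qed.

Lemma order_opp n f : order n f -> order n (fun t => - f t)%C.
Proof.
  intros [K [d [HK [Hd H]]]]. exists K, d. split; [exact HK|]. split; [exact Hd|].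
  intros t Ht. rewrite Cmod_opp. apply H; exact Ht.
Qed.

Lemma order_minus n f g : order n f -> order n g -> order n (fun t => f t - g t)%C.
Proof. intros Hf Hg. apply order_plus; [exact Hf|apply order_opp; exact Hg]. Qed.

Lemma order_ext n f g : (forall t, f t = g t) -> order n f -> order n g.
Proof.
  intros E [K [d [HK [Hd H]]]]. exists K, d. split; [exact HK|]. split; [exact Hd|].
  intros t Ht. rewrite <- E. apply H; exact Ht.
Qed.

Lemma order_comp_lin n f (c : C) : order n f -> order n (fun t => f (c * t)%C).
Proof.
  intros [K [d [HK [Hd H]]]]. pose proof (Cmod_ge_0 c) as Hc.
  exists (K * Cmod c ^ n), (d / (Cmod c + 1)). split.
  { apply Rmult_le_pos; [exact HK|apply pow_le; exact Hc]. } split.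
  { split; [apply Rdiv_lt_0_compat; lra|].
    apply (Rmult_le_reg_r (Cmod c + 1)); [lra|].
    replace (d / (Cmod c + 1) * (Cmod c + 1)) with d by (field; lra). lra. }
  intros t Ht. apply (Rmult_le_compat_r (Cmod c + 1)) in Ht; [|lra].
  replace (d / (Cmod c + 1) * (Cmod c + 1)) with d in Ht by (field; lra).
  pose proof (Cmod_ge_0 t).
  eapply Rle_trans; [apply H; rewrite Cmod_mult; nra|].
  rewrite Cmod_mult, Rpow_mult_distr. right. ring.
Qed.

(** Integration along the segment from 0 to t raises the order by one. *)
Lemma order_primitive n F f :
  (forall t, cder F t (f t)) -> (forall t, ccont f t) -> order n f ->
  order (S n) (fun t => F t - F 0)%C.
Proof.
  intros HF Hc [K [d [HK [Hd H]]]]. exists K, d. split; [exact HK|]. split; [exact Hd|].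
  intros t Ht.
  pose proof (FTC_line F f 0%C t 0 1 ltac:(lra) ltac:(intros; apply HF) ltac:(intros; apply Hc)) as I.
  replace (0 + t * 1)%C with t in I by ring. replace (0 + t * 0)%C with (RtoC 0) in I by ring.
  replace (K * Cmod t ^ S n) with (Cmod t * (K * Cmod t ^ n) * (1 - 0)) by (simpl; ring).
  apply (is_CRI_bound _ 0 1 _ _ ltac:(lra)) with (2 := I).
  intros s Hs. apply Cmod_mult_le; [lra|].
  assert (Hst : Cmod (0 + t * s)%C <= Cmod t).
  { rewrite Cplus_0_l, Cmod_mult, Cmod_R, Rabs_pos_eq by lra. pose proof (Cmod_ge_0 t). nra. }
  eapply Rle_trans; [apply H; lra|]. apply Rmult_le_compat_l; [exact HK|].
  apply pow_incr. split; [apply Cmod_ge_0|exact Hst].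
Qed.

Lemma cexp_order_1 : order 1 (fun t => cexp t - 1)%C.
Proof.
  apply (order_ext 1 (fun t => cexp t - cexp 0)%C); [intros; rewrite cexp_0; reflexivity|].
  apply (order_primitive 0 cexp cexp).
  - intros; apply cder_cexp.
  - intros t; eapply cder_ccont, cder_cexp.
  - exists (exp 1), 1. split; [left; apply exp_pos|]. split; [lra|]. intros t Ht.
    rewrite Cmod_cexp. simpl. rewrite Rmult_1_r. apply exp_le_mono.
    pose proof (re_le_Cmod t). pose proof (Rle_abs (Re t)). lra.
Qed.

Lemma holo_cexp_id t : holo cexp t.
Proof. exists (cexp t); apply cder_cexp. Qed.

Lemma cexp_order_2 : order 2 (fun t => cexp t - 1 - t)%C.
Proof.
  apply (order_ext 2 (fun t => (cexp t - t) - (cexp 0 - 0))%C).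
  { intros; rewrite cexp_0. ring. }
  apply (order_primitive 1 (fun t => cexp t - t)%C (fun t => cexp t - 1)%C).
  - intros t. apply cder_minus; [apply cder_cexp|apply cder_id].
  - intros t. pose proof (holo_cexp_id t). apply holo_ccont. holo_auto.
  - apply cexp_order_1.
Qed.

Lemma two_neq : RtoC 2 <> 0%C. Proof. apply RtoC_neq_0; lra. Qed.
Lemma six_neq : RtoC 6 <> 0%C. Proof. apply RtoC_neq_0; lra. Qed.

Lemma cexp_order_3 : order 3 (fun t => cexp t - 1 - t - t * t / 2)%C.
Proof.
  apply (order_ext 3 (fun t => (cexp t - t - t * t / 2) - (cexp 0 - 0 - 0 * 0 / 2))%C).
  { intros; rewrite cexp_0. field. }
  apply (order_primitive 2 (fun t => cexp t - t - t * t / 2)%C (fun t => cexp t - 1 - t)%C).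
  - intros t. eapply cder_eq.
    + apply cder_minus; [apply cder_minus; [apply cder_cexp|apply cder_id]|].
      unfold Cdiv. apply cder_mult; [apply cder_mult; apply cder_id|apply cder_const].
    + cbv beta. field.
  - intros t. pose proof (holo_cexp_id t). apply holo_ccont. holo_auto.
  - apply cexp_order_2.
Qed.

Lemma cexp_order_4 : order 4 (fun t => cexp t - 1 - t - t * t / 2 - t * t * t / 6)%C.
Proof.
  apply (order_ext 4 (fun t => (cexp t - t - t * t / 2 - t * t * t / 6)
      - (cexp 0 - 0 - 0 * 0 / 2 - 0 * 0 * 0 / 6))%C).
  { intros; rewrite cexp_0. field. }
  apply (order_primitive 3 (fun t => cexp t - t - t * t / 2 - t * t * t / 6)%C
     (fun t => cexp t - 1 - t - t * t / 2)%C).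
  - intros t. eapply cder_eq.
    + apply cder_minus; [apply cder_minus; [apply cder_minus; [apply cder_cexp|apply cder_id]|]|].
      * unfold Cdiv. apply cder_mult; [apply cder_mult; apply cder_id|apply cder_const].
      * unfold Cdiv. apply cder_mult; [|apply cder_const].
        apply cder_mult; [apply cder_mult; apply cder_id|apply cder_id].
    + cbv beta. field.
  - intros t. pose proof (holo_cexp_id t). apply holo_ccont. holo_auto. apply two_neq.
  - apply cexp_order_3.
Qed.

Lemma csinh_order_4 : order 4 (fun t => csinh t - t - t * t * t / 6)%C.
Proof.
  apply (order_ext 4 (fun t => / 2 * (cexp t - 1 - t - t * t / 2 - t * t * t / 6)
    - / 2 * ((fun s => cexp s - 1 - s - s * s / 2 - s * s * s / 6) (- (1) * t)))%C).
  - intros t. cbv beta. unfold csinh. replace (- (1) * t)%C with (- t)%C by ring. field.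
  - apply order_minus; apply order_scal; [apply cexp_order_4|].
    apply (order_comp_lin 4 _ (- (1))%C cexp_order_4).
Qed.

Lemma csinh_order_1 : order 1 csinh.
Proof.
  apply (order_ext 1 (fun t => (csinh t - t - t * t * t / 6) + (t + / 6 * (t * t * t)))%C).
  { intros t. field. }
  apply order_plus; [apply (order_weaken 4); [lia|apply csinh_order_4]|].
  apply order_plus; [apply order_id|]. apply order_scal.
  apply (order_weaken 3); [lia|].
  apply (order_mult 2 1); [apply (order_mult 1 1)|]; apply order_id.
Qed.

(** The constant term of the Laurent expansion of
    exp (2 i t z) / (sinh (p t) sinh (q t)) at t = 0. *)
Definition laurent_c (p q : R) (z : C) : C :=
  (- (p * p + q * q) / (6 * p * q) - 2 * (z * z) / (p * q))%C.

(** The Laurent expansion that defines laurent_c, with denominators cleared. It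
    is a product of Taylor polynomials, with the remainder of exp of order 3 and
    those of sinh of order 4. *)
Lemma laurent_order (p q : R) (z : C) : p <> 0 -> q <> 0 ->
  order 5 (fun t => p * q * (t * t) * cexp (2 * Ci * z * t)
     - csinh (p * t) * csinh (q * t)
         * (1 + 2 * Ci * z * t + p * q * laurent_c p q z * (t * t)))%C.
Proof.
  intros Hp Hq. apply RtoC_neq_0 in Hp, Hq.
  set (e := (fun t => cexp t - 1 - t - t * t / 2)%C).
  set (s := (fun t => csinh t - t - t * t * t / 6)%C).
  set (c := laurent_c p q z).
  set (u := (2 * Ci * z)%C).
  assert (Hc : (p * q * c)%C = (- (p * p + q * q) / 6 - 2 * (z * z))%C).
  { unfold c, laurent_c. field. auto. }
  assert (Hu : (u * u)%C = (- (4) * (z * z))%C).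
  { unfold u. replace (2 * Ci * z * (2 * Ci * z))%C with ((Ci * Ci) * (4 * (z * z)))%C by ring.
    rewrite Ci2. ring. }
  assert (T3 : order 3 (fun t => t * t * t)%C)
    by (apply (order_mult 2 1); [apply (order_mult 1 1)|]; apply order_id).
  assert (T2 : order 2 (fun t => t * t)%C) by (apply (order_mult 1 1); apply order_id).
  assert (Hpoly : order 0 (fun t => 1 + u * t + p * q * c * (t * t))%C).
  { apply order_plus; [apply order_plus; [apply order_const|]|].
    - apply (order_weaken 1); [lia|]. apply order_scal, order_id.
    - apply (order_weaken 2); [lia|]. apply order_scal, T2. }
  assert (Sp : order 4 (fun t => s (p * t)%C)) by (apply order_comp_lin, csinh_order_4).
  assert (Sq : order 4 (fun t => s (q * t)%C)) by (apply order_comp_lin, csinh_order_4).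
  assert (Lq : order 1 (fun t => csinh (q * t))%C) by (apply order_comp_lin, csinh_order_1).
  assert (Lp : order 1 (fun t => p * t + p * p * p / 6 * (t * t * t))%C).
  { apply order_plus; [apply order_scal, order_id|]. apply (order_weaken 3); [lia|].
    apply order_scal, T3. }
  apply (order_ext 5 (fun t => (p * q * ((t * t) * e (u * t)) +
      (- (s (p * t) * csinh (q * t) * (1 + u * t + p * q * c * (t * t))) +
       - ((p * t + p * p * p / 6 * (t * t * t)) * s (q * t) * (1 + u * t + p * q * c * (t * t))))) +
      (- (p * p * p * q * q * q / 36 * ((t * t * t) * (t * t * t) * (1 + u * t + p * q * c * (t * t)))) +
       - (p * q * (p * p + q * q) / 6 * ((t * t) * (t * t * t)) * (u + p * q * c * t))))%C).
  { intros t. unfold e, s.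
    assert (E : (p * q * c)%C = (- (p * p + q * q) / 6 + u * u / 2)%C).
    { rewrite Hc, Hu. field. }
    replace (p * q * c)%C with (- (p * p + q * q) / 6 + u * u / 2)%C by (symmetry; exact E).
    field. }
  apply order_plus; apply order_plus.
  - apply order_scal. apply (order_mult 2 3); [exact T2|].
    apply order_comp_lin. apply cexp_order_3.
  - apply order_plus; apply order_opp.
    + apply (order_mult 5 0); [apply (order_mult 4 1); assumption|exact Hpoly].
    + apply (order_mult 5 0); [apply (order_mult 1 4); assumption|exact Hpoly].
  - apply order_opp. apply order_scal. apply (order_weaken 6); [lia|].
    apply (order_mult 6 0); [apply (order_mult 3 3); assumption|exact Hpoly].
  - apply order_opp. apply (order_mult 5 0).
    + apply order_scal. apply (order_mult 2 3); assumption.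
    + apply order_plus; [apply order_const|]. apply (order_weaken 1); [lia|].
      apply order_scal, order_id.
Qed.

Lemma csinh_lower_0 : exists d, 0 < d /\ forall t, Cmod t <= d -> Cmod t / 2 <= Cmod (csinh t).
Proof.
  destruct csinh_order_4 as [K [d [HK [Hd H]]]].
  exists (Rmin d (/ (2 * (K + 1)))). split.
  { apply Rmin_pos; [lra|]. apply Rinv_0_lt_compat; lra. }
  intros t Ht.
  assert (H1 : Cmod t <= d) by (eapply Rle_trans; [exact Ht|apply Rmin_l]).
  assert (H2 : Cmod t <= / (2 * (K + 1))) by (eapply Rle_trans; [exact Ht|apply Rmin_r]).
  specialize (H t H1). set (r := Cmod t) in *. assert (Hr : 0 <= r) by apply Cmod_ge_0.
  apply (Rmult_le_compat_r (2 * (K + 1))) in H2; [|lra].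
  rewrite Rinv_l in H2 by lra.
  pose proof (Cmod_triangle_rev t (t * t * t / 6 + (csinh t - t - t * t * t / 6))%C) as T.
  replace (t + (t * t * t / 6 + (csinh t - t - t * t * t / 6)))%C with (csinh t) in T by field.
  pose proof (Cmod_triangle (t * t * t / 6)%C (csinh t - t - t * t * t / 6)%C) as T2.
  assert (E : Cmod (t * t * t / 6)%C = r * r * r / 6).
  { rewrite Cmod_div by apply six_neq. rewrite !Cmod_mult, Cmod_R, Rabs_pos_eq by lra. reflexivity. }
  rewrite E in T2. fold r in T.
  assert (r3 : r * r * r <= r) by nra.
  assert (r4 : K * r ^ 4 <= r * (/ 4)).
  { replace (K * r ^ 4) with (r * ((K * r) * (r * r))) by ring.
    apply Rmult_le_compat_l; [exact Hr|].
    assert (K * r <= / 2) by lra. assert (r * r <= / 2) by nra.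
    assert (0 <= K * r) by nra. nra. }
  lra.
Qed.

(** * The defining integral of g *)

(** The integrand of T z minus the principal part of its Laurent expansion at
    the triple pole 0. It is bounded near 0, and its even part on the real line
    is 2 i times the integrand of g (gamN_sym). *)
Definition gamN (p q : R) (z t : C) : C :=
  ((cexp (2 * Ci * t * z) * (/ csinh (RtoC p * t) * / csinh (RtoC q * t))
    - / (RtoC p * RtoC q) * / (t * t) - 2 * Ci * z / (RtoC p * RtoC q) * / t
    - laurent_c p q z) * / t)%C.

Lemma gamN_bounded_0 p q z : 0 < p -> 0 < q -> exists K d, 0 <= K /\ 0 < d /\
  forall t : C, t <> 0%C -> Cmod t <= d -> Cmod (gamN p q z t) <= K.
Proof.
  intros Hp Hq.
  destruct (laurent_order p q z ltac:(lra) ltac:(lra)) as [K [d [HK [Hd H]]]].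
  destruct csinh_lower_0 as [d0 [Hd0 H0]].
  exists (4 * K / (p * p * (q * q))), (Rmin d (Rmin (d0 / p) (d0 / q))).
  assert (Hpq : 0 < p * p * (q * q)) by (apply Rmult_lt_0_compat; nra).
  split. { apply Rmult_le_pos; [lra|]. left; apply Rinv_0_lt_compat; exact Hpq. }
  split. { repeat apply Rmin_pos; try apply Rdiv_lt_0_compat; lra. }
  intros t Ht Htd.
  assert (M1 : Cmod t <= d) by (eapply Rle_trans; [exact Htd|apply Rmin_l]).
  assert (M2 : Cmod t <= d0 / p).
  { eapply Rle_trans; [exact Htd|]. eapply Rle_trans; [apply Rmin_r|apply Rmin_l]. }
  assert (M3 : Cmod t <= d0 / q).
  { eapply Rle_trans; [exact Htd|]. eapply Rle_trans; [apply Rmin_r|apply Rmin_r]. }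
  set (r := Cmod t) in *. assert (Hr : 0 < r) by (apply Cmod_gt_0; exact Ht).
  assert (S : forall a, 0 < a -> r <= d0 / a -> a * r / 2 <= Cmod (csinh (RtoC a * t))%C).
  { intros a Ha Hra.
    assert (E : Cmod (RtoC a * t)%C = a * r) by (rewrite Cmod_mult, Cmod_R, Rabs_pos_eq by lra; reflexivity).
    rewrite <- E. apply H0. rewrite E.
    apply (Rmult_le_compat_l a) in Hra; [|lra].
    replace (a * (d0 / a)) with d0 in Hra by (field; lra). exact Hra. }
  pose proof (S p Hp M2) as Sp. pose proof (S q Hq M3) as Sq.
  assert (HpC : RtoC p <> 0%C) by (apply RtoC_neq_0; lra).
  assert (HqC : RtoC q <> 0%C) by (apply RtoC_neq_0; lra).
  assert (Hsp : csinh (RtoC p * t)%C <> 0%C) by (apply Cmod_gt_0; nra).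
  assert (Hsq : csinh (RtoC q * t)%C <> 0%C) by (apply Cmod_gt_0; nra).
  set (den := (RtoC p * RtoC q * (t * t * t) * (csinh (p * t) * csinh (q * t)))%C).
  assert (Hden : den <> 0%C)
    by (unfold den; exact (Cmult_neq_0 _ _ (Cmult_neq_0 _ _ (Cmult_neq_0 _ _ HpC HqC)
      (Cmult_neq_0 _ _ (Cmult_neq_0 _ _ Ht Ht) Ht)) (Cmult_neq_0 _ _ Hsp Hsq))).
  specialize (H t M1). fold r in H.
  set (num := (p * q * (t * t) * cexp (2 * Ci * z * t)
     - csinh (p * t) * csinh (q * t)
         * (1 + 2 * Ci * z * t + p * q * laurent_c p q z * (t * t)))%C) in *.
  assert (E : gamN p q z t = (num / den)%C).
  { unfold gamN, num, den. replace (2 * Ci * t * z)%C with (2 * Ci * z * t)%C by ring.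
    field. auto. }
  rewrite E, Cmod_div by exact Hden.
  assert (Hdl : p * p * (q * q) / 4 * r ^ 5 <= Cmod den).
  { unfold den. rewrite !Cmod_mult, !Cmod_R, !(Rabs_pos_eq p), !(Rabs_pos_eq q) by lra. fold r.
    assert (Q : (p * r / 2) * (q * r / 2) <= Cmod (csinh (p * t))%C * Cmod (csinh (q * t))%C)
      by (apply Rmult_le_compat; nra).
    replace (p * p * (q * q) / 4 * r ^ 5) with (p * q * (r * r * r) * (p * r / 2 * (q * r / 2))) by field.
    apply Rmult_le_compat_l; [|exact Q]. repeat apply Rmult_le_pos; lra. }
  assert (Hr5 : 0 < r ^ 5) by (apply pow_lt; exact Hr).
  assert (Hdp : 0 < Cmod den) by (apply Cmod_gt_0; exact Hden).
  apply (Rmult_le_reg_r (Cmod den)); [exact Hdp|].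
  replace (Cmod num / Cmod den * Cmod den) with (Cmod num) by (field; lra).
  eapply Rle_trans; [exact H|].
  replace (K * r ^ 5) with (4 * K / (p * p * (q * q)) * (p * p * (q * q) / 4 * r ^ 5)) by (field; lra).
  apply Rmult_le_compat_l; [|exact Hdl].
  apply Rmult_le_pos; [lra|]. left; apply Rinv_0_lt_compat; exact Hpq.
Qed.

Lemma gamN_neq p q x y : 0 < p -> 0 < q -> 0 <= y <= kap p q -> (x, y) <> RtoC 0 ->
  csinh (RtoC p * (x, y))%C <> 0%C /\ csinh (RtoC q * (x, y))%C <> 0%C.
Proof.
  intros Hp Hq Hy Hn.
  pose proof (kap_lt_l p q Hp Hq). pose proof (kap_lt_r p q Hp Hq).
  assert (Hc : x <> 0 \/ 0 < y).
  { destruct (Req_dec x 0) as [->|Hx]; [|left; exact Hx]. right.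
    destruct (Req_dec y 0) as [->|Hy0]; [|lra]. exfalso. apply Hn. reflexivity. }
  split; apply csinh_lin_neq_0; try assumption; destruct Hc as [Hc|Hc]; try (left; exact Hc);
    right; (split; [apply Rmult_lt_0_compat; assumption|]).
  - apply Rle_lt_trans with (p * kap p q); [apply Rmult_le_compat_l; lra|assumption].
  - apply Rle_lt_trans with (q * kap p q); [apply Rmult_le_compat_l; lra|assumption].
Qed.

Lemma holo_gamN p q z x y : 0 < p -> 0 < q -> 0 <= y <= kap p q -> (x, y) <> RtoC 0 ->
  holo (gamN p q z) (x, y).
Proof.
  intros Hp Hq Hy Hn. destruct (gamN_neq p q x y Hp Hq Hy Hn) as [H1 H2].
  unfold gamN.
  assert (Hi : holo (fun t => / t)%C (x, y)) by (apply (holo_inv (fun t => t)); [apply holo_id|exact Hn]).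
  assert (Hpi : holo (fun t => / csinh (RtoC p * t))%C (x, y))
    by (apply holo_inv; [apply holo_csinh_lin|exact H1]).
  assert (Hqi : holo (fun t => / csinh (RtoC q * t))%C (x, y))
    by (apply holo_inv; [apply holo_csinh_lin|exact H2]).
  holo_auto. apply Cmult_neq_0; exact Hn.
Qed.

(** The exponential is compensated by the two hyperbolic sines; what remains is
    of the size of laurent_c / t. *)
Lemma gamN_bounded_far p q z : 0 < p -> 0 < q -> Rabs (Im z) < (p + q) / 2 ->
  exists K X, 0 <= K /\ 1 <= X /\ forall x y, X <= Rabs x -> 0 <= y <= kap p q ->
    Cmod (gamN p q z (x, y)) <= K / Rabs x.
Proof.
  intros Hp Hq Hz.
  set (K0 := exp (2 * kap p q * Rabs (Re z)) * (4 * 4)).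
  set (K1 := Cmod (/ (RtoC p * RtoC q))%C). set (K2 := Cmod (2 * Ci * z / (RtoC p * RtoC q))%C).
  set (K3 := Cmod (laurent_c p q z)).
  assert (P0 : 0 <= K0) by (unfold K0; pose proof (exp_pos (2 * kap p q * Rabs (Re z))); lra).
  assert (P1 : 0 <= K1) by apply Cmod_ge_0. assert (P2 : 0 <= K2) by apply Cmod_ge_0.
  assert (P3 : 0 <= K3) by apply Cmod_ge_0.
  exists (K0 + K1 * 1 + K2 * 1 + K3), (Rmax 1 (Rmax (/ p) (/ q))).
  split; [lra|]. split; [apply Rmax_l|].
  intros x y Hx Hy.
  assert (X1 : 1 <= Rabs x) by (eapply Rle_trans; [apply Rmax_l|exact Hx]).
  assert (X2 : / p <= Rabs x).
  { eapply Rle_trans; [|exact Hx]. eapply Rle_trans; [apply (Rmax_l (/ p) (/ q))|apply Rmax_r]. }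
  assert (X3 : / q <= Rabs x).
  { eapply Rle_trans; [|exact Hx]. eapply Rle_trans; [apply (Rmax_r (/ p) (/ q))|apply Rmax_r]. }
  set (t := (x, y) : C).
  assert (Ht1 : Rabs x <= Cmod t) by (apply (re_le_Cmod t)).
  assert (Ht0 : t <> 0%C) by (apply Cmod_gt_0; lra).
  assert (Hit : Cmod (/ t)%C <= / Rabs x).
  { rewrite Cmod_inv by exact Ht0. apply Rinv_le_contravar; lra. }
  assert (Hix : / Rabs x <= 1) by (rewrite <- Rinv_1; apply Rinv_le_contravar; lra).
  assert (S : forall a, 0 < a -> / a <= Rabs x -> Cmod (/ csinh (RtoC a * t))%C <= 4 * exp (- a * Rabs x)).
  { intros a Ha Hax.
    assert (Hax1 : 1 <= a * Rabs x).
    { apply (Rmult_le_compat_l a) in Hax; [|lra]. rewrite Rinv_r in Hax by lra. exact Hax. }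
    pose proof (csinh_lower_lin a x y Ha Hax1) as B. fold t in B.
    pose proof (exp_pos (a * Rabs x)).
    rewrite Cmod_inv by (apply Cmod_gt_0; lra).
    eapply Rle_trans; [apply Rinv_le_contravar; [|exact B]; lra|].
    replace (- a * Rabs x) with (- (a * Rabs x)) by ring. rewrite exp_Ropp. right. field. lra. }
  assert (HE : Cmod (cexp (2 * Ci * t * z) * (/ csinh (RtoC p * t) * / csinh (RtoC q * t)))%C <= K0).
  { assert (E1 : Cmod (cexp (2 * Ci * t * z))%C
        <= exp (2 * kap p q * Rabs (Re z)) * exp ((p + q) * Rabs x)).
    { unfold t. rewrite Cmod_cexp_kernel.
      apply Rmult_le_compat; try (left; apply exp_pos); apply exp_le_mono.
      - pose proof (Rle_abs (- Re z)) as A. rewrite Rabs_Ropp in A. pose proof (Rabs_pos (Re z)).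
        assert (y * - Re z <= y * Rabs (Re z)) by (apply Rmult_le_compat_l; lra).
        assert (y * Rabs (Re z) <= kap p q * Rabs (Re z)) by (apply Rmult_le_compat_r; lra). lra.
      - pose proof (Rle_abs (- (x * Im z))) as A. rewrite Rabs_Ropp, Rabs_mult in A.
        pose proof (Rabs_pos x).
        assert (Rabs x * Rabs (Im z) <= Rabs x * ((p + q) / 2)) by (apply Rmult_le_compat_l; lra). lra. }
    eapply Rle_trans; [apply Cmod_mult_le; [exact E1|apply Cmod_mult_le; apply S; assumption]|].
    right. unfold K0.
    replace (exp (2 * kap p q * Rabs (Re z)) * exp ((p + q) * Rabs x) *
       (4 * exp (- p * Rabs x) * (4 * exp (- q * Rabs x))))
      with (exp (2 * kap p q * Rabs (Re z)) * (4 * 4) *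
        (exp ((p + q) * Rabs x) * (exp (- p * Rabs x) * exp (- q * Rabs x)))) by ring.
    rewrite <- !exp_plus.
    replace ((p + q) * Rabs x + (- p * Rabs x + - q * Rabs x)) with 0 by ring.
    rewrite exp_0. ring. }
  unfold gamN. fold t. unfold Rdiv. apply Cmod_mult_le; [|exact Hit].
  eapply Rle_trans; [apply Cmod_triangle_minus|]. apply Rplus_le_compat; [|apply Rle_refl].
  eapply Rle_trans; [apply Cmod_triangle_minus|]. apply Rplus_le_compat.
  - eapply Rle_trans; [apply Cmod_triangle_minus|]. apply Rplus_le_compat; [exact HE|].
    apply Cmod_mult_le; [apply Rle_refl|].
    rewrite Cmod_inv, Cmod_mult by (apply Cmult_neq_0; exact Ht0).
    rewrite <- Rinv_1. apply Rinv_le_contravar; [lra|]. nra.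
  - apply Cmod_mult_le; [apply Rle_refl|]. lra.
Qed.

Lemma gamN_sym p q z t : 0 < p -> 0 < q -> t <> 0 ->
  (gamN p q z (RtoC t) + gamN p q z (RtoC (- t)))%C = (4 * Ci * hg_integrand p q z t)%C.
Proof.
  intros Hp Hq Ht.
  assert (HpC : RtoC p <> 0%C) by (apply RtoC_neq_0; lra).
  assert (HqC : RtoC q <> 0%C) by (apply RtoC_neq_0; lra).
  assert (HtC : RtoC t <> 0%C) by (apply RtoC_neq_0; lra).
  assert (Hsp : csinh (RtoC p * RtoC t)%C <> 0%C) by (apply (csinh_lin_neq_0 p t 0); [exact Hp|left; exact Ht]).
  assert (Hsq : csinh (RtoC q * RtoC t)%C <> 0%C) by (apply (csinh_lin_neq_0 q t 0); [exact Hq|left; exact Ht]).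
  unfold gamN, hg_integrand.
  rewrite <- !csinh_R, !RtoC_mult, !RtoC_opp.
  replace (RtoC p * - RtoC t)%C with (- (RtoC p * RtoC t))%C by ring.
  replace (RtoC q * - RtoC t)%C with (- (RtoC q * RtoC t))%C by ring.
  rewrite !csinh_opp.
  set (S := csinh (RtoC p * RtoC t)%C) in *. set (S' := csinh (RtoC q * RtoC t)%C) in *.
  unfold csin.
  replace (2 * Ci * - RtoC t * z)%C with (- (Ci * (2 * t * z)))%C by ring.
  replace (2 * Ci * RtoC t * z)%C with (Ci * (2 * t * z))%C by ring.
  pose proof Ci_neq_0. field. repeat split; assumption.
Qed.

(** The rectangle [-n, n] x [0, k] is indented around 0 by the square
    [-e, e] x [0, e]. *)
Lemma indented_contour f k e n : 0 < e -> e < k -> e < n ->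
  (forall x y, 0 <= y <= k -> (x, y) <> RtoC 0 -> holo f (x, y)) ->
  (hint f (- n) (- e) 0 + hint f e n 0)%C =
  ((hint f (- n) n k + Ci * vint f (- n) 0 k - Ci * vint f n 0 k)
   - (hint f (- e) e e + Ci * vint f (- e) 0 e - Ci * vint f e 0 e))%C.
Proof.
  intros He Hek Hen Hf.
  assert (Hx : forall x y, x <> 0 -> (x, y) <> RtoC 0)
    by (intros x y Hx E; apply (f_equal Re) in E; simpl in E; lra).
  assert (Hy : forall x y, y <> 0 -> (x, y) <> RtoC 0) by (intros; apply pair_neq_0; assumption).
  assert (R1 : rect f (- n) (- e) 0 k = 0%C).
  { apply goursat; [lra|lra|]. intros x y H1 H2. apply Hf; [lra|apply Hx; lra]. }
  assert (R2 : rect f (- e) e e k = 0%C).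
  { apply goursat; [lra|lra|]. intros x y H1 H2. apply Hf; [lra|apply Hy; lra]. }
  assert (R3 : rect f e n 0 k = 0%C).
  { apply goursat; [lra|lra|]. intros x y H1 H2. apply Hf; [lra|apply Hx; lra]. }
  unfold rect in R1, R2, R3.
  rewrite (hint_Chasles f (- n) (- e) n k), (hint_Chasles f (- e) e n k);
    try lra; try (intros; apply holo_ccont, Hf; [lra|apply Hy; lra]).
  rewrite (vint_Chasles f e 0 e k) in R3;
    try lra; try (intros; apply holo_ccont, Hf; [lra|apply Hx; lra]).
  rewrite (vint_Chasles f (- e) 0 e k) in R1;
    try lra; try (intros; apply holo_ccont, Hf; [lra|apply Hx; lra]).
  assert (E : forall a b : C, (a - b)%C = 0%C -> a = b).
  { intros a b H. replace a with (a - b + b)%C by ring. rewrite H. ring. }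
  apply E.
  match goal with |- ?X = _ => transitivity
    ((hint f (- n) (- e) 0 + Ci * (vint f (- e) 0 e + vint f (- e) e k) -
      hint f (- n) (- e) k - Ci * vint f (- n) 0 k)
    + (hint f (- e) e e + Ci * vint f e e k - hint f (- e) e k - Ci * vint f (- e) e k)
    + (hint f e n 0 + Ci * vint f n 0 k - hint f e n k - Ci * (vint f e 0 e + vint f e e k)))%C
  end; [ring|].
  rewrite R1, R2, R3. ring.
Qed.

Lemma atan_lim c : 0 < c -> forall n, 0 < n -> Rabs (PI / 2 - atan (n / c)) <= c / n.
Proof.
  intros Hc n Hn.
  assert (Hp : 0 < n / c) by (apply Rdiv_lt_0_compat; assumption).
  rewrite <- atan_inv by exact Hp. replace (/ (n / c)) with (c / n) by (field; lra).
  assert (Hcn : 0 < c / n) by (apply Rdiv_lt_0_compat; assumption).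
  pose proof (bounded_variation atan (fun x => / (1 + Rsqr x)) 1 0 (c / n)) as B.
  rewrite atan_0, !Rminus_0_r, (Rabs_pos_eq (c / n)) in B by lra.
  rewrite Rmult_1_l in B. apply B. intros t _. split; [apply is_derive_atan|].
  pose proof (Rle_0_sqr t). rewrite Rabs_pos_eq by (left; apply Rinv_0_lt_compat; lra).
  rewrite <- Rinv_1. apply Rinv_le_contravar; lra.
Qed.

Lemma hint_inv c n : 0 < c -> 0 < n ->
  hint (fun t => / t)%C (- n) n c = (- (2 * Ci * atan (n / c)))%C.
Proof.
  intros Hc Hn. apply is_CRI_unique.
  assert (Hp2 : forall t : R, 0 < t * (t * 1) + c * (c * 1)) by (intros t; nra).
  apply (is_CRI_ext (fun t => (t / (t ^ 2 + c ^ 2), - c / (t ^ 2 + c ^ 2)) : C)); [lra| |].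
  { intros t _. reflexivity. }
  replace (- (2 * Ci * atan (n / c)))%C with ((0, - (2 * atan (n / c))) : C)
    by (apply C_eq; simpl; ring).
  apply (is_RInt_fct_extend_pair (U := R_NormedModule) (V := R_NormedModule)); simpl.
  - replace 0 with (minus (/ 2 * ln (n ^ 2 + c ^ 2)) (/ 2 * ln ((- n) ^ 2 + c ^ 2))).
    + apply (is_RInt_derive (fun t => / 2 * ln (t ^ 2 + c ^ 2))).
      * intros t _. auto_derive; [apply Hp2|]. field. specialize (Hp2 t); lra.
      * intros t _. apply (ex_derive_continuous (V := R_NormedModule)).
        auto_derive. specialize (Hp2 t); lra.
    + unfold minus, plus, opp; simpl. replace (- n * (- n * 1)) with (n * (n * 1)) by ring. ring.
  - replace (- (2 * atan (n / c))) with (minus (- atan (n / c)) (- atan (- n / c))).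
    + apply (is_RInt_derive (fun t => - atan (t / c))).
      * intros t _. auto_derive; [lra|]. field. specialize (Hp2 t); split; lra.
      * intros t _. apply (ex_derive_continuous (V := R_NormedModule)).
        auto_derive. specialize (Hp2 t); lra.
    + replace (- n / c) with (- (n / c)) by (field; lra).
      rewrite atan_opp. unfold minus, plus, opp; simpl. ring.
Qed.

Lemma Cmod_pair_ge x y : Rabs x <= Cmod (x, y).
Proof. exact (re_le_Cmod (x, y)). Qed.

Lemma hint_inv2 c n : 0 < c -> 1 <= n ->
  Cmod (hint (fun t => / (t * t))%C (- n) n c) <= 2 / n.
Proof.
  intros Hc Hn.
  assert (H0 : forall x, (x, c) <> RtoC 0) by (intros; apply pair_neq_0; lra).
  rewrite (hint_primitive (fun t => - / t)%C (fun t => / (t * t))%C).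
  - assert (B : forall x, Rabs x = n -> Cmod (- / (x, c))%C <= / n).
    { intros x Hx. rewrite Cmod_opp, Cmod_inv by apply H0.
      pose proof (Cmod_pair_ge x c). apply Rinv_le_contravar; lra. }
    cbv beta. eapply Rle_trans; [apply Cmod_triangle_minus|].
    pose proof (B n (Rabs_pos_eq n ltac:(lra))).
    pose proof (B (- n) ltac:(rewrite Rabs_Ropp; apply Rabs_pos_eq; lra)). unfold Rdiv. lra.
  - lra.
  - intros x _. eapply cder_eq; [apply cder_opp, cder_inv, H0|]. ring.
  - intros x _. apply holo_ccont. holo_auto. apply Cmult_neq_0; apply H0.
Qed.

Lemma hint_inv3 c n : 0 < c -> 1 <= n ->
  Cmod (hint (fun t => / (t * t) * / t)%C (- n) n c) <= 1 / n.
Proof.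
  intros Hc Hn.
  assert (H0 : forall x, (x, c) <> RtoC 0) by (intros; apply pair_neq_0; lra).
  rewrite (hint_primitive (fun t => (- / 2) * / (t * t))%C (fun t => / (t * t) * / t)%C).
  - assert (B : forall x, Rabs x = n -> Cmod ((- / 2) * / ((x, c) * (x, c)))%C <= / 2 * (/ n * 1)).
    { intros x Hx. apply Cmod_mult_le.
      - rewrite Cmod_opp, Cmod_inv, Cmod_R, Rabs_pos_eq by (try apply two_neq; lra). lra.
      - pose proof (Cmod_pair_ge x c). assert (n <= Cmod (x, c)) by lra.
        rewrite Cmod_inv, Cmod_mult by (apply Cmult_neq_0; apply H0).
        rewrite Rinv_mult. apply Rmult_le_compat; try (left; apply Rinv_0_lt_compat; lra).
        + apply Rinv_le_contravar; lra.
        + rewrite <- Rinv_1. apply Rinv_le_contravar; lra. }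
    cbv beta. eapply Rle_trans; [apply Cmod_triangle_minus|].
    pose proof (B n (Rabs_pos_eq n ltac:(lra))).
    pose proof (B (- n) ltac:(rewrite Rabs_Ropp; apply Rabs_pos_eq; lra)). unfold Rdiv. lra.
  - lra.
  - intros x _. eapply cder_eq.
    + apply cder_scal_l. apply (cder_Cinv (fun t => t * t)%C).
      * apply cder_mult; apply cder_id.
      * apply Cmult_neq_0; apply H0.
    + cbv beta. field. apply H0.
  - intros x _. apply holo_ccont. apply holo_mult.
    + apply holo_inv; [holo_auto|]. apply Cmult_neq_0; apply H0.
    + apply (holo_inv (fun t => t)); [apply holo_id|apply H0].
Qed.

(** Of the subtracted terms only laurent_c / t has a nonzero integral in the
    limit, namely - i pi laurent_c. *)
Lemma hint_gamN_lim p q z : 0 < p -> 0 < q -> Rabs (Im z) < (p + q) / 2 ->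
  exists K m, 0 <= K /\ 0 < m /\ forall n, 1 <= n ->
    Cmod (hint (gamN p q z) (- n) n (kap p q)
          - (gamT p q z + Ci * PI * laurent_c p q z))%C <= K * (exp (- m * n) + / n).
Proof.
  intros Hp Hq Hz. pose proof (kap_pos p q Hp Hq) as Hk.
  set (k := kap p q) in *.
  pose proof (W_ldom _ _ _ _ _ (kernel_gamq p q Hp Hq) ltac:(left; exact Hk) Hz) as D.
  fold k in D.
  set (f0 := fun t => (gamq p q t * cexp (2 * Ci * t * z))%C) in *.
  set (M := gamQ p q * exp (-2 * k * Re z)) in *. set (m := p + q - 2 * Rabs (Im z)) in *.
  assert (Hm : 0 < m) by (unfold m; lra).
  set (c1 := (/ (RtoC p * RtoC q))%C). set (c2 := (2 * Ci * z / (RtoC p * RtoC q))%C).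
  set (c3 := laurent_c p q z).
  set (K0 := Rabs (2 * (M / m))).
  exists (K0 + Cmod c1 * 1 + Cmod c2 * 2 + Cmod c3 * (2 * k)), m.
  pose proof (Cmod_ge_0 c1) as P1. pose proof (Cmod_ge_0 c2) as P2. pose proof (Cmod_ge_0 c3) as P3.
  assert (P0 : 0 <= K0) by apply Rabs_pos.
  split. { assert (0 <= Cmod c3 * (2 * k)) by (apply Rmult_le_pos; lra). lra. }
  split; [exact Hm|].
  intros n Hn.
  assert (H0 : forall x, (x, k) <> RtoC 0) by (intros; apply pair_neq_0; lra).
  set (f1 := fun t : C => (/ (t * t) * / t)%C). set (f2 := fun t : C => (/ (t * t))%C).
  set (f3 := fun t : C => (/ t)%C).
  assert (C0 : forall x, ccont f0 (x, k)) by (intros x; apply (proj2 D)).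
  assert (C3 : forall x, ccont f3 (x, k)).
  { intros x. apply holo_ccont. apply (holo_inv (fun t => t)); [apply holo_id|apply H0]. }
  assert (C2 : forall x, ccont f2 (x, k)).
  { intros x. apply holo_ccont. unfold f2. holo_auto. apply Cmult_neq_0; apply H0. }
  assert (C1 : forall x, ccont f1 (x, k)).
  { intros x. apply cont_mult; [apply C2|apply C3]. }
  assert (E : hint (gamN p q z) (- n) n k
     = (hint f0 (- n) n k - c1 * hint f1 (- n) n k - c2 * hint f2 (- n) n k - c3 * hint f3 (- n) n k)%C).
  { assert (Cs : forall (g : C -> C) c, (forall x, ccont g (x, k)) -> forall x, ccont (fun t => c * g t)%C (x, k)).
    { intros g c Hg x. apply cont_mult; [apply cont_const|apply Hg]. }
    unfold hint.
    rewrite <- (CRI_scal c1 (fun t => f1 (t, k))) by (try lra; intros; apply rcont_h, C1).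
    rewrite <- (CRI_scal c2 (fun t => f2 (t, k))) by (try lra; intros; apply rcont_h, C2).
    rewrite <- (CRI_scal c3 (fun t => f3 (t, k))) by (try lra; intros; apply rcont_h, C3).
    rewrite <- (CRI_minus (fun t => f0 (t, k)) (fun t => c1 * f1 (t, k))%C);
      [|lra|intros; apply rcont_h, C0|intros; apply (rcont_h (fun t => c1 * f1 t)%C), (Cs f1 c1 C1)].
    rewrite <- (CRI_minus (fun t => f0 (t, k) - c1 * f1 (t, k))%C (fun t => c2 * f2 (t, k))%C);
      [|lra| |intros; apply (rcont_h (fun t => c2 * f2 t)%C), (Cs f2 c2 C2)].
    2: { intros. apply (rcont_h (fun t => f0 t - c1 * f1 t)%C). apply cont_minus; [apply C0|apply (Cs f1 c1 C1)]. }
    rewrite <- (CRI_minus (fun t => f0 (t, k) - c1 * f1 (t, k) - c2 * f2 (t, k))%C (fun t => c3 * f3 (t, k))%C);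
      [|lra| |intros; apply (rcont_h (fun t => c3 * f3 t)%C), (Cs f3 c3 C3)].
    2: { intros. apply (rcont_h (fun t => f0 t - c1 * f1 t - c2 * f2 t)%C).
         apply cont_minus; [apply cont_minus; [apply C0|apply (Cs f1 c1 C1)]|apply (Cs f2 c2 C2)]. }
    apply CRI_ext; [lra|]. intros t _.
    destruct (gamN_neq p q t k Hp Hq ltac:(fold k; lra) (H0 t)) as [S1 S2].
    unfold gamN, f0, f1, f2, f3, gamq, c1, c2, c3. field.
    repeat split; try assumption; try apply H0; apply RtoC_neq_0; lra. }
  rewrite E. unfold f3 at 1. rewrite (hint_inv k n Hk ltac:(lra)).
  pose proof (LI_lim f0 k M m n D ltac:(lra)) as A0.
  pose proof (hint_inv3 k n Hk Hn) as A1. fold f1 in A1.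
  pose proof (hint_inv2 k n Hk Hn) as A2. fold f2 in A2.
  pose proof (atan_lim k Hk n ltac:(lra)) as A3.
  change (gamT p q z) with (LI f0 k).
  replace (hint f0 (- n) n k - c1 * hint f1 (- n) n k - c2 * hint f2 (- n) n k -
     c3 * - (2 * Ci * atan (n / k)) - (LI f0 k + Ci * PI * c3))%C
    with (- (LI f0 k - hint f0 (- n) n k) + (- (c1 * hint f1 (- n) n k) + (- (c2 * hint f2 (- n) n k)
      + - (c3 * (2 * Ci * RtoC (PI / 2 - atan (n / k)))))))%C.
  2: { rewrite RtoC_minus, RtoC_div by lra. field. }
  eapply Rle_trans; [apply Cmod_triangle|].
  eapply Rle_trans; [apply Rplus_le_compat_l, Cmod_triangle|].
  eapply Rle_trans; [apply Rplus_le_compat_l, Rplus_le_compat_l, Cmod_triangle|].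
  rewrite !Cmod_opp, !Cmod_mult, Cmod_Ci, !Cmod_R, (Rabs_pos_eq 2) by lra.
  pose proof (exp_pos (- m * n)) as Hexp. assert (Hin : 0 < / n) by (apply Rinv_0_lt_compat; lra).
  assert (B0 : 2 * (M / m) * exp (- m * n) <= K0 * exp (- m * n))
    by (apply Rmult_le_compat_r; [lra|apply Rle_abs]).
  unfold Rdiv in A1, A2, A3.
  assert (B1 : Cmod c1 * Cmod (hint f1 (- n) n k) <= Cmod c1 * (1 * / n))
    by (apply Rmult_le_compat_l; lra).
  assert (B2 : Cmod c2 * Cmod (hint f2 (- n) n k) <= Cmod c2 * (2 * / n))
    by (apply Rmult_le_compat_l; lra).
  assert (B3 : Cmod c3 * (2 * 1 * Rabs (PI / 2 - atan (n / k))) <= Cmod c3 * (2 * (k * / n)))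
    by (apply Rmult_le_compat_l; unfold Rdiv; lra).
  assert (0 <= K0 * / n) by (apply Rmult_le_pos; lra).
  assert (0 <= Cmod c1 * exp (- m * n)) by (apply Rmult_le_pos; lra).
  assert (0 <= Cmod c2 * exp (- m * n)) by (apply Rmult_le_pos; lra).
  assert (0 <= Cmod c3 * (2 * k) * exp (- m * n))
    by (apply Rmult_le_pos; [apply Rmult_le_pos|]; lra).
  lra.
Qed.

Lemma is_RInt_gen_eps (f : R -> C) (l : C) :
  (forall a b, 0 < a -> a <= b -> forall t, a <= t <= b -> rcont f t) ->
  (forall eps, 0 < eps -> exists d N, 0 < d /\ forall a b, 0 < a -> a < d -> N < b -> a <= b ->
     Cmod (CRI f a b - l)%C < eps) ->
  is_RInt_gen (V := C_R_CompleteNormedModule) f (at_right 0) (Rbar_locally p_infty) l.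
Proof.
  intros Hc H P HP. apply locally_Cmod in HP. destruct HP as [eps [He HP]].
  destruct (H eps He) as [d [N [Hd K]]].
  apply (Filter_prod _ _ _ (fun a => 0 < a /\ a < Rmin d 1) (fun b => Rmax N 1 < b)).
  - exists (mkposreal (Rmin d 1) ltac:(apply Rmin_pos; lra)). intros a Ha Ha0. split; [exact Ha0|].
    change (Rabs (a - 0) < Rmin d 1) in Ha. rewrite Rminus_0_r, Rabs_pos_eq in Ha by lra. exact Ha.
  - exists (Rmax N 1). intros b Hb. exact Hb.
  - intros a b [Ha1 Ha2] Hb. exists (CRI f a b).
    pose proof (Rmin_l d 1). pose proof (Rmin_r d 1). pose proof (Rmax_l N 1). pose proof (Rmax_r N 1).
    simpl. split.
    + apply CRI_correct; [lra|]. apply Hc; lra.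
    + apply HP. apply K; lra.
Qed.

Lemma four_Ci_neq : (4 * Ci)%C <> 0%C.
Proof. apply Cmult_neq_0; [apply RtoC_neq_0; lra|apply Ci_neq_0]. Qed.

(** The real segments [- n, - e] and [e, n] are moved to height kap. The detour
    around 0 is short and gamN is bounded there; the vertical sides at - n and n
    vanish in the limit by gamN_bounded_far. *)
Theorem hg_integral p q z : 0 < p -> 0 < q -> Rabs (Im z) < (p + q) / 2 ->
  is_RInt_gen (V := C_R_CompleteNormedModule) (hg_integrand p q z) (at_right 0)
    (Rbar_locally p_infty) ((gamT p q z + Ci * PI * laurent_c p q z) / (4 * Ci))%C.
Proof.
  intros Hp Hq Hz. pose proof (kap_pos p q Hp Hq) as Hk. set (k := kap p q) in *.
  set (L := (gamT p q z + Ci * PI * laurent_c p q z)%C).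
  set (N := gamN p q z).
  assert (HN : forall x y, 0 <= y <= k -> (x, y) <> RtoC 0 -> holo N (x, y))
    by (intros; apply holo_gamN; assumption).
  assert (HNr : forall t, t <> 0 -> rcont (fun s => N (s, 0)) t).
  { intros t Ht. apply rcont_h, holo_ccont, HN; [lra|].
    intros E. apply (f_equal Re) in E. simpl in E. lra. }
  assert (Hsym : forall t, t <> 0 ->
     hg_integrand p q z t = (/ (4 * Ci) * (N (t, 0) + N ((- t)%R, 0)))%C).
  { intros t Ht. change (N (t, 0)) with (N (RtoC t)). change (N (- t, 0)) with (N (RtoC (- t))).
    unfold N. rewrite gamN_sym by assumption. field. apply Ci_neq_0. }
  assert (HNl : forall t, t <> 0 -> rcont (fun s => N (- s, 0)) t).
  { intros t Ht. apply (continuous_comp (fun s : R => - s) (fun s => N (s, 0))).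
    - apply (continuous_opp (V := R_NormedModule)). apply continuous_id.
    - apply HNr. lra. }
  assert (Hcont : forall t, 0 < t -> rcont (hg_integrand p q z) t).
  { intros t Ht. unfold rcont.
    apply (continuous_ext_loc _ (fun t => / (4 * Ci) * (N (t, 0%R) + N ((- t)%R, 0%R)))%C).
    - exists (mkposreal t Ht). intros s Hs. change (Rabs (s - t) < t) in Hs.
      symmetry. apply Hsym. apply Rabs_def2 in Hs. lra.
    - apply cont_mult; [apply cont_const|]. apply cont_plus; [apply HNr; lra|apply HNl; lra]. }
  assert (Hint : forall e n, 0 < e -> e <= n ->
     CRI (hg_integrand p q z) e n = (/ (4 * Ci) * (hint N (- n) (- e) 0 + hint N e n 0))%C).
  { intros e n He Hen.
    rewrite (CRI_ext _ (fun t => / (4 * Ci) * (N (t, 0%R) + N ((- t)%R, 0%R)))%C) by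
      (try exact Hen; intros; apply Hsym; lra).
    rewrite (CRI_scal (/ (4 * Ci))%C (fun t => N (t, 0%R) + N ((- t)%R, 0%R))%C);
      [|exact Hen|intros; apply cont_plus; [apply HNr; lra|apply HNl; lra]].
    rewrite (CRI_plus (fun t => N (t, 0%R)) (fun t => N ((- t)%R, 0%R)));
      [|exact Hen|intros; apply HNr; lra|intros; apply HNl; lra].
    rewrite (CRI_neg (fun t => N (t, 0%R)) e n Hen) by (intros; apply HNr; lra).
    unfold hint. ring. }
  apply is_RInt_gen_eps.
  { intros a b Ha Hab t Ht. apply Hcont; lra. }
  intros eps He.
  destruct (gamN_bounded_0 p q z Hp Hq) as [K0 [d0 [HK0 [Hd0 H0]]]].
  destruct (gamN_bounded_far p q z Hp Hq Hz) as [K1 [X1 [HK1 [HX1 H1]]]].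
  destruct (hint_gamN_lim p q z Hp Hq Hz) as [K2 [m [HK2 [Hm H2]]]].
  fold N in H0, H1, H2. fold k in H1, H2. fold L in H2.
  destruct (exp_decay_shift m K2 (eps / 4) Hm ltac:(lra)) as [X2 HX2].
  set (d := Rmin (Rmin k 1) (Rmin (d0 / 3) (eps / (4 * (4 * K0 + 1))))).
  set (Nn := Rmax (Rmax X1 X2) ((K2 + 2 * K1 * k + 1) * (4 / eps))).
  assert (Hd : 0 < d).
  { repeat apply Rmin_pos; try lra. apply Rdiv_lt_0_compat; lra. }
  exists d, Nn. split; [exact Hd|].
  intros e n He0 Hed HnN Hen.
  assert (D1 : d <= k) by (eapply Rle_trans; apply Rmin_l).
  assert (D2 : d <= 1) by (eapply Rle_trans; [apply Rmin_l|apply Rmin_r]).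
  assert (D3 : d <= d0 / 3) by (eapply Rle_trans; [apply Rmin_r|apply Rmin_l]).
  assert (D4 : d <= eps / (4 * (4 * K0 + 1))) by (eapply Rle_trans; [apply Rmin_r|apply Rmin_r]).
  assert (N1 : X1 <= Nn) by (eapply Rle_trans; [apply (Rmax_l X1 X2)|apply Rmax_l]).
  assert (N2 : X2 <= Nn) by (eapply Rle_trans; [apply (Rmax_r X1 X2)|apply Rmax_l]).
  assert (N3 : (K2 + 2 * K1 * k + 1) * (4 / eps) <= Nn) by apply Rmax_r.
  rewrite (Hint e n He0 Hen).
  rewrite (indented_contour N k e n He0 ltac:(lra) ltac:(lra) HN).
  set (B1 := hint N (- n) n k) in *. set (V1 := vint N (- n) 0 k). set (V2 := vint N n 0 k).
  set (S := (hint N (- e) e e + Ci * vint N (- e) 0 e - Ci * vint N e 0 e)%C).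
  assert (HS : Cmod S <= 4 * K0 * e).
  { assert (Q : forall x y, (x, y) <> RtoC 0 -> Rabs x <= e -> Rabs y <= e -> Cmod (N (x, y)) <= K0).
    { intros x y Hn Hx Hy. apply H0; [exact Hn|].
      eapply Rle_trans; [apply Cmod_le_re_im|]. simpl. lra. }
    assert (Q1 : forall x y, x <> 0 -> (x, y) <> RtoC 0)
      by (intros x y Hx E; apply (f_equal Re) in E; simpl in E; lra).
    assert (S1 : Cmod (hint N (- e) e e) <= K0 * (e - - e)).
    { apply hint_bound; [lra| |].
      - intros x Hx. apply holo_ccont, HN; [lra|apply pair_neq_0; lra].
      - intros x Hx. apply Q; [apply pair_neq_0; lra|apply Rabs_le; lra|rewrite Rabs_pos_eq; lra]. }
    assert (S2 : Cmod (vint N (- e) 0 e) <= K0 * (e - 0)).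
    { apply vint_bound; [lra| |].
      - intros y Hy. apply holo_ccont, HN; [lra|apply Q1; lra].
      - intros y Hy. apply Q; [apply Q1; lra|rewrite Rabs_Ropp, Rabs_pos_eq; lra|rewrite Rabs_pos_eq; lra]. }
    assert (S3 : Cmod (vint N e 0 e) <= K0 * (e - 0)).
    { apply vint_bound; [lra| |].
      - intros y Hy. apply holo_ccont, HN; [lra|apply Q1; lra].
      - intros y Hy. apply Q; [apply Q1; lra|rewrite Rabs_pos_eq; lra|rewrite Rabs_pos_eq; lra]. }
    unfold S. eapply Rle_trans; [apply Cmod_triangle_minus|].
    eapply Rle_trans; [apply Rplus_le_compat_r, Cmod_triangle|].
    rewrite !Cmod_mult, Cmod_Ci. lra. }
  assert (HV : forall x, Rabs x = n -> Cmod (vint N x 0 k) <= K1 / n * (k - 0)).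
  { intros x Hx. apply vint_bound; [lra| |].
    - intros y Hy. apply holo_ccont, HN; [lra|]. intros E. apply (f_equal Re) in E. simpl in E.
      rewrite E, Rabs_R0 in Hx. lra.
    - intros y Hy. rewrite <- Hx. apply H1; [lra|exact Hy]. }
  assert (Hn1 : 1 <= n) by lra.
  pose proof (HV n (Rabs_pos_eq n ltac:(lra))) as HV2. fold V2 in HV2.
  pose proof (HV (- n) ltac:(rewrite Rabs_Ropp; apply Rabs_pos_eq; lra)) as HV1. fold V1 in HV1.
  pose proof (H2 n Hn1) as HB. fold B1 in HB.
  specialize (HX2 n ltac:(lra)).
  replace (/ (4 * Ci) * (B1 + Ci * V1 - Ci * V2 - S) - L / (4 * Ci))%C
    with (((B1 - L) + (Ci * V1 + (- (Ci * V2) + - S))) * / (4 * Ci))%C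
    by (field; apply Ci_neq_0).
  rewrite Cmod_mult, Cmod_inv by apply four_Ci_neq.
  rewrite Cmod_mult, Cmod_Ci, Cmod_R, Rabs_pos_eq by lra.
  assert (T : Cmod ((B1 - L) + (Ci * V1 + (- (Ci * V2) + - S)))%C
     <= Cmod (B1 - L)%C + (Cmod V1 + (Cmod V2 + Cmod S))).
  { eapply Rle_trans; [apply Cmod_triangle|]. apply Rplus_le_compat_l.
    eapply Rle_trans; [apply Cmod_triangle|]. rewrite Cmod_mult, Cmod_Ci, Rmult_1_l.
    apply Rplus_le_compat_l.
    eapply Rle_trans; [apply Cmod_triangle|]. rewrite !Cmod_opp, Cmod_mult, Cmod_Ci, Rmult_1_l. lra. }
  (* both 1/n terms together *)
  assert (Hn4 : (K2 + 2 * K1 * k) * / n <= eps / 4).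
  { apply (Rmult_le_reg_r n); [lra|]. rewrite Rmult_assoc, Rinv_l by lra.
    assert (Q : (K2 + 2 * K1 * k + 1) * (4 / eps) <= n) by lra.
    apply (Rmult_le_compat_r (eps / 4)) in Q; [|lra].
    replace ((K2 + 2 * K1 * k + 1) * (4 / eps) * (eps / 4)) with (K2 + 2 * K1 * k + 1) in Q by (field; lra).
    lra. }
  assert (He4 : 4 * K0 * e <= eps / 4).
  { assert (Q : e <= eps / (4 * (4 * K0 + 1))) by lra.
    apply (Rmult_le_compat_r (4 * K0 + 1)) in Q; [|lra].
    replace (eps / (4 * (4 * K0 + 1)) * (4 * K0 + 1)) with (eps / 4) in Q by (field; lra). lra. }
  unfold Rdiv in HV1, HV2.
  assert (Cmod (B1 - L)%C + (Cmod V1 + (Cmod V2 + Cmod S)) <= 3 * (eps / 4)) by lra.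
  lra.
Qed.

Lemma hg_value p q z : 0 < p -> 0 < q -> Rabs (Im z) < (p + q) / 2 ->
  hg p q z = ((gamT p q z + Ci * PI * laurent_c p q z) / (4 * Ci))%C.
Proof.
  intros Hp Hq Hz. apply (is_RInt_gen_unique (V := C_R_CompleteNormedModule)).
  apply hg_integral; assumption.
Qed.

Lemma hg_opp p q z : 0 < p -> 0 < q -> Rabs (Im z) < (p + q) / 2 ->
  hg p q (- z)%C = (- hg p q z)%C.
Proof.
  intros Hp Hq Hz. rewrite (hg_value p q z Hp Hq Hz).
  apply (is_RInt_gen_unique (V := C_R_CompleteNormedModule)).
  pose proof (is_RInt_gen_opp _ _ (hg_integral p q z Hp Hq Hz)) as H.
  eapply is_RInt_gen_ext; [|exact H].
  apply (Filter_prod _ _ _ (fun a => 0 < a) (fun b => 0 < b)).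
  - exists (mkposreal 1 Rlt_0_1). intros a _ Ha. exact Ha.
  - exists 0. intros b Hb. exact Hb.
  - intros a b Ha Hb t Ht. simpl in Ht.
    assert (Ht0 : 0 < t) by (eapply Rlt_trans; [apply (Rmin_pos a b Ha Hb)|apply Ht]).
    change ((- hg_integrand p q z t)%C = hg_integrand p q (- z)%C t).
    assert (HpC : RtoC p <> 0%C) by (apply RtoC_neq_0; lra).
    assert (HqC : RtoC q <> 0%C) by (apply RtoC_neq_0; lra).
    assert (HtC : RtoC t <> 0%C) by (apply RtoC_neq_0; lra).
    assert (Sh : forall a, 0 < a -> RtoC (sinh (a * t)) <> 0%C).
    { intros c Hc. apply RtoC_neq_0. unfold sinh.
      pose proof (exp_increasing (- (c * t)) (c * t) ltac:(nra)). lra. }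
    unfold hg_integrand, csin.
    replace (Ci * (2 * t * - z))%C with (- (Ci * (2 * t * z)))%C by ring.
    replace (- - (Ci * (2 * t * z)))%C with (Ci * (2 * t * z))%C by ring.
    pose proof Ci_neq_0. field. repeat split; auto.
Qed.

(** The term i pi laurent_c / 4 of i g z is the opposite of i chi + i alpha z^2
    / 4. *)
Lemma Gstrip_eq p q z : 0 < p -> 0 < q -> Rabs (Im z) < (p + q) / 2 ->
  (cexp (Ci * hg p q z) * cexp (Ci * chi p q + Ci * alpha p q * z ^ 2 / 4))%C = Gstrip p q z.
Proof.
  intros Hp Hq Hz. rewrite <- cexp_plus. unfold Gstrip. f_equal.
  rewrite (hg_value p q z Hp Hq Hz). unfold chi, alpha, laurent_c.
  assert (HpC : RtoC p <> 0%C) by (apply RtoC_neq_0; lra).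
  assert (HqC : RtoC q <> 0%C) by (apply RtoC_neq_0; lra).
  pose proof Ci_neq_0.
  rewrite RtoC_mult, RtoC_plus, !RtoC_div, !RtoC_mult by (try apply Rmult_integral_contrapositive; lra).
  field. repeat split; assumption.
Qed.

(** * The gamma function on its whole domain of holomorphy *)

Definition gfac (p q : R) (z : C) : C := cexp (Ci * chi p q + Ci * alpha p q * z ^ 2 / 4)%C.

(** The ratio G_R (z + i p) / G_R z. *)
Definition sfac (p q : R) (z : C) : C := (1 + cexp (- (2 * PI * (z + Ci * p / 2) / q)))%C.

Lemma gfac_step p q z : 0 < p -> 0 < q ->
  (2 * ccosh (PI * (z + Ci * p / 2) / q) * gfac p q (z + Ci * p))%C = (sfac p q z * gfac p q z)%C.
Proof.
  intros Hp Hq.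
  assert (HpC : RtoC p <> 0%C) by (apply RtoC_neq_0; lra).
  assert (HqC : RtoC q <> 0%C) by (apply RtoC_neq_0; lra).
  unfold gfac, sfac, ccosh.
  set (A := (Ci * chi p q + Ci * alpha p q * z ^ 2 / 4)%C).
  set (w := (PI * (z + Ci * p / 2) / q)%C).
  replace (Ci * chi p q + Ci * alpha p q * (z + Ci * p) ^ 2 / 4)%C with (A + - w)%C.
  2: { unfold A, w, alpha.
       replace (Ci * (2 * PI / (p * q))%R * (z + Ci * p) ^ 2 / 4)%C
         with (Ci * (2 * PI / (p * q))%R * z ^ 2 / 4
               + (Ci * Ci) * (2 * PI / (p * q))%R * (2 * p * z + Ci * p * p) / 4)%C by field.
       rewrite Ci2, RtoC_div by (apply Rmult_integral_contrapositive; lra).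
       rewrite !RtoC_mult.
       field. auto. }
  replace (- (2 * PI * (z + Ci * p / 2) / q))%C with (- w + - w)%C by (unfold w; field; exact HqC).
  rewrite !cexp_plus, !cexp_opp. field. apply cexp_neq_0.
Qed.

Lemma cexp_shift_re (w : C) : cexp w = (- (1))%C -> Re w = 0.
Proof.
  intros H. pose proof (Cmod_cexp w) as E. rewrite H, Cmod_opp, Cmod_1, <- exp_0 in E.
  apply exp_inv in E. lra.
Qed.

Lemma sfac_re (p q : R) (z : C) : 0 < q -> Re (- (2 * PI * (z + Ci * p / 2) / q))%C = - (2 * PI / q) * Re z.
Proof.
  intros Hq. rewrite Re_opp, Re_div_R by lra. rewrite <- RtoC_mult, Re_mult, Re_RtoC, Im_RtoC.
  replace (Re (z + Ci * p / 2)%C) with (Re z).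
  - field. lra.
  - rewrite Re_plus, Re_div_R by lra. reim. field.
Qed.

Lemma sfac_neq p q z : 0 < q -> Re z <> 0 -> sfac p q z <> 0%C.
Proof.
  intros Hq Hz E.
  assert (E1 : cexp (- (2 * PI * (z + Ci * p / 2) / q))%C = (- (1))%C).
  { unfold sfac in E. replace (cexp (- (2 * PI * (z + Ci * p / 2) / q)))%C
      with ((1 + cexp (- (2 * PI * (z + Ci * p / 2) / q))) - 1)%C by ring. rewrite E. ring. }
  apply cexp_shift_re in E1. rewrite sfac_re in E1 by exact Hq.
  pose proof PI_RGT_0. assert (0 < 2 * PI / q) by (apply Rdiv_lt_0_compat; lra).
  apply Hz. nra.
Qed.

Lemma sfac_period p q z : 0 < q -> sfac p q (z + Ci * q)%C = sfac p q z.
Proof.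
  intros Hq. assert (HqC : RtoC q <> 0%C) by (apply RtoC_neq_0; lra).
  unfold sfac. f_equal.
  replace (- (2 * PI * (z + Ci * q + Ci * p / 2) / q))%C
    with (- (2 * PI * (z + Ci * p / 2) / q) - Ci * PI - Ci * PI)%C by (field; exact HqC).
  rewrite !cexp_minus, cexp_iPI. field.
Qed.

Lemma holo_sfac p q z : 0 < q -> holo (sfac p q) z.
Proof.
  intros Hq. unfold sfac. holo_auto; apply RtoC_neq_0; lra.
Qed.

Lemma sfac_bound p q z x0 : 0 < q -> 0 < x0 -> x0 <= Re z ->
  1 - exp (- (2 * PI / q) * x0) <= Cmod (sfac p q z) <= 2.
Proof.
  intros Hq Hx0 Hz. pose proof PI_RGT_0. assert (H2 : 0 < 2 * PI / q) by (apply Rdiv_lt_0_compat; lra).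
  assert (E : Cmod (cexp (- (2 * PI * (z + Ci * p / 2) / q))%C) <= exp (- (2 * PI / q) * x0)).
  { rewrite Cmod_cexp, sfac_re by exact Hq. apply exp_le_mono. nra. }
  assert (E1 : exp (- (2 * PI / q) * x0) <= 1).
  { rewrite <- exp_0. apply exp_le_mono. nra. }
  unfold sfac. split.
  - eapply Rle_trans; [|apply Cmod_triangle_rev]. rewrite Cmod_1. lra.
  - eapply Rle_trans; [apply Cmod_triangle|]. rewrite Cmod_1. lra.
Qed.

Section Gamma.
Variables p q : R.
Hypothesis Hp : 0 < p.
Hypothesis Hq : 0 < q.
Let a := amean p q.

(** The plane without the half-line [- i a, - i oo) that contains the poles. *)
Definition gam_dom (p q : R) (w : C) : Prop := Re w <> 0 \/ - amean p q < Im w.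

Lemma Gstrip_neq_0 w : Gstrip p q w <> 0%C.
Proof. apply cexp_neq_0. Qed.

Lemma Gstrip_up w : - a < Im w -> Im w + p < a ->
  Gstrip p q (w + Ci * p)%C = (sfac p q w * Gstrip p q w)%C.
Proof.
  unfold a, amean. intros H1 H2. rewrite Gstrip_step by assumption. unfold sfac. ring.
Qed.

Lemma hG_up_S n w : (hG_up p q (S n) w * gfac p q w)%C
  = (sfac p q (w - Ci * p) * (hG_up p q n (w - Ci * p) * gfac p q (w - Ci * p)))%C.
Proof.
  simpl. unfold c_. simpl.
  pose proof (gfac_step p q (w - Ci * p)%C Hp Hq) as S.
  replace (w - Ci * p + Ci * p / 2)%C with (w - Ci * p / 2)%C in S by field.
  replace (w - Ci * p + Ci * p)%C with w in S by ring.
  transitivity (hG_up p q n (w - Ci * p) * (2 * ccosh (PI * (w - Ci * p / 2) / q) * gfac p q w))%C; [ring|].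
  rewrite S. ring.
Qed.

Lemma hG_down_S n w : sfac p q w <> 0%C -> (hG_down p q (S n) w * gfac p q w)%C
  = (hG_down p q n (w + Ci * p) * gfac p q (w + Ci * p) / sfac p q w)%C.
Proof.
  intros Hs. simpl. unfold c_. simpl.
  pose proof (gfac_step p q w Hp Hq) as S.
  assert (Hc : (2 * ccosh (PI * (w + Ci * p / 2) / q))%C <> 0%C).
  { intros E. rewrite E in S. replace (0 * gfac p q (w + Ci * p))%C with (RtoC 0) in S by ring.
    symmetry in S. revert S. apply Cmult_neq_0; [exact Hs|apply cexp_neq_0]. }
  set (c := (2 * ccosh (PI * (w + Ci * p / 2) / q))%C) in *.
  transitivity (hG_down p q n (w + Ci * p) / c * (sfac p q w * gfac p q w) / sfac p q w)%C; [field; auto|].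
  rewrite <- S. field. auto.
Qed.

Lemma Gstrip_sfac_neq w : - a < Im w -> Im w + p < a -> sfac p q w <> 0%C.
Proof.
  intros H1 H2 E. pose proof (Gstrip_up w H1 H2) as S. rewrite E in S.
  apply (Gstrip_neq_0 (w + Ci * p)%C). rewrite S. ring.
Qed.

Lemma hG_0 w : Rabs (Im w) < a -> (cexp (Ci * hg p q w) * gfac p q w)%C = Gstrip p q w.
Proof. intros H. apply Gstrip_eq; assumption. Qed.

Lemma Im_down w : Im (w - Ci * p)%C = Im w - p. Proof. reim. ring. Qed.
Lemma Im_up w : Im (w + Ci * p)%C = Im w + p. Proof. reim. ring. Qed.
Lemma Re_down w (b : R) : Re (w - Ci * b)%C = Re w. Proof. reim. ring. Qed.
Lemma Re_up w (b : R) : Re (w + Ci * b)%C = Re w. Proof. reim. ring. Qed.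

(** The strip has height p + q > p, so a point may be reached by different
    numbers of steps; the values agree by Gstrip_up. *)
Lemma hG_up_strip n : forall w, Rabs (Im w) < a -> Rabs (Im w - INR n * p) < a ->
  (hG_up p q n w * gfac p q w)%C = Gstrip p q w.
Proof.
  induction n as [|n IH]; intros w H1 H2.
  - apply hG_0; exact H1.
  - rewrite hG_up_S. rewrite S_INR in H2. apply Rabs_def2 in H1, H2.
    pose proof (pos_INR n). assert (0 <= INR n * p) by (apply Rmult_le_pos; lra).
    rewrite IH.
    + rewrite <- Gstrip_up; [f_equal; ring|rewrite Im_down; lra|rewrite Im_down; lra].
    + rewrite Im_down. apply Rabs_def1; lra.
    + rewrite Im_down. apply Rabs_def1; lra.
Qed.

Lemma hG_up_eq n : forall m w, (n <= m)%nat -> Rabs (Im w - INR n * p) < a ->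
  Rabs (Im w - INR m * p) < a ->
  (hG_up p q m w * gfac p q w)%C = (hG_up p q n w * gfac p q w)%C.
Proof.
  induction n as [|n IH]; intros m w Hnm H1 H2.
  - simpl in H1. rewrite Rmult_0_l, Rminus_0_r in H1.
    rewrite hG_up_strip by assumption. simpl. symmetry. apply hG_0; exact H1.
  - destruct m as [|m]; [lia|]. rewrite !hG_up_S. f_equal.
    rewrite S_INR in H1, H2. apply IH; [lia| |]; rewrite Im_down.
    + replace (Im w - p - INR n * p) with (Im w - (INR n + 1) * p) by ring. exact H1.
    + replace (Im w - p - INR m * p) with (Im w - (INR m + 1) * p) by ring. exact H2.
Qed.

Lemma hG_down_strip n : forall w, Rabs (Im w) < a -> Rabs (Im w + INR n * p) < a ->
  (hG_down p q n w * gfac p q w)%C = Gstrip p q w.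
Proof.
  induction n as [|n IH]; intros w H1 H2.
  - apply hG_0; exact H1.
  - rewrite S_INR in H2. apply Rabs_def2 in H1, H2.
    pose proof (pos_INR n). assert (0 <= INR n * p) by (apply Rmult_le_pos; lra).
    assert (Hs : sfac p q w <> 0%C) by (apply Gstrip_sfac_neq; lra).
    rewrite hG_down_S by exact Hs. rewrite IH.
    + rewrite Gstrip_up by lra. field. exact Hs.
    + rewrite Im_up. apply Rabs_def1; lra.
    + rewrite Im_up. apply Rabs_def1; lra.
Qed.

Lemma hG_down_eq n : forall m w, (n <= m)%nat -> Rabs (Im w + INR n * p) < a ->
  Rabs (Im w + INR m * p) < a -> (Re w <> 0 \/ n = 0%nat) ->
  (hG_down p q m w * gfac p q w)%C = (hG_down p q n w * gfac p q w)%C.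
Proof.
  induction n as [|n IH]; intros m w Hnm H1 H2 H3.
  - simpl in H1. rewrite Rmult_0_l, Rplus_0_r in H1.
    rewrite hG_down_strip by assumption. simpl. symmetry. apply hG_0; exact H1.
  - destruct m as [|m]; [lia|]. destruct H3 as [H3|H3]; [|lia].
    rewrite !hG_down_S by (apply sfac_neq; assumption). unfold Cdiv. f_equal.
    rewrite S_INR in H1, H2. apply IH; [lia| | |]; rewrite ?Im_up, ?Re_up.
    + replace (Im w + p + INR n * p) with (Im w + (INR n + 1) * p) by ring. exact H1.
    + replace (Im w + p + INR m * p) with (Im w + (INR m + 1) * p) by ring. exact H2.
    + left; exact H3.
Qed.

Lemma hG_steps_spec w : let n := hG_steps p q w in
  Rabs (Rabs (Im w) - INR n * p) < a /\
  forall m, Rabs (Rabs (Im w) - INR m * p) < a -> (n <= m)%nat.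
Proof.
  intros n. set (r := (Rabs (Im w) - amean p q) / p).
  destruct (archimed r) as [A1 A2].
  assert (Hr : r * p = Rabs (Im w) - a) by (unfold r, a; field; lra).
  assert (Ha : a = (p + q) / 2) by reflexivity.
  pose proof (Rabs_pos (Im w)) as Hpos.
  unfold n, hG_steps. fold r.
  destruct (Z_le_gt_dec (up r) 0) as [L|L].
  - assert (E : Z.to_nat (up r) = 0%nat) by (apply Z2Nat.inj with (m := 0%Z) || lia; lia).
    rewrite E. split; [|intros; lia]. simpl.
    assert (r < 0) by (apply Rlt_le_trans with (IZR (up r)); [exact A1|apply IZR_le; exact L]).
    apply Rabs_def1; nra.
  - assert (E : INR (Z.to_nat (up r)) = IZR (up r)) by (rewrite INR_IZR_INZ, Z2Nat.id by lia; reflexivity).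
    rewrite E. split.
    + apply Rabs_def1; nra.
    + intros m Hm. apply Rabs_def2 in Hm. apply INR_le. rewrite E.
      rewrite INR_IZR_INZ in Hm |- *. apply IZR_le.
      assert (Q : r < IZR (Z.of_nat m)) by nra.
      assert (IZR (up r) < IZR (Z.of_nat m) + 1) by lra.
      rewrite <- plus_IZR in H. apply lt_IZR in H. lia.
Qed.

Lemma hGR_up n w : 0 <= Im w -> Rabs (Im w - INR n * p) < a ->
  hGR p q w = (hG_up p q n w * gfac p q w)%C.
Proof.
  intros Hw Hn. destruct (hG_steps_spec w) as [S1 S2].
  rewrite (Rabs_pos_eq (Im w)) in S1, S2 by exact Hw.
  unfold hGR, hG. destruct (Rle_dec 0 (Im w)) as [_|C]; [|contradiction].
  fold (gfac p q w). symmetry. apply hG_up_eq; auto.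
Qed.

Lemma hGR_down n w : Im w < 0 -> Rabs (Im w + INR n * p) < a -> gam_dom p q w ->
  hGR p q w = (hG_down p q n w * gfac p q w)%C.
Proof.
  intros Hw Hn Hd. destruct (hG_steps_spec w) as [S1 S2].
  rewrite (Rabs_left (Im w)) in S1, S2 by exact Hw.
  assert (Q : forall m, Rabs (- Im w - INR m * p) = Rabs (Im w + INR m * p)).
  { intros m. rewrite <- Rabs_Ropp. f_equal. ring. }
  rewrite Q in S1. specialize (S2 n). rewrite Q in S2.
  unfold hGR, hG. destruct (Rle_dec 0 (Im w)) as [C|_]; [lra|].
  fold (gfac p q w). symmetry. apply hG_down_eq; auto.
  destruct Hd as [Hd|Hd]; [left; exact Hd|right].
  destruct (hG_steps_spec w) as [_ S3].
  specialize (S3 0%nat). simpl in S3. rewrite Rmult_0_l, Rminus_0_r, Rabs_Rabsolu in S3.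
  assert (Rabs (Im w) < a) by (apply Rabs_def1; [unfold a, amean; lra|exact Hd]).
  specialize (S3 H). lia.
Qed.

Lemma hGR_strip w : Rabs (Im w) < a -> hGR p q w = Gstrip p q w.
Proof.
  intros Hw. destruct (Rle_dec 0 (Im w)) as [H|H].
  - rewrite (hGR_up 0 w H); [apply hG_0; exact Hw|]. simpl. rewrite Rmult_0_l, Rminus_0_r; exact Hw.
  - rewrite (hGR_down 0 w); [apply hG_0; exact Hw|lra| |].
    + simpl. rewrite Rmult_0_l, Rplus_0_r; exact Hw.
    + right. apply Rabs_def2 in Hw. apply Hw.
Qed.

Lemma gam_dom_up w b : 0 <= b -> gam_dom p q w -> gam_dom p q (w + Ci * b)%C.
Proof.
  intros Hb [H|H]; [left; rewrite Re_up; exact H|right].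
  replace (Im (w + Ci * b)%C) with (Im w + b) by (reim; ring). lra.
Qed.

Theorem hGR_step w : gam_dom p q w -> hGR p q (w + Ci * p)%C = (sfac p q w * hGR p q w)%C.
Proof.
  intros Hd. assert (Ha : a = (p + q) / 2) by reflexivity.
  destruct (hG_steps_spec w) as [S1 _]. set (n := hG_steps p q w) in *.
  destruct (Rle_dec 0 (Im w)) as [H|H].
  - rewrite (Rabs_pos_eq (Im w)) in S1 by exact H.
    rewrite (hGR_up n w H S1). rewrite (hGR_up (S n) (w + Ci * p)%C).
    + rewrite hG_up_S. replace (w + Ci * p - Ci * p)%C with w by ring. reflexivity.
    + rewrite Im_up. lra.
    + rewrite Im_up, S_INR. replace (Im w + p - (INR n + 1) * p) with (Im w - INR n * p) by ring. exact S1.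
  - assert (H' : Im w < 0) by lra.
    destruct (Rlt_dec (- a) (Im w)) as [Hs|Hs].
    + assert (Hw : Rabs (Im w) < a) by (apply Rabs_def1; lra).
      rewrite (hGR_strip w Hw).
      destruct (Rle_dec 0 (Im w + p)) as [Hup|Hup].
      * rewrite (hGR_up 1 (w + Ci * p)%C).
        -- rewrite hG_up_S. replace (w + Ci * p - Ci * p)%C with w by ring.
           simpl. rewrite hG_0 by exact Hw. reflexivity.
        -- rewrite Im_up; exact Hup.
        -- rewrite Im_up. simpl. replace (Im w + p - 1 * p) with (Im w) by ring. exact Hw.
      * rewrite hGR_strip; [apply Gstrip_up; lra|]. rewrite Im_up. apply Rabs_def1; lra.
    + assert (Hre : Re w <> 0) by (destruct Hd as [Hd|Hd]; [exact Hd|unfold a in Hs; contradiction]).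
      assert (Hf : sfac p q w <> 0%C) by (apply sfac_neq; assumption).
      destruct (Rle_dec 0 (Im w + p)) as [Hup|Hup].
      * rewrite (hGR_down 1 w H'); [|simpl; apply Rabs_def1; lra|exact Hd].
        rewrite hG_down_S by exact Hf. simpl.
        assert (Hw : Rabs (Im (w + Ci * p)%C) < a) by (rewrite Im_up; apply Rabs_def1; lra).
        rewrite hG_0 by exact Hw. rewrite hGR_strip by exact Hw. field. exact Hf.
      * rewrite (Rabs_left (Im w)) in S1 by exact H'.
        destruct n as [|n].
        { simpl in S1. rewrite Rmult_0_l, Rminus_0_r in S1. apply Rabs_def2 in S1. lra. }
        assert (S1' : Rabs (Im w + INR (S n) * p) < a).
        { rewrite <- Rabs_Ropp. replace (- (Im w + INR (S n) * p)) with (- Im w - INR (S n) * p) by ring.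
          exact S1. }
        rewrite (hGR_down (S n) w H' S1' Hd), hG_down_S by exact Hf.
        rewrite (hGR_down n (w + Ci * p)%C).
        -- field. exact Hf.
        -- rewrite Im_up. lra.
        -- rewrite Im_up. rewrite S_INR in S1'.
           replace (Im w + p + INR n * p) with (Im w + (INR n + 1) * p) by ring. exact S1'.
        -- left. rewrite Re_up. exact Hre.
Qed.

(** Every point of the domain is reached from the strip by shifts over i p. *)
Lemma strip_induction (P : C -> Prop) :
  (forall w, Rabs (Im w) < a -> P w) ->
  (forall w, gam_dom p q w -> a <= Im w -> P (w - Ci * p)%C -> P w) ->
  (forall w, Re w <> 0 -> Im w <= - a -> P (w + Ci * p)%C -> P w) ->
  forall w, gam_dom p q w -> P w.
Proof.
  intros H0 Hu Hd.
  assert (Ha : a = (p + q) / 2) by reflexivity.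
  assert (K : forall n w, gam_dom p q w -> Rabs (Im w) < a + INR n * p -> P w).
  { induction n as [|n IH]; intros w Hw Hn.
    - apply H0. simpl in Hn. lra.
    - rewrite S_INR in Hn. apply Rabs_def2 in Hn.
      pose proof (pos_INR n). assert (0 <= INR n * p) by (apply Rmult_le_pos; lra).
      destruct (Rlt_dec (Im w) a) as [L1|L1]; [destruct (Rlt_dec (- a) (Im w)) as [L2|L2]|].
      + apply H0. apply Rabs_def1; lra.
      + assert (Hre : Re w <> 0) by (destruct Hw as [Hw|Hw]; [exact Hw|unfold a in L2; contradiction]).
        apply Hd; [exact Hre|lra|]. apply IH; [left; rewrite Re_up; exact Hre|].
        rewrite Im_up. apply Rabs_def1; lra.
      + apply Hu; [exact Hw|lra|]. apply IH.
        * right. rewrite Im_down. fold a. lra.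
        * rewrite Im_down. apply Rabs_def1; lra. }
  intros w Hw. destruct (nfloor_ex (Rabs (Im w) / p)) as [n Hn].
  { apply Rmult_le_pos; [apply Rabs_pos|left; apply Rinv_0_lt_compat; exact Hp]. }
  apply (K (S n) w Hw). rewrite S_INR. destruct Hn as [_ Hn].
  apply (Rmult_lt_compat_r p) in Hn; [|exact Hp].
  replace (Rabs (Im w) / p * p) with (Rabs (Im w)) in Hn by (field; lra). lra.
Qed.

Theorem holo_hGR w : gam_dom p q w -> holo (hGR p q) w.
Proof.
  assert (Ha : a = (p + q) / 2) by reflexivity.
  revert w. apply strip_induction.
  - intros w Hw. apply (holo_ext_loc (Gstrip p q) _ w (a - Rabs (Im w))); [lra| |].
    + intros v Hv. symmetry. apply hGR_strip.
      pose proof (im_le_Cmod (v - w)%C) as E. rewrite Im_minus in E.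
      pose proof (Rabs_triang (Im v - Im w) (Im w)) as T.
      replace (Im v - Im w + Im w) with (Im v) in T by ring. lra.
    + apply holo_Gstrip; assumption.
  - intros w Hd Hw IH.
    apply (holo_ext_loc (fun v => sfac p q (v - Ci * p) * hGR p q (v - Ci * p))%C _ w q); [exact Hq| |].
    + intros v Hv. rewrite <- hGR_step; [f_equal; ring|]. right. rewrite Im_down.
      pose proof (im_le_Cmod (v - w)%C) as E. rewrite Im_minus in E. apply Rabs_le_between in E.
      fold a. lra.
    + apply holo_mult.
      * apply (holo_comp (sfac p q) (fun v => v - Ci * p)%C); [apply holo_sfac; exact Hq|holo_auto].
      * apply (holo_comp (hGR p q) (fun v => v - Ci * p)%C); [exact IH|holo_auto].
  - intros w Hre Hw IH.
    apply (holo_ext_loc (fun v => hGR p q (v + Ci * p) / sfac p q v)%C _ w (Rabs (Re w))).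
    + apply Rabs_pos_lt; exact Hre.
    + intros v Hv.
      assert (Hv0 : Re v <> 0).
      { intros E. pose proof (re_le_Cmod (v - w)%C) as Q. rewrite Re_minus, E in Q.
        rewrite Rminus_0_l, Rabs_Ropp in Q. lra. }
      rewrite hGR_step by (left; exact Hv0). field. apply sfac_neq; assumption.
    + apply holo_div.
      * apply (holo_comp (hGR p q) (fun v => v + Ci * p)%C); [exact IH|holo_auto].
      * apply holo_sfac; exact Hq.
      * apply sfac_neq; assumption.
Qed.
End Gamma.

(** In the strip the roles of p and q may be exchanged, since T is symmetric in
    them. The equation propagates over shifts by i p because both factors are
    periodic with respect to the other shift; the lines left out by the open
    strips follow by continuity. *)
Lemma hGR_step_q p q w : 0 < p -> 0 < q -> gam_dom p q w ->
  hGR p q (w + Ci * q)%C = (sfac q p w * hGR p q w)%C.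
Proof.
  intros Hp Hq.
  set (a := amean p q). assert (Ha : a = (p + q) / 2) by reflexivity.
  revert w.
  set (P := fun w => hGR p q (w + Ci * q)%C = (sfac q p w * hGR p q w)%C).
  assert (Iq : forall w, Im (w + Ci * q)%C = Im w + q) by (intros; reim; ring).
  assert (Ip : forall w, Im (w + Ci * p)%C = Im w + p) by (intros; reim; ring).
  (* the two shifts commute *)
  assert (HS : forall v, gam_dom p q v -> P v -> P (v + Ci * p)%C).
  { intros v Hv HP. unfold P in *.
    replace (v + Ci * p + Ci * q)%C with (v + Ci * q + Ci * p)%C by ring.
    rewrite (hGR_step p q Hp Hq (v + Ci * q)%C) by (apply gam_dom_up; [lra|exact Hv]).
    rewrite (hGR_step p q Hp Hq v Hv), HP, sfac_period, sfac_period by assumption. ring. }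
  assert (Hbase : forall w, - a < Im w -> Im w + q < a -> P w).
  { intros w H1 H2. unfold P.
    rewrite !hGR_strip; try assumption; try (fold a; rewrite ?Iq; apply Rabs_def1; lra).
    rewrite !(Gstrip_sym p q). apply Gstrip_up; try assumption; unfold amean in *; lra. }
  assert (HQ : forall n w, - a + INR n * p < Im w -> Im w < - a + (INR n + 1) * p -> P w).
  { induction n as [|n IH]; intros w H1 H2.
    - simpl in H1, H2. apply Hbase; lra.
    - rewrite S_INR in H1, H2. pose proof (pos_INR n).
      assert (0 <= INR n * p) by (apply Rmult_le_pos; lra).
      replace w with (w - Ci * p + Ci * p)%C by ring.
      assert (I1 : Im (w - Ci * p)%C = Im w - p) by (reim; ring).
      apply HS; [right; fold a; lra|]. apply IH; lra. }
  (* the strips of HQ leave out the lines Im w = - a + n p *)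
  assert (Hcont : forall w, gam_dom p q w -> (forall e, 0 < e < p -> P (w + Ci * e)%C) -> P w).
  { intros w Hw H. unfold P in *.
    set (F := fun v => (hGR p q (v + Ci * q) - sfac q p v * hGR p q v)%C).
    assert (HF : ccont F w).
    { apply holo_ccont. unfold F. apply holo_minus; [|apply holo_mult].
      - apply (holo_comp (hGR p q) (fun v => v + Ci * q)%C); [|holo_auto].
        apply holo_hGR; try assumption. apply gam_dom_up; [lra|exact Hw].
      - apply holo_sfac; exact Hp.
      - apply holo_hGR; assumption. }
    assert (E : F w = 0%C).
    { apply C_small_eq. intros eps He.
      apply continuous_Cmod with (eps := eps) in HF; [|exact He].
      apply locally_Cmod in HF. destruct HF as [d [Hd K]].
      set (e := Rmin (p / 2) (d / 2)).
      assert (He1 : 0 < e) by (apply Rmin_pos; lra).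
      assert (He2 : e <= p / 2) by apply Rmin_l. assert (He3 : e <= d / 2) by apply Rmin_r.
      specialize (K (w + Ci * e)%C). replace (w + Ci * e - w)%C with (Ci * e)%C in K by ring.
      rewrite Cmod_mult, Cmod_Ci, Cmod_R, Rabs_pos_eq in K by lra.
      specialize (K ltac:(lra)). unfold F in K at 1. rewrite (H e) in K by lra.
      replace (sfac q p (w + Ci * e) * hGR p q (w + Ci * e) -
         sfac q p (w + Ci * e) * hGR p q (w + Ci * e) - F w)%C with (- (F w - 0))%C in K by ring.
      rewrite Cmod_opp in K. lra. }
    unfold F in E. replace (hGR p q (w + Ci * q)%C)
      with ((hGR p q (w + Ci * q) - sfac q p w * hGR p q w) + sfac q p w * hGR p q w)%C by ring.
    rewrite E. ring. }
  assert (Hup : forall w, - a < Im w -> P w).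
  { intros w Hw.
    destruct (nfloor_ex ((Im w + a) / p)) as [n [N1 N2]].
    { left. apply Rdiv_lt_0_compat; lra. }
    apply (Rmult_le_compat_r p) in N1; [|lra]. apply (Rmult_lt_compat_r p) in N2; [|lra].
    replace ((Im w + a) / p * p) with (Im w + a) in N1, N2 by (field; lra).
    destruct N1 as [N1|N1].
    - apply (HQ n); lra.
    - apply Hcont; [right; exact Hw|]. intros e He. apply (HQ n);
        replace (Im (w + Ci * e)%C) with (Im w + e) by (reim; ring); lra. }
  assert (Hdown : forall n w, Re w <> 0 -> - a - INR n * p < Im w -> P w).
  { induction n as [|n IH]; intros w Hre Hw.
    - simpl in Hw. apply Hup; lra.
    - rewrite S_INR in Hw.
      assert (Hre2 : Re (w + Ci * p)%C <> 0) by (replace (Re (w + Ci * p)%C) with (Re w) by (reim; ring); exact Hre).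
      pose proof (IH (w + Ci * p)%C Hre2 ltac:(rewrite Ip; lra)) as H. unfold P in *.
      replace (w + Ci * p + Ci * q)%C with (w + Ci * q + Ci * p)%C in H by ring.
      assert (Hd : gam_dom p q w) by (left; exact Hre).
      rewrite (hGR_step p q Hp Hq (w + Ci * q)%C) in H by (apply gam_dom_up; [lra|exact Hd]).
      rewrite (hGR_step p q Hp Hq w Hd), sfac_period, sfac_period in H by assumption.
      assert (Hs : sfac p q w <> 0%C) by (apply sfac_neq; assumption).
      transitivity (/ sfac p q w * (sfac p q w * hGR p q (w + Ci * q)))%C; [field; exact Hs|].
      rewrite H. field. exact Hs. }
  intros w [Hre|Him].
  - destruct (nfloor_ex (Rabs (Im w + a) / p)) as [n [_ N2]].
    { apply Rmult_le_pos; [apply Rabs_pos|left; apply Rinv_0_lt_compat; exact Hp]. }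
    apply (Hdown (S n)); [exact Hre|]. rewrite S_INR.
    apply (Rmult_lt_compat_r p) in N2; [|lra].
    replace (Rabs (Im w + a) / p * p) with (Rabs (Im w + a)) in N2 by (field; lra).
    pose proof (Rle_abs (- (Im w + a))) as Q. rewrite Rabs_Ropp in Q. lra.
  - apply Hup. exact Him.
Qed.

(** * Reflection *)

(** The value of G_R w G_R (- w); the function G itself satisfies G w G (- w) =
    1. *)
Definition gref (p q : R) (w : C) : C := cexp (2 * Ci * chi p q + Ci * alpha p q * (w * w) / 2)%C.

Lemma gref_step p q w : 0 < p -> 0 < q ->
  (gref p q (w + Ci * p) * sfac p q (- (w + Ci * p)))%C = (gref p q w * sfac p q w)%C.
Proof.
  intros Hp Hq.
  assert (HpC : RtoC p <> 0%C) by (apply RtoC_neq_0; lra).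
  assert (HqC : RtoC q <> 0%C) by (apply RtoC_neq_0; lra).
  unfold gref, sfac.
  set (X := (- (2 * PI * (w + Ci * p / 2) / q))%C).
  set (A := (2 * Ci * chi p q + Ci * alpha p q * (w * w) / 2)%C).
  replace (- (2 * PI * (- (w + Ci * p) + Ci * p / 2) / q))%C with (- X)%C by (unfold X; field; exact HqC).
  replace (2 * Ci * chi p q + Ci * alpha p q * ((w + Ci * p) * (w + Ci * p)) / 2)%C with (A + X)%C.
  2: { unfold A, X, alpha.
       replace (Ci * (2 * PI / (p * q))%R * ((w + Ci * p) * (w + Ci * p)) / 2)%C
         with (Ci * (2 * PI / (p * q))%R * (w * w) / 2
               + (Ci * Ci) * (2 * PI / (p * q))%R * (2 * p * w + Ci * p * p) / 2)%C by field.
       rewrite Ci2, RtoC_div by (apply Rmult_integral_contrapositive; lra).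
       rewrite !RtoC_mult.
       field. auto. }
  rewrite !cexp_plus, cexp_opp. field. apply cexp_neq_0.
Qed.

(** In the strip g is odd. Both sides satisfy the same equation under w -> w + i
    p. *)
Theorem hGR_reflection p q w : 0 < p -> 0 < q -> Re w <> 0 ->
  (hGR p q w * hGR p q (- w))%C = gref p q w.
Proof.
  intros Hp Hq Hre.
  assert (Step : forall v, Re v <> 0 ->
    (hGR p q (v + Ci * p) * hGR p q (- (v + Ci * p)) * sfac p q (- (v + Ci * p)))%C
    = (sfac p q v * (hGR p q v * hGR p q (- v)))%C).
  { intros v Hv. rewrite (hGR_step p q Hp Hq v) by (left; exact Hv).
    assert (Hn : Re (- (v + Ci * p))%C <> 0).
    { replace (Re (- (v + Ci * p))%C) with (- Re v) by (reim; ring). lra. }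
    pose proof (hGR_step p q Hp Hq (- (v + Ci * p))%C (or_introl Hn)) as E.
    replace (- (v + Ci * p) + Ci * p)%C with (- v)%C in E by ring. rewrite E. ring. }
  assert (Hw : gam_dom p q w) by (left; exact Hre).
  revert Hre. revert w Hw.
  apply (strip_induction p q Hp Hq (fun w => Re w <> 0 -> (hGR p q w * hGR p q (- w))%C = gref p q w)).
  - intros v Hv _.
    assert (Hv' : Rabs (Im (- v)%C) < amean p q) by (rewrite Im_opp, Rabs_Ropp; exact Hv).
    rewrite (hGR_strip p q Hp Hq v Hv), (hGR_strip p q Hp Hq (- v)%C Hv').
    rewrite <- (hG_0 p q Hp Hq v Hv), <- (hG_0 p q Hp Hq (- v)%C Hv').
    rewrite hg_opp by assumption. unfold gfac, gref. rewrite <- !cexp_plus. f_equal. field.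
  - intros v _ _ IH Hv.
    assert (Hv2 : Re (v - Ci * p)%C <> 0) by (rewrite Re_down; exact Hv).
    specialize (IH Hv2). pose proof (Step _ Hv2) as S. rewrite IH in S.
    pose proof (gref_step p q (v - Ci * p)%C Hp Hq) as G.
    replace (v - Ci * p + Ci * p)%C with v in S, G by ring.
    assert (Hs : sfac p q (- v)%C <> 0%C) by (apply sfac_neq; [exact Hq|rewrite Re_opp; lra]).
    transitivity (hGR p q v * hGR p q (- v) * sfac p q (- v) * / sfac p q (- v))%C; [field; exact Hs|].
    rewrite S. replace (sfac p q (v - Ci * p) * gref p q (v - Ci * p))%C
      with (gref p q v * sfac p q (- v))%C by (rewrite G; ring).
    field. exact Hs.
  - intros v Hv0 _ IH Hv.
    assert (Hv2 : Re (v + Ci * p)%C <> 0) by (rewrite Re_up; exact Hv).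
    specialize (IH Hv2). pose proof (Step _ Hv) as S. rewrite IH, gref_step in S by assumption.
    assert (Hs : sfac p q v <> 0%C) by (apply sfac_neq; assumption).
    transitivity (/ sfac p q v * (sfac p q v * (hGR p q v * hGR p q (- v))))%C; [field; exact Hs|].
    rewrite <- S. field. exact Hs.
Qed.

Lemma hGR_neq_0 p q w : 0 < p -> 0 < q -> Re w <> 0 \/ Rabs (Im w) < amean p q -> hGR p q w <> 0%C.
Proof.
  intros Hp Hq [H|H] E.
  - pose proof (hGR_reflection p q w Hp Hq H) as R. rewrite E, Cmult_0_l in R.
    symmetry in R. revert R. apply cexp_neq_0.
  - rewrite hGR_strip in E by assumption. revert E. apply cexp_neq_0.
Qed.

(** * Behaviour for large real part *)

Lemma gamQ_pos p q : 0 < p -> 0 < q -> 0 <= gamQ p q.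
Proof. intros Hp Hq. exact (kernel_Q_pos _ _ _ _ (kernel_gamq p q Hp Hq)). Qed.

Lemma gamT_bound_half p q w : 0 < p -> 0 < q -> Rabs (Im w) <= p / 2 ->
  Cmod (gamT p q w) <= 2 * gamQ p q / q * exp (- (2 * kap p q) * Re w).
Proof.
  intros Hp Hq Hw. pose proof (gamQ_pos p q Hp Hq) as HQ.
  eapply Rle_trans; [apply gamT_bound; lra|].
  replace (- (2 * kap p q) * Re w) with (-2 * kap p q * Re w) by ring.
  pose proof (exp_pos (-2 * kap p q * Re w)) as He.
  replace (2 * gamQ p q / q * exp (-2 * kap p q * Re w))
    with (2 * (gamQ p q * exp (-2 * kap p q * Re w)) * / q) by (field; lra).
  unfold Rdiv. apply Rmult_le_compat_l.
  - apply Rmult_le_pos; [lra|]. apply Rmult_le_pos; lra.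
  - apply Rinv_le_contravar; lra.
Qed.

(** In the strip by the bound on T, and beyond it because the factors sfac are
    bounded above and below for Re w >= x0. *)
Theorem hGR_bounds p q x0 M : 0 < p -> 0 < q -> 0 < x0 ->
  exists B, 1 <= B /\ forall w, x0 <= Re w -> Rabs (Im w) <= M ->
    Cmod (hGR p q w) <= B /\ / B <= Cmod (hGR p q w).
Proof.
  intros Hp Hq Hx0.
  set (f0 := 1 - exp (- (2 * PI / q) * x0)).
  assert (Hf0 : 0 < f0).
  { pose proof PI_RGT_0. assert (0 < 2 * PI / q) by (apply Rdiv_lt_0_compat; lra).
    assert (exp (- (2 * PI / q) * x0) < 1); [|unfold f0; lra].
    rewrite <- exp_0. apply exp_increasing. nra. }
  set (D := Rmax 2 (/ f0)). assert (HD2 : 2 <= D) by apply Rmax_l. assert (HDf : / f0 <= D) by apply Rmax_r.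
  assert (K : forall n, exists B, 1 <= B /\ forall w, x0 <= Re w -> Rabs (Im w) <= p / 2 + INR n * p ->
    Cmod (hGR p q w) <= B /\ / B <= Cmod (hGR p q w)).
  { induction n as [|n [B [HB IH]]].
    - set (c := 2 * gamQ p q / q).
      assert (Hc : 0 <= c).
      { unfold c. apply Rmult_le_pos; [pose proof (gamQ_pos p q Hp Hq); lra|].
        left; apply Rinv_0_lt_compat; exact Hq. }
      exists (exp (c / 4)). split; [rewrite <- exp_0; apply exp_le_mono; lra|].
      intros w Hre Him. simpl in Him. rewrite Rmult_0_l, Rplus_0_r in Him.
      rewrite hGR_strip by (try assumption; unfold amean; lra).
      unfold Gstrip. rewrite Cmod_cexp, <- exp_Ropp.
      assert (T : Cmod (gamT p q w / 4)%C <= c / 4).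
      { rewrite Cmod_div, Cmod_R, Rabs_pos_eq by (try apply RtoC_neq_0; lra).
        pose proof (gamT_bound_half p q w Hp Hq Him) as G. fold c in G.
        assert (exp (- (2 * kap p q) * Re w) <= 1).
        { rewrite <- exp_0. apply exp_le_mono. pose proof (kap_pos p q Hp Hq). nra. }
        assert (c * exp (- (2 * kap p q) * Re w) <= c * 1) by (apply Rmult_le_compat_l; lra).
        lra. }
      pose proof (re_le_Cmod (gamT p q w / 4)%C) as R. assert (R' := Rle_trans _ _ _ R T).
      apply Rabs_le_between in R'. split; apply exp_le_mono; lra.
    - exists (B * D). split; [nra|]. intros w Hre Him.
      assert (HBD : / (B * D) = / B * / D) by (apply Rinv_mult).
      assert (HiB : 0 < / B) by (apply Rinv_0_lt_compat; lra).
      assert (HiD : / D <= / 2) by (apply Rinv_le_contravar; lra).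
      assert (HiD0 : 0 < / D) by (apply Rinv_0_lt_compat; lra).
      assert (HiDf : / D <= f0).
      { rewrite <- (Rinv_inv f0). apply Rinv_le_contravar; [apply Rinv_0_lt_compat; exact Hf0|exact HDf]. }
      rewrite S_INR in Him.
      assert (Hn : 0 <= INR n * p) by (apply Rmult_le_pos; [apply pos_INR|lra]).
      destruct (Rle_dec (Rabs (Im w)) (p / 2 + INR n * p)) as [Hs|Hs].
      { destruct (IH w Hre Hs) as [U1 U2]. split; [nra|]. rewrite HBD. nra. }
      destruct (Rle_dec 0 (Im w)) as [L|L].
      + rewrite Rabs_pos_eq in Him, Hs by exact L.
        set (v := (w - Ci * p)%C).
        assert (Rv : Re v = Re w) by (unfold v; reim; ring).
        assert (Iv : Im v = Im w - p) by (unfold v; reim; ring).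
        destruct (IH v) as [U1 U2]; [lra|rewrite Iv; apply Rabs_le; lra|].
        destruct (sfac_bound p q v x0 Hq Hx0 ltac:(lra)) as [S1 S2]. fold f0 in S1.
        replace w with (v + Ci * p)%C by (unfold v; ring).
        rewrite hGR_step by (try assumption; left; lra). rewrite Cmod_mult. split.
        * rewrite Rmult_comm. apply Rmult_le_compat; try apply Cmod_ge_0; lra.
        * rewrite HBD, Rmult_comm. apply Rmult_le_compat; lra.
      + rewrite Rabs_left in Him, Hs by lra.
        set (v := (w + Ci * p)%C).
        assert (Rv : Re v = Re w) by (unfold v; reim; ring).
        assert (Iv : Im v = Im w + p) by (unfold v; reim; ring).
        destruct (IH v) as [U1 U2]; [lra|rewrite Iv; apply Rabs_le; lra|].
        destruct (sfac_bound p q w x0 Hq Hx0 Hre) as [S1 S2]. fold f0 in S1.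
        assert (Hsf : sfac p q w <> 0%C) by (apply Cmod_gt_0; lra).
        assert (E : hGR p q w = (hGR p q v * / sfac p q w)%C).
        { unfold v. rewrite hGR_step by (try assumption; left; lra). field. exact Hsf. }
        rewrite E, Cmod_mult, Cmod_inv by exact Hsf. split.
        * apply Rmult_le_compat; try apply Cmod_ge_0; try lra.
          { left; apply Rinv_0_lt_compat; lra. }
          eapply Rle_trans; [|exact HDf]. apply Rinv_le_contravar; lra.
        * rewrite HBD. apply Rmult_le_compat; try lra.
          eapply Rle_trans; [exact HiD|]. apply Rinv_le_contravar; lra. }
  destruct (nfloor_ex (Rabs M / p)) as [n [_ N2]].
  { apply Rmult_le_pos; [apply Rabs_pos|left; apply Rinv_0_lt_compat; exact Hp]. }
  destruct (K (S n)) as [B [HB H]]. exists B. split; [exact HB|].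
  intros w Hre Him. apply H; [exact Hre|]. rewrite S_INR.
  apply (Rmult_lt_compat_r p) in N2; [|lra].
  replace (Rabs M / p * p) with (Rabs M) in N2 by (field; lra).
  pose proof (Rle_abs M). lra.
Qed.

(** Convergence to 1 for x -> +oo. *)
Definition tends1 (f : R -> C) : Prop :=
  forall eps, 0 < eps -> exists X, forall x, X <= x -> Cmod (f x - 1)%C <= eps.

Lemma tends1_ext f g : (forall x, 1 <= x -> f x = g x) -> tends1 f -> tends1 g.
Proof.
  intros E H eps He. destruct (H eps He) as [X K]. exists (Rmax 1 X). intros x Hx.
  pose proof (Rmax_l 1 X). pose proof (Rmax_r 1 X). rewrite <- E by lra. apply K; lra.
Qed.

Lemma tends1_mult f g : tends1 f -> tends1 g -> tends1 (fun x => f x * g x)%C.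
Proof.
  intros Hf Hg eps He. set (e := Rmin 1 (eps / 3)).
  assert (Hep : 0 < e) by (apply Rmin_pos; lra).
  assert (e1 : e <= 1) by apply Rmin_l. assert (e2 : e <= eps / 3) by apply Rmin_r.
  destruct (Hf e Hep) as [X K]. destruct (Hg e Hep) as [Y L].
  exists (Rmax X Y). intros x Hx.
  specialize (K x (Rle_trans _ _ _ (Rmax_l X Y) Hx)).
  specialize (L x (Rle_trans _ _ _ (Rmax_r X Y) Hx)).
  replace (f x * g x - 1)%C with ((f x - 1) * (g x - 1) + ((f x - 1) + (g x - 1)))%C by ring.
  eapply Rle_trans; [apply Cmod_triangle|].
  pose proof (Cmod_triangle (f x - 1)%C (g x - 1)%C).
  assert (Cmod ((f x - 1) * (g x - 1))%C <= e * 1) by (apply Cmod_mult_le; lra). lra.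
Qed.

Lemma tends1_inv f : tends1 f -> tends1 (fun x => / f x)%C.
Proof.
  intros Hf eps He. set (e := Rmin (/ 2) (eps / 2)).
  assert (Hep : 0 < e) by (apply Rmin_pos; lra).
  assert (e1 : e <= / 2) by apply Rmin_l. assert (e2 : e <= eps / 2) by apply Rmin_r.
  destruct (Hf e Hep) as [X K]. exists X. intros x Hx. specialize (K x Hx).
  assert (Hl : / 2 <= Cmod (f x)).
  { pose proof (Cmod_triangle_rev 1%C (f x - 1)%C) as T.
    replace (1 + (f x - 1))%C with (f x) in T by ring. rewrite Cmod_1 in T. lra. }
  assert (H0 : f x <> 0%C) by (apply Cmod_gt_0; lra).
  replace (/ f x - 1)%C with (- (f x - 1) * / f x)%C by (field; exact H0).
  eapply Rle_trans; [apply (Cmod_mult_le _ _ e 2)|lra].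
  - rewrite Cmod_opp. exact K.
  - rewrite Cmod_inv by exact H0. replace 2 with (/ / 2) by field. apply Rinv_le_contravar; lra.
Qed.

Lemma tends1_cexp f : (forall eps, 0 < eps -> exists X, forall x, X <= x -> Cmod (f x) < eps) ->
  tends1 (fun x => cexp (f x)).
Proof.
  intros H eps He.
  assert (Hc : ccont cexp 0%C) by (apply (cder_ccont _ _ _ (cder_cexp 0%C))).
  apply continuous_Cmod with (eps := eps) in Hc; [|exact He].
  apply locally_Cmod in Hc. destruct Hc as [d [Hd K]].
  destruct (H d Hd) as [X L]. exists X. intros x Hx. specialize (K (f x)).
  replace (f x - 0)%C with (f x) in K by ring. rewrite cexp_0 in K. left. apply K, L, Hx.
Qed.

Lemma tends1_sfac p q v : 0 < q -> tends1 (fun x => sfac p q (x, v)).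
Proof.
  intros Hq eps He. pose proof PI_RGT_0.
  destruct (exp_small (2 * PI / q) eps) as [X [HX K]]; [apply Rdiv_lt_0_compat; lra|exact He|].
  exists X. intros x Hx. unfold sfac.
  replace (1 + cexp (- (2 * PI * ((x, v) + Ci * p / 2) / q)) - 1)%C
    with (cexp (- (2 * PI * ((x, v) + Ci * p / 2) / q)))%C by ring.
  rewrite Cmod_cexp, sfac_re by exact Hq. simpl. left. apply K, Hx.
Qed.

(** * Contours that bend upwards on the right *)

(** The integral of h along the vertical segment from (T, c0) to (T, C0),
    followed by the horizontal half-line from (T, C0) to the right. *)
Definition RP (h : C -> C) (T c0 C0 : R) : C :=
  (Ci * vint h T c0 C0 + IL (fun t => h ((T + t)%R, C0)))%C.

Definition rdecay (h : C -> C) (T c d M m : R) : Prop :=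
  0 < m /\ forall x y, T <= x -> c <= y <= d -> Cmod (h (x, y)) <= M * exp (- m * (x - T)).

Definition rholo (h : C -> C) (T c d : R) : Prop :=
  forall x y, T <= x -> c <= y <= d -> holo h (x, y).

Lemma edom_ray h T c M m : rholo h T c c -> rdecay h T c c M m ->
  edom (fun t => h ((T + t)%R, c)) M m.
Proof.
  intros Hh [Hm HM]. split; [exact Hm|]. intros t Ht. split.
  - apply rcont_ray, holo_ccont, Hh; lra.
  - eapply Rle_trans; [apply HM; lra|]. right. do 3 f_equal; ring.
Qed.

Lemma RP_height h T c0 C1 C2 M m : c0 <= C1 -> C1 <= C2 ->
  rholo h T c0 C2 -> rdecay h T C1 C2 M m -> RP h T c0 C1 = RP h T c0 C2.
Proof.
  intros H1 H2 Hh HM. unfold RP.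
  rewrite (vint_Chasles h T c0 C1 C2 H1 H2) by (intros; apply holo_ccont, Hh; lra).
  rewrite (IL_vshift h T C1 C2 M m H2 (proj1 HM)).
  - ring.
  - intros; apply Hh; lra.
  - apply HM.
Qed.

Lemma RP_base h T c0 c1 C0 : c0 <= c1 -> c1 <= C0 -> rholo h T c0 C0 ->
  RP h T c0 C0 = (Ci * vint h T c0 c1 + RP h T c1 C0)%C.
Proof.
  intros H1 H2 Hh. unfold RP.
  rewrite (vint_Chasles h T c0 c1 C0 H1 H2) by (intros; apply holo_ccont, Hh; lra). ring.
Qed.

Lemma RP_abscissa h T T' c0 C0 M m : T < T' -> c0 < C0 ->
  rholo h T c0 C0 -> rdecay h T C0 C0 M m ->
  RP h T c0 C0 = (hint h T T' c0 + RP h T' c0 C0)%C.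
Proof.
  intros HT Hc Hh HM. unfold RP.
  assert (R : rect h T T' c0 C0 = 0%C).
  { apply goursat; [exact HT|exact Hc|]. intros x y Hx Hy. apply Hh; lra. }
  unfold rect in R.
  rewrite (IL_Chasles (fun t => h ((T + t)%R, C0)) M m (T' - T)).
  - rewrite (IL_ext _ (fun t => h ((T' + t)%R, C0))) by (intros; do 2 f_equal; ring).
    pose proof (hint_ray h T (T' - T) C0 ltac:(lra) ltac:(intros; apply holo_ccont, Hh; lra)) as E.
    replace (T + (T' - T)) with T' in E by ring. rewrite <- E.
    replace (Ci * vint h T c0 C0)%C
      with (Ci * vint h T c0 C0 + (hint h T T' c0 + Ci * vint h T' c0 C0 - hint h T T' C0 - Ci * vint h T c0 C0))%C
      by (rewrite R; ring).
    ring.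
  - lra.
  - apply edom_ray; [|exact HM]. intros x y Hx Hy. apply Hh; lra.
Qed.

Lemma vint_shift h T c d s : c <= d -> (forall y, c + s <= y <= d + s -> ccont h (T, y)) ->
  vint (fun z => h (z + Ci * s)%C) T c d = vint h T (c + s) (d + s).
Proof.
  intros Hcd Hc. unfold vint.
  transitivity (CRI (fun t => (fun y => h (T, y)) (t + s)) c d).
  - apply CRI_ext; [exact Hcd|]. intros t _. f_equal. apply C_eq; simpl; ring.
  - apply (CRI_shift (fun y => h (T, y))); [exact Hcd|]. intros t Ht. apply rcont_v, Hc, Ht.
Qed.

Lemma RP_shift h T c0 C0 s : c0 <= C0 -> rholo h T (c0 + s) (C0 + s) ->
  RP (fun z => h (z + Ci * s)%C) T c0 C0 = RP h T (c0 + s) (C0 + s).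
Proof.
  intros Hc Hh. unfold RP. rewrite vint_shift; [|exact Hc|intros; apply holo_ccont, Hh; lra].
  do 2 f_equal. apply functional_extensionality. intros t. f_equal. apply C_eq; simpl; ring.
Qed.

Lemma RP_ext f g T c0 C0 : c0 <= C0 -> (forall z, T <= Re z -> f z = g z) ->
  RP f T c0 C0 = RP g T c0 C0.
Proof.
  intros Hc H. unfold RP, vint. f_equal; [f_equal; apply CRI_ext; [exact Hc|]|apply IL_ext].
  - intros t _. apply H. simpl. lra.
  - intros t Ht. apply H. simpl. lra.
Qed.

Lemma RP_comb f g T c0 C0 M m M' m' k c : c0 <= C0 ->
  rholo f T c0 C0 -> rholo g T c0 C0 -> rdecay f T C0 C0 M m -> rdecay g T C0 C0 M' m' ->
  RP (fun z => k * (f z + c * g z))%C T c0 C0 = (k * (RP f T c0 C0 + c * RP g T c0 C0))%C.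
Proof.
  intros Hc Hf Hg Df Dg. unfold RP, vint.
  assert (Cf : forall t, c0 <= t <= C0 -> rcont (fun s => f (T, s)) t)
    by (intros; apply rcont_v, holo_ccont, Hf; lra).
  assert (Cg : forall t, c0 <= t <= C0 -> rcont (fun s => g (T, s)) t)
    by (intros; apply rcont_v, holo_ccont, Hg; lra).
  rewrite (CRI_scal k (fun s => f (T, s) + c * g (T, s))%C); [|exact Hc|].
  2: { intros t Ht. apply cont_plus; [apply Cf; exact Ht|].
       apply cont_mult; [apply cont_const|apply Cg; exact Ht]. }
  rewrite (CRI_plus (fun s => f (T, s)) (fun s => c * g (T, s))%C); [|exact Hc|exact Cf|].
  2: { intros t Ht. apply cont_mult; [apply cont_const|apply Cg; exact Ht]. }
  rewrite (CRI_scal c (fun s => g (T, s))); [|exact Hc|exact Cg].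
  pose proof (edom_ray f T C0 M m ltac:(intros x y Hx Hy; apply Hf; lra) Df) as Ef.
  pose proof (edom_ray g T C0 M' m' ltac:(intros x y Hx Hy; apply Hg; lra) Dg) as Eg.
  assert (E : IL (fun t => k * (f ((T + t)%R, C0) + c * g ((T + t)%R, C0)))%C
     = (k * (IL (fun t => f ((T + t)%R, C0)) + c * IL (fun t => g ((T + t)%R, C0))))%C).
  { rewrite (IL_ext _ (fun t => k * f ((T + t)%R, C0) + (k * c) * g ((T + t)%R, C0))%C) by (intros; ring).
    assert (Ekf : edom (fun t => k * f ((T + t)%R, C0))%C (Cmod k * M) m).
    { split; [apply Ef|]. intros t Ht. destruct (proj2 Ef t Ht) as [E1 E2]. split.
      - apply cont_mult; [apply cont_const|exact E1].
      - rewrite Cmod_mult, Rmult_assoc. apply Rmult_le_compat_l; [apply Cmod_ge_0|exact E2]. }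
    rewrite (IL_comb _ _ _ _ _ _ (k * c)%C Ekf Eg), (IL_scal _ _ _ k Ef). ring. }
  rewrite E. ring.
Qed.

Lemma hint_comb f g T c k cc : 0 <= T ->
  (forall x, - T <= x <= T -> ccont f (x, c)) -> (forall x, - T <= x <= T -> ccont g (x, c)) ->
  hint (fun z => k * (f z + cc * g z))%C (- T) T c = (k * (hint f (- T) T c + cc * hint g (- T) T c))%C.
Proof.
  intros HT Hf Hg. unfold hint.
  assert (Cf : forall t, - T <= t <= T -> rcont (fun s => f (s, c)) t)
    by (intros; apply rcont_h, Hf; lra).
  assert (Cg : forall t, - T <= t <= T -> rcont (fun s => g (s, c)) t)
    by (intros; apply rcont_h, Hg; lra).
  rewrite (CRI_scal k (fun s => f (s, c) + cc * g (s, c))%C); [|lra|].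
  2: { intros t Ht. apply cont_plus; [apply Cf; exact Ht|].
       apply cont_mult; [apply cont_const|apply Cg; exact Ht]. }
  rewrite (CRI_plus (fun s => f (s, c)) (fun s => cc * g (s, c))%C); [|lra|exact Cf|].
  2: { intros t Ht. apply cont_mult; [apply cont_const|apply Cg; exact Ht]. }
  rewrite (CRI_scal cc (fun s => g (s, c))); [|lra|exact Cg]. reflexivity.
Qed.

(** * The Toda integral *)

(** The integrand of the Toda integral. *)
Definition fI (p q : R) (u y z : C) : C :=
  (hGR p q (z + u) * hGR p q (- z + u) * cexp (Ci * alpha p q * z * y))%C.

(** The contour runs along [- T, T]; on the right it rises to height C0, on the
    left it descends to height - C0. The left part is the right part for - y, as
    fI_opp shows. *)
Definition J (p q T C0 : R) (u y : C) : C :=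
  (hint (fI p q u y) (- T) T 0 + RP (fI p q u y) T 0 C0 + RP (fI p q u (- y)) T 0 C0)%C.

(** The values of T and C0 do not matter once they are large (It_eq); these are
    large enough. *)
Definition It (p q : R) (u y : C) : C :=
  J p q (Rabs (Re u) + 1) (Rabs (Im u) + Rabs (Im y) + 1) u y.

Section Toda.
Variables p q : R.
Hypothesis Hp : 0 < p.
Hypothesis Hq : 0 < q.
Let a := amean p q.
Let al := alpha p q.

Lemma al_pos : 0 < al.
Proof.
  unfold al, alpha. pose proof PI_RGT_0. apply Rdiv_lt_0_compat; [lra|].
  apply Rmult_lt_0_compat; assumption.
Qed.

Lemma fI_opp u y z : fI p q u y (- z)%C = fI p q u (- y)%C z.
Proof.
  unfold fI. replace (- - z)%C with z by ring.
  replace (Ci * alpha p q * - z * y)%C with (Ci * alpha p q * z * - y)%C by ring. ring.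
Qed.

Lemma holo_fI u y z : gam_dom p q (z + u)%C -> gam_dom p q (- z + u)%C -> holo (fI p q u y) z.
Proof.
  intros H1 H2. unfold fI. apply holo_mult; [apply holo_mult|].
  - apply (holo_comp (hGR p q) (fun z => z + u)%C); [apply holo_hGR; assumption|holo_auto].
  - apply (holo_comp (hGR p q) (fun z => - z + u)%C); [apply holo_hGR; assumption|holo_auto].
  - holo_auto.
Qed.

Lemma dom_right u x s : Rabs (Re u) < x ->
  gam_dom p q ((x, s) + u)%C /\ gam_dom p q (- (x, s) + u)%C.
Proof.
  intros H. apply Rabs_def2 in H.
  split; left; [rewrite Re_plus|rewrite Re_plus, Re_opp]; simpl in *; lra.
Qed.

Lemma rholo_fI u y T c d : Rabs (Re u) < T -> rholo (fI p q u y) T c d.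
Proof.
  intros H x s Hx Hs. apply holo_fI; apply dom_right; lra.
Qed.

Lemma holo_fI_line u y x : - a < Im u -> holo (fI p q u y) (x, 0).
Proof.
  intros H. apply holo_fI; right; fold a; reim; simpl; lra.
Qed.

Lemma Cmod_gref w : Cmod (gref p q w) = exp (- al * (Re w * Im w)).
Proof.
  unfold gref. fold al. rewrite Cmod_cexp. f_equal.
  rewrite Re_plus, Re_div_R by lra. reim. field.
Qed.

(** By reflection the second factor behaves like the Gaussian gref, so that on
    the height s the integrand is of the size of exp (- alpha x (s - Im u + Im
    y)). The bound is uniform for u and y in bounded sets, as It_holo requires.
    *)
Lemma fI_decay T x0 A A' Y1 Y2 m0 C2 : 0 < x0 -> 0 < m0 -> exists M, 0 <= M /\
  forall u y x s, Rabs (Re u) <= T - x0 -> Im u <= A -> - A' <= Im u -> Rabs (Im y) <= Y1 ->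
    Rabs (Re y) <= Y2 -> T <= x -> Rabs s <= C2 -> A + Y1 + m0 <= s ->
    Cmod (fI p q u y (x, s)) <= M * exp (- (al * m0) * (x - T)).
Proof.
  intros Hx0 Hm0. pose proof al_pos as Hal.
  destruct (hGR_bounds p q x0 (C2 + Rabs A + Rabs A') Hp Hq Hx0) as [B [HB HBd]].
  exists (B * (B * exp (al * (Rabs T * Y1 + C2 * Y2)))).
  assert (HE : forall x, 0 < exp x) by apply exp_pos.
  split. { repeat apply Rmult_le_pos; try lra. left; apply HE. }
  intros u y x s Hu1 Hu2 Hu3 Hy1 Hy2 Hx Hs1 Hs2.
  pose proof (Rabs_pos (Im y)) as Yp1. pose proof (Rabs_pos (Re y)) as Yp2.
  apply Rabs_le_between in Hu1.
  set (z := (x, s) : C).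
  assert (HA : Rabs (Im u) <= Rabs A + Rabs A').
  { pose proof (Rle_abs A). pose proof (Rle_abs A'). pose proof (Rabs_pos A). pose proof (Rabs_pos A').
    apply Rabs_le; lra. }
  assert (B1 : Cmod (hGR p q (z + u)%C) <= B).
  { apply HBd; [change (x0 <= x + Re u); lra|].
    change (Rabs (s + Im u) <= C2 + Rabs A + Rabs A').
    eapply Rle_trans; [apply Rabs_triang|]. lra. }
  assert (Rw : Re (z - u)%C = x - Re u) by reflexivity.
  assert (Iw : Im (z - u)%C = s - Im u) by reflexivity.
  destruct (HBd (z - u)%C) as [_ B2].
  { rewrite Rw. lra. }
  { rewrite Iw. unfold Rminus. eapply Rle_trans; [apply Rabs_triang|]. rewrite Rabs_Ropp. lra. }
  assert (B3 : Cmod (hGR p q (- z + u)%C) <= B * exp (- al * ((x - Re u) * (s - Im u)))).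
  { pose proof (hGR_reflection p q (z - u)%C Hp Hq ltac:(rewrite Rw; lra)) as R.
    replace (- (z - u))%C with (- z + u)%C in R by ring.
    pose proof (f_equal Cmod R) as R2. rewrite Cmod_mult, Cmod_gref, Rw, Iw in R2.
    rewrite <- R2.
    set (g1 := Cmod (hGR p q (z - u)%C)) in *. set (g2 := Cmod (hGR p q (- z + u)%C)).
    assert (0 <= g2) by apply Cmod_ge_0.
    assert (1 <= B * g1).
    { apply (Rmult_le_compat_l B) in B2; [|lra]. rewrite Rinv_r in B2 by lra. exact B2. }
    nra. }
  assert (B4 : Cmod (cexp (Ci * alpha p q * z * y)) = exp (- al * (x * Im y + s * Re y))).
  { rewrite Cmod_cexp. f_equal. unfold z. fold al. destruct y as [y1 y2]. simpl. ring. }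
  unfold fI. rewrite Cmod_mult, B4.
  eapply Rle_trans.
  { apply Rmult_le_compat_r; [left; apply HE|]. apply Cmod_mult_le; [exact B1|exact B3]. }
  replace (B * (B * exp (- al * ((x - Re u) * (s - Im u)))) * exp (- al * (x * Im y + s * Re y)))
    with (B * (B * (exp (- al * ((x - Re u) * (s - Im u))) * exp (- al * (x * Im y + s * Re y))))) by ring.
  replace (B * (B * exp (al * (Rabs T * Y1 + C2 * Y2))) * exp (- (al * m0) * (x - T)))
    with (B * (B * (exp (al * (Rabs T * Y1 + C2 * Y2)) * exp (- (al * m0) * (x - T))))) by ring.
  rewrite <- !exp_plus.
  apply Rmult_le_compat_l; [lra|]. apply Rmult_le_compat_l; [lra|]. apply exp_le_mono.
  assert (K : - ((x - Re u) * (s - Im u) + (x * Im y + s * Re y))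
     <= (Rabs T * Y1 + C2 * Y2) - m0 * (x - T)).
  { assert (K1 : (x - T) * (s - Im u) <= (x - Re u) * (s - Im u))
      by (apply Rmult_le_compat_r; lra).
    assert (K2 : (x - T) * (A + Y1 + m0 - A) <= (x - T) * (s - Im u))
      by (apply Rmult_le_compat_l; lra).
    assert (K3 : - (x * Im y) <= (x - T) * Y1 + Rabs T * Y1).
    { pose proof (Rle_abs (- Im y)) as Q. rewrite Rabs_Ropp in Q.
      pose proof (Rle_abs (- (T * Im y))) as Q2. rewrite Rabs_Ropp, Rabs_mult in Q2.
      assert ((x - T) * - Im y <= (x - T) * Y1) by (apply Rmult_le_compat_l; lra).
      assert (Rabs T * Rabs (Im y) <= Rabs T * Y1) by (apply Rmult_le_compat_l; [apply Rabs_pos|lra]).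
      lra. }
    assert (K4 : - (s * Re y) <= C2 * Y2).
    { pose proof (Rle_abs (- (s * Re y))) as Q. rewrite Rabs_Ropp, Rabs_mult in Q.
      assert (Rabs s * Rabs (Re y) <= C2 * Y2) by (apply Rmult_le_compat; try apply Rabs_pos; lra).
      lra. }
    lra. }
  apply (Rmult_le_compat_l al) in K; [|lra]. lra.
Qed.

Lemma rdecay_fI u y T c d : Rabs (Re u) < T -> c <= d -> Im u + Rabs (Im y) < c ->
  exists M m, rdecay (fI p q u y) T c d M m.
Proof.
  intros HT Hcd Hc.
  destruct (fI_decay T (T - Rabs (Re u)) (Im u) (- Im u) (Rabs (Im y)) (Rabs (Re y))
    (c - (Im u + Rabs (Im y))) (Rabs c + Rabs d)) as [M [HM H]]; [lra|lra|].
  exists M, (al * (c - (Im u + Rabs (Im y)))). split.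
  - apply Rmult_lt_0_compat; [apply al_pos|lra].
  - intros x s Hx Hs. apply H; try lra.
    pose proof (Rle_abs d). pose proof (Rle_abs (- c)) as Q. rewrite Rabs_Ropp in Q.
    pose proof (Rabs_pos c). pose proof (Rabs_pos d). apply Rabs_le; lra.
Qed.

Lemma J_height u y T C1 C2 : - a < Im u -> Rabs (Re u) < T ->
  Rabs (Im u) + Rabs (Im y) < C1 -> C1 <= C2 -> J p q T C1 u y = J p q T C2 u y.
Proof.
  intros Hu HT H1 H2. unfold J.
  pose proof (Rabs_pos (Im u)). pose proof (Rabs_pos (Im y)). pose proof (Rle_abs (Im u)).
  destruct (rdecay_fI u y T C1 C2) as [M [m D]]; try lra.
  destruct (rdecay_fI u (- y)%C T C1 C2) as [M' [m' D']]; try (rewrite ?Im_opp, ?Rabs_Ropp; lra).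
  rewrite (RP_height (fI p q u y) T 0 C1 C2 M m), (RP_height (fI p q u (- y)) T 0 C1 C2 M' m');
    try lra; try assumption; try (apply rholo_fI; exact HT). reflexivity.
Qed.

Lemma hint_fI_opp u y b c : b <= c -> - a < Im u ->
  hint (fI p q u y) (- c) (- b) 0 = hint (fI p q u (- y)) b c 0.
Proof.
  intros Hbc Hu. unfold hint.
  rewrite <- (CRI_neg (fun t => fI p q u y (t, 0))); [|exact Hbc|].
  - apply CRI_ext; [exact Hbc|]. intros t _. rewrite <- fI_opp. f_equal. apply C_eq; simpl; ring.
  - intros t _. apply rcont_h, holo_ccont, holo_fI_line, Hu.
Qed.

Lemma J_abscissa u y T T' C0 : - a < Im u -> Rabs (Re u) < T -> T <= T' ->
  Rabs (Im u) + Rabs (Im y) < C0 -> J p q T C0 u y = J p q T' C0 u y.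
Proof.
  intros Hu HT [HT'| ->] HC; [|reflexivity]. unfold J.
  pose proof (Rabs_pos (Im u)). pose proof (Rabs_pos (Im y)). pose proof (Rle_abs (Im u)).
  pose proof (Rabs_pos (Re u)).
  destruct (rdecay_fI u y T C0 C0) as [M [m D]]; try lra.
  destruct (rdecay_fI u (- y)%C T C0 C0) as [M' [m' D']]; try (rewrite ?Im_opp, ?Rabs_Ropp; lra).
  rewrite (RP_abscissa (fI p q u y) T T' 0 C0 M m HT' ltac:(lra) (rholo_fI u y T 0 C0 HT) D).
  rewrite (RP_abscissa (fI p q u (- y)) T T' 0 C0 M' m' HT' ltac:(lra) (rholo_fI u (- y) T 0 C0 HT) D').
  assert (Cc : forall b c x, b <= x <= c -> ccont (fI p q u y) (x, 0))
    by (intros; apply holo_ccont, holo_fI_line, Hu).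
  rewrite (hint_Chasles (fI p q u y) (- T') (- T) T' 0) by (try lra; apply Cc).
  rewrite (hint_Chasles (fI p q u y) (- T) T T' 0) by (try lra; apply Cc).
  rewrite (hint_fI_opp u y T T') by (try assumption; lra). ring.
Qed.

Lemma It_eq u y T C0 : - a < Im u -> Rabs (Re u) < T ->
  Rabs (Im u) + Rabs (Im y) < C0 -> It p q u y = J p q T C0 u y.
Proof.
  intros Hu HT HC. unfold It.
  set (T0 := Rabs (Re u) + 1). set (C1 := Rabs (Im u) + Rabs (Im y) + 1).
  rewrite (J_height u y T0 C1 (Rmax C1 C0)) by (try assumption; unfold T0, C1; try lra; apply Rmax_l).
  rewrite (J_abscissa u y T0 (Rmax T0 T) (Rmax C1 C0));
    [|exact Hu|unfold T0; lra|apply Rmax_l|eapply Rlt_le_trans; [exact HC|apply Rmax_r]].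
  rewrite (J_height u y T C0 (Rmax C1 C0)) by (try assumption; apply Rmax_r).
  rewrite (J_abscissa u y T (Rmax T0 T) (Rmax C1 C0));
    [reflexivity|exact Hu|exact HT|apply Rmax_r|eapply Rlt_le_trans; [exact HC|apply Rmax_r]].
Qed.

Lemma It_even u y : - a < Im u -> It p q u (- y)%C = It p q u y.
Proof.
  intros Hu.
  rewrite (It_eq u (- y)%C (Rabs (Re u) + 1) (Rabs (Im u) + Rabs (Im y) + 1)) by
    (try exact Hu; rewrite ?Im_opp, ?Rabs_Ropp; lra).
  unfold It, J. replace (- - y)%C with y by ring.
  pose proof (hint_fI_opp u y (- (Rabs (Re u) + 1)) (Rabs (Re u) + 1)) as E.
  rewrite Ropp_involutive in E. rewrite <- E; [ring| |exact Hu].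
  pose proof (Rabs_pos (Re u)). lra.
Qed.
End Toda.

(** * Analyticity of the Toda integral *)

(** Boundedness passes from quarters to the whole and holds near every point. *)
Lemma cont_bounded_rect f a b c d : a < b -> c < d -> on_rect a b c d (ccont f) ->
  exists M, on_rect a b c d (fun z => Cmod (f z) <= M).
Proof.
  intros Hab Hcd Hf.
  apply (bisection (fun a b c d => exists M, on_rect a b c d (fun z => Cmod (f z) <= M)) a b c d Hab Hcd).
  - intros a1 b1 c1 d1 _ _ _ _ _ _ [M1 H1] [M2 H2] [M3 H3] [M4 H4].
    exists (Rmax (Rmax M1 M2) (Rmax M3 M4)). intros x y Hx Hy.
    pose proof (Rmax_l M1 M2). pose proof (Rmax_r M1 M2). pose proof (Rmax_l M3 M4).
    pose proof (Rmax_r M3 M4). pose proof (Rmax_l (Rmax M1 M2) (Rmax M3 M4)).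
    pose proof (Rmax_r (Rmax M1 M2) (Rmax M3 M4)).
    destruct (Rle_dec x ((a1 + b1) / 2)), (Rle_dec y ((c1 + d1) / 2)).
    + pose proof (H1 x y ltac:(lra) ltac:(lra)). cbv beta in *. lra.
    + pose proof (H3 x y ltac:(lra) ltac:(lra)). cbv beta in *. lra.
    + pose proof (H2 x y ltac:(lra) ltac:(lra)). cbv beta in *. lra.
    + pose proof (H4 x y ltac:(lra) ltac:(lra)). cbv beta in *. lra.
  - intros x y Hx Hy. pose proof (Hf x y Hx Hy) as Hc.
    apply continuous_Cmod with (eps := 1) in Hc; [|lra].
    apply locally_Cmod in Hc. destruct Hc as [dl [Hdl K]].
    exists (dl / 2). split; [lra|]. intros a1 b1 c1 d1 _ A1 _ _ A2 _ _ _ A3 A4.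
    exists (Cmod (f (x, y)) + 1). intros u v Hu Hv.
    assert (Hd : Cmod ((u, v) - (x, y))%C < dl).
    { eapply Rle_lt_trans; [apply Cmod_le_re_im|]. simpl.
      assert (Rabs (u + - x) < dl / 2) by (apply Rabs_def1; lra).
      assert (Rabs (v + - y) < dl / 2) by (apply Rabs_def1; lra). lra. }
    specialize (K _ Hd).
    pose proof (Cmod_triangle (f (u, v) - f (x, y))%C (f (x, y))) as T.
    replace (f (u, v) - f (x, y) + f (x, y))%C with (f (u, v)) in T by ring. lra.
Qed.

Section Analytic.
Variables p q : R.
Hypothesis Hp : 0 < p.
Hypothesis Hq : 0 < q.
Let a := amean p q.
Let al := alpha p q.

Lemma hGR_bounded_rect x1 x2 y1 y2 : x1 < x2 -> y1 < y2 ->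
  (0 < x1 \/ x2 < 0 \/ - a < y1) ->
  exists M, 0 <= M /\ on_rect x1 x2 y1 y2 (fun z => Cmod (hGR p q z) <= M).
Proof.
  intros Hx Hy H.
  destruct (cont_bounded_rect (hGR p q) x1 x2 y1 y2 Hx Hy) as [M HM].
  - intros x y H1 H2. apply holo_ccont, holo_hGR; try assumption.
    destruct H as [H|[H|H]]; [left|left|right]; simpl; unfold a in *; lra.
  - exists M. split; [|exact HM].
    eapply Rle_trans; [apply Cmod_ge_0|]. apply (HM x1 y1); lra.
Qed.

(** The arguments u and y of the Toda integral vary with v; near p0 they stay within
    bounds for which a single contour serves. *)
Variables (U Y : C -> C) (p0 : C) (r : R) (x0 A A' Y1 Y2 T C0 : R).
Hypothesis HU : forall v, holo U v.
Hypothesis HY : forall v, holo Y v.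
Hypothesis Hr : 0 < r.
Hypothesis Hx0 : 0 < x0.
Hypothesis HT : 0 < T.
Hypothesis HC0 : A + Y1 + 1 <= C0.
Hypothesis HC0' : 0 < C0.
Hypothesis HA : - A' < A.
Hypothesis HU1 : forall v, in_square p0 r v -> Rabs (Re (U v)) <= T - x0.
Hypothesis HU2 : forall v, in_square p0 r v -> - A' <= Im (U v) <= A.
Hypothesis HU3 : - a < - A'.
Hypothesis HY1 : forall v, in_square p0 r v -> Rabs (Im (Y v)) <= Y1.
Hypothesis HY2 : forall v, in_square p0 r v -> Rabs (Re (Y v)) <= Y2.

Lemma holo_fI_param z v :
  gam_dom p q (z + U v)%C -> gam_dom p q (- z + U v)%C -> holo (fun v => fI p q (U v) (Y v) z) v.
Proof.
  intros H1 H2. unfold fI. pose proof (HU v). pose proof (HY v).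
  apply holo_mult; [apply holo_mult|].
  - apply (holo_comp (hGR p q) (fun v => z + U v)%C); [apply holo_hGR; assumption|].
    apply (holo_plus (fun _ => z) U); [apply holo_const|assumption].
  - apply (holo_comp (hGR p q) (fun v => - z + U v)%C); [apply holo_hGR; assumption|].
    apply (holo_plus (fun _ => - z)%C U); [apply holo_const|assumption].
  - apply (holo_cexp (fun v => Ci * alpha p q * z * Y v)%C).
    apply (holo_mult (fun _ => Ci * alpha p q * z)%C Y); [apply holo_const|assumption].
Qed.

Lemma exp_factor_bound z v : in_square p0 r v -> Rabs (Re z) <= T -> Rabs (Im z) <= C0 ->
  Cmod (cexp (Ci * alpha p q * z * Y v))%C <= exp (al * (T * Y1 + C0 * Y2)).
Proof.
  intros Hv H1 H2. rewrite Cmod_cexp. apply exp_le_mono. fold al.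
  pose proof (HY1 v Hv) as B1. pose proof (HY2 v Hv) as B2.
  pose proof (al_pos p q Hp Hq) as Hal. fold al in Hal.
  replace (Re (Ci * al * z * Y v)%C) with (al * - (Re z * Im (Y v) + Im z * Re (Y v)))
    by (reim; ring).
  apply Rmult_le_compat_l; [lra|].
  assert (K1 : - (Re z * Im (Y v)) <= T * Y1).
  { pose proof (Rle_abs (- (Re z * Im (Y v)))) as Q. rewrite Rabs_Ropp, Rabs_mult in Q.
    assert (Rabs (Re z) * Rabs (Im (Y v)) <= T * Y1) by (apply Rmult_le_compat; try apply Rabs_pos; lra). lra. }
  assert (K2 : - (Im z * Re (Y v)) <= C0 * Y2).
  { pose proof (Rle_abs (- (Im z * Re (Y v)))) as Q. rewrite Rabs_Ropp, Rabs_mult in Q.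
    assert (Rabs (Im z) * Rabs (Re (Y v)) <= C0 * Y2) by (apply Rmult_le_compat; try apply Rabs_pos; lra). lra. }
  lra.
Qed.

Lemma HReU v : in_square p0 r v -> - (T - x0) <= Re (U v) <= T - x0.
Proof. intros Hv. apply Rabs_le_between. apply HU1; exact Hv. Qed.

Lemma in_square_center : in_square p0 r p0.
Proof. split; lra. Qed.

Lemma holo_hint_param : holo (fun v => hint (fI p q (U v) (Y v)) (- T) T 0) p0.
Proof.
  pose proof (HReU p0 in_square_center) as HR0.
  destruct (hGR_bounded_rect (- (2 * T)) (2 * T) (- A') A) as [M [HM HMb]];
    [lra|lra|right; right; lra|].
  assert (Hdom : forall v t, in_square p0 r v -> gam_dom p q ((t, 0%R) + U v)%C /\ gam_dom p q (- (t, 0%R) + U v)%C).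
  { intros v t Hv. pose proof (HU2 v Hv). fold a in HU3. split; right; fold a; reim; simpl; lra. }
  unfold hint.
  apply (param_holo _ _ _ _ (bounded_functional_CRI (- T) T ltac:(lra))
    (fun v t => fI p q (U v) (Y v) (t, 0)) p0 r (M * M * exp (al * (T * Y1 + C0 * Y2))) Hr).
  - intros v t Hv _. apply rcont_h, holo_ccont, holo_fI; try assumption; apply Hdom; exact Hv.
  - intros v t Hv _. apply holo_fI_param; apply Hdom; exact Hv.
  - intros v t Hv Ht. rewrite Rmult_1_r. unfold fI.
    pose proof (HReU v Hv) as Rv. pose proof (HU2 v Hv) as Iv.
    apply Cmod_mult_le; [apply Cmod_mult_le|].
    + replace ((t, 0) + U v)%C with ((t + Re (U v), Im (U v)) : C)
        by (apply C_eq; reim; simpl; ring).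
      apply HMb; lra.
    + replace (- (t, 0) + U v)%C with ((- t + Re (U v), Im (U v)) : C)
        by (apply C_eq; reim; simpl; ring).
      apply HMb; lra.
    + apply exp_factor_bound; [exact Hv|simpl; apply Rabs_le; lra|simpl; rewrite Rabs_R0; lra].
Qed.

Lemma holo_RP_param : holo (fun v => RP (fI p q (U v) (Y v)) T 0 C0) p0.
Proof.
  pose proof (HReU p0 in_square_center) as HR0.
  pose proof (al_pos p q Hp Hq) as Hal. fold al in Hal.
  assert (Hdom : forall v t s, T <= t -> in_square p0 r v ->
     gam_dom p q ((t, s) + U v)%C /\ gam_dom p q (- (t, s) + U v)%C).
  { intros v t s Ht Hv. apply dom_right. pose proof (HU1 v Hv). lra. }
  unfold RP. apply holo_plus; [apply (holo_mult (fun _ => Ci)); [apply holo_const|]|].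
  - destruct (hGR_bounded_rect x0 (2 * T) (- A') (C0 + A)) as [M [HM HMb]]; [lra|lra|left; lra|].
    destruct (hGR_bounded_rect (- (2 * T)) (- x0) (- C0 - A') A) as [M' [HM' HMb']]; [lra|lra|right; left; lra|].
    unfold vint.
    apply (param_holo _ _ _ _ (bounded_functional_CRI 0 C0 ltac:(lra))
      (fun v s => fI p q (U v) (Y v) (T, s)) p0 r (M * M' * exp (al * (T * Y1 + C0 * Y2))) Hr).
    + intros v t Hv _. apply rcont_v, holo_ccont, holo_fI; try assumption; apply Hdom; try exact Hv; lra.
    + intros v t Hv _. apply holo_fI_param; apply Hdom; try exact Hv; lra.
    + intros v t Hv Ht. rewrite Rmult_1_r. unfold fI.
      pose proof (HReU v Hv) as Rv. pose proof (HU2 v Hv) as Iv.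
      apply Cmod_mult_le; [apply Cmod_mult_le|].
      * replace ((T, t) + U v)%C with ((T + Re (U v), t + Im (U v)) : C)
          by (apply C_eq; reim; simpl; ring).
        apply HMb; lra.
      * replace (- (T, t) + U v)%C with ((- T + Re (U v), - t + Im (U v)) : C)
          by (apply C_eq; reim; simpl; ring).
        apply HMb'; lra.
      * apply exp_factor_bound; [exact Hv|simpl; apply Rabs_le; lra|simpl; apply Rabs_le; lra].
  - destruct (fI_decay p q Hp Hq T x0 A A' Y1 Y2 1 C0 Hx0 ltac:(lra)) as [M [HM HMb]].
    fold al in HMb. assert (Hm : 0 < al * 1) by lra.
    apply (param_holo _ _ _ _ (bounded_functional_IL (al * 1) Hm)
      (fun v t => fI p q (U v) (Y v) ((T + t)%R, C0)) p0 r M Hr).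
    + intros v t Hv Ht. apply rcont_ray, holo_ccont, holo_fI; try assumption; apply Hdom; try exact Hv; lra.
    + intros v t Hv Ht. apply holo_fI_param; apply Hdom; try exact Hv; lra.
    + intros v t Hv Ht. eapply Rle_trans.
      * apply HMb; try lra; try (apply HU1; exact Hv); try (apply HU2; exact Hv);
          [apply HY1; exact Hv|apply HY2; exact Hv|rewrite Rabs_pos_eq; lra].
      * right. do 3 f_equal. ring.
Qed.
End Analytic.

(** Near p0 one contour serves for all parameters; param_holo applies to its
    three parts. *)
Theorem It_holo p q (U Y : C -> C) p0 : 0 < p -> 0 < q ->
  (forall v, holo U v) -> (forall v, holo Y v) -> - amean p q < Im (U p0) ->
  holo (fun v => It p q (U v) (Y v)) p0.
Proof.
  intros Hp Hq HU HY Hu.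
  set (a := amean p q) in *.
  (* within e of U p0 the values of U stay above - a *)
  set (e := Rmin (/ 2) ((Im (U p0) + a) / 2)).
  assert (He : 0 < e) by (apply Rmin_pos; lra).
  assert (He1 : e <= / 2) by apply Rmin_l. assert (He2 : e <= (Im (U p0) + a) / 2) by apply Rmin_r.
  pose proof (holo_ccont _ _ (HU p0)) as CU. pose proof (holo_ccont _ _ (HY p0)) as CY.
  apply continuous_Cmod with (eps := e) in CU; [|exact He].
  apply continuous_Cmod with (eps := 1) in CY; [|lra].
  apply locally_Cmod in CU. destruct CU as [d1 [Hd1 K1]].
  apply locally_Cmod in CY. destruct CY as [d2 [Hd2 K2]].
  set (r := Rmin (d1 / 3) (d2 / 3)).
  assert (Hr : 0 < r) by (apply Rmin_pos; lra).
  assert (Hr1 : r <= d1 / 3) by apply Rmin_l. assert (Hr2 : r <= d2 / 3) by apply Rmin_r.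
  assert (Hsq : forall v, in_square p0 r v -> Cmod (v - p0)%C <= 2 * r).
  { intros v [V1 V2]. eapply Rle_trans; [apply Cmod_le_re_im|]. rewrite Re_minus, Im_minus.
    assert (Rabs (Re v - Re p0) <= r) by (apply Rabs_le; lra).
    assert (Rabs (Im v - Im p0) <= r) by (apply Rabs_le; lra). lra. }
  set (u0 := U p0) in *. set (y0 := Y p0) in *.
  assert (BU : forall v, in_square p0 r v -> Rabs (Re (U v) - Re u0) <= e /\ Rabs (Im (U v) - Im u0) <= e).
  { intros v Hv. pose proof (Hsq v Hv). specialize (K1 v ltac:(lra)). split.
    - eapply Rle_trans; [apply (re_le_Cmod (U v - u0)%C)|lra].
    - eapply Rle_trans; [apply (im_le_Cmod (U v - u0)%C)|lra]. }
  assert (BY : forall v, in_square p0 r v -> Rabs (Re (Y v) - Re y0) <= 1 /\ Rabs (Im (Y v) - Im y0) <= 1).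
  { intros v Hv. pose proof (Hsq v Hv). specialize (K2 v ltac:(lra)). split.
    - eapply Rle_trans; [apply (re_le_Cmod (Y v - y0)%C)|lra].
    - eapply Rle_trans; [apply (im_le_Cmod (Y v - y0)%C)|lra]. }
  assert (tri : forall s t c, Rabs (s - t) <= c -> Rabs s <= Rabs t + c).
  { intros s t c H. pose proof (Rabs_triang (s - t) t) as Q. replace (s - t + t) with s in Q by ring. lra. }
  pose proof (Rabs_pos (Re u0)). pose proof (Rabs_pos (Im y0)). pose proof (Rabs_pos (Im u0)).
  set (T := Rabs (Re u0) + 2). set (A := Rabs (Im u0) + 1). set (A' := - (Im u0 - e)).
  set (Y1 := Rabs (Im y0) + 1). set (Y2 := Rabs (Re y0) + 1). set (C0 := A + Y1 + 1).
  pose proof (Rle_abs (Im u0)). pose proof (Rle_abs (- Im u0)) as Q0. rewrite Rabs_Ropp in Q0.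
  assert (G1 : forall v, in_square p0 r v -> Rabs (Re (U v)) <= T - 1).
  { intros v Hv. pose proof (tri _ _ _ (proj1 (BU v Hv))). unfold T. lra. }
  assert (G2 : forall v, in_square p0 r v -> - A' <= Im (U v) <= A).
  { intros v Hv. pose proof (proj2 (BU v Hv)) as B. apply Rabs_le_between in B. unfold A, A'. lra. }
  assert (G3 : forall v, in_square p0 r v -> Rabs (Im (Y v)) <= Y1).
  { intros v Hv. exact (tri _ _ _ (proj2 (BY v Hv))). }
  assert (G4 : forall v, in_square p0 r v -> Rabs (Re (Y v)) <= Y2).
  { intros v Hv. exact (tri _ _ _ (proj1 (BY v Hv))). }
  assert (G3' : forall v, in_square p0 r v -> Rabs (Im (- Y v)%C) <= Y1).
  { intros v Hv. rewrite Im_opp, Rabs_Ropp. apply G3; exact Hv. }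
  assert (G4' : forall v, in_square p0 r v -> Rabs (Re (- Y v)%C) <= Y2).
  { intros v Hv. rewrite Re_opp, Rabs_Ropp. apply G4; exact Hv. }
  assert (HY' : forall v, holo (fun v => - Y v)%C v) by (intros v; apply holo_opp, HY).
  apply (holo_ext_loc (fun v => J p q T C0 (U v) (Y v)) _ p0 r Hr).
  - intros v Hv. symmetry.
    assert (Hs : in_square p0 r v).
    { replace v with (p0 + (v - p0))%C by ring. apply in_square_Cmod. lra. }
    pose proof (G2 v Hs). pose proof (G1 v Hs). pose proof (G3 v Hs).
    pose proof (tri _ _ _ (proj2 (BU v Hs))).
    apply It_eq; try assumption; unfold A' in *; fold a; try lra.
    unfold C0, A. lra.
  - assert (F1 : 0 < T) by (unfold T; lra).
    assert (F2 : A + Y1 + 1 <= C0) by (unfold C0; lra).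
    assert (F3 : 0 < C0) by (unfold C0, A, Y1; lra).
    assert (F4 : - A' < A) by (unfold A', A; lra).
    assert (F5 : - a < - A') by (unfold A'; lra).
    unfold J. apply holo_plus; [apply holo_plus|].
    + apply (holo_hint_param p q Hp Hq U Y p0 r 1 A A' Y1 Y2 T C0); try assumption; lra.
    + apply (holo_RP_param p q Hp Hq U Y p0 r 1 A A' Y1 Y2 T C0); try assumption; lra.
    + apply (holo_RP_param p q Hp Hq U (fun v => - Y v)%C p0 r 1 A A' Y1 Y2 T C0); try assumption; lra.
Qed.

(** * The Toda integral on the real line *)

Lemma is_RInt_gen_line (f : R -> C) (l : C) :
  (forall t, rcont f t) ->
  (forall eps, 0 < eps -> exists N, forall a b, a < - N -> N < b -> a <= b ->
     Cmod (CRI f a b - l)%C < eps) ->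
  is_RInt_gen (V := C_R_CompleteNormedModule) f (Rbar_locally m_infty) (Rbar_locally p_infty) l.
Proof.
  intros Hc H P HP. apply locally_Cmod in HP. destruct HP as [eps [He HP]].
  destruct (H eps He) as [N K].
  apply (Filter_prod _ _ _ (fun a => a < - Rmax N 0) (fun b => Rmax N 0 < b)).
  - exists (- Rmax N 0). intros a Ha. exact Ha.
  - exists (Rmax N 0). intros b Hb. exact Hb.
  - intros a b Ha Hb. exists (CRI f a b).
    pose proof (Rmax_l N 0). pose proof (Rmax_r N 0). simpl. split.
    + apply CRI_correct; [lra|]. intros; apply Hc.
    + apply HP. apply K; lra.
Qed.

(** For real y and Im u < 0 the integrand decays on the real line itself, so the
    contour may be lowered back to it. *)
Theorem It_real p q u (y : C) : 0 < p -> 0 < q -> - amean p q < Im u -> Im u < 0 -> Im y = 0 ->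
  is_RInt_gen (V := C_R_CompleteNormedModule) (fun t => fI p q u y (RtoC t))
    (Rbar_locally m_infty) (Rbar_locally p_infty) (It p q u y).
Proof.
  intros Hp Hq Hu1 Hu2 Hy.
  set (T := Rabs (Re u) + 1). set (C0 := Rabs (Im u) + 1).
  assert (HT : Rabs (Re u) < T) by (unfold T; lra).
  pose proof (Rabs_pos (Re u)). pose proof (Rabs_pos (Im u)).
  rewrite (It_eq p q Hp Hq u y T C0 Hu1 HT ltac:(rewrite Hy, Rabs_R0; unfold C0; lra)).
  assert (Dec : forall y', Im y' = 0 -> exists M m, rdecay (fI p q u y') T 0 C0 M m).
  { intros y' Hy'. apply rdecay_fI; try assumption; [unfold C0; lra|rewrite Hy', Rabs_R0; lra]. }
  assert (E : forall y', Im y' = 0 -> RP (fI p q u y') T 0 C0 = IL (fun t => fI p q u y' ((T + t)%R, 0%R))).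
  { intros y' Hy'. destruct (Dec y' Hy') as [M [m D]].
    rewrite <- (RP_height (fI p q u y') T 0 0 C0 M m); try lra; try exact D.
    - unfold RP, vint. rewrite CRI_point. ring.
    - unfold C0; lra.
    - apply rholo_fI; assumption. }
  assert (Ed : forall y', Im y' = 0 -> exists M m, edom (fun t => fI p q u y' ((T + t)%R, 0%R)) M m).
  { intros y' Hy'. destruct (Dec y' Hy') as [M [m [D1 D2]]]. exists M, m. apply edom_ray.
    - apply rholo_fI; assumption.
    - split; [exact D1|]. intros x s Hx Hs. apply D2; [exact Hx|unfold C0; lra]. }
  unfold J. rewrite (E y Hy), (E (- y)%C ltac:(rewrite Im_opp, Hy; ring)).
  assert (Hc : forall y' t, rcont (fun s => fI p q u y' (s, 0)) t)
    by (intros; apply rcont_h, holo_ccont, holo_fI_line; assumption).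
  apply is_RInt_gen_line; [apply Hc|].
  intros eps He.
  destruct (Ed y Hy) as [M [m D]]. destruct (Ed (- y)%C ltac:(rewrite Im_opp, Hy; ring)) as [M' [m' D']].
  destruct (IL_correct _ _ _ D (eps / 3) ltac:(lra)) as [N1 H1].
  destruct (IL_correct _ _ _ D' (eps / 3) ltac:(lra)) as [N2 H2].
  exists (T + Rmax 0 (Rmax N1 N2)). intros b c Hb Hc2 _.
  pose proof (Rmax_l 0 (Rmax N1 N2)). pose proof (Rmax_r 0 (Rmax N1 N2)).
  pose proof (Rmax_l N1 N2). pose proof (Rmax_r N1 N2).
  specialize (H1 (c - T) ltac:(lra)). specialize (H2 (- b - T) ltac:(lra)).
  rewrite <- (hint_ray (fI p q u y) T (c - T) 0) in H1 by
    (try lra; intros; apply holo_ccont, holo_fI_line; assumption).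
  rewrite <- (hint_ray (fI p q u (- y)) T (- b - T) 0) in H2 by
    (try lra; intros; apply holo_ccont, holo_fI_line; assumption).
  replace (T + (c - T)) with c in H1 by ring. replace (T + (- b - T)) with (- b) in H2 by ring.
  change (CRI (fun t => fI p q u y (RtoC t)) b c) with (hint (fI p q u y) b c 0).
  assert (Cc : forall s, ccont (fI p q u y) (s, 0)) by (intros; apply holo_ccont, holo_fI_line; assumption).
  rewrite (hint_Chasles (fI p q u y) b (- T) c 0) by (try lra; intros; apply Cc).
  rewrite (hint_Chasles (fI p q u y) (- T) T c 0) by (try lra; intros; apply Cc).
  pose proof (hint_fI_opp p q Hp Hq u y T (- b) ltac:(lra) Hu1) as Eo.
  rewrite Ropp_involutive in Eo. rewrite Eo.
  set (I1 := IL (fun t => fI p q u y ((T + t)%R, 0%R))) in *.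
  set (I2 := IL (fun t => fI p q u (- y) ((T + t)%R, 0%R))) in *.
  match goal with |- Cmod (?h2 + (?h0 + ?h1) - (?h0 + I1 + I2))%C < _ =>
    replace (h2 + (h0 + h1) - (h0 + I1 + I2))%C with ((h1 - I1) + (h2 - I2))%C by ring end.
  eapply Rle_lt_trans; [apply Cmod_triangle|]. lra.
Qed.

(** * Shifts of the Toda integral *)

Definition Em (b' : R) (y : C) : C := cexp (- (PI * y / b'))%C.
(** sfac b b' u - 1, the coefficient of the shifted term in It_shift. *)
Definition Qf (b b' : R) (u : C) : C := cexp (- (2 * PI * (u + Ci * b / 2) / b'))%C.

Section Shift.
Variables p q b b' : R.
Hypothesis Hp : 0 < p.
Hypothesis Hq : 0 < q.
Hypothesis Hb : 0 < b.
Hypothesis Hb' : 0 < b'.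
Hypothesis Hal : alpha p q = 2 * PI / (b * b').
Hypothesis Hstep : forall w, gam_dom p q w -> hGR p q (w + Ci * b)%C = (sfac b b' w * hGR p q w)%C.

(** The factor sfac from the step of G_R splits into two terms; its exponential
    multiplies exp (i alpha z y) to the same function at y + i b. *)
Lemma fI_shift u y z : gam_dom p q (z + u)%C ->
  fI p q (u + Ci * b / 2)%C y (z + Ci * b / 2)%C
  = (Em b' y * (fI p q u y z + Qf b b' u * fI p q u (y + Ci * b)%C z))%C.
Proof.
  intros Hd. assert (HbC : RtoC b <> 0%C) by (apply RtoC_neq_0; lra).
  assert (HbC' : RtoC b' <> 0%C) by (apply RtoC_neq_0; lra).
  assert (HalC : RtoC (alpha p q) = (2 * PI / (b * b'))%C).
  { rewrite Hal. rewrite RtoC_div by (apply Rmult_integral_contrapositive; lra).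
    rewrite !RtoC_mult. reflexivity. }
  unfold fI.
  replace (z + Ci * b / 2 + (u + Ci * b / 2))%C with (z + u + Ci * b)%C by field.
  replace (- (z + Ci * b / 2) + (u + Ci * b / 2))%C with (- z + u)%C by ring.
  rewrite (Hstep _ Hd), HalC. unfold sfac, Em, Qf.
  replace (cexp (Ci * (2 * PI / (b * b')) * (z + Ci * b / 2) * y))%C
    with (cexp (- (PI * y / b')) * cexp (Ci * (2 * PI / (b * b')) * z * y))%C.
  2: { rewrite <- cexp_plus. f_equal.
       replace (Ci * (2 * PI / (b * b')) * (z + Ci * b / 2) * y)%C
         with (Ci * (2 * PI / (b * b')) * z * y + (Ci * Ci) * (PI * y / b'))%C
         by (field; auto).
       rewrite Ci2. field; auto. }
  replace (cexp (Ci * (2 * PI / (b * b')) * z * (y + Ci * b)))%C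
    with (cexp (Ci * (2 * PI / (b * b')) * z * y) * cexp (- (2 * PI * z / b')))%C.
  2: { rewrite <- cexp_plus. f_equal.
       replace (Ci * (2 * PI / (b * b')) * z * (y + Ci * b))%C
         with (Ci * (2 * PI / (b * b')) * z * y + (Ci * Ci) * (2 * PI * z / b'))%C
         by (field; auto).
       rewrite Ci2. field; auto. }
  replace (cexp (- (2 * PI * (z + u + Ci * b / 2) / b')))%C
    with (cexp (- (2 * PI * (u + Ci * b / 2) / b')) * cexp (- (2 * PI * z / b')))%C.
  2: { rewrite <- cexp_plus. f_equal. field; auto. }
  ring.
Qed.

Lemma vint_reflect f T c : 0 <= c -> (forall s, 0 <= s <= c -> ccont f (- T, s)) ->
  vint (fun z => f (- z)%C) T (- c) 0 = vint f (- T) 0 c.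
Proof.
  intros Hc Hf. unfold vint.
  pose proof (CRI_neg (fun s => f (- T, s)) (- c) 0) as E.
  rewrite Ropp_0, Ropp_involutive in E. rewrite <- E; [reflexivity|lra|].
  intros t Ht. apply rcont_v, Hf. lra.
Qed.

(** By fI_shift the right side is the integral of the integrand of the left side
    over its contour moved up by i b / 2. No singularity lies between the two
    contours, and RP_height adjusts their far ends. *)
Theorem It_shift u y : - amean p q < Im u ->
  It p q (u + Ci * b / 2)%C y
  = (Em b' y * (It p q u y + Qf b b' u * It p q u (y + Ci * b)%C))%C.
Proof.
  intros Hu. set (u2 := (u + Ci * b / 2)%C).
  assert (Ru : Re u2 = Re u) by (unfold u2; rewrite Re_plus, Re_div_R by lra; reim; field).
  assert (Iu : Im u2 = Im u + b / 2) by (unfold u2; rewrite Im_plus, Im_div_R by lra; reim; field).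
  set (T := Rabs (Re u) + 1). set (C0 := Rabs (Im u) + Rabs (Im y) + 3 * b + 1).
  pose proof (Rabs_pos (Re u)). pose proof (Rabs_pos (Im u)). pose proof (Rabs_pos (Im y)).
  pose proof (Rle_abs (Im u)).
  assert (Iy : Rabs (Im (y + Ci * b)%C) <= Rabs (Im y) + b).
  { replace (Im (y + Ci * b)%C) with (Im y + b) by (reim; ring).
    eapply Rle_trans; [apply Rabs_triang|]. rewrite (Rabs_pos_eq b); lra. }
  assert (Iu' : Rabs (Im u2) <= Rabs (Im u) + b).
  { rewrite Iu. eapply Rle_trans; [apply Rabs_triang|]. rewrite (Rabs_pos_eq (b / 2)); lra. }
  assert (HT : Rabs (Re u) < T) by (unfold T; lra).
  rewrite (It_eq p q Hp Hq u2 y T C0) by (rewrite ?Ru; unfold T, C0; lra).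
  rewrite (It_eq p q Hp Hq u y T C0) by (unfold T, C0; lra).
  rewrite (It_eq p q Hp Hq u (y + Ci * b)%C T C0) by (unfold T, C0; lra).
  set (h1 := fI p q u2 y). set (h1m := fI p q u2 (- y)%C).
  set (k := Em b' y). set (c := Qf b b' u).
  assert (HC0 : 0 <= C0) by (unfold C0; lra).
  assert (dec : forall y', Rabs (Im y') <= Rabs (Im y) + b ->
     exists M m, rdecay (fI p q u y') T C0 C0 M m).
  { intros y' Hy'. apply rdecay_fI; try assumption; [lra|]. unfold C0. lra. }
  assert (Iy2 : Rabs (Im (- y)%C) <= Rabs (Im y) + b) by (rewrite Im_opp, Rabs_Ropp; lra).
  assert (Iy3 : Rabs (Im (- (y + Ci * b))%C) <= Rabs (Im y) + b) by (rewrite Im_opp, Rabs_Ropp; lra).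
  destruct (dec y ltac:(lra)) as [M1 [m1 D1]]. destruct (dec _ Iy) as [M2 [m2 D2]].
  destruct (dec _ Iy2) as [M3 [m3 D3]]. destruct (dec _ Iy3) as [M4 [m4 D4]].
  assert (hol : forall y' c1 d1, rholo (fI p q u y') T c1 d1) by (intros; apply rholo_fI; assumption).
  assert (hol2 : forall y' c1 d1, rholo (fI p q u2 y') T c1 d1)
    by (intros; apply rholo_fI; try assumption; rewrite Ru; exact HT).
  assert (lin : forall y', - amean p q < Im u -> forall x, ccont (fI p q u y') (x, 0))
    by (intros; apply holo_ccont, holo_fI_line; assumption).
  unfold J. fold h1 h1m.
  (* the right side as a single integral over the contour of It p q u y *)
  match goal with |- _ = ?r => transitivity (hint (fun z => k * (fI p q u y z + c * fI p q u (y + Ci * b)%C z))%C (- T) T 0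
     + RP (fun z => k * (fI p q u y z + c * fI p q u (y + Ci * b)%C z))%C T 0 C0
     + RP (fun z => k * (fI p q u (- y)%C z + c * fI p q u (- (y + Ci * b))%C z))%C T 0 C0)%C end.
  2: { rewrite hint_comb by (try (unfold T; lra); intros; apply lin; exact Hu).
       rewrite (RP_comb (fI p q u y) (fI p q u (y + Ci * b)%C) T 0 C0 M1 m1 M2 m2) by (try apply hol; try assumption).
       rewrite (RP_comb (fI p q u (- y)%C) (fI p q u (- (y + Ci * b))%C) T 0 C0 M3 m3 M4 m4)
         by (try apply hol; try assumption).
       ring. }
  assert (E1 : hint (fun z => k * (fI p q u y z + c * fI p q u (y + Ci * b)%C z))%C (- T) T 0
     = hint h1 (- T) T (b / 2)).
  { unfold hint. apply CRI_ext; [unfold T; lra|]. intros t _. unfold k, c. rewrite <- fI_shift.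
    - unfold h1, u2. f_equal. apply C_eq; [rewrite Re_plus, Re_div_R by lra|rewrite Im_plus, Im_div_R by lra]; reim; simpl; field.
    - right. reim. simpl. lra. }
  assert (hs : forall z : C, T <= Re z -> gam_dom p q (z + u)%C /\ gam_dom p q (- z + u)%C).
  { intros [x s] Hz. apply dom_right. simpl in Hz. lra. }
  assert (Cb : (Ci * b / 2)%C = (Ci * (b / 2)%R)%C) by (rewrite RtoC_div by lra; field).
  assert (Cb2 : forall z : C, (z + Ci * (- (b / 2))%R)%C = (z - Ci * b / 2)%C)
    by (intros; rewrite RtoC_opp, RtoC_div by lra; field).
  assert (dec1 : forall c1 d1, C0 - b / 2 <= c1 -> c1 <= d1 -> exists M m, rdecay h1 T c1 d1 M m).
  { intros c1 d1 Hc1 Hd1. apply rdecay_fI; try assumption; [rewrite Ru; exact HT|rewrite Iu; unfold C0 in Hc1; lra]. }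
  assert (dec1m : forall c1 d1, C0 - b / 2 <= c1 -> c1 <= d1 -> exists M m, rdecay h1m T c1 d1 M m).
  { intros c1 d1 Hc1 Hd1. apply rdecay_fI; try assumption; [rewrite Ru; exact HT|].
    rewrite Iu, Im_opp, Rabs_Ropp. unfold C0 in Hc1; lra. }
  assert (E2 : RP (fun z => k * (fI p q u y z + c * fI p q u (y + Ci * b)%C z))%C T 0 C0
     = RP h1 T (b / 2) C0).
  { rewrite (RP_ext _ (fun z => h1 (z + Ci * (b / 2)%R)%C)); [|exact HC0|].
    2: { intros z Hz. unfold k, c. rewrite <- fI_shift by (apply hs; exact Hz).
         unfold h1, u2. rewrite Cb. reflexivity. }
    rewrite RP_shift by (try exact HC0; apply hol2).
    rewrite Rplus_0_l. destruct (dec1 C0 (C0 + b / 2)) as [M [m D]]; [lra|lra|].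
    symmetry. apply (RP_height h1 T (b / 2) C0 (C0 + b / 2) M m); [unfold C0; lra|lra|apply hol2|exact D]. }
  assert (E3 : RP (fun z => k * (fI p q u (- y)%C z + c * fI p q u (- (y + Ci * b))%C z))%C T 0 C0
     = RP h1m T (- (b / 2)) C0).
  { rewrite (RP_ext _ (fun z => h1m (z + Ci * (- (b / 2))%R)%C)); [|exact HC0|].
    2: { intros z Hz. unfold k, c, h1m. rewrite <- !fI_opp, <- fI_shift by (apply hs; exact Hz).
         unfold u2. f_equal. rewrite Cb2. ring. }
    rewrite RP_shift by (try exact HC0; apply hol2).
    rewrite Rplus_0_l. destruct (dec1m (C0 + - (b / 2)) C0) as [M [m D]]; [lra|lra|].
    apply (RP_height h1m T (- (b / 2)) (C0 + - (b / 2)) C0 M m); [unfold C0; lra|lra|apply hol2|exact D]. }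
  rewrite E1, E2, E3.
  rewrite (RP_base h1 T 0 (b / 2) C0) by (try apply hol2; unfold C0; lra).
  rewrite (RP_base h1m T (- (b / 2)) 0 C0) by (try apply hol2; unfold C0; lra).
  assert (hh : forall x s, 0 <= s <= b / 2 -> holo h1 (x, s)).
  { intros x s Hs. unfold h1. apply holo_fI; try assumption; right; reim; rewrite Iu; simpl; lra. }
  assert (E4 : vint h1m T (- (b / 2)) 0 = vint h1 (- T) 0 (b / 2)).
  { rewrite <- vint_reflect; [|lra|intros; apply holo_ccont, hh; lra].
    unfold vint. apply CRI_ext; [lra|]. intros t _. unfold h1, h1m. symmetry. apply fI_opp. }
  rewrite E4.
  assert (G : rect h1 (- T) T 0 (b / 2) = 0%C).
  { apply goursat; [unfold T; lra|lra|]. intros x s _ Hs. apply hh; exact Hs. }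
  unfold rect in G.
  match type of G with (?A + ?B - ?C1 - ?D)%C = _ =>
    replace C1 with (A + B - D)%C by (transitivity (C1 + (A + B - C1 - D))%C; [ring|rewrite G; ring]) end.
  ring.
Qed.
End Shift.

(** * Difference equations of the Toda integral *)

Lemma par_pos p q d : 0 < p -> 0 < q -> 0 < par p q d.
Proof. destruct d; auto. Qed.

Lemma alpha_par p q d : 0 < p -> 0 < q ->
  alpha p q = 2 * PI / (par p q (opp_sgn d) * par p q d).
Proof. intros Hp Hq. unfold alpha. destruct d; simpl; field; lra. Qed.

Lemma amean_par p q d : amean p q = (par p q (opp_sgn d) + par p q d) / 2.
Proof. unfold amean. destruct d; simpl; field. Qed.

Lemma hGR_step_par p q d w : 0 < p -> 0 < q -> gam_dom p q w ->
  hGR p q (w + Ci * par p q (opp_sgn d))%C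
  = (sfac (par p q (opp_sgn d)) (par p q d) w * hGR p q w)%C.
Proof.
  intros Hp Hq Hw. destruct d; simpl; [apply hGR_step_q|apply hGR_step]; assumption.
Qed.

Section Difference.
Variables (p q : R) (d : sgn).
Hypothesis Hp : 0 < p.
Hypothesis Hq : 0 < q.
Let b := par p q (opp_sgn d).
Let b' := par p q d.

Lemma It_shift_plus u y : - amean p q < Im u ->
  It p q (u + Ci * b / 2)%C y
  = (Em b' y * (It p q u y + Qf b b' u * It p q u (y + Ci * b)%C))%C.
Proof.
  apply It_shift; try assumption; try (apply par_pos; assumption).
  - apply alpha_par; assumption.
  - intros w Hw. apply hGR_step_par; assumption.
Qed.

Lemma It_shift_minus u y : - amean p q < Im u ->
  It p q (u + Ci * b / 2)%C y
  = (Em b' (- y)%C * (It p q u y + Qf b b' u * It p q u (y - Ci * b)%C))%C.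
Proof.
  intros Hu. pose proof (It_shift_plus u (- y)%C Hu) as E.
  replace (- y + Ci * b)%C with (- (y - Ci * b))%C in E by ring.
  assert (Hb : 0 < b) by (apply par_pos; assumption).
  rewrite (It_even p q Hp Hq u y Hu), (It_even p q Hp Hq u _ Hu) in E.
  rewrite It_even in E; [exact E|assumption|assumption|].
  rewrite Im_plus, Im_div_R by lra. reim. lra.
Qed.

Lemma Em_opp y : (Em b' (- y) * Em b' y)%C = 1%C.
Proof.
  unfold Em. rewrite <- cexp_plus, <- cexp_0. f_equal.
  assert (RtoC b' <> 0%C) by (apply RtoC_neq_0; pose proof (par_pos p q d Hp Hq); unfold b'; lra).
  field; assumption.
Qed.

Lemma Em_Qf_shift u y :
  (Em b' y * Qf b b' (u + Ci * b / 2) * Em b' (- (y + Ci * b)))%C = Qf b b' u.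
Proof.
  unfold Em, Qf. rewrite <- !cexp_plus. f_equal.
  assert (RtoC b' <> 0%C) by (apply RtoC_neq_0; pose proof (par_pos p q d Hp Hq); unfold b'; lra).
  field; assumption.
Qed.

(** Two shifts over i b / 2, the second in the direction opposite to the first,
    so that y returns to itself. *)
Lemma It_shift_two u y : - amean p q < Im u ->
  It p q (u + Ci * b)%C y
  = ((1 + Qf b b' u * Qf b b' u) * It p q u y
     + Qf b b' u * (It p q u (y + Ci * b) + It p q u (y - Ci * b)))%C.
Proof.
  intros Hu. assert (Hb : 0 < b) by (apply par_pos; assumption).
  assert (Hu2 : - amean p q < Im (u + Ci * b / 2)%C) by (rewrite Im_plus, Im_div_R by lra; reim; lra).
  pose proof (It_shift_plus (u + Ci * b / 2)%C y Hu2) as E1.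
  pose proof (It_shift_minus u y Hu) as E2.
  pose proof (It_shift_minus u (y + Ci * b)%C Hu) as E3.
  replace (u + Ci * b / 2 + Ci * b / 2)%C with (u + Ci * b)%C in E1 by field.
  replace (y + Ci * b - Ci * b)%C with y in E3 by ring.
  rewrite E1, E2, E3.
  pose proof (Em_opp y) as K1. pose proof (Em_Qf_shift u y) as K2.
  set (I0 := It p q u y). set (I1 := It p q u (y + Ci * b)%C). set (I2 := It p q u (y - Ci * b)%C).
  transitivity (Em b' (- y) * Em b' y * (I0 + Qf b b' u * I2)
    + (Em b' y * Qf b b' (u + Ci * b / 2) * Em b' (- (y + Ci * b))) * (I1 + Qf b b' u * I0))%C; [ring|].
  rewrite K1, K2. ring.
Qed.

(** The combination of It_shift_two with both forms of the half shift. *)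
Theorem It_x_equation u y : - amean p q < Im u ->
  (It p q (u + Ci * b) y + (1 - Qf b b' u * Qf b b' u) * It p q u y)%C
  = ((Em b' (- y) + Em b' y) * It p q (u + Ci * b / 2) y)%C.
Proof.
  intros Hu. rewrite It_shift_two by exact Hu.
  transitivity (Em b' (- y) * It p q (u + Ci * b / 2) y + Em b' y * It p q (u + Ci * b / 2) y)%C; [|ring].
  rewrite (It_shift_plus u y Hu) at 1. rewrite (It_shift_minus u y Hu).
  pose proof (Em_opp y) as K1.
  set (I0 := It p q u y). set (I1 := It p q u (y + Ci * b)%C). set (I2 := It p q u (y - Ci * b)%C).
  transitivity (Em b' (- y) * Em b' y * (I0 + Qf b b' u * I1) + Em b' (- y) * Em b' y * (I0 + Qf b b' u * I2))%C;
    [rewrite K1|]; ring.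
Qed.

(** Both forms of the half shift have the same left side. *)
Theorem It_y_equation u y : - amean p q < Im u ->
  (Qf b b' u * (Em b' y * It p q u (y + Ci * b) - Em b' (- y) * It p q u (y - Ci * b)))%C
  = ((Em b' (- y) - Em b' y) * It p q u y)%C.
Proof.
  intros Hu. pose proof (It_shift_plus u y Hu) as E1. rewrite (It_shift_minus u y Hu) in E1.
  set (I0 := It p q u y) in *. set (I1 := It p q u (y + Ci * b)%C) in *. set (I2 := It p q u (y - Ci * b)%C) in *.
  transitivity (Em b' y * (I0 + Qf b b' u * I1) - Em b' (- y) * Qf b b' u * I2 - Em b' y * I0)%C; [ring|].
  rewrite <- E1. ring.
Qed.
End Difference.

(** * Continuation of the Toda integral in x *)

(** The argument u of the Toda integral as a function of x; the shift x -> x + i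
    b becomes u -> u + i b / 2. *)
Definition uX (p q eta : R) (x : C) : C := ((x - eta) / 2 - Ci * amean p q / 2)%C.

Lemma Im_uX p q eta x : Im (uX p q eta x) = (Im x - amean p q) / 2.
Proof.
  unfold uX. rewrite Im_minus, !Im_div_R by lra. reim. field.
Qed.

Lemma uX_shift p q eta x (b : R) : uX p q eta (x + Ci * b)%C = (uX p q eta x + Ci * b / 2)%C.
Proof. unfold uX. field. Qed.

(** The plane cut along the half-lines to the left in the lower half-plane only:
    the Toda integral is holomorphic above Im x = - a, without cuts. *)
Definition lowdom (p q eta : R) (x : C) : Prop :=
  forall k l : nat, eta < Re x \/ Im x <> - (amean p q + INR k * p + INR l * q).

Lemma xdom_lowdom p q eta x : 0 < p -> 0 < q -> xdom p q eta x -> lowdom p q eta x.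
Proof.
  intros Hp Hq H k l. destruct (H k l) as [K|K]; [left; exact K|right].
  intros E. apply K. rewrite E, Rabs_Ropp. apply Rabs_pos_eq.
  assert (0 <= INR k * p) by (apply Rmult_le_pos; [apply pos_INR|lra]).
  assert (0 <= INR l * q) by (apply Rmult_le_pos; [apply pos_INR|lra]).
  unfold amean. lra.
Qed.

Lemma lowdom_up p q eta d x : lowdom p q eta x -> lowdom p q eta (x + Ci * par p q d)%C.
Proof.
  intros H k l. rewrite Re_up, Im_up. destruct d; unfold par.
  - destruct (H (S k) l) as [K|K]; [left; exact K|right]. rewrite S_INR in K.
    intros E. apply K. lra.
  - destruct (H k (S l)) as [K|K]; [left; exact K|right]. rewrite S_INR in K.
    intros E. apply K. lra.
Qed.

Section Continuation.
Variables (p q eta : R) (y : C).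
Hypothesis Hp : 0 < p.
Hypothesis Hq : 0 < q.
Let a := amean p q.
Let bb (d : sgn) := par p q (opp_sgn d).
Let W (d : sgn) (x : C) : C := sfac (bb d) (par p q d) (x - eta).
Let cc (d : sgn) : C := (2 * c_ p q d y)%C.
Let Ihat (x : C) : C := It p q (uX p q eta x) y.

Lemma bb_pos d : 0 < bb d.
Proof. apply par_pos; assumption. Qed.

(** Where both arguments w and w + i b lie in the strip, sfac is a quotient of
    the zero-free function Gstrip; sfac has period i b'. *)
Lemma sfac_neq_below d w : Im w <= - a -> (forall k : nat, Im w <> - (a + INR k * par p q d)) ->
  sfac (bb d) (par p q d) w <> 0%C.
Proof.
  pose proof (par_pos p q d Hp Hq) as Hb. pose proof (bb_pos d) as Hbb.
  assert (Ha : a = (bb d + par p q d) / 2) by apply amean_par.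
  assert (K : forall n v, - a - INR n * par p q d < Im v -> Im v < - a + par p q d ->
     (forall k : nat, Im v <> - (a + INR k * par p q d)) -> sfac (bb d) (par p q d) v <> 0%C).
  { induction n as [|n IH]; intros v H1 H2 H3.
    - simpl in H1. apply Gstrip_sfac_neq; unfold amean; fold (bb d) (par p q d); try lra; try assumption.
    - rewrite S_INR in H1. destruct (Rlt_dec (- a - INR n * par p q d) (Im v)) as [H|H]; [apply IH; assumption|].
      rewrite <- sfac_period by assumption.
      pose proof (H3 n) as Hn. pose proof (pos_INR n).
      assert (0 <= INR n * par p q d) by (apply Rmult_le_pos; lra).
      apply IH; rewrite ?Im_up; try lra.
      intros k E. apply (H3 (S k)). rewrite S_INR. lra. }
  intros H1 H2. destruct (INR_unbounded ((- a - Im w) / par p q d)) as [n Hn].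
  apply (K n); [|lra|exact H2].
  apply (Rmult_lt_compat_r (par p q d)) in Hn; [|exact Hb].
  unfold Rdiv in Hn. rewrite Rmult_assoc, Rinv_l in Hn by lra. lra.
Qed.

Lemma W_neq_0 d x : lowdom p q eta x -> Im x <= - a -> W d x <> 0%C.
Proof.
  intros H1 H2. pose proof (par_pos p q d Hp Hq) as Hb. unfold W.
  destruct (Rlt_dec eta (Re x)) as [H|H].
  - apply sfac_neq; [exact Hb|]. rewrite Re_minus, Re_RtoC. lra.
  - apply sfac_neq_below.
    + rewrite Im_minus, Im_RtoC. lra.
    + intros k E. rewrite Im_minus, Im_RtoC in E. destruct d; simpl in E.
      * destruct (H1 k 0%nat) as [K|K]; [lra|]. apply K. simpl. unfold a in E. lra.
      * destruct (H1 0%nat k) as [K|K]; [lra|]. apply K. simpl. unfold a in E. lra.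
Qed.

Lemma W_shift d x : W d (x + Ci * par p q d)%C = W d x.
Proof.
  unfold W. replace (x + Ci * par p q d - eta)%C with (x - eta + Ci * par p q d)%C by ring.
  apply sfac_period, par_pos; assumption.
Qed.

Lemma W_shift_two d x : W d (x + Ci * par p q d + Ci * par p q d)%C = W d x.
Proof. rewrite !W_shift. reflexivity. Qed.

Lemma holo_W d x : holo (W d) x.
Proof.
  unfold W. apply (holo_comp (sfac (bb d) (par p q d)) (fun x => x - eta)%C).
  - apply holo_sfac, par_pos; assumption.
  - holo_auto.
Qed.

Lemma Ihat_equation d x : - a < Im x ->
  (Ihat (x + Ci * bb d + Ci * bb d) + W d x * Ihat x)%C = (cc d * Ihat (x + Ci * bb d))%C.
Proof.
  intros Hx. pose proof (par_pos p q d Hp Hq) as Hb.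
  assert (HbC : RtoC (par p q d) <> 0%C) by (apply RtoC_neq_0; lra).
  pose proof (It_x_equation p q d Hp Hq (uX p q eta x) y) as E.
  fold (bb d) in E. rewrite Im_uX in E. specialize (E ltac:(fold a; lra)).
  unfold Ihat. rewrite !uX_shift.
  replace (uX p q eta x + Ci * bb d / 2 + Ci * bb d / 2)%C with (uX p q eta x + Ci * bb d)%C by field.
  replace (cc d) with (Em (par p q d) (- y) + Em (par p q d) y)%C.
  2: { unfold cc, c_, ccosh, Em. replace (- (PI * - y / par p q d))%C with (PI * y / par p q d)%C by (field; exact HbC).
       field. }
  rewrite <- E. f_equal. f_equal. unfold W, sfac, Qf. rewrite <- cexp_plus.
  replace (- (2 * PI * (uX p q eta x + Ci * bb d / 2) / par p q d) + - (2 * PI * (uX p q eta x + Ci * bb d / 2) / par p q d))%C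
    with (- (2 * PI * (x - eta + Ci * bb d / 2) / par p q d) + Ci * PI)%C.
  - rewrite cexp_plus, cexp_iPI. ring.
  - unfold uX. assert (Ha : RtoC (amean p q) = ((bb d + par p q d) / 2)%C).
    { rewrite (amean_par p q d). rewrite RtoC_div, RtoC_plus by lra. reflexivity. }
    rewrite Ha. field. exact HbC.
Qed.

Lemma holo_Ihat x : - a < Im x -> holo Ihat x.
Proof.
  intros Hx. apply (It_holo p q (uX p q eta) (fun _ => y)); try assumption.
  - intros v. unfold uX. holo_auto; apply RtoC_neq_0; lra.
  - intros v. apply holo_const.
  - rewrite Im_uX. fold a. lra.
Qed.

(** The recursion ends as soon as Im x > - a; n bounds the number of steps. *)
Fixpoint Itf (n : nat) (x : C) : C :=
  match n with
  | O => Ihat x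
  | S m => if Rlt_dec (- a) (Im x) then Ihat x
           else ((cc Minus * Itf m (x + Ci * p) - Itf m (x + Ci * p + Ci * p)) / W Minus x)%C
  end.

(** The continuation of the Toda integral across the line Im x = - a, by means
    of the difference equation for the step i p. *)
Definition Itil (x : C) : C := Itf (Z.to_nat (up ((- a - Im x) / p))) x.

Lemma Itf_stable n : forall m x, - a - INR n * p < Im x -> - a - INR m * p < Im x -> Itf n x = Itf m x.
Proof.
  assert (Up : forall n x, - a < Im x -> Itf n x = Ihat x).
  { intros [|k] x Hx; [reflexivity|]. simpl. destruct (Rlt_dec (- a) (Im x)); [reflexivity|lra]. }
  induction n as [|n IH]; intros m x H1 H2.
  - simpl in H1. rewrite !Up by lra. reflexivity.
  - destruct m as [|m]; [simpl in H2; rewrite !Up by lra; reflexivity|].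
    rewrite S_INR in H1, H2. simpl. destruct (Rlt_dec (- a) (Im x)); [reflexivity|].
    rewrite (IH m (x + Ci * p)%C), (IH m (x + Ci * p + Ci * p)%C) by (rewrite !Im_up; lra). reflexivity.
Qed.

Lemma Itil_Itf n x : - a - INR n * p < Im x -> Itil x = Itf n x.
Proof.
  intros H. apply Itf_stable; [|exact H].
  set (r := (- a - Im x) / p). destruct (archimed r) as [A _].
  assert (Hr : r * p = - a - Im x) by (unfold r; field; lra).
  assert (B : r < INR (Z.to_nat (up r))).
  { destruct (Z_le_gt_dec 0 (up r)) as [Z0|Z0].
    - rewrite INR_IZR_INZ, Z2Nat.id by exact Z0. exact A.
    - assert (IZR (up r) <= -1) by (apply IZR_le; lia). pose proof (pos_INR (Z.to_nat (up r))). lra. }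
  apply (Rmult_lt_compat_r p) in B; [|exact Hp]. lra.
Qed.

Lemma depth x : exists n : nat, - a - INR n * p < Im x.
Proof.
  destruct (INR_unbounded ((- a - Im x) / p)) as [n Hn]. exists n.
  apply (Rmult_lt_compat_r p) in Hn; [|exact Hp].
  unfold Rdiv in Hn. rewrite Rmult_assoc, Rinv_l in Hn by lra. lra.
Qed.

Lemma Itil_above x : - a < Im x -> Itil x = Ihat x.
Proof. intros H. apply (Itil_Itf 0). simpl. lra. Qed.

Lemma Itil_below x : Im x <= - a ->
  Itil x = ((cc Minus * Itil (x + Ci * p) - Itil (x + Ci * p + Ci * p)) / W Minus x)%C.
Proof.
  intros H. destruct (depth x) as [n Hn].
  rewrite (Itil_Itf (S n) x) by (rewrite S_INR; lra). simpl.
  destruct (Rlt_dec (- a) (Im x)); [lra|].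
  rewrite !(Itil_Itf n) by (rewrite ?Im_up; lra). reflexivity.
Qed.

Lemma Itil_equation_Minus x : W Minus x <> 0%C \/ - a < Im x ->
  (Itil (x + Ci * p + Ci * p) + W Minus x * Itil x)%C = (cc Minus * Itil (x + Ci * p))%C.
Proof.
  intros H. destruct (Rlt_dec (- a) (Im x)) as [K|K].
  - rewrite !Itil_above by (rewrite ?Im_up; lra). apply (Ihat_equation Minus x K).
  - destruct H as [H|H]; [|contradiction].
    rewrite (Itil_below x) by lra. field. exact H.
Qed.

Lemma below_induction (P : C -> Prop) :
  (forall x, - a < Im x -> P x) ->
  (forall x, lowdom p q eta x -> Im x <= - a -> P (x + Ci * p)%C -> P (x + Ci * p + Ci * p)%C -> P x) ->
  forall x, lowdom p q eta x -> P x.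
Proof.
  intros H1 H2 x. destruct (depth x) as [n Hn]. revert x Hn.
  induction n as [|n IH]; intros x Hn Hx.
  - apply H1. simpl in Hn. lra.
  - rewrite S_INR in Hn. destruct (Rlt_dec (- a) (Im x)) as [K|K]; [apply H1; exact K|].
    pose proof (lowdom_up p q eta Plus x Hx) as U1. pose proof (lowdom_up p q eta Plus _ U1) as U2.
    apply H2; try assumption; try lra; apply IH; try assumption; rewrite !Im_up; lra.
Qed.

(** Near a point on or below the line Im x = - a, the difference equation
    expresses the continuation everywhere by its values at higher points. *)
Theorem holo_Itil x : lowdom p q eta x -> holo Itil x.
Proof.
  revert x. apply below_induction.
  - intros x Hx. apply (holo_ext_loc Ihat _ x (Im x + a)); [lra| |apply holo_Ihat; exact Hx].
    intros v Hv. symmetry. apply Itil_above.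
    pose proof (im_le_Cmod (v - x)%C) as E. rewrite Im_minus in E.
    assert (E2 : Rabs (Im v - Im x) < Im x + a) by lra. apply Rabs_def2 in E2. lra.
  - intros x Hd Hx H1 H2. pose proof (W_neq_0 Minus x Hd Hx) as HW.
    pose proof (holo_ccont _ _ (holo_W Minus x)) as CW.
    apply continuous_Cmod with (eps := Cmod (W Minus x)) in CW; [|apply Cmod_gt_0; exact HW].
    apply locally_Cmod in CW. destruct CW as [dl [Hdl K]].
    apply (holo_ext_loc (fun v => (cc Minus * Itil (v + Ci * p) - Itil (v + Ci * p + Ci * p)) / W Minus v)%C _ x dl Hdl).
    + intros v Hv. specialize (K v Hv).
      assert (HWv : W Minus v <> 0%C).
      { intros E. rewrite E in K. unfold Cminus in K. rewrite Cplus_0_l, Cmod_opp in K. lra. }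
      pose proof (Itil_equation_Minus v (or_introl HWv)) as E. rewrite <- E. field. exact HWv.
    + apply holo_div; [|apply holo_W|exact HW]. apply holo_minus.
      * apply (holo_mult (fun _ => cc Minus)); [apply holo_const|].
        apply (holo_comp Itil (fun v => v + Ci * p)%C); [exact H1|holo_auto].
      * apply (holo_comp Itil (fun v => v + Ci * p + Ci * p)%C); [exact H2|holo_auto].
Qed.

(** The two difference operators commute, so the equation of the other step is
    inherited by the continuation. *)
Theorem Itil_equation d x : lowdom p q eta x ->
  (Itil (x + Ci * bb d + Ci * bb d) + W d x * Itil x)%C = (cc d * Itil (x + Ci * bb d))%C.
Proof.
  destruct d.
  2: { intros H. apply Itil_equation_Minus. destruct (Rlt_dec (- a) (Im x)); [right; assumption|left].
       apply W_neq_0; [exact H|lra]. }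
  set (L := fun x => (Itil (x + Ci * q + Ci * q) + W Plus x * Itil x - cc Plus * Itil (x + Ci * q))%C).
  change (bb Plus) with q.
  assert (HL : forall x, lowdom p q eta x -> L x = 0%C).
  { apply below_induction.
    - intros v Hv. unfold L. rewrite !Itil_above by (rewrite ?Im_up; lra).
      pose proof (Ihat_equation Plus v Hv) as E. change (bb Plus) with q in E. rewrite E. ring.
    - intros v Hd Hv L1 L2. pose proof (W_neq_0 Minus v Hd Hv) as HW.
      (* the difference operator for the step i p, applied to L *)
      assert (E0 : (W Minus v * L v)%C = 0%C).
      { pose proof (lowdom_up p q eta Minus v Hd) as D1. pose proof (lowdom_up p q eta Minus _ D1) as D2.
        assert (eqs : forall w, lowdom p q eta w -> (W Minus w * Itil w)%C
           = (cc Minus * Itil (w + Ci * p) - Itil (w + Ci * p + Ci * p))%C).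
        { intros w Hw. pose proof (Itil_equation_Minus w) as E. rewrite <- E; [ring|].
          destruct (Rlt_dec (- a) (Im w)); [right; assumption|left; apply W_neq_0; [exact Hw|lra]]. }
        pose proof (eqs _ Hd) as e0. pose proof (eqs _ D1) as e1. pose proof (eqs _ D2) as e2. simpl in e1, e2.
        pose proof (W_shift Minus v) as s1. pose proof (W_shift_two Minus v) as s2. simpl in s1, s2.
        rewrite s1 in e1. rewrite s2 in e2.
        pose proof (W_shift Plus v) as t1. pose proof (W_shift_two Plus v) as t2. simpl in t1, t2.
        transitivity (W Minus v * Itil (v + Ci * q + Ci * q) + W Plus v * (W Minus v * Itil v)
           - cc Plus * (W Minus v * Itil (v + Ci * q)))%C; [unfold L; ring|].
        rewrite e0, e1, e2.
        transitivity (cc Minus * L (v + Ci * p) - L (v + Ci * p + Ci * p))%C; [|rewrite L1, L2; ring].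
        unfold L. rewrite t1, t2.
        replace (v + Ci * q + Ci * q + Ci * p + Ci * p)%C with (v + Ci * p + Ci * p + Ci * q + Ci * q)%C by ring.
        replace (v + Ci * q + Ci * q + Ci * p)%C with (v + Ci * p + Ci * q + Ci * q)%C by ring.
        replace (v + Ci * q + Ci * p + Ci * p)%C with (v + Ci * p + Ci * p + Ci * q)%C by ring.
        replace (v + Ci * q + Ci * p)%C with (v + Ci * p + Ci * q)%C by ring.
        ring. }
      destruct (Ceq_dec (L v) 0%C) as [Z|Z]; [exact Z|]. exfalso.
      exact (Cmult_neq_0 _ _ HW Z E0). }
  intros Hx. specialize (HL x Hx). unfold L in HL.
  transitivity (Itil (x + Ci * q + Ci * q) + W Plus x * Itil x - cc Plus * Itil (x + Ci * q) + cc Plus * Itil (x + Ci * q))%C;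
    [ring|rewrite HL; ring].
Qed.
End Continuation.

(** * Square roots *)

(** A difference quotient of f times a continuous function. *)
Lemma cder_mult_vanish f k z l : cder f z l -> ccont k z ->
  cder (fun v => (f v - f z) * k v)%C z (l * k z)%C.
Proof.
  intros Hf Hk. apply cder_eps. intros eps He.
  set (B := Cmod (k z) + 1). assert (HB : 0 < B) by (unfold B; pose proof (Cmod_ge_0 (k z)); lra).
  set (L := Cmod l + 1). assert (HL : 0 < L) by (unfold L; pose proof (Cmod_ge_0 l); lra).
  assert (He1 : 0 < eps / (2 * B)) by (apply Rdiv_lt_0_compat; lra).
  assert (He2 : 0 < Rmin 1 (eps / (2 * L))) by (apply Rmin_pos; [lra|apply Rdiv_lt_0_compat; lra]).
  destruct (proj1 (cder_eps f z l) Hf _ He1) as [d1 [Hd1 K1]].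
  apply continuous_Cmod with (eps := Rmin 1 (eps / (2 * L))) in Hk; [|exact He2].
  apply locally_Cmod in Hk. destruct Hk as [d2 [Hd2 K2]].
  exists (Rmin d1 d2). split; [apply Rmin_pos; assumption|]. intros h Hh.
  pose proof (Rmin_l d1 d2). pose proof (Rmin_r d1 d2).
  specialize (K1 h ltac:(lra)). specialize (K2 (z + h)%C). replace (z + h - z)%C with h in K2 by ring.
  specialize (K2 ltac:(lra)).
  pose proof (Rmin_l 1 (eps / (2 * L))). pose proof (Rmin_r 1 (eps / (2 * L))).
  replace ((f (z + h) - f z) * k (z + h) - (f z - f z) * k z - l * k z * h)%C
    with ((f (z + h) - f z - l * h) * k (z + h) + l * (k (z + h) - k z) * h)%C by ring.
  eapply Rle_trans; [apply Cmod_triangle|]. rewrite !Cmod_mult.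
  assert (Bk : Cmod (k (z + h)%C) <= B).
  { unfold B. pose proof (Cmod_triangle (k z) (k (z + h) - k z)%C) as T.
    replace (k z + (k (z + h) - k z))%C with (k (z + h))%C in T by ring. lra. }
  assert (E1 : Cmod (f (z + h) - f z - l * h)%C * Cmod (k (z + h)%C) <= eps / (2 * B) * Cmod h * B).
  { apply Rmult_le_compat; try apply Cmod_ge_0; assumption. }
  assert (E2 : Cmod l * Cmod (k (z + h) - k z)%C <= L * (eps / (2 * L))).
  { apply Rmult_le_compat; try apply Cmod_ge_0; [unfold L|]; lra. }
  assert (E3 : Cmod l * Cmod (k (z + h) - k z)%C * Cmod h <= L * (eps / (2 * L)) * Cmod h).
  { apply Rmult_le_compat_r; [apply Cmod_ge_0|exact E2]. }
  replace (eps / (2 * B) * Cmod h * B) with (eps / 2 * Cmod h) in E1 by (field; lra).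
  replace (L * (eps / (2 * L)) * Cmod h) with (eps / 2 * Cmod h) in E3 by (field; lra).
  lra.
Qed.

(** r v - r z = (f v - f z) / (r v + r z). *)
Lemma sqrt_holo f r z d : 0 < d -> (forall v, Cmod (v - z)%C < d -> (r v * r v)%C = f v) ->
  ccont r z -> holo f z -> r z <> 0%C -> holo r z.
Proof.
  intros Hd Hr Cr [l Hf] Hz.
  assert (Hz2 : (r z + r z)%C <> 0%C).
  { replace (r z + r z)%C with (2 * r z)%C by ring. apply Cmult_neq_0; [exact two_neq|exact Hz]. }
  pose proof Cr as Cr2.
  apply continuous_Cmod with (eps := Cmod (r z + r z)%C) in Cr2; [|apply Cmod_gt_0; exact Hz2].
  apply locally_Cmod in Cr2. destruct Cr2 as [d2 [Hd2 K]].
  assert (Hn : forall v, Cmod (v - z)%C < d2 -> (r v + r z)%C <> 0%C).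
  { intros v Hv E. specialize (K v Hv).
    replace (r v - r z)%C with ((r v + r z) - (r z + r z))%C in K by ring.
    rewrite E in K. unfold Cminus in K. rewrite Cplus_0_l, Cmod_opp in K. lra. }
  assert (Ck : ccont (fun v => / (r v + r z))%C z).
  { apply (cont_comp (fun v => r v + r z)%C Cinv).
    - apply cont_plus; [exact Cr|apply cont_const].
    - apply (cder_ccont _ _ _ (cder_inv _ Hz2)). }
  pose proof (cder_mult_vanish f _ z l Hf Ck) as D.
  apply (holo_ext_loc (fun v => (f v - f z) * / (r v + r z) + r z)%C r z (Rmin d d2)).
  - apply Rmin_pos; assumption.
  - intros v Hv. pose proof (Rmin_l d d2). pose proof (Rmin_r d d2).
    rewrite <- (Hr v) by lra. rewrite <- (Hr z).
    + field. apply Hn. lra.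
    + replace (z - z)%C with (RtoC 0) by ring. rewrite Cmod_0. exact Hd.
  - apply holo_plus; [eexists; exact D|apply holo_const].
Qed.

(** The complement of the half-line (-oo, 0]. *)
Definition slit (z : C) : Prop := 0 < Re z \/ Im z <> 0.

(** The sum z + |z| bisects the angle between z and the positive axis. *)
Definition csq (z : C) : C := ((z + Cmod z) / sqrt (2 * (Cmod z + Re z)))%C.

Lemma Cmod_sqr (z : C) : Cmod z * Cmod z = Re z * Re z + Im z * Im z.
Proof.
  unfold Cmod. rewrite sqrt_sqrt; [unfold Re, Im; ring|].
  pose proof (pow2_ge_0 (fst z)). pose proof (pow2_ge_0 (snd z)). lra.
Qed.

Lemma slit_pos z : slit z -> 0 < Cmod z + Re z.
Proof.
  intros H. pose proof (Cmod_ge_0 z). pose proof (Cmod_sqr z) as S.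
  destruct (Rlt_dec 0 (Re z)) as [K|K]; [lra|].
  destruct H as [H|H]; [contradiction|].
  assert (0 < Im z * Im z) by nra. nra.
Qed.

Lemma csq_sqr z : slit z -> (csq z * csq z)%C = z.
Proof.
  intros H. pose proof (slit_pos z H) as P.
  assert (Q : 0 < sqrt (2 * (Cmod z + Re z))) by (apply sqrt_lt_R0; lra).
  unfold csq. set (s := sqrt (2 * (Cmod z + Re z))) in *.
  assert (Hs : s * s = 2 * (Cmod z + Re z)) by (apply sqrt_sqrt; lra).
  assert (HsC : RtoC s <> 0%C) by (apply RtoC_neq_0; lra).
  assert (E : ((z + Cmod z) * (z + Cmod z))%C = (z * RtoC (s * s))%C).
  { rewrite Hs. pose proof (Cmod_sqr z) as S. apply C_eq; reim; nra. }
  replace ((z + Cmod z) / s * ((z + Cmod z) / s))%C with ((z + Cmod z) * (z + Cmod z) / (s * s))%C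
    by (field; exact HsC).
  rewrite E, RtoC_mult. field. exact HsC.
Qed.

Lemma csq_Re z : slit z -> 0 < Re (csq z).
Proof.
  intros H. pose proof (slit_pos z H) as P.
  assert (Q : 0 < sqrt (2 * (Cmod z + Re z))) by (apply sqrt_lt_R0; lra).
  unfold csq. rewrite Re_div_R by lra. rewrite Re_plus, Re_RtoC.
  apply Rdiv_lt_0_compat; lra.
Qed.

Lemma csq_neq_0 z : slit z -> csq z <> 0%C.
Proof. intros H E. pose proof (csq_Re z H) as K. rewrite E in K. simpl in K. lra. Qed.

Lemma slit_neq_0 z : slit z -> z <> 0%C.
Proof. intros [H|H] E; rewrite E in H; simpl in H; lra. Qed.

Lemma slit_open z : slit z -> exists d, 0 < d /\ forall v, Cmod (v - z)%C < d -> slit v.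
Proof.
  intros [H|H].
  - exists (Re z). split; [exact H|]. intros v Hv. left.
    pose proof (re_le_Cmod (v - z)%C) as E. rewrite Re_minus in E.
    assert (E2 : Rabs (Re v - Re z) < Re z) by lra. apply Rabs_def2 in E2. lra.
  - exists (Rabs (Im z)). split; [apply Rabs_pos_lt; exact H|]. intros v Hv. right. intros E0.
    pose proof (im_le_Cmod (v - z)%C) as E. rewrite Im_minus, E0, Rminus_0_l, Rabs_Ropp in E. lra.
Qed.

(** Two square roots in the right half-plane satisfy (s - s')(s + s') = z - z',
    and s + s' is bounded below. *)
Lemma csq_ccont z : slit z -> ccont csq z.
Proof.
  intros H. pose proof (csq_Re z H) as P. destruct (slit_open z H) as [d [Hd K]].
  apply continuous_Cmod. intros eps He. apply locally_Cmod.
  exists (Rmin d (eps * Re (csq z))). split; [apply Rmin_pos; [exact Hd|apply Rmult_lt_0_compat; assumption]|].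
  intros v Hv. pose proof (Rmin_l d (eps * Re (csq z))). pose proof (Rmin_r d (eps * Re (csq z))).
  assert (Sv : slit v) by (apply K; lra). pose proof (csq_Re v Sv) as Pv.
  assert (E : ((csq v - csq z) * (csq v + csq z))%C = (v - z)%C).
  { transitivity (csq v * csq v - csq z * csq z)%C; [ring|]. rewrite !csq_sqr by assumption. reflexivity. }
  apply (f_equal Cmod) in E. rewrite Cmod_mult in E.
  assert (B : Re (csq z) <= Cmod (csq v + csq z)%C).
  { pose proof (re_le_Cmod (csq v + csq z)%C) as Q. rewrite Re_plus in Q.
    pose proof (Rle_abs (Re (csq v) + Re (csq z))). lra. }
  pose proof (Cmod_ge_0 (csq v - csq z)%C).
  apply (Rmult_lt_reg_r (Re (csq z))); [exact P|]. nra.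
Qed.

Lemma holo_csq z : slit z -> holo csq z.
Proof.
  intros H. destruct (slit_open z H) as [d [Hd K]].
  apply (sqrt_holo (fun v => v) csq z d Hd).
  - intros v Hv. apply csq_sqr, K, Hv.
  - apply csq_ccont, H.
  - apply holo_id.
  - apply csq_neq_0, H.
Qed.

(** A continuous choice of sign is constant. *)
Lemma sqrt_path_unique (r1 r2 : R -> C) T : 0 <= T ->
  (forall t, 0 <= t -> rcont r1 t) -> (forall t, 0 <= t -> rcont r2 t) ->
  (forall t, 0 <= t -> (r1 t * r1 t)%C = (r2 t * r2 t)%C /\ r2 t <> 0%C) ->
  r1 T = r2 T -> r1 0 = r2 0.
Proof.
  intros HT C1 C2 Hsq HTT.
  set (h := fun t => Re (r1 t / r2 t)%C).
  assert (pm : forall t, 0 <= t -> r1 t = r2 t \/ r1 t = (- r2 t)%C).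
  { intros t Ht. destruct (Hsq t Ht) as [E _].
    destruct (Ceq_dec (r1 t - r2 t)%C 0%C) as [Z|Z].
    - left. replace (r1 t) with (r1 t - r2 t + r2 t)%C by ring. rewrite Z. ring.
    - right. destruct (Ceq_dec (r1 t + r2 t)%C 0%C) as [Z2|Z2].
      + replace (r1 t) with (r1 t + r2 t - r2 t)%C by ring. rewrite Z2. ring.
      + exfalso. apply (Cmult_neq_0 _ _ Z Z2).
        replace ((r1 t - r2 t) * (r1 t + r2 t))%C with (r1 t * r1 t - r2 t * r2 t)%C by ring.
        rewrite E. ring. }
  destruct (pm 0 ltac:(lra)) as [E|E]; [exact E|]. exfalso.
  assert (N : forall t, 0 <= t -> r2 t <> 0%C) by (intros t Ht; apply (Hsq t Ht)).
  assert (h0 : h 0 = -1).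
  { unfold h. rewrite E. replace (- r2 0 / r2 0)%C with (- (1))%C by (field; apply N; lra).
    simpl. ring. }
  assert (hT : h T = 1).
  { unfold h. rewrite HTT. replace (r2 T / r2 T)%C with (RtoC 1); [reflexivity|].
    field. apply N; lra. }
  assert (Hc : forall t, 0 <= t -> continuous (T := R_UniformSpace) (U := R_UniformSpace) h t).
  { intros t Ht. unfold h.
    apply (continuous_comp (U := R_UniformSpace) (V := C_UniformSpace) (W := R_UniformSpace) (fun t => r1 t / r2 t)%C Re).
    - apply cont_mult; [apply C1; exact Ht|].
      apply (cont_comp r2 Cinv); [apply C2; exact Ht|]. apply (cder_ccont _ _ _ (cder_inv _ (N t Ht))).
    - apply (continuous_fst (U := R_UniformSpace) (V := R_UniformSpace)). }
  (* h is known to be continuous on [0, +oo) only *)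
  destruct (IVT_gen (fun t => h (Rabs t)) 0 T 0) as [x [_ Hx]].
  - intros t. apply continuity_pt_filterlim.
    apply (continuous_comp (U := R_UniformSpace) (V := R_UniformSpace) (W := R_UniformSpace) Rabs h).
    + apply continuous_Rabs.
    + apply Hc, Rabs_pos.
  - rewrite Rabs_R0, h0, Rabs_pos_eq, hT by lra. split; [rewrite Rmin_left|rewrite Rmax_right]; lra.
  - assert (Hx0 : 0 <= Rabs x) by apply Rabs_pos.
    destruct (pm _ Hx0) as [Q|Q]; unfold h in Hx; rewrite Q in Hx.
    + replace (r2 (Rabs x) / r2 (Rabs x))%C with (RtoC 1) in Hx by (field; apply N, Hx0). simpl in Hx. lra.
    + replace (- r2 (Rabs x) / r2 (Rabs x))%C with (- RtoC 1)%C in Hx by (field; apply N, Hx0). simpl in Hx. lra.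
Qed.

(** * Branches of square roots along half-lines *)

(** The relation that defines sqrt_from_infty f p, as a predicate on the value
    w. *)
Definition branch (f : C -> C) (p w : C) : Prop :=
  exists r : R -> C,
      (forall t : R, 0 <= t ->
         continuous (U := C_UniformSpace) r t /\
         (r t * r t = f (p + t))%C) /\
      (exists L : R, 0 < L /\
         filterlim r (Rbar_locally p_infty)
           (locally (T := C_UniformSpace) (RtoC L))) /\
      r 0 = w.

Lemma lim_tends1 (r : R -> C) L : 0 < L ->
  filterlim r (Rbar_locally p_infty) (locally (T := C_UniformSpace) (RtoC L))
  <-> tends1 (fun t => r t / L)%C.
Proof.
  intros HL. assert (HLC : RtoC L <> 0%C) by (apply RtoC_neq_0; lra).
  assert (E : forall t, Cmod (r t - L)%C = L * Cmod (r t / L - 1)%C).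
  { intros t. replace (r t - L)%C with (L * (r t / L - 1))%C by (field; exact HLC).
    rewrite Cmod_mult, Cmod_R, Rabs_pos_eq by lra. reflexivity. }
  split; intros H.
  - intros eps He. destruct (H (fun v => Cmod (v - L)%C < L * eps)) as [X K].
    + apply locally_Cmod. exists (L * eps). split; [apply Rmult_lt_0_compat; assumption|auto].
    + exists (X + 1). intros x Hx. specialize (K x ltac:(lra)). rewrite E in K.
      apply Rmult_lt_reg_l in K; lra.
  - intros P HP. apply locally_Cmod in HP. destruct HP as [d [Hd K]].
    assert (Hd2 : 0 < d / (2 * L)) by (apply Rdiv_lt_0_compat; lra).
    destruct (H (d / (2 * L)) Hd2) as [X Q].
    exists X. intros x Hx. apply K. rewrite E. specialize (Q x ltac:(lra)).
    apply (Rmult_le_compat_l L) in Q; [|lra].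
    replace (L * (d / (2 * L))) with (d / 2) in Q by (field; lra). lra.
Qed.

Lemma branch_mult f g h p p' p'' w w' : branch f p w -> branch g p' w' ->
  (forall t, 0 <= t -> h (p'' + t)%C = (f (p + t) * g (p' + t))%C) ->
  branch h p'' (w * w')%C.
Proof.
  intros [r [H1 [[L [HL H2]] H3]]] [r' [H1' [[L' [HL' H2']] H3']]] Hh.
  assert (HLC : RtoC L <> 0%C) by (apply RtoC_neq_0; lra).
  assert (HLC' : RtoC L' <> 0%C) by (apply RtoC_neq_0; lra).
  exists (fun t => r t * r' t)%C. split; [|split].
  - intros t Ht. destruct (H1 t Ht) as [A B]. destruct (H1' t Ht) as [A' B']. split.
    + apply cont_mult; assumption.
    + rewrite Hh, <- B, <- B' by exact Ht. ring.
  - exists (L * L'). split; [apply Rmult_lt_0_compat; assumption|].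
    apply lim_tends1; [apply Rmult_lt_0_compat; assumption|].
    apply lim_tends1 in H2; [|exact HL]. apply lim_tends1 in H2'; [|exact HL'].
    apply (tends1_ext (fun t => (r t / L) * (r' t / L'))%C); [|apply tends1_mult; assumption].
    intros t _. rewrite RtoC_mult. field. auto.
  - rewrite H3, H3'. reflexivity.
Qed.

Lemma branch_inv f h p p' w : branch f p w -> (forall t, 0 <= t -> f (p + t)%C <> 0%C) ->
  (forall t, 0 <= t -> h (p' + t)%C = (/ f (p + t))%C) ->
  branch h p' (/ w)%C.
Proof.
  intros [r [H1 [[L [HL H2]] H3]]] Hn Hh.
  assert (HLC : RtoC L <> 0%C) by (apply RtoC_neq_0; lra).
  assert (Hr : forall t, 0 <= t -> r t <> 0%C).
  { intros t Ht E. apply (Hn t Ht). rewrite <- (proj2 (H1 t Ht)), E. ring. }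
  exists (fun t => / r t)%C. split; [|split].
  - intros t Ht. destruct (H1 t Ht) as [A B]. split.
    + apply (cont_comp r Cinv); [exact A|]. apply (cder_ccont _ _ _ (cder_inv _ (Hr t Ht))).
    + rewrite Hh, <- B by exact Ht. field. apply Hr, Ht.
  - exists (/ L). assert (HL2 : 0 < / L) by (apply Rinv_0_lt_compat; exact HL). split; [exact HL2|].
    apply lim_tends1; [exact HL2|]. apply lim_tends1 in H2; [|exact HL].
    apply tends1_inv in H2. intros eps He. destruct (H2 eps He) as [X K].
    exists (Rmax X 0). intros x Hx. pose proof (Rmax_l X 0). pose proof (Rmax_r X 0).
    replace (/ r x / RtoC (/ L))%C with (/ (r x / L))%C; [apply K; lra|].
    rewrite RtoC_inv by lra. field. split; [exact HLC|apply Hr; lra].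
  - rewrite H3. reflexivity.
Qed.

Lemma branch_ext f h p p' w : branch f p w ->
  (forall t, 0 <= t -> h (p' + t)%C = f (p + t)%C) -> branch h p' w.
Proof.
  intros [r [H1 [H2 H3]]] Hh. exists r. split; [|split; assumption].
  intros t Ht. rewrite Hh by exact Ht. apply H1, Ht.
Qed.

Lemma branch_const (k : R) h p : 0 < k -> (forall t, 0 <= t -> h (p + t)%C = (k * k)%C) ->
  branch h p k.
Proof.
  intros Hk Hh. assert (HkC : RtoC k <> 0%C) by (apply RtoC_neq_0; lra).
  exists (fun _ => RtoC k). split; [|split; [|reflexivity]].
  - intros t Ht. split; [apply cont_const|rewrite Hh by exact Ht; reflexivity].
  - exists k. split; [exact Hk|]. apply lim_tends1; [exact Hk|].
    intros eps He. exists 0. intros x _. replace (k / k - 1)%C with (RtoC 0) by (field; exact HkC).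
    rewrite Cmod_0. lra.
Qed.

(** Two branches agree far to the right, where both have positive real part. *)
Lemma branch_unique (f : C -> C) p w w' : (forall t, 0 <= t -> f (p + t)%C <> 0%C) ->
  branch f p w -> branch f p w' -> w = w'.
Proof.
  intros Hn [r [H1 [[L [HL H2]] <-]]] [r' [H1' [[L' [HL' H2']] <-]]].
  apply lim_tends1 in H2; [|exact HL]. apply lim_tends1 in H2'; [|exact HL'].
  assert (pos : forall (s : R -> C) l, 0 < l -> tends1 (fun t => s t / l)%C ->
     exists X, forall x, X <= x -> 0 < Re (s x)).
  { intros s l Hl H. destruct (H (/ 2) ltac:(lra)) as [X K]. exists X. intros x Hx. specialize (K x Hx).
    pose proof (re_le_Cmod (s x / l - 1)%C) as Q. rewrite Re_minus, Re_div_R, Re_RtoC in Q by lra.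
    assert (Q2 : Rabs (Re (s x) / l - 1) <= / 2) by lra. apply Rabs_le_between in Q2.
    replace (Re (s x)) with (l * (Re (s x) / l)) by (field; lra). apply Rmult_lt_0_compat; lra. }
  destruct (pos r L HL H2) as [X K]. destruct (pos r' L' HL' H2') as [X' K'].
  set (T := Rmax 0 (Rmax X X')).
  assert (T0 : 0 <= T) by apply Rmax_l.
  assert (T1 : Rmax X X' <= T) by apply Rmax_r.
  pose proof (Rmax_l X X'). pose proof (Rmax_r X X').
  apply (sqrt_path_unique r r' T T0).
  - intros t Ht. apply H1, Ht.
  - intros t Ht. apply H1', Ht.
  - intros t Ht. rewrite (proj2 (H1 t Ht)), (proj2 (H1' t Ht)). split; [reflexivity|].
    intros E. apply (Hn t Ht). rewrite <- (proj2 (H1' t Ht)), E. ring.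
  - specialize (K T ltac:(lra)). specialize (K' T ltac:(lra)).
    destruct (Ceq_dec (r T - r' T)%C 0%C) as [Z|Z].
    + replace (r T) with (r T - r' T + r' T)%C by ring. rewrite Z. ring.
    + exfalso. apply (Cmult_neq_0 (r T - r' T) (r T + r' T)); [exact Z| |].
      * intros E. apply (f_equal Re) in E. rewrite Re_plus in E. simpl (Re 0%C) in E. lra.
      * transitivity (r T * r T - r' T * r' T)%C; [ring|].
        rewrite (proj2 (H1 T T0)), (proj2 (H1' T T0)). ring.
Qed.

Lemma branch_value (f : C -> C) p w : (forall t, 0 <= t -> f (p + t)%C <> 0%C) ->
  branch f p w -> sqrt_from_infty f p = w.
Proof.
  intros Hn Hw. apply (branch_unique f p); [exact Hn| |exact Hw].
  unfold sqrt_from_infty. apply (epsilon_spec (inhabits (RtoC 0)) (branch f p)).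
  exists w. exact Hw.
Qed.

(** On a half-line to the right, sfac - 1 has constant argument and decreasing
    modulus, so that sfac meets (-oo, 0] only if sfac has a zero at the height Im w
    and Re w <= 0. *)
Definition slit_ray (b b' : R) (w : C) : Prop := 0 < Re w \/ sfac b b' (Ci * Im w)%C <> 0%C.

Lemma sfac_polar b b' w : 0 < b' ->
  sfac b b' w = (1 + RtoC (exp (- (2 * PI / b') * Re w)) * cexp (Ci * (- (2 * PI / b') * (Im w + b / 2))%R))%C.
Proof.
  intros Hb'. assert (HbC' : RtoC b' <> 0%C) by (apply RtoC_neq_0; lra).
  unfold sfac. rewrite <- cexp_R, <- cexp_plus. do 2 f_equal.
  apply C_eq.
  - rewrite Re_opp, Re_div_R by lra. rewrite <- RtoC_mult, Re_mult, !Re_plus, Re_RtoC, Im_RtoC, Re_div_R by lra. reim. field. lra.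
  - rewrite Im_opp, Im_div_R by lra. rewrite <- RtoC_mult, Im_mult, !Im_plus, Re_RtoC, Im_RtoC, Im_div_R by lra. reim. field. lra.
Qed.

Lemma slit_ray_slit b b' w t : 0 < b' -> slit_ray b b' w -> 0 <= t -> slit (sfac b b' (w + t)%C).
Proof.
  intros Hb' H Ht. pose proof PI_RGT_0. assert (Hk : 0 < 2 * PI / b') by (apply Rdiv_lt_0_compat; lra).
  rewrite sfac_polar by exact Hb'.
  replace (Re (w + t)%C) with (Re w + t) by (reim; ring).
  replace (Im (w + t)%C) with (Im w) by (reim; ring).
  unfold slit_ray in H. rewrite sfac_polar in H by exact Hb'.
  replace (Re (Ci * Im w)%C) with 0 in H by (reim; ring).
  replace (Im (Ci * Im w)%C) with (Im w) in H by (reim; ring).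
  rewrite Rmult_0_r, exp_0 in H.
  set (th := - (2 * PI / b') * (Im w + b / 2)) in *. set (k := 2 * PI / b') in *.
  assert (Hc : cexp (Ci * th)%C = (cos th, sin th)).
  { unfold cexp. replace (Re (Ci * th)%C) with 0 by (reim; ring).
    replace (Im (Ci * th)%C) with th by (reim; ring). rewrite exp_0. ring. }
  rewrite Hc in *. set (rr := exp (- k * (Re w + t))). assert (0 < rr) by apply exp_pos.
  destruct (Req_dec (sin th) 0) as [S|S].
  - left. reim. simpl. pose proof (sin2_cos2 th) as SC. rewrite S in SC. unfold Rsqr in SC.
    assert (Hcos : cos th = 1 \/ cos th = -1).
    { destruct (Req_dec (cos th) 1); [left; assumption|right].
      assert (Z : (cos th - 1) * (cos th + 1) = 0) by lra.
      apply Rmult_integral in Z. lra. }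
    destruct Hcos as [C1|C1]; rewrite C1; [lra|].
    assert (rr < 1); [|lra].
    unfold rr. rewrite <- exp_0. apply exp_increasing.
    destruct H as [H|H]; [nra|]. exfalso. apply H. rewrite S, C1. apply C_eq; reim; simpl; ring.
  - right. reim. simpl. intros E. apply S.
    assert (Z : rr * sin th = 0) by lra. apply Rmult_integral in Z. lra.
Qed.

Lemma slit_ray_open b b' w : 0 < b' -> slit_ray b b' w ->
  exists d, 0 < d /\ forall v, Cmod (v - w)%C < d -> slit_ray b b' v.
Proof.
  intros Hb' [H|H].
  - exists (Re w). split; [exact H|]. intros v Hv. left.
    pose proof (re_le_Cmod (v - w)%C) as E. rewrite Re_minus in E.
    assert (E2 : Rabs (Re v - Re w) < Re w) by lra. apply Rabs_def2 in E2. lra.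
  - pose proof (holo_ccont _ _ (holo_sfac b b' (Ci * Im w)%C Hb')) as Cs.
    apply continuous_Cmod with (eps := Cmod (sfac b b' (Ci * Im w)%C)) in Cs; [|apply Cmod_gt_0; exact H].
    apply locally_Cmod in Cs. destruct Cs as [d [Hd K]]. exists d. split; [exact Hd|].
    intros v Hv. right. intros E. specialize (K (Ci * Im v)%C). rewrite E in K.
    replace (0 - sfac b b' (Ci * Im w))%C with (- sfac b b' (Ci * Im w))%C in K by ring.
    rewrite Cmod_opp in K. apply (Rlt_irrefl (Cmod (sfac b b' (Ci * Im w)%C))). apply K.
    replace (Ci * Im v - Ci * Im w)%C with (Ci * (Im v - Im w)%R)%C by (rewrite RtoC_minus; ring).
    rewrite Cmod_mult, Cmod_R.
    replace (Cmod Ci) with 1 by (symmetry; transitivity (sqrt 1); [unfold Cmod; f_equal; simpl; ring|apply sqrt_1]).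
    pose proof (im_le_Cmod (v - w)%C) as E2. rewrite Im_minus in E2. lra.
Qed.

Lemma tends1_csq f : tends1 f -> tends1 (fun t => csq (f t)).
Proof.
  intros H eps He.
  assert (S1 : slit 1%C) by (left; simpl; lra).
  assert (E1 : csq 1%C = 1%C).
  { pose proof (csq_sqr 1%C S1) as Q. pose proof (csq_Re 1%C S1) as P.
    destruct (Ceq_dec (csq 1 - 1)%C 0%C) as [Z|Z].
    - replace (csq 1%C) with (csq 1 - 1 + 1)%C by ring. rewrite Z. ring.
    - exfalso. apply (Cmult_neq_0 (csq 1 - 1) (csq 1 + 1)); [exact Z| |].
      + intros E. apply (f_equal Re) in E. rewrite Re_plus in E. simpl (Re 0%C) in E. rewrite Re_RtoC in E. lra.
      + transitivity (csq 1 * csq 1 - 1)%C; [ring|rewrite Q; ring]. }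
  pose proof (csq_ccont 1%C S1) as Cc.
  apply continuous_Cmod with (eps := eps) in Cc; [|exact He].
  apply locally_Cmod in Cc. destruct Cc as [d [Hd K]].
  destruct (H (d / 2) ltac:(lra)) as [X Q]. exists X. intros x Hx.
  rewrite <- E1. left. apply K. specialize (Q x Hx). lra.
Qed.

Lemma tends1_ray f (w : C) : tends1 (fun x => f (x, Im w)) -> tends1 (fun t => f (w + RtoC t)%C).
Proof.
  intros H eps He. destruct (H eps He) as [X K]. exists (X - Re w). intros x Hx.
  replace (w + x)%C with ((Re w + x, Im w) : C) by (apply C_eq; reim; simpl; ring).
  apply K. lra.
Qed.

Lemma rcont_ray_comp f (w : C) t : ccont f (w + RtoC t)%C -> rcont (fun s => f (w + RtoC s)%C) t.
Proof.
  intros H. apply (cont_comp (fun s => w + RtoC s)%C f); [|exact H].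
  apply cont_plus; [apply cont_const|apply cont_id_R].
Qed.

Lemma branch_intro (s f : C -> C) w :
  (forall t, 0 <= t -> ccont s (w + RtoC t)%C) ->
  (forall t, 0 <= t -> (s (w + RtoC t) * s (w + RtoC t))%C = f (w + RtoC t)%C) ->
  tends1 (fun t => s (w + RtoC t)%C) -> branch f w (s w).
Proof.
  intros H1 H2 H3. exists (fun t => s (w + RtoC t)%C). split; [|split].
  - intros t Ht. split; [apply rcont_ray_comp, H1, Ht|apply H2, Ht].
  - exists 1. split; [lra|]. apply lim_tends1; [lra|].
    apply (tends1_ext (fun t => s (w + RtoC t)%C)); [|exact H3]. intros x _. field.
  - f_equal. ring.
Qed.

Lemma branch_sfac b b' w : 0 < b' -> slit_ray b b' w -> branch (sfac b b') w (csq (sfac b b' w)).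
Proof.
  intros Hb' H. apply (branch_intro (fun v => csq (sfac b b' v))).
  - intros t Ht. apply (cont_comp (sfac b b') csq).
    + apply (holo_ccont _ _ (holo_sfac b b' _ Hb')).
    + apply csq_ccont, slit_ray_slit; assumption.
  - intros t Ht. apply csq_sqr, slit_ray_slit; assumption.
  - apply (tends1_csq (fun t => sfac b b' (w + RtoC t)%C)), tends1_ray, tends1_sfac, Hb'.
Qed.

(** * The square root of 1 / G_R *)

(** The zeros of sfac are symmetric about - i b / 2. *)
Lemma sfac_reflect b b' w : 0 < b' ->
  sfac b b' (- w - Ci * b)%C = (cexp (2 * PI * (w + Ci * b / 2) / b') * sfac b b' w)%C.
Proof.
  intros Hb'. assert (HbC' : RtoC b' <> 0%C) by (apply RtoC_neq_0; lra).
  unfold sfac. rewrite cexp_opp, (cexp_opp (2 * PI * (w + Ci * b / 2) / b')%C).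
  rewrite <- cexp_opp.
  replace (- (2 * PI * (- w - Ci * b + Ci * b / 2) / b'))%C with (2 * PI * (w + Ci * b / 2) / b')%C by (field; exact HbC').
  field. apply cexp_neq_0.
Qed.

Section Root.
Variables p q : R.
Hypothesis Hp : 0 < p.
Hypothesis Hq : 0 < q.
Let a := amean p q.
Let bb (d : sgn) := par p q (opp_sgn d).

(** The step also holds between the poles on the imaginary axis. *)
Lemma hGR_step_down w : Im w <= - a -> sfac p q w <> 0%C ->
  hGR p q (w + Ci * p)%C = (sfac p q w * hGR p q w)%C.
Proof.
  intros Hw Hs. assert (Ha : a = (p + q) / 2) by reflexivity.
  destruct (hG_steps_spec p q Hp Hq w) as [S1 S2]. fold a in S1, S2.
  assert (E : exists n, hG_steps p q w = S n).
  { destruct (hG_steps p q w) as [|n] eqn:En; [exfalso|exists n; reflexivity].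
    simpl in S1. rewrite Rmult_0_l, Rminus_0_r, Rabs_Rabsolu, (Rabs_left (Im w)) in S1 by lra. lra. }
  destruct E as [n En]. rewrite En in S1, S2.
  assert (E1 : hGR p q w = (hG_down p q (S n) w * gfac p q w)%C).
  { unfold hGR, hG. rewrite En. destruct (Rle_dec 0 (Im w)) as [L|L]; [lra|reflexivity]. }
  rewrite E1, hG_down_S by assumption.
  rewrite (Rabs_left (Im w)) in S1, S2 by lra. rewrite S_INR in S1.
  assert (E2 : hGR p q (w + Ci * p)%C = (hG_down p q n (w + Ci * p) * gfac p q (w + Ci * p))%C).
  (* for Im (w + i p) >= 0 the definition of hG changes, but then w + i p lies in the strip *)
  { destruct (Rle_dec 0 (Im (w + Ci * p)%C)) as [L|L].
    - rewrite Im_up in L. assert (Hn : (S n <= 1)%nat).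
      { apply S2. simpl. apply Rabs_def1; lra. }
      assert (n = 0%nat) by lia. subst n. simpl (hG_down _ _ 0 _).
      assert (B : Rabs (Im (w + Ci * p)%C) < a) by (rewrite Im_up; apply Rabs_def1; lra).
      rewrite hG_0 by assumption. apply hGR_strip; assumption.
    - assert (En2 : hG_steps p q (w + Ci * p)%C = n).
      { destruct (hG_steps_spec p q Hp Hq (w + Ci * p)%C) as [T1 T2]. fold a in T1, T2.
        rewrite (Rabs_left (Im (w + Ci * p)%C)) in T1, T2 by lra. rewrite Im_up in T1, T2, L.
        apply Nat.le_antisymm.
        - apply T2. replace (- (Im w + p) - INR n * p) with (- Im w - (INR n + 1) * p) by ring. exact S1.
        - apply le_S_n, S2. rewrite S_INR.
          match type of T1 with Rabs ?e < _ => match goal with |- Rabs ?e' < _ =>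
            replace e' with e by ring end end. exact T1. }
      unfold hGR, hG. rewrite En2. destruct (Rle_dec 0 (Im (w + Ci * p)%C)); [contradiction|reflexivity]. }
  rewrite E2. field. exact Hs.
Qed.

Lemma xdom_minus eta x : xdom p q eta x <-> xdom p q 0 (x - eta)%C.
Proof.
  unfold xdom. split; intros H k l; specialize (H k l);
    rewrite Re_minus, Im_minus, Re_RtoC, Im_RtoC, Rminus_0_r in *; destruct H as [H|H];
    try (left; lra); right; exact H.
Qed.

Lemma xdom_right w t : xdom p q 0 w -> 0 <= t -> xdom p q 0 (w + RtoC t)%C.
Proof.
  intros H Ht k l. rewrite Re_plus, Im_plus, Re_RtoC, Im_RtoC, Rplus_0_r.
  destruct (H k l) as [K|K]; [left; lra|right; exact K].
Qed.

Lemma xdom_off w k l : xdom p q 0 w -> Re w <= 0 ->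
  Im w <> a + INR k * p + INR l * q /\ Im w <> - (a + INR k * p + INR l * q).
Proof.
  intros H Hw. destruct (H k l) as [K|K]; [lra|].
  assert (0 <= INR k * p) by (apply Rmult_le_pos; [apply pos_INR|lra]).
  assert (0 <= INR l * q) by (apply Rmult_le_pos; [apply pos_INR|lra]).
  assert (0 < a) by (unfold a, amean; lra). fold a in K.
  split; intros E; apply K; rewrite E, ?Rabs_Ropp; apply Rabs_pos_eq; lra.
Qed.

Lemma xdom_on w : (forall k l, Re w <= 0 ->
  Im w <> a + INR k * p + INR l * q /\ Im w <> - (a + INR k * p + INR l * q)) -> xdom p q 0 w.
Proof.
  intros H k l. destruct (Rlt_dec 0 (Re w)) as [K|K]; [left; exact K|right].
  destruct (H k l ltac:(lra)) as [A B]. fold a. intros E.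
  unfold Rabs in E. destruct (Rcase_abs (Im w)); lra.
Qed.

Lemma xdom_inwards_up w : xdom p q 0 w -> Im w <= - a -> xdom p q 0 (w + Ci * p)%C.
Proof.
  intros H Hw. apply xdom_on. intros k l. rewrite Re_up, Im_up. intros Hre.
  assert (0 <= INR k * p) by (apply Rmult_le_pos; [apply pos_INR|lra]).
  assert (0 <= INR l * q) by (apply Rmult_le_pos; [apply pos_INR|lra]).
  split; intros E.
  - unfold a, amean in *. lra.
  - destruct (xdom_off w (S k) l H Hre) as [_ K]. apply K. rewrite S_INR. lra.
Qed.

Lemma xdom_inwards_down w : xdom p q 0 w -> a <= Im w -> xdom p q 0 (w - Ci * p)%C.
Proof.
  intros H Hw. apply xdom_on. intros k l. rewrite Re_down, Im_down. intros Hre.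
  assert (0 <= INR k * p) by (apply Rmult_le_pos; [apply pos_INR|lra]).
  assert (0 <= INR l * q) by (apply Rmult_le_pos; [apply pos_INR|lra]).
  split; intros E.
  - destruct (xdom_off w (S k) l H Hre) as [K _]. apply K. rewrite S_INR. lra.
  - unfold a, amean in *. lra.
Qed.

Lemma xdom_induction (P : C -> Prop) :
  (forall w, Rabs (Im w) < a -> P w) ->
  (forall w, xdom p q 0 w -> a <= Im w -> P (w - Ci * p)%C -> P w) ->
  (forall w, xdom p q 0 w -> Im w <= - a -> P (w + Ci * p)%C -> P w) ->
  forall w, xdom p q 0 w -> P w.
Proof.
  intros H0 Hu Hd.
  assert (Ha : a = (p + q) / 2) by reflexivity.
  assert (K : forall n w, xdom p q 0 w -> Rabs (Im w) < a + INR n * p -> P w).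
  { induction n as [|n IH]; intros w Hw Hn.
    - apply H0. simpl in Hn. lra.
    - rewrite S_INR in Hn. apply Rabs_def2 in Hn.
      pose proof (pos_INR n). assert (0 <= INR n * p) by (apply Rmult_le_pos; lra).
      destruct (Rlt_dec (Im w) a) as [L1|L1]; [destruct (Rlt_dec (- a) (Im w)) as [L2|L2]|].
      + apply H0. apply Rabs_def1; lra.
      + apply Hd; [exact Hw|lra|]. apply IH; [apply xdom_inwards_up; [exact Hw|lra]|].
        rewrite Im_up. apply Rabs_def1; lra.
      + apply Hu; [exact Hw|lra|]. apply IH; [apply xdom_inwards_down; [exact Hw|lra]|].
        rewrite Im_down. apply Rabs_def1; lra. }
  intros w Hw. destruct (nfloor_ex (Rabs (Im w) / p)) as [n Hn].
  { apply Rmult_le_pos; [apply Rabs_pos|left; apply Rinv_0_lt_compat; exact Hp]. }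
  apply (K (S n) w Hw). rewrite S_INR. destruct Hn as [_ Hn].
  apply (Rmult_lt_compat_r p) in Hn; [|exact Hp].
  replace (Rabs (Im w) / p * p) with (Rabs (Im w)) in Hn by (field; lra). lra.
Qed.

(** A zero of sfac at height Im w makes w or w + i b lie on a cut. *)
Lemma xdom_slit_ray d w : xdom p q 0 w -> xdom p q 0 (w + Ci * bb d)%C -> slit_ray (bb d) (par p q d) w.
Proof.
  intros H1 H2. pose proof (par_pos p q d Hp Hq) as Hb. pose proof (bb_pos p q Hp Hq d) as Hbb. fold (bb d) in Hbb.
  assert (Ha : a = (bb d + par p q d) / 2) by apply amean_par.
  destruct (Rlt_dec 0 (Re w)) as [K|K]; [left; exact K|right].
  assert (I0 : Im (Ci * Im w)%C = Im w) by (reim; ring).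
  destruct (Rle_dec (Im w) (- a)) as [L|L]; [|destruct (Rle_dec a (Im w + bb d)) as [L2|L2]].
  - apply (sfac_neq_below p q Hp Hq d); rewrite I0; [exact L|]. intros k E. fold a in E. destruct d; simpl in E.
    + apply (proj2 (xdom_off w k 0 H1 ltac:(lra))). simpl. lra.
    + apply (proj2 (xdom_off w 0 k H1 ltac:(lra))). simpl. lra.
  - intros E. pose proof (sfac_reflect (bb d) (par p q d) (Ci * Im w)%C Hb) as R.
    rewrite E, Cmult_0_r in R. revert R.
    assert (I1 : Im (- (Ci * Im w) - Ci * bb d)%C = - (Im w + bb d)) by (reim; ring).
    apply (sfac_neq_below p q Hp Hq d); rewrite I1; [fold a; lra|].
    assert (Hre : Re (w + Ci * bb d)%C <= 0) by (rewrite Re_up; lra).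
    intros k E2. fold a in E2. destruct d; unfold par in E2.
    + apply (proj1 (xdom_off _ k 0 H2 Hre)). rewrite Im_up. change (INR 0) with 0. lra.
    + apply (proj1 (xdom_off _ 0 k H2 Hre)). rewrite Im_up. change (INR 0) with 0. lra.
  - apply Gstrip_sfac_neq; try assumption; rewrite ?I0; unfold amean; fold (bb d); lra.
Qed.

Lemma hGR_step_Minus w : lowdom p q 0 w -> hGR p q (w + Ci * p)%C = (sfac p q w * hGR p q w)%C.
Proof.
  intros H. destruct (Rlt_dec (- a) (Im w)) as [L|L].
  - apply hGR_step; try assumption. right. exact L.
  - apply hGR_step_down; [lra|]. pose proof (W_neq_0 p q 0 Hp Hq Minus w H ltac:(fold a; lra)) as K.
    simpl in K. replace (w - 0)%C with w in K by ring. exact K.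
Qed.

(** On the imaginary axis below - i a the step for p holds by hGR_step_down; the
    one for q follows because the two steps commute. *)
Theorem hGR_step_lowdom d w : lowdom p q 0 w ->
  hGR p q (w + Ci * bb d)%C = (sfac (bb d) (par p q d) w * hGR p q w)%C.
Proof.
  destruct d; [|apply hGR_step_Minus]. change (bb Plus) with q. change (par p q Plus) with p.
  revert w. apply (below_induction p q 0 Hp).
  - intros w Hw. apply hGR_step_q; try assumption. right. exact Hw.
  - intros w Hd Hw IH _.
    pose proof (hGR_step_Minus w Hd) as E1.
    pose proof (hGR_step_Minus _ (lowdom_up p q 0 Minus w Hd)) as E2. simpl in E2.
    rewrite sfac_period in E2 by exact Hq.
    rewrite E1, sfac_period in IH by exact Hp.
    replace (w + Ci * p + Ci * q)%C with (w + Ci * q + Ci * p)%C in IH by ring.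
    rewrite E2 in IH.
    pose proof (W_neq_0 p q 0 Hp Hq Minus w Hd Hw) as K.
    simpl in K. replace (w - 0)%C with w in K by ring.
    destruct (Ceq_dec (hGR p q (w + Ci * q) - sfac q p w * hGR p q w)%C 0%C) as [Z|Z].
    + replace (hGR p q (w + Ci * q)%C) with (hGR p q (w + Ci * q) - sfac q p w * hGR p q w + sfac q p w * hGR p q w)%C by ring.
      rewrite Z. ring.
    + exfalso. apply (Cmult_neq_0 _ _ K Z).
      transitivity (sfac p q w * hGR p q (w + Ci * q) - sfac q p w * (sfac p q w * hGR p q w))%C; [ring|].
      rewrite IH. ring.
Qed.

Definition rinv (w : C) : C := (/ hGR p q w)%C.
Definition rho (w : C) : C := sqrt_from_infty rinv w.

(** In the strip the branch is exp (- T / 8). A step upwards divides it by the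
    principal square root of sfac, which is continuous along the half-line
    because the two ends of the step are off the cuts. *)
Lemma rho_local w : xdom p q 0 w -> exists (d : R) (rl : C -> C), 0 < d /\ holo rl w /\
  forall v, Cmod (v - w)%C < d ->
    (forall t, 0 <= t -> hGR p q (v + RtoC t)%C <> 0%C) /\ branch rinv v (rl v).
Proof.
  assert (Ha : a = (p + q) / 2) by reflexivity.
  assert (near : forall (v w : C) d, Cmod (v - w)%C < d -> - d < Im v - Im w < d).
  { intros v u d H. pose proof (im_le_Cmod (v - u)%C) as E. rewrite Im_minus in E.
    assert (E2 : Rabs (Im v - Im u) < d) by lra. apply Rabs_def2 in E2. lra. }
  revert w. apply xdom_induction.
  - intros w Hw. exists (a - Rabs (Im w)), (fun v => cexp (- (gamT p q v / 8))%C).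
    split; [lra|]. split.
    + apply (holo_cexp (fun v => - (gamT p q v / 8))%C), holo_opp.
      apply (holo_div (gamT p q) (fun _ => RtoC 8)); [|apply holo_const|apply RtoC_neq_0; lra].
      apply holo_gamT; assumption.
    + intros v Hv. apply near in Hv.
      assert (Iv : forall t, Rabs (Im (v + RtoC t)%C) < a).
      { intros t. rewrite Im_plus, Im_RtoC, Rplus_0_r. apply Rabs_def2 in Hw.
        unfold Rabs in Hv |- *. destruct (Rcase_abs (Im w)), (Rcase_abs (Im v)); lra. }
      split.
      * intros t _. apply hGR_neq_0; try assumption. right. apply Iv.
      * apply (branch_intro (fun v => cexp (- (gamT p q v / 8))%C)).
        -- intros t _. apply holo_ccont, (holo_cexp (fun v => - (gamT p q v / 8))%C), holo_opp.
           apply (holo_div (gamT p q) (fun _ => RtoC 8)); [|apply holo_const|apply RtoC_neq_0; lra].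
           apply holo_gamT; try assumption. apply Iv.
        -- intros t _. unfold rinv. rewrite hGR_strip by (try assumption; apply Iv).
           unfold Gstrip. rewrite <- cexp_opp, <- cexp_plus. f_equal. field.
        -- apply tends1_cexp. intros eps He.
           assert (Iv0 := Iv 0). rewrite Im_plus, Im_RtoC, Rplus_0_r in Iv0.
           set (D := p + q - 2 * Rabs (Im v)). assert (HD : 0 < D) by (unfold D; lra).
           destruct (exp_decay_shift (2 * kap p q) (2 * gamQ p q / D) (8 * eps)) as [X K].
           { pose proof (kap_pos p q Hp Hq). lra. } { lra. }
           exists (X - Re v). intros x Hx. specialize (K (Re v + x) ltac:(lra)).
           rewrite Cmod_opp, Cmod_div, Cmod_R, Rabs_pos_eq by (try apply RtoC_neq_0; lra).
           pose proof (gamT_bound p q (v + RtoC x)%C Hp Hq) as B.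
           specialize (B ltac:(pose proof (Iv x); lra)).
           rewrite Re_plus, Im_plus, Re_RtoC, Im_RtoC, Rplus_0_r in B. fold D in B.
           replace (2 * (gamQ p q * exp (-2 * kap p q * (Re v + x))) / D)
             with (2 * gamQ p q / D * exp (- (2 * kap p q) * (Re v + x))) in B; [lra|].
           replace (- (2 * kap p q) * (Re v + x)) with (-2 * kap p q * (Re v + x)) by ring. field. lra.
  - intros w Hw HI [d1 [rl [Hd1 [Hol Hb]]]].
    assert (Hs : slit_ray p q (w - Ci * p)%C).
    { apply (xdom_slit_ray Minus); simpl; [apply xdom_inwards_down; assumption|].
      change (bb Minus) with p. replace (w - Ci * p + Ci * p)%C with w by ring. exact Hw. }
    destruct (slit_ray_open p q _ Hq Hs) as [d2 [Hd2 Ho]].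
    set (d := Rmin (Rmin d1 d2) q).
    exists d, (fun v => rl (v - Ci * p) * / csq (sfac p q (v - Ci * p)))%C.
    split; [repeat apply Rmin_pos; assumption|].
    pose proof (Rmin_l (Rmin d1 d2) q). pose proof (Rmin_r (Rmin d1 d2) q).
    pose proof (Rmin_l d1 d2). pose proof (Rmin_r d1 d2). fold d in H, H0.
    pose proof (slit_ray_slit p q _ 0 Hq Hs (Rle_refl 0)) as Hs0. rewrite Cplus_0_r in Hs0.
    split.
    + apply holo_mult; [apply (holo_comp rl (fun v => v - Ci * p)%C); [exact Hol|holo_auto]|].
      apply (holo_inv (fun v => csq (sfac p q (v - Ci * p)%C))); [|apply csq_neq_0; exact Hs0].
      apply (holo_comp csq (fun v => sfac p q (v - Ci * p)%C)); [apply holo_csq; exact Hs0|].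
      apply (holo_comp (sfac p q) (fun v => v - Ci * p)%C); [apply holo_sfac; exact Hq|holo_auto].
    + intros v Hv. specialize (Ho (v - Ci * p)%C). specialize (Hb (v - Ci * p)%C).
      replace (v - Ci * p - (w - Ci * p))%C with (v - w)%C in Ho, Hb by ring.
      specialize (Ho ltac:(lra)). destruct (Hb ltac:(lra)) as [N B].
      apply near in Hv.
      assert (St : forall t, hGR p q (v + RtoC t)%C = (sfac p q (v - Ci * p + t) * hGR p q (v - Ci * p + t))%C).
      { intros t. rewrite <- hGR_step; try assumption.
        - f_equal. ring.
        - right. fold a. rewrite Im_plus, Im_down, Im_RtoC. lra. }
      assert (Ns : forall t, 0 <= t -> sfac p q (v - Ci * p + t)%C <> 0%C)
        by (intros t Ht; apply slit_neq_0, slit_ray_slit; assumption).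
      split.
      * intros t Ht. rewrite St. apply Cmult_neq_0; [apply Ns; exact Ht|apply N; exact Ht].
      * apply (branch_mult rinv (fun z => / sfac p q z)%C rinv (v - Ci * p)%C (v - Ci * p)%C v).
        -- exact B.
        -- apply (branch_inv (sfac p q) _ (v - Ci * p)%C); [apply branch_sfac; assumption|exact Ns|reflexivity].
        -- intros t Ht. unfold rinv. rewrite St. field. split; [apply Ns|apply N]; exact Ht.
  - intros w Hw HI [d1 [rl [Hd1 [Hol Hb]]]].
    assert (Hs : slit_ray p q w).
    { apply (xdom_slit_ray Minus); simpl; [exact Hw|apply xdom_inwards_up; assumption]. }
    destruct (slit_ray_open p q _ Hq Hs) as [d2 [Hd2 Ho]].
    set (d := Rmin d1 d2).
    exists d, (fun v => rl (v + Ci * p) * csq (sfac p q v))%C.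
    split; [repeat apply Rmin_pos; assumption|].
    pose proof (Rmin_l d1 d2). pose proof (Rmin_r d1 d2). fold d in H, H0.
    pose proof (slit_ray_slit p q _ 0 Hq Hs (Rle_refl 0)) as Hs0. rewrite Cplus_0_r in Hs0.
    split.
    + apply holo_mult; [apply (holo_comp rl (fun v => v + Ci * p)%C); [exact Hol|holo_auto]|].
      apply (holo_comp csq (sfac p q)); [apply holo_csq; exact Hs0|apply holo_sfac; exact Hq].
    + intros v Hv. specialize (Ho v ltac:(lra)). specialize (Hb (v + Ci * p)%C).
      replace (v + Ci * p - (w + Ci * p))%C with (v - w)%C in Hb by ring.
      destruct (Hb ltac:(lra)) as [N B].
      assert (Ns : forall t, 0 <= t -> sfac p q (v + t)%C <> 0%C)
        by (intros t Ht; apply slit_neq_0, slit_ray_slit; assumption).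
      assert (St : forall t, 0 <= t -> hGR p q (v + Ci * p + RtoC t)%C = (sfac p q (v + t) * hGR p q (v + t))%C).
      { intros t Ht. replace (v + Ci * p + t)%C with (v + t + Ci * p)%C by ring.
        destruct (Rlt_dec (- a) (Im (v + t)%C)) as [L|L].
        - apply hGR_step; try assumption. right. exact L.
        - apply hGR_step_down; [lra|apply Ns; exact Ht]. }
      assert (N2 : forall t, 0 <= t -> hGR p q (v + RtoC t)%C <> 0%C).
      { intros t Ht E. apply (N t Ht). rewrite St, E by exact Ht. ring. }
      split; [exact N2|].
      apply (branch_mult rinv (sfac p q) rinv (v + Ci * p)%C v v); [exact B|apply branch_sfac; assumption|].
      intros t Ht. unfold rinv. rewrite St by exact Ht. field. split; [apply N2|apply Ns]; exact Ht.
Qed.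

Lemma hGR_ray_neq_0 w t : xdom p q 0 w -> 0 <= t -> hGR p q (w + RtoC t)%C <> 0%C.
Proof.
  intros H Ht. destruct (rho_local w H) as [d [rl [Hd [_ K]]]].
  destruct (K w) as [N _].
  { replace (w - w)%C with (RtoC 0) by ring. rewrite Cmod_0. exact Hd. }
  apply N, Ht.
Qed.

Lemma Cinv_neq_0 (z : C) : z <> 0%C -> (/ z)%C <> 0%C.
Proof.
  intros Hz E. pose proof (Cinv_r _ Hz) as Q. rewrite E, Cmult_0_r in Q.
  apply (f_equal Re) in Q. simpl in Q. lra.
Qed.

Lemma rinv_neq_0 w t : xdom p q 0 w -> 0 <= t -> rinv (w + RtoC t)%C <> 0%C.
Proof. intros H Ht. apply Cinv_neq_0, hGR_ray_neq_0; assumption. Qed.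

Lemma rho_branch w : xdom p q 0 w -> branch rinv w (rho w).
Proof.
  intros H. destruct (rho_local w H) as [d [rl [Hd [_ K]]]].
  destruct (K w) as [_ B].
  { replace (w - w)%C with (RtoC 0) by ring. rewrite Cmod_0. exact Hd. }
  unfold rho. rewrite (branch_value rinv w (rl w)); [exact B| |exact B].
  intros t Ht. apply rinv_neq_0; assumption.
Qed.

Theorem holo_rho w : xdom p q 0 w -> holo rho w.
Proof.
  intros H. destruct (rho_local w H) as [d [rl [Hd [Hol K]]]].
  apply (holo_ext_loc rl _ w d Hd); [|exact Hol].
  intros v Hv. destruct (K v Hv) as [N B]. symmetry. apply branch_value; [|exact B].
  intros t Ht. apply Cinv_neq_0, N, Ht.
Qed.

(** Both sides are branches of 1 / G_R, by the step of G_R and uniqueness. *)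
Theorem rho_step d w : xdom p q 0 w -> xdom p q 0 (w + Ci * bb d)%C ->
  (csq (sfac (bb d) (par p q d) w) * rho (w + Ci * bb d))%C = rho w.
Proof.
  intros H1 H2. pose proof (par_pos p q d Hp Hq) as Hb.
  pose proof (xdom_slit_ray d w H1 H2) as Hs.
  apply (branch_unique rinv w); [intros t Ht; apply rinv_neq_0; assumption| |apply rho_branch; exact H1].
  apply (branch_mult (sfac (bb d) (par p q d)) rinv rinv w (w + Ci * bb d)%C w);
    [apply branch_sfac; assumption|apply rho_branch; exact H2|].
  intros t Ht.
  assert (Hsf : sfac (bb d) (par p q d) (w + t)%C <> 0%C) by (apply slit_neq_0, slit_ray_slit; assumption).
  assert (St : hGR p q (w + Ci * bb d + RtoC t)%C = (sfac (bb d) (par p q d) (w + t) * hGR p q (w + t))%C).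
  { replace (w + Ci * bb d + t)%C with (w + t + Ci * bb d)%C by ring.
    apply hGR_step_lowdom, xdom_lowdom; try assumption. apply xdom_right; assumption. }
  pose proof (hGR_ray_neq_0 w t H1 Ht) as N2.
  unfold rinv. rewrite St. field. split; assumption.
Qed.

End Root.

(** * The square root of sinh on the right half-plane *)

Lemma sqrt_eq_pos (z w : C) : (z * z)%C = (w * w)%C -> 0 < Re z -> 0 < Re w -> z = w.
Proof.
  intros E Hz Hw. destruct (Ceq_dec (z - w)%C 0%C) as [Z|Z].
  - replace z with (z - w + w)%C by ring. rewrite Z. ring.
  - exfalso. apply (Cmult_neq_0 (z - w) (z + w)); [exact Z| |].
    + intros Q. apply (f_equal Re) in Q. rewrite Re_plus in Q. simpl (Re 0%C) in Q. lra.
    + transitivity (z * z - w * w)%C; [ring|rewrite E; ring].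
Qed.

(** The branch of sinh (pi y / b) ^ (1/2) on the right half-plane. *)
Definition rhalf (b : R) (y : C) : C :=
  (cexp (PI * y / (2 * b)) * csq (1 - cexp (- (2 * PI * y / b))) / sqrt 2)%C.

Section Right_half.
Variable b : R.
Hypothesis Hb : 0 < b.

Let HbC : RtoC b <> 0%C.
Proof. apply RtoC_neq_0; lra. Qed.

Let sqrt2_pos : 0 < sqrt 2.
Proof. apply sqrt_lt_R0; lra. Qed.

Let sqrt2_neq : RtoC (sqrt 2) <> 0%C.
Proof. apply RtoC_neq_0; lra. Qed.

Lemma rhalf_slit y : 0 < Re y -> slit (1 - cexp (- (2 * PI * y / b)))%C.
Proof.
  intros Hy. left. pose proof PI_RGT_0.
  pose proof (re_le_Cmod (cexp (- (2 * PI * y / b)))) as E. rewrite Cmod_cexp in E.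
  assert (E2 : Re (- (2 * PI * y / b))%C < 0).
  { rewrite Re_opp, Re_div_R by lra. rewrite <- RtoC_mult, Re_mult, Re_RtoC, Im_RtoC.
    assert (0 < 2 * PI * Re y / b); [|unfold Rdiv in *; lra].
    apply Rdiv_lt_0_compat; [|exact Hb]. apply Rmult_lt_0_compat; lra. }
  apply exp_increasing in E2. rewrite exp_0 in E2.
  rewrite Re_minus. change (Re 1%C) with 1.
  pose proof (Rle_abs (Re (cexp (- (2 * PI * y / b))))). lra.
Qed.

Lemma rhalf_sqr y : 0 < Re y -> (rhalf b y * rhalf b y)%C = csinh (PI * y / b)%C.
Proof.
  intros Hy. pose proof (csq_sqr _ (rhalf_slit y Hy)) as Q.
  unfold rhalf, csinh. set (E := cexp (- (2 * PI * y / b))) in *. set (s := csq (1 - E)%C) in *.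
  transitivity (cexp (PI * y / (2 * b)) * cexp (PI * y / (2 * b)) * (s * s) / (sqrt 2 * sqrt 2))%C.
  - field. exact sqrt2_neq.
  - assert (S2 : (sqrt 2 * sqrt 2)%C = 2%C) by (rewrite <- RtoC_mult, sqrt_sqrt by lra; reflexivity).
    rewrite Q, S2, <- cexp_plus.
    replace (PI * y / (2 * b) + PI * y / (2 * b))%C with (PI * y / b)%C by (field; exact HbC).
    unfold E. replace (- (2 * PI * y / b))%C with (- (PI * y / b) + - (PI * y / b))%C by (field; exact HbC).
    rewrite cexp_plus.
    pose proof (cexp_opp_l (PI * y / b)%C) as K.
    set (e1 := cexp (PI * y / b)) in *. set (e2 := cexp (- (PI * y / b))) in *.
    transitivity ((e1 - (e2 * e1) * e2) / 2)%C; [field|rewrite K; field].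
Qed.

Lemma rhalf_neq_0 y : 0 < Re y -> rhalf b y <> 0%C.
Proof.
  intros Hy. unfold rhalf, Cdiv.
  apply Cmult_neq_0; [apply Cmult_neq_0; [apply cexp_neq_0|apply csq_neq_0, rhalf_slit, Hy]|].
  apply Cinv_neq_0; exact sqrt2_neq.
Qed.

Lemma holo_rhalf y : 0 < Re y -> holo (rhalf b) y.
Proof.
  intros Hy. unfold rhalf.
  apply (holo_div (fun y => cexp (PI * y / (2 * b)) * csq (1 - cexp (- (2 * PI * y / b))))%C (fun _ => RtoC (sqrt 2)));
    [|apply holo_const|exact sqrt2_neq].
  assert (RtoC 2 * b <> 0)%C by (apply Cmult_neq_0; [exact two_neq|exact HbC]).
  apply holo_mult; [holo_auto; assumption|].
  apply (holo_comp csq (fun y => 1 - cexp (- (2 * PI * y / b)))%C); [apply holo_csq, rhalf_slit, Hy|].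
  holo_auto; assumption.
Qed.

(** The exponential gains a factor exp (i pi / 2), and the other factor has
    period i b. *)
Lemma rhalf_up y : rhalf b (y + Ci * b)%C = (Ci * rhalf b y)%C.
Proof.
  unfold rhalf.
  replace (PI * (y + Ci * b) / (2 * b))%C with (PI * y / (2 * b) + Ci * (PI / 2))%C by (field; exact HbC).
  replace (- (2 * PI * (y + Ci * b) / b))%C with (- (2 * PI * y / b) - Ci * PI - Ci * PI)%C by (field; exact HbC).
  rewrite cexp_plus, cexp_iPI2, !cexp_minus, cexp_iPI.
  replace (cexp (- (2 * PI * y / b)) / - (1) / - (1))%C with (cexp (- (2 * PI * y / b))) by field.
  field. exact sqrt2_neq.
Qed.

Lemma rhalf_down y : rhalf b (y - Ci * b)%C = (- Ci * rhalf b y)%C.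
Proof.
  pose proof (rhalf_up (y - Ci * b)%C) as E.
  replace (y - Ci * b + Ci * b)%C with y in E by ring. rewrite E.
  transitivity (- (Ci * Ci) * rhalf b (y - Ci * b))%C; [|ring].
  rewrite Ci2. apply C_eq; reim; ring.
Qed.

Lemma csq_real (x : R) : 0 < x -> Im (csq x) = 0.
Proof.
  intros Hx. assert (H : slit x) by (left; exact Hx). pose proof (slit_pos _ H).
  unfold csq. rewrite Im_div_R.
  - rewrite Im_plus, !Im_RtoC. unfold Rdiv. ring.
  - assert (0 < sqrt (2 * (Cmod x + Re x))) by (apply sqrt_lt_R0; lra). lra.
Qed.

Lemma rhalf_real (y : R) : 0 < y -> 0 < Re (rhalf b y) /\ Im (rhalf b y) = 0.
Proof.
  intros Hy. pose proof (rhalf_slit y Hy) as S.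
  assert (E1 : cexp (PI * y / (2 * b)) = RtoC (exp (PI * y / (2 * b)))).
  { rewrite <- cexp_R. f_equal. rewrite RtoC_div, !RtoC_mult by lra. reflexivity. }
  assert (E2 : (1 - cexp (- (2 * PI * y / b)))%C = RtoC (1 - exp (- (2 * PI * y / b)))).
  { rewrite RtoC_minus, <- cexp_R. do 2 f_equal. rewrite RtoC_opp, RtoC_div, !RtoC_mult by lra. reflexivity. }
  unfold rhalf. rewrite Re_div_R, Im_div_R by lra. rewrite E1, E2 in *.
  set (x := 1 - exp (- (2 * PI * y / b))) in *.
  assert (Hx : 0 < x) by (destruct S as [S|S]; [exact S|rewrite Im_RtoC in S; lra]).
  rewrite Re_mult, Im_mult, Re_RtoC, Im_RtoC, csq_real by exact Hx.
  pose proof (csq_Re x S) as P. pose proof (exp_pos (PI * y / (2 * b))). split.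
  - apply Rdiv_lt_0_compat; [|exact sqrt2_pos].
    assert (0 < exp (PI * y / (2 * b)) * Re (csq x)) by (apply Rmult_lt_0_compat; assumption). lra.
  - unfold Rdiv. ring.
Qed.

(** The segment from y to Re y stays in the half-plane; on the real axis both
    branches are positive. *)
Lemma sqrt_right_half_value (f : C -> C) y : (forall z, f z = csinh (PI * z / b)%C) ->
  0 < Re y -> sqrt_right_half f y = rhalf b y.
Proof.
  intros Hf.
  set (P := fun r : C -> C => forall y : C, 0 < Re y ->
      continuous (T := C_UniformSpace) (U := C_UniformSpace) r y /\
      (r y * r y = f y)%C /\
      (Im y = 0 -> 0 < Re (r y) /\ Im (r y) = 0)).
  assert (HP : P (sqrt_right_half f)).
  { unfold sqrt_right_half. apply (epsilon_spec (inhabits (fun _ : C => RtoC 0)) P).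
    exists (rhalf b). intros z Hz. split; [|split].
    - apply holo_ccont, holo_rhalf, Hz.
    - rewrite Hf. apply rhalf_sqr, Hz.
    - intros Iz. replace z with (RtoC (Re z)) by (apply C_eq; [reflexivity|rewrite Im_RtoC; symmetry; exact Iz]).
      apply rhalf_real, Hz. }
  intros Hy. set (path := fun t : R => ((Re y, Im y * (1 - t)) : C)).
  assert (Cp : forall t, rcont path t).
  { intros t. apply (continuous_ext (fun t => RtoC (Re y) + Ci * (Im y * (1 - RtoC t)))%C).
    - intros s. unfold path. apply C_eq; reim; simpl; ring.
    - apply cont_plus; [apply cont_const|]. apply cont_mult; [apply cont_const|].
      apply cont_mult; [apply cont_const|]. apply cont_minus; [apply cont_const|apply cont_id_R]. }
  pose proof (sqrt_path_unique (fun t => sqrt_right_half f (path t)) (fun t => rhalf b (path t)) 1 ltac:(lra)) as U.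
  assert (E0 : path 0 = y) by (unfold path; apply C_eq; simpl; ring).
  cbv beta in U. rewrite E0 in U. apply U.
  - intros t _. apply (cont_comp path (sqrt_right_half f)); [apply Cp|]. apply (HP (path t)). exact Hy.
  - intros t _. apply (cont_comp path (rhalf b)); [apply Cp|]. apply holo_ccont, holo_rhalf. exact Hy.
  - intros t _. destruct (HP (path t) Hy) as [_ [Q _]]. split; [|apply rhalf_neq_0; exact Hy].
    rewrite Q, Hf, rhalf_sqr by exact Hy. reflexivity.
  - destruct (HP (path 1) Hy) as [_ [Q K]].
    assert (E1 : path 1 = RtoC (Re y)) by (unfold path; apply C_eq; simpl; ring).
    rewrite E1 in *. destruct (K (Im_RtoC _)) as [K1 _].
    apply sqrt_eq_pos; [|exact K1|apply rhalf_real, Hy].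
    rewrite Q, Hf, rhalf_sqr by exact Hy. reflexivity.
Qed.
End Right_half.

Lemma sqrt_right_half_s p q d y : 0 < p -> 0 < q -> 0 < Re y ->
  sqrt_right_half (s_ p q d) y = rhalf (par p q d) y.
Proof.
  intros Hp Hq Hy. apply sqrt_right_half_value; [apply par_pos; assumption|reflexivity|exact Hy].
Qed.

(** * The prefactor *)

(** The reflection equation at y - i a, and one step for each of p and q from y
    - i a to y + i a. *)
Lemma prefactor_numerator p q (y : C) : 0 < p -> 0 < q -> 0 < Re y ->
  (hG p q (y + Ci * amean p q) * hG p q (- y + Ci * amean p q))%C
  = (4 * csinh (PI * y / p) * csinh (PI * y / q))%C.
Proof.
  intros Hp Hq Hy.
  assert (HpC : RtoC p <> 0%C) by (apply RtoC_neq_0; lra).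
  assert (HqC : RtoC q <> 0%C) by (apply RtoC_neq_0; lra).
  assert (Ha : RtoC (amean p q) = ((p + q) / 2)%C).
  { unfold amean. rewrite RtoC_div, RtoC_plus by lra. reflexivity. }
  assert (Hal : RtoC (alpha p q) = (2 * PI / (p * q))%C).
  { unfold alpha. rewrite RtoC_div by (apply Rmult_integral_contrapositive; lra). rewrite !RtoC_mult. reflexivity. }
  set (a := RtoC (amean p q)) in *.
  set (v := (y - Ci * a)%C).
  assert (Rv : forall s : R, Re (v + Ci * s)%C = Re y).
  { intros s. rewrite Re_up. unfold v, a. rewrite Re_down. reflexivity. }
  assert (Rv0 : Re v <> 0) by (unfold v, a; rewrite Re_down; lra).
  pose proof (hGR_reflection p q v Hp Hq Rv0) as Refl.
  assert (S1 : hGR p q (v + Ci * q)%C = (sfac q p v * hGR p q v)%C) by (apply hGR_step_q; try assumption; left; exact Rv0).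
  assert (S2 : hGR p q (v + Ci * q + Ci * p)%C = (sfac p q (v + Ci * q) * hGR p q (v + Ci * q))%C).
  { apply hGR_step; try assumption; left. rewrite Rv; lra. }
  replace (v + Ci * q + Ci * p)%C with (y + Ci * a)%C in S2 by (unfold v; rewrite Ha; field).
  replace (- v)%C with (- y + Ci * a)%C in Refl by (unfold v; ring).
  rewrite S1 in S2.
  assert (F1 : sfac q p v = (1 - cexp (- (2 * PI * y / p)))%C).
  { unfold sfac, v. rewrite Ha.
    replace (- (2 * PI * (y - Ci * ((p + q) / 2) + Ci * q / 2) / p))%C with (- (2 * PI * y / p) + Ci * PI)%C by (field; exact HpC).
    rewrite cexp_plus, cexp_iPI. ring. }
  assert (F2 : sfac p q (v + Ci * q)%C = (1 - cexp (- (2 * PI * y / q)))%C).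
  { unfold sfac, v. rewrite Ha.
    replace (- (2 * PI * (y - Ci * ((p + q) / 2) + Ci * q + Ci * p / 2) / q))%C with (- (2 * PI * y / q) - Ci * PI)%C by (field; exact HqC).
    rewrite cexp_minus, cexp_iPI. field. }
  assert (E : (hGR p q (y + Ci * a) * hGR p q (- y + Ci * a))%C
     = ((1 - cexp (- (2 * PI * y / p))) * (1 - cexp (- (2 * PI * y / q))) * gref p q v)%C).
  { rewrite S2, F1, F2, <- Refl. ring. }
  unfold hGR in E.
  set (h1 := hG p q (y + Ci * a)) in *. set (h2 := hG p q (- y + Ci * a)) in *.
  assert (G : (gref p q v)%C = (cexp (PI * y / p) * cexp (PI * y / q) *
     (cexp (Ci * chi p q + Ci * alpha p q * (y + Ci * a) ^ 2 / 4) *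
      cexp (Ci * chi p q + Ci * alpha p q * (- y + Ci * a) ^ 2 / 4)))%C).
  { unfold gref, v. rewrite <- !cexp_plus. f_equal. rewrite Hal, Ha.
    transitivity (2 * Ci * chi p q + PI * y * (- (Ci * Ci)) * (p + q) / (p * q)
      + Ci * (2 * PI / (p * q)) * (y * y + (Ci * ((p + q) / 2)) * (Ci * ((p + q) / 2))) / 2)%C.
    - field. split; assumption.
    - rewrite Ci2 at 1.
      field. split; assumption. }
  rewrite G in E.
  set (g1 := cexp (Ci * chi p q + Ci * alpha p q * (y + Ci * a) ^ 2 / 4)) in *.
  set (g2 := cexp (Ci * chi p q + Ci * alpha p q * (- y + Ci * a) ^ 2 / 4)) in *.
  assert (N1 : g1 <> 0%C) by apply cexp_neq_0. assert (N2 : g2 <> 0%C) by apply cexp_neq_0.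
  transitivity (h1 * g1 * (h2 * g2) / (g1 * g2))%C; [field; split; assumption|].
  rewrite E. unfold csinh.
  replace (- (2 * PI * y / p))%C with (- (PI * y / p) + - (PI * y / p))%C by (field; exact HpC).
  replace (- (2 * PI * y / q))%C with (- (PI * y / q) + - (PI * y / q))%C by (field; exact HqC).
  rewrite !cexp_plus.
  pose proof (cexp_opp_l (PI * y / p)%C) as K1. pose proof (cexp_opp_l (PI * y / q)%C) as K2.
  set (e1 := cexp (PI * y / p)) in *. set (e2 := cexp (- (PI * y / p))) in *.
  set (e3 := cexp (PI * y / q)) in *. set (e4 := cexp (- (PI * y / q))) in *.
  transitivity ((e1 - (e2 * e1) * e2) * (e3 - (e4 * e3) * e4))%C; [field; split; assumption|].
  rewrite K1, K2. field.
Qed.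

(** The square root of 4 s_+(y) s_-(y) / (a_+ a_-). *)
Definition Kpre (p q : R) (y : C) : C := (2 / sqrt (p * q) * rhalf p y * rhalf q y)%C.

Lemma Kpre_real p q (y : R) : 0 < p -> 0 < q -> 0 < y ->
  exists k, 0 < k /\ Kpre p q y = RtoC k.
Proof.
  intros Hp Hq Hy. destruct (rhalf_real p Hp y Hy) as [P1 P2]. destruct (rhalf_real q Hq y Hy) as [Q1 Q2].
  assert (Hs : 0 < sqrt (p * q)) by (apply sqrt_lt_R0, Rmult_lt_0_compat; assumption).
  exists (2 / sqrt (p * q) * Re (rhalf p y) * Re (rhalf q y)). split.
  - repeat apply Rmult_lt_0_compat; try assumption; [lra|apply Rinv_0_lt_compat; exact Hs].
  - unfold Kpre. rewrite !RtoC_mult, RtoC_div by lra.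
    f_equal; [f_equal|]; apply C_eq; try reflexivity; rewrite Im_RtoC; assumption.
Qed.

Theorem prefactor_value p q eta (y : R) x : 0 < p -> 0 < q -> 0 < y -> xdom p q eta x ->
  sqrt_from_infty (FT_prefactor_sq p q eta y) x = (Kpre p q y * rho p q (x - eta))%C.
Proof.
  intros Hp Hq Hy Hx. apply xdom_minus in Hx.
  assert (HpC : RtoC p <> 0%C) by (apply RtoC_neq_0; lra).
  assert (HqC : RtoC q <> 0%C) by (apply RtoC_neq_0; lra).
  assert (Hs : 0 < sqrt (p * q)) by (apply sqrt_lt_R0, Rmult_lt_0_compat; assumption).
  assert (HsC : RtoC (sqrt (p * q)) <> 0%C) by (apply RtoC_neq_0; lra).
  destruct (Kpre_real p q y Hp Hq Hy) as [k [Hk Ek]].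
  assert (K2 : (k * k)%C = (4 * csinh (PI * y / p) * csinh (PI * y / q) / (p * q))%C).
  { rewrite <- Ek. unfold Kpre. rewrite <- !rhalf_sqr by assumption.
    transitivity (4 * (rhalf p y * rhalf p y) * (rhalf q y * rhalf q y) / (sqrt (p * q) * sqrt (p * q)))%C.
    - field. exact HsC.
    - assert (S2 : (sqrt (p * q) * sqrt (p * q))%C = (p * q)%C)
        by (rewrite <- !RtoC_mult, sqrt_sqrt by (left; apply Rmult_lt_0_compat; assumption); reflexivity).
      rewrite S2. reflexivity. }
  assert (Hf : forall t, 0 <= t -> FT_prefactor_sq p q eta y (x + t)%C = (k * k * rinv p q (x - eta + t))%C).
  { intros t Ht. unfold FT_prefactor_sq, rinv. rewrite K2, prefactor_numerator by assumption.
    replace (x + t - eta)%C with (x - eta + t)%C by ring. field.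
    repeat split; try assumption. apply hGR_ray_neq_0; assumption. }
  assert (HkC : RtoC k <> 0%C) by (apply RtoC_neq_0; lra).
  apply branch_value.
  - intros t Ht. rewrite Hf by exact Ht.
    apply Cmult_neq_0; [apply Cmult_neq_0; exact HkC|apply rinv_neq_0; assumption].
  - rewrite Ek. apply (branch_mult (fun _ => k * k)%C (rinv p q) _ x (x - eta)%C x).
    + apply branch_const; [exact Hk|reflexivity].
    + apply rho_branch; assumption.
    + exact Hf.
Qed.

(** * The joint eigenfunction *)

Lemma CInt_FT p q eta x y : 0 < p -> 0 < q ->
  CInt (FT_integrand p q eta x y) (Rbar_locally m_infty) (Rbar_locally p_infty)
  = It p q (uX p q eta x) y.
Proof.
  intros Hp Hq. assert (Ha : 0 < amean p q) by (unfold amean; lra).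
  assert (Iu : Im (uX p q eta x) = - amean p q / 2) by (rewrite Im_uX, Im_RtoC; field).
  unfold CInt. apply (is_RInt_gen_unique (V := C_R_CompleteNormedModule)).
  pose proof (It_real p q (uX p q eta x) y Hp Hq ltac:(lra) ltac:(lra) (Im_RtoC y)) as E.
  replace (FT_integrand p q eta x y) with (fun t => fI p q (uX p q eta x) y (RtoC t)); [exact E|].
  apply functional_extensionality. intros t. unfold fI, FT_integrand, uX.
  do 2 f_equal; f_equal; ring.
Qed.

Lemma xdom_real p q eta (x : R) : 0 < p -> 0 < q -> xdom p q eta x.
Proof.
  intros Hp Hq k l. right. rewrite Im_RtoC, Rabs_R0. pose proof (pos_INR k). pose proof (pos_INR l).
  assert (0 <= INR k * p) by (apply Rmult_le_pos; lra). assert (0 <= INR l * q) by (apply Rmult_le_pos; lra).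
  unfold amean. lra.
Qed.

Lemma FT_value p q eta x y : 0 < p -> 0 < q -> 0 < y ->
  FT p q eta x y = (Kpre p q y * rho p q (x - eta) * cexp (Ci * alpha p q * y ^ 2 / 4)
     * It p q (uX p q eta x) y)%C.
Proof.
  intros Hp Hq Hy. unfold FT. rewrite CInt_FT, prefactor_value; try assumption; [reflexivity|].
  apply xdom_real; assumption.
Qed.

Lemma holo_sub (f : C -> C) (c z : C) : holo f (z - c)%C -> holo (fun w => f (w - c))%C z.
Proof. intros H. apply (holo_comp f (fun w => w - c)%C); [exact H|holo_auto]. Qed.

Lemma sigma_plus p q eta d x : 0 < p -> 0 < q ->
  slit_ray (par p q (opp_sgn d)) (par p q d) (x - eta)%C ->
  sqrt_from_infty (fun u => 1 + e_ p q d (- (2 * u) - Ci * par p q (opp_sgn d) + 2 * eta))%C x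
  = csq (sfac (par p q (opp_sgn d)) (par p q d) (x - eta)).
Proof.
  intros Hp Hq Hs. pose proof (par_pos p q d Hp Hq) as Hb.
  assert (HbC : RtoC (par p q d) <> 0%C) by (apply RtoC_neq_0; lra).
  set (b := par p q (opp_sgn d)) in *.
  assert (E : forall t, (1 + e_ p q d (- (2 * (x + RtoC t)) - Ci * b + 2 * eta))%C = sfac b (par p q d) (x - eta + t)%C).
  { intros t. unfold e_, sfac. do 2 f_equal. field. exact HbC. }
  apply branch_value.
  - intros t Ht. rewrite E. apply slit_neq_0, slit_ray_slit; assumption.
  - apply (branch_ext (sfac b (par p q d)) _ (x - eta)%C); [apply branch_sfac; assumption|].
    intros t _. apply E.
Qed.

Lemma sigma_minus p q eta d x : 0 < p -> 0 < q ->
  slit_ray (par p q (opp_sgn d)) (par p q d) (x - Ci * par p q (opp_sgn d) - eta)%C ->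
  sqrt_from_infty (fun u => 1 + e_ p q d (- (2 * u) + Ci * par p q (opp_sgn d) + 2 * eta))%C x
  = csq (sfac (par p q (opp_sgn d)) (par p q d) (x - Ci * par p q (opp_sgn d) - eta)).
Proof.
  intros Hp Hq Hs. pose proof (par_pos p q d Hp Hq) as Hb.
  assert (HbC : RtoC (par p q d) <> 0%C) by (apply RtoC_neq_0; lra).
  set (b := par p q (opp_sgn d)) in *.
  assert (E : forall t, (1 + e_ p q d (- (2 * (x + RtoC t)) + Ci * b + 2 * eta))%C = sfac b (par p q d) (x - Ci * b - eta + t)%C).
  { intros t. unfold e_, sfac. do 2 f_equal. field. exact HbC. }
  apply branch_value.
  - intros t Ht. rewrite E. apply slit_neq_0, slit_ray_slit; assumption.
  - apply (branch_ext (sfac b (par p q d)) _ (x - Ci * b - eta)%C); [apply branch_sfac; assumption|].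
    intros t _. apply E.
Qed.

(** With the square roots absorbed by rho_step, the equation is Itil_equation at
    the lowest of the three points. *)
Theorem Toda_x p q eta (y : R) : 0 < p -> 0 < q -> 0 < y ->
  exists Phi : C -> C,
    analytic_continuation (xdom p q eta) (fun _ : R => True) (fun x : R => FT p q eta x y) Phi /\
    forall (d : sgn) (x : C),
      xdom p q eta x ->
      xdom p q eta (x + Ci * par p q (opp_sgn d))%C ->
      xdom p q eta (x - Ci * par p q (opp_sgn d))%C ->
      HT p q eta d Phi x = (2 * c_ p q d y * Phi x)%C.
Proof.
  intros Hp Hq Hy. assert (Ha : 0 < amean p q) by (unfold amean; lra).
  set (k := (Kpre p q y * cexp (Ci * alpha p q * y ^ 2 / 4))%C).
  exists (fun x => k * rho p q (x - eta) * Itil p q eta y x)%C. split; [split|].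
  - intros x Hx. apply holo_mult; [apply (holo_mult (fun _ => k)); [apply holo_const|]|].
    + apply (holo_sub (rho p q)), holo_rho; try assumption. exact (proj1 (xdom_minus p q eta x) Hx).
    + apply holo_Itil; try assumption. apply xdom_lowdom; assumption.
  - intros x _. rewrite FT_value by assumption. unfold k.
    rewrite Itil_above; [ring|assumption|rewrite Im_RtoC; lra].
  - intros d x H0 Hu Hd. set (b := par p q (opp_sgn d)) in *.
    assert (X0 := proj1 (xdom_minus p q eta _) H0).
    assert (Xu := proj1 (xdom_minus p q eta _) Hu).
    assert (Xd := proj1 (xdom_minus p q eta _) Hd).
    assert (Su : slit_ray b (par p q d) (x - eta)%C).
    { apply xdom_slit_ray; try assumption. fold b. replace (x - eta + Ci * b)%C with (x + Ci * b - eta)%C by ring. exact Xu. }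
    assert (Sd : slit_ray b (par p q d) (x - Ci * b - eta)%C).
    { apply xdom_slit_ray; try assumption. fold b. replace (x - Ci * b - eta + Ci * b)%C with (x - eta)%C by ring. exact X0. }
    unfold HT, translate. fold b. rewrite sigma_plus, sigma_minus by assumption. fold b.
    change (x + - (Ci * b))%C with (x - Ci * b)%C.
    pose proof (rho_step p q Hp Hq d (x - eta)%C X0) as R1. cbv beta in R1. fold b in R1.
    replace (x - eta + Ci * b)%C with (x + Ci * b - eta)%C in R1 by ring. specialize (R1 Xu).
    pose proof (rho_step p q Hp Hq d (x - Ci * b - eta)%C Xd) as R2. cbv beta in R2. fold b in R2.
    replace (x - Ci * b - eta + Ci * b)%C with (x - eta)%C in R2 by ring. specialize (R2 X0).
    pose proof (Itil_equation p q eta y Hp Hq d (x - Ci * b)%C (xdom_lowdom _ _ _ _ Hp Hq Hd)) as I.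
    cbv beta in I. fold b in I. replace (x - Ci * b + Ci * b)%C with x in I by ring.
    pose proof (slit_ray_slit b (par p q d) _ 0 (par_pos p q d Hp Hq) Sd (Rle_refl 0)) as Q.
    rewrite Cplus_0_r in Q. apply csq_sqr in Q.
    rewrite <- R2.
    set (s1 := csq (sfac b (par p q d) (x - eta))) in *. set (s2 := csq (sfac b (par p q d) (x - Ci * b - eta))) in *.
    rewrite <- Q in I.
    transitivity (k * (s1 * rho p q (x + Ci * b - eta)) * Itil p q eta y (x + Ci * b)
       + k * rho p q (x - eta) * (s2 * s2 * Itil p q eta y (x - Ci * b)))%C; [ring|].
    rewrite R1.
    transitivity (k * rho p q (x - eta) * (2 * c_ p q d y * Itil p q eta y x))%C; [|ring].
    rewrite <- I. ring.
Qed.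

(** The shift y -> y + i b multiplies the root of sinh (pi y / b) by i and the
    Gaussian factor by a constant times exp (- pi y / b'); what remains is
    It_y_equation. *)
Theorem Toda_y p q eta (x : R) : 0 < p -> 0 < q ->
  exists Psi : C -> C,
    analytic_continuation (fun y : C => 0 < Re y) (fun y : R => 0 < y) (fun y : R => FT p q eta x y) Psi /\
    forall (d : sgn) (y : C), 0 < Re y -> HThat p q eta d Psi y = (e_ p q d x * Psi y)%C.
Proof.
  intros Hp Hq. assert (Ha : 0 < amean p q) by (unfold amean; lra).
  assert (Iu : - amean p q < Im (uX p q eta x)) by (rewrite Im_uX, Im_RtoC; lra).
  set (r := rho p q (x - eta)). set (u := uX p q eta x) in *.
  set (g := fun y : C => cexp (Ci * alpha p q * y ^ 2 / 4)).
  exists (fun y => Kpre p q y * r * g y * It p q u y)%C. split; [split|].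
  - intros y Hy. apply holo_mult; [apply holo_mult; [apply holo_mult; [|apply holo_const]|]|].
    + unfold Kpre. apply holo_mult; [apply (holo_mult (fun _ => 2 / sqrt (p * q))%C); [apply holo_const|]|];
        apply holo_rhalf; assumption.
    + unfold g. apply (holo_cexp (fun y => Ci * alpha p q * y ^ 2 / 4)%C).
      apply (holo_ext_loc (fun y => Ci * alpha p q * (y * y) / 4)%C _ y 1); [lra|intros v _; field|].
      holo_auto; apply RtoC_neq_0; lra.
    + apply (It_holo p q (fun _ => u) (fun y => y)); try assumption; intros v; [apply holo_const|apply holo_id].
  - intros y Hy. rewrite FT_value by assumption. reflexivity.
  - intros d y Hy. set (b := par p q (opp_sgn d)). set (b' := par p q d).
    assert (Hb : 0 < b) by (apply par_pos; assumption). assert (Hb' : 0 < b') by (apply par_pos; assumption).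
    assert (HbC : RtoC b <> 0%C) by (apply RtoC_neq_0; lra).
    assert (HbC' : RtoC b' <> 0%C) by (apply RtoC_neq_0; lra).
    assert (HaC : RtoC (amean p q) = ((b + b') / 2)%C).
    { rewrite (amean_par p q d). rewrite RtoC_div, RtoC_plus by lra. reflexivity. }
    assert (HalC : RtoC (alpha p q) = (2 * PI / (b * b'))%C).
    { rewrite (alpha_par p q d Hp Hq). fold b b'. rewrite RtoC_div by (apply Rmult_integral_contrapositive; lra).
      rewrite !RtoC_mult. reflexivity. }
    assert (Ru : 0 < Re (y + Ci * b)%C) by (rewrite Re_up; exact Hy).
    assert (Rd : 0 < Re (y - Ci * b)%C) by (rewrite Re_down; exact Hy).
    unfold HThat, translate. fold b.
    change (y + - (Ci * b))%C with (y - Ci * b)%C.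
    rewrite !sqrt_right_half_s by assumption. fold b'.
    set (c0 := (2 / sqrt (p * q))%C).
    assert (HK : forall v, Kpre p q v = (c0 * rhalf b' v * rhalf b v)%C).
    { intros v. unfold Kpre, b, b'. fold c0. destruct d; simpl; ring. }
    rewrite !HK, rhalf_up, rhalf_down by assumption.
    set (gb := cexp (- (Ci * PI * b / (2 * b')))%C).
    assert (Gu : g (y + Ci * b)%C = (g y * gb * Em b' y)%C).
    { unfold g, gb, Em. rewrite <- !cexp_plus. f_equal. rewrite HalC.
      transitivity (Ci * (2 * PI / (b * b')) * (y * y + 2 * y * Ci * b + Ci * Ci * b * b) / 4)%C; [field; auto|].
      transitivity (Ci * PI * y * y / (2 * b * b') + (Ci * Ci) * PI * y / b' + Ci * (Ci * Ci) * PI * b / (2 * b'))%C; [field; auto|].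
      rewrite Ci2. field. auto. }
    assert (Gd : g (y - Ci * b)%C = (g y * gb * Em b' (- y))%C).
    { unfold g, gb, Em. rewrite <- !cexp_plus. f_equal. rewrite HalC.
      transitivity (Ci * (2 * PI / (b * b')) * (y * y - 2 * y * Ci * b + Ci * Ci * b * b) / 4)%C; [field; auto|].
      transitivity (Ci * PI * y * y / (2 * b * b') - (Ci * Ci) * PI * y / b' + Ci * (Ci * Ci) * PI * b / (2 * b'))%C; [field; auto|].
      rewrite Ci2. field. auto. }
    assert (Ex : (e_ p q d eta * Ci * gb)%C = (e_ p q d x * Qf b b' u)%C).
    { transitivity (e_ p q d eta * cexp (Ci * (PI / 2)) * gb)%C; [rewrite cexp_iPI2; reflexivity|].
      unfold e_, gb, Qf. fold b'. rewrite <- !cexp_plus. f_equal.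
      unfold u, uX. rewrite HaC. field. auto. }
    pose proof (It_y_equation p q d Hp Hq u y Iu) as Y. fold b b' in Y.
    pose proof (rhalf_sqr b' Hb' y Hy) as S.
    assert (E2 : (Em b' (- y) - Em b' y)%C = (2 * (rhalf b' y * rhalf b' y))%C).
    { rewrite S. unfold Em, csinh. replace (- (PI * - y / b'))%C with (PI * y / b')%C by (field; exact HbC'). field. }
    rewrite E2 in Y.
    pose proof (rhalf_neq_0 b' Hb' y Hy) as N0. pose proof (rhalf_neq_0 b' Hb' _ Ru) as N1.
    pose proof (rhalf_neq_0 b' Hb' _ Rd) as N2.
    assert (NQ : Qf b b' u <> 0%C) by apply cexp_neq_0.
    rewrite Gu, Gd.
    set (R0 := rhalf b' y) in *. set (Rp := rhalf b' (y + Ci * b)%C) in *. set (Rm := rhalf b' (y - Ci * b)%C) in *.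
    set (Ip := It p q u (y + Ci * b)%C) in *. set (Im' := It p q u (y - Ci * b)%C) in *. set (I0 := It p q u y) in *.
    transitivity (e_ p q d eta * Ci * gb * (c0 * rhalf b y * r * g y) / (2 * R0 * Qf b b' u)
       * (Qf b b' u * (Em b' y * Ip - Em b' (- y) * Im')))%C.
    { field. repeat split; assumption. }
    rewrite Y, Ex. field. split; assumption.
Qed.

Theorem mainTheorem4 (ap am eta : R) (hap : 0 < ap) (ham : 0 < am) :
  (forall y : R, 0 < y ->
     exists Phi : C -> C,
       analytic_continuation (xdom ap am eta) (fun _ : R => True)
         (fun x : R => FT ap am eta x y) Phi /\
       forall (d : sgn) (x : C),
         xdom ap am eta x ->
         xdom ap am eta (x + Ci * par ap am (opp_sgn d))%C ->
         xdom ap am eta (x - Ci * par ap am (opp_sgn d))%C ->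
         HT ap am eta d Phi x = (2 * c_ ap am d y * Phi x)%C)
  /\
  (forall x : R,
     exists Psi : C -> C,
       analytic_continuation (fun y : C => 0 < Re y) (fun y : R => 0 < y)
         (fun y : R => FT ap am eta x y) Psi /\
       forall (d : sgn) (y : C),
         0 < Re y ->
         HThat ap am eta d Psi y = (e_ ap am d x * Psi y)%C).
Proof.
  split.
  - intros y Hy. apply Toda_x; assumption.
  - intros x. apply Toda_y; assumption.
Qed.
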